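(* Let $\mu=m$ and $\gamma=2p$, where $m\ge1$ and $p$ are integers, let $\delta=2(m-p)$ and $\lambda>0$. For $|\arg a|<\pi/4$ write $$S_{\mu,\gamma}(a;\lambda)=a^{1-\delta}\,\mathcal{H}(1)+H_{\mu,\gamma}(a;\lambda)+J(a;\lambda).$$ Then the exponentially small contribution $J(a;\lambda)$ has the expansion $$J(a;\lambda)+(-1)^{m-p}\pi a^{2p+1}e^{\lambda-2\pi a}\sum_{r=0}^{m-1}\sum_{\ell=r}^{m-1}A_\ell B_{r\ell}\,\frac{\sigma_r(a)(2\pi)^r}{a^{2m-r}}\;\sim\;(-1)^{m-p}\left(\frac{\lambda}{\pi a^2}\right)^{\delta-1/2}\sum_{r=0}^\infty(-1)^rC_r\left(\frac{\lambda}{\pi^2a^2}\right)^{r}\sum_{k=1}^\infty\frac{e^{-\pi^2k^2a^2/\lambda}}{k^{2r+\delta}}$$ as $|a|\to\infty$ in $|\arg a|<\pi/4$. When $m=0$ (that is, $\mu=0$) the same holds with the double sum on the left-hand side equal to zero.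
   Context: For real $\gamma$, $\mu\ge 0$, $\lambda>0$ and complex $a$ with $|\arg a|<\pi/4$, $$S_{\mu,\gamma}(a;\lambda):=\sum_{n=1}^\infty\frac{n^\gamma e^{-\lambda n^2/a^2}}{(n^2+a^2)^\mu}.$$ All powers take their principal values (positive for positive $a$). $(x)_n=x(x+1)\cdots(x+n-1)$, $(x)_0=1$; $\zeta$ is the Riemann zeta function; $U(\alpha,\beta,z)$ is the confluent hypergeometric function of the second kind (Tricomi's function). Define $$\mathcal{H}(1)=\tfrac12\,\Gamma\left(\tfrac{1+\gamma}{2}\right)U\left(\tfrac{1+\gamma}{2},\,1+\tfrac{1+\gamma}{2}-\mu,\,\lambda\right),$$ $$H_{\mu,\gamma}(a;\lambda)=\begin{cases}0 & (p\ge1)\\ -\tfrac12a^{-\delta} & (p=0)\\ a^{-\delta}\sum_{k=0}^{|p|}\zeta(2k)\,R_k(\mu,|p|)\,a^{2k} & (p\le-1),\end{cases}$$ where, for $q=|p|=-p$ and $0\le k\le q$, $$R_k(\mu,q)=\frac{(-1)^{q-k}}{(q-k)!}\,U(k-q,\,1+k-q-\mu,\,\lambda).$$ For $0\le\ell\le m-1$, $$A_\ell=\frac{(-1)^\ell\lambda^{m-1-\ell}}{(m-1-\ell)!\,\ell!},$$ and the numbers $B_{r\ell}$ ($0\le r\le\ell$), depending on $p$, are defined by the polynomial identity in $s$ $$\left(1-p+\tfrac12s\right)_\ell=\sum_{r=0}^\ell B_{r\ell}\,(s+1)_r .$$ Also $$\sigma_r(a)=e^{2\pi a}\sum_{k=1}^\infty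 k^re^{-2\pi ka},$$ $$C_r=\sum_{n=0}^r\frac{(-\lambda)^n(m)_n}{n!}\,\frac{(2m-2p+2n)_{2r-2n}}{2^{2r-2n}(r-n)!},$$ which equals $\frac{(2m-2p)_{2r}}{2^{2r}r!}\,{}_2F_2(-r,m;m-p,m-p+\tfrac12;\lambda)$ whenever the latter expression is defined. The symbol $\sim$ denotes an asymptotic expansion in the Poincaré sense, relative to the factor $e^{-\pi^2a^2/\lambda}$: for every integer $M\ge1$, the difference between the left-hand side and the right-hand side truncated to $0\le r\le M-1$ is $O\left(|a|^{1-2\delta-2M}\,\bigl|e^{-\pi^2a^2/\lambda}\bigr|\right)$ as $|a|\to\infty$, uniformly in each closed subsector $|\arg a|\le\pi/4-\epsilon$, $\epsilon>0$. *)

(* Defs.v *)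
From Stdlib Require Import Reals ZArith.
From Coquelicot Require Import Coquelicot.
Open Scope R_scope.

Fixpoint poch (x : R) (n : nat) : R :=
  match n with
  | O => 1
  | S k => poch x k * (x + INR k)
  end.

(* Gauss' limit for the entire function 1/Gamma:
   1/Gamma(x) = lim (x)_{n+1} / (n! n^x), for every real x. *)
Definition rGamma (x : R) : R :=
  real (Lim_seq (fun n => poch x (S n) / (INR (fact n) * Rpower (INR n) x))).

(* Junk value 0 at the poles x = 0, -1, -2, ... *)
Definition Gamma (x : R) : R := / rGamma x.

(* Riemann's zeta function on (-1,1) and (1,+oo); the Euler-Maclaurin
   correction provides the analytic continuation to s > -1, as needed at s = 0.
   For s > 1 both correction terms vanish in the limit. *)
Definition zeta (s : R) : R :=
  real (Lim_seq (fun N =>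
    sum_n_m (fun k => Rpower (INR k) (- s)) 1 N
    + Rpower (INR N) (1 - s) / (s - 1) - Rpower (INR N) (- s) / 2)).

Definition KummerM (a b z : R) : R :=
  PSeries (fun n => poch a n / (poch b n * INR (fact n))) z.

(* Value of U(a,b,z) at z > 0 for b not an integer; rGamma makes the poles of
   the denominators Gamma(a-b+1), Gamma(a) contribute 0. *)
Definition TricomiU_gen (a b z : R) : R :=
  Gamma (1 - b) * rGamma (a - b + 1) * KummerM a b z
  + Gamma (b - 1) * rGamma a * Rpower z (1 - b) * KummerM (a - b + 1) (2 - b) z.

(* For integer b, U is the limit of its values at non-integer parameters
   (the general formula has a removable singularity there). *)
Definition TricomiU (a b z : R) : R :=
  if Req_EM_T (frac_part b) 0
  then real (Lim (fun b' => TricomiU_gen a b' z) b)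
  else TricomiU_gen a b z.

Definition Cexp (z : C) : C :=
  (exp (Re z) * cos (Im z), exp (Re z) * sin (Im z)).

(* Principal argument, in (-PI, PI], for z <> 0. *)
Definition Carg (z : C) : R :=
  if Rle_dec 0 (Im z) then acos (Re z / Cmod z) else - acos (Re z / Cmod z).

Definition Clog (z : C) : C := (ln (Cmod z), Carg z).

Definition Cpower (z : C) (s : R) : C := Cexp (RtoC s * Clog z)%C.

Definition CSeries (u : nat -> C) : C :=
  (Series (fun n => Re (u n)), Series (fun n => Im (u n))).

(* The summation index n >= 1 is S j, j >= 0. *)
Definition Ssum (mu gamma : R) (a : C) (lambda : R) : C :=
  CSeries (fun j => let n := INR (S j) in
    RtoC (Rpower n gamma) * Cexp (- (RtoC (lambda * n ^ 2) / a ^ 2))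
    / Cpower (RtoC (n ^ 2) + a ^ 2) mu)%C.

Definition calH1 (mu gamma lambda : R) : R :=
  / 2 * Gamma ((1 + gamma) / 2)
  * TricomiU ((1 + gamma) / 2) (1 + (1 + gamma) / 2 - mu) lambda.

(* R_k(mu,q), for 0 <= k <= q. *)
Definition Rcoef (k : nat) (mu : R) (q : nat) (lambda : R) : R :=
  (-1) ^ (q - k) / INR (fact (q - k))
  * TricomiU (INR k - INR q) (1 + INR k - INR q - mu) lambda.

(* H_{mu,gamma}(a;lambda) with gamma = 2p. *)
Definition Hfun (mu : R) (p : Z) (a : C) (lambda : R) : C :=
  let delta := 2 * (mu - IZR p) in
  if (1 <=? p)%Z then RtoC 0
  else if (p =? 0)%Z then (- (RtoC (/ 2) * Cpower a (- delta)))%C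
  else
    let q := Z.abs_nat p in
    (Cpower a (- delta)
     * sum_n (fun k => RtoC (zeta (INR (2 * k)) * Rcoef k mu q lambda)
                       * a ^ (2 * k)) q)%C.

Definition Jfun (mu : R) (p : Z) (a : C) (lambda : R) : C :=
  let delta := 2 * (mu - IZR p) in
  (Ssum mu (2 * IZR p) a lambda
   - Cpower a (1 - delta) * RtoC (calH1 mu (2 * IZR p) lambda)
   - Hfun mu p a lambda)%C.

Definition Acoef (m : nat) (lambda : R) (l : nat) : R :=
  (-1) ^ l * lambda ^ (m - 1 - l) / (INR (fact (m - 1 - l)) * INR (fact l)).

(* B r l stands for B_{r l}; only the entries with r <= l are constrained, and
   they are uniquely determined since the (s+1)_r form a graded basis. *)
Definition is_Bcoef (p : Z) (B : nat -> nat -> R) : Prop :=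
  forall (l : nat) (s : R),
    poch (1 - IZR p + s / 2) l = sum_n (fun r => B r l * poch (s + 1) r) l.

Definition sigma (r : nat) (a : C) : C :=
  (Cexp (RtoC (2 * PI) * a)
   * CSeries (fun j => let k := INR (S j) in
       RtoC (k ^ r) * Cexp (- (RtoC (2 * PI * k) * a))))%C.

Definition Ccoef (m : nat) (p : Z) (lambda : R) (r : nat) : R :=
  sum_n (fun n =>
    (- lambda) ^ n * poch (INR m) n / INR (fact n)
    * (poch (2 * INR m - 2 * IZR p + 2 * INR n) (2 * r - 2 * n)
       / (2 ^ (2 * r - 2 * n) * INR (fact (r - n))))) r.

(* The indices range over 0 <= r <= l <= m-1; sum_n has an inclusive upper
   bound, so the empty case m = 0 is treated separately. *)
Definition ABsum (m : nat) (B : nat -> nat -> R) (lambda : R) (a : C) : C :=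
  match m with
  | O => RtoC 0
  | S m' =>
      sum_n (fun r =>
        sum_n_m (fun l =>
          RtoC (Acoef m lambda l * B r l) * (sigma r a * RtoC ((2 * PI) ^ r))
          / a ^ (2 * m - r))%C r m') m'
  end.

Definition Esum (delta lambda : R) (r : nat) (a : C) : C :=
  CSeries (fun j => let k := INR (S j) in
    Cexp (- (RtoC (PI ^ 2 * k ^ 2) * a ^ 2 / RtoC lambda))
    / RtoC (Rpower k (2 * INR r + delta)))%C.

(* Truncated to 0 <= r <= M-1; meaningful for M >= 1 only. *)
Definition expansion (m : nat) (p : Z) (lambda : R) (M : nat) (a : C) : C :=
  let delta := 2 * (INR m - IZR p) in
  (RtoC (powerRZ (-1) (Z.of_nat m - p))
   * Cpower (RtoC lambda / (RtoC PI * a ^ 2)) (delta - / 2)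
   * sum_n (fun r =>
       RtoC ((-1) ^ r * Ccoef m p lambda r)
       * (RtoC lambda / (RtoC (PI ^ 2) * a ^ 2)) ^ r
       * Esum delta lambda r a) (M - 1))%C.

(* Main.v *)
Require Import Defs.
From Stdlib Require Import Reals ZArith Lra Lia Psatz.
From Coquelicot Require Import Coquelicot.
Open Scope R_scope.

(* Multiply J plus the residue sum by a^delta and call the result c(m,p), as a function of lambda.
   Each of its four constituents (the lattice sum, the Tricomi function, the zeta polynomial and the
   residue sum) satisfies
     c(m,p) = c(m+1,p+1) + c(m+1,p)   and   d/d lambda c(m,p) = - c(m,p+1),
   so that (e^(-lambda) c(m,p))' = - e^(-lambda) c(m-1,p), and the formal saddle-point series with the
   coefficients C_r obeys the same differential equations.  For m = p = 0 Jacobi's theta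
   transformation shows that c(0,0) is equal to its series; differentiation gives all p >= 0, and
   integration over lambda, starting from 0, gives first p < 0 and then all m.  No constant of
   integration appears because c(m,p) vanishes as lambda -> 0+: for m = 0 > p the lattice sum and the
   zeta polynomial both tend to zeta(-2p), for p = 0 < m this is the partial fraction expansion of coth
   differentiated m - 1 times, and the recurrence in (m,p) gives the rest.  Integration from 0 turns an error
   O(e^(-pi^2 a^2/lambda)) into one smaller by a factor lambda^2/a^2, as the truncation order needs. *)

(** The expansion is wanted at one fixed lambda, but every step integrates the preceding error in
    lambda. The error must therefore be controlled for all lambda in an interval (0, L] and all a of
    a closed subsector at once. This is why it is measured by [saddle_size], which keeps the joint
    dependence on a and lambda, and why |a| >= 1 is imposed throughout. The integration argument
    needs a nonnegative power of lambda in that scale, which fails for small truncation orders when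
    delta is very negative; such orders are recovered from larger ones by discarding terms that are
    themselves of the size of the error. Contour integrals are replaced by explicit primitives. The
    theta transformation and the partial fractions of coth have one source: integrating f against
    the Dirichlet kernel over a unit interval gives (f(0) + f(1))/2 up to O(1/N), and the primitives
    are written down with the error function for a Gaussian f and with exponentials for an
    exponential f. The Gaussian integral itself is determined by the self-dual case of the theta
    relation. *)

(** * Complex arithmetic and the complex exponential *)

Lemma C_eq_parts (z w : C) : Re z = Re w -> Im z = Im w -> z = w.
Proof. destruct z, w; simpl; intros; congruence. Qed.

Lemma Re_plus (z w : C) : Re (z + w)%C = Re z + Re w. Proof. reflexivity. Qed.
Lemma Im_plus (z w : C) : Im (z + w)%C = Im z + Im w. Proof. reflexivity. Qed.
Lemma Re_opp (z : C) : Re (- z)%C = - Re z. Proof. reflexivity. Qed.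
Lemma Im_opp (z : C) : Im (- z)%C = - Im z. Proof. reflexivity. Qed.
Lemma Re_minus (z w : C) : Re (z - w)%C = Re z - Re w. Proof. reflexivity. Qed.
Lemma Im_minus (z w : C) : Im (z - w)%C = Im z - Im w. Proof. reflexivity. Qed.
Lemma Re_mult (z w : C) : Re (z * w)%C = Re z * Re w - Im z * Im w. Proof. reflexivity. Qed.
Lemma Im_mult (z w : C) : Im (z * w)%C = Re z * Im w + Im z * Re w. Proof. reflexivity. Qed.
Lemma Re_RtoC (x : R) : Re (RtoC x) = x. Proof. reflexivity. Qed.
Lemma Im_RtoC (x : R) : Im (RtoC x) = 0. Proof. reflexivity. Qed.
Lemma Re_scal (x : R) (z : C) : Re (RtoC x * z)%C = x * Re z.
Proof. rewrite Re_mult, Re_RtoC, Im_RtoC; ring. Qed.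
Lemma Im_scal (x : R) (z : C) : Im (RtoC x * z)%C = x * Im z.
Proof. rewrite Im_mult, Re_RtoC, Im_RtoC; ring. Qed.

Global Hint Rewrite Re_plus Im_plus Re_opp Im_opp Re_minus Im_minus Re_mult Im_mult
  Re_RtoC Im_RtoC : reim.

Lemma im_le_Cmod (z : C) : Rabs (Im z) <= Cmod z.
Proof. eapply Rle_trans; [apply Rmax_r | apply (Rmax_Cmod z)]. Qed.

Lemma Cmod_le_parts (z : C) : Cmod z <= Rabs (Re z) + Rabs (Im z).
Proof.
  replace z with (RtoC (Re z) + Ci * RtoC (Im z))%C at 1.
  2:{ apply C_eq_parts; autorewrite with reim; unfold Ci; simpl; ring. }
  eapply Rle_trans; [apply Cmod_triangle |].
  rewrite Cmod_mult, Cmod_Ci, !Cmod_R; lra.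
Qed.

Lemma RtoC_neq (x : R) : x <> 0 -> RtoC x <> RtoC 0.
Proof. intros H E; apply H; now apply RtoC_inj. Qed.

Lemma Cmod_nneg (x : R) : 0 <= x -> Cmod (RtoC x) = x.
Proof. intros; rewrite Cmod_R, Rabs_pos_eq; auto. Qed.

Lemma Cexp_plus (z w : C) : Cexp (z + w)%C = (Cexp z * Cexp w)%C.
Proof.
  apply C_eq_parts; unfold Cexp; autorewrite with reim; simpl;
    rewrite exp_plus, ?cos_plus, ?sin_plus; ring.
Qed.

Lemma Cexp_RtoC (x : R) : Cexp (RtoC x) = RtoC (exp x).
Proof.
  apply C_eq_parts; unfold Cexp; simpl; rewrite ?cos_0, ?sin_0; ring.
Qed.

Lemma Cexp_0 : Cexp (RtoC 0) = RtoC 1.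
Proof. now rewrite Cexp_RtoC, exp_0. Qed.

Lemma Cmod_Cexp (z : C) : Cmod (Cexp z) = exp (Re z).
Proof.
  unfold Cmod, Cexp; simpl.
  replace (_ + _) with (exp (Re z) * exp (Re z)).
  - rewrite sqrt_square; auto. apply Rlt_le, exp_pos.
  - assert (H := sin2_cos2 (Im z)); unfold Rsqr in H.
    transitivity (exp (Re z) * exp (Re z) * (sin (Im z) * sin (Im z) + cos (Im z) * cos (Im z)));
      [rewrite H |]; ring.
Qed.

Lemma Cexp_neq_0 (z : C) : Cexp z <> RtoC 0.
Proof. apply Cmod_gt_0; rewrite Cmod_Cexp; apply exp_pos. Qed.

Lemma Cexp_opp (z : C) : (Cexp (- z) * Cexp z)%C = RtoC 1.
Proof. rewrite <- Cexp_plus, <- Cexp_0; f_equal; ring. Qed.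

Lemma Cexp_opp_inv (z : C) : Cexp (- z)%C = (/ Cexp z)%C.
Proof.
  assert (H := Cexp_neq_0 z). rewrite <- (Cmult_1_r (Cexp (- z))), <- (Cinv_r (Cexp z)) by auto.
  rewrite Cmult_assoc, Cexp_opp; ring.
Qed.

Lemma Cexp_INR (n : nat) (z : C) : Cexp (RtoC (INR n) * z)%C = (Cexp z ^ n)%C.
Proof.
  induction n as [|n IH].
  - simpl. replace (RtoC 0 * z)%C with (RtoC 0) by ring. apply Cexp_0.
  - rewrite S_INR, Cpow_S, <- IH, <- Cexp_plus; f_equal.
    rewrite RtoC_plus; ring.
Qed.

(** * Differentiation of complex functions of a real variable *)

(** The variable is always real: lambda, or a parameter along a line or ray in the plane.
    Differentiating the two components then gives the usual calculus. *)
Definition is_Cderive (F : R -> C) (t : R) (l : C) : Prop :=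
  is_derive (fun t => Re (F t)) t (Re l) /\ is_derive (fun t => Im (F t)) t (Im l).

Lemma is_derive_eq (f : R -> R) (x l l' : R) : is_derive f x l -> l = l' -> is_derive f x l'.
Proof. now intros H <-. Qed.

Lemma is_Cderive_eq (F : R -> C) (t : R) (l l' : C) : is_Cderive F t l -> l = l' -> is_Cderive F t l'.
Proof. now intros H <-. Qed.

Lemma is_Cderive_ext (F G : R -> C) (t : R) (l : C) :
  (forall t, F t = G t) -> is_Cderive F t l -> is_Cderive G t l.
Proof.
  intros E [H1 H2]; split; [eapply is_derive_ext; [|exact H1] | eapply is_derive_ext; [|exact H2]];
  intros; simpl; now rewrite E.
Qed.

Lemma is_Cderive_ext_loc (F G : R -> C) (t : R) (l : C) :
  locally t (fun t => F t = G t) -> is_Cderive F t l -> is_Cderive G t l.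
Proof.
  intros E [H1 H2]; split;
    [eapply is_derive_ext_loc; [|exact H1] | eapply is_derive_ext_loc; [|exact H2]];
  apply (filter_imp (fun s => F s = G s)); auto; intros s H; simpl; now rewrite H.
Qed.

Lemma is_Cderive_unique (F : R -> C) (t : R) (l l' : C) :
  is_Cderive F t l -> is_Cderive F t l' -> l = l'.
Proof.
  intros [H1 H2] [H3 H4]; apply C_eq_parts.
  - now rewrite <- (is_derive_unique _ _ _ H1), <- (is_derive_unique _ _ _ H3).
  - now rewrite <- (is_derive_unique _ _ _ H2), <- (is_derive_unique _ _ _ H4).
Qed.

Lemma is_Cderive_const (c : C) (t : R) : is_Cderive (fun _ => c) t (RtoC 0).
Proof. split; apply (is_derive_const (K := R_AbsRing) (V := R_NormedModule)). Qed.

Lemma is_Cderive_RtoC (f : R -> R) (t l : R) :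
  is_derive f t l -> is_Cderive (fun t => RtoC (f t)) t (RtoC l).
Proof. intros H; split; [exact H |]. simpl. apply (is_derive_const (K := R_AbsRing) (V := R_NormedModule)). Qed.

Lemma is_Cderive_plus (F G : R -> C) (t : R) (l k : C) :
  is_Cderive F t l -> is_Cderive G t k -> is_Cderive (fun t => F t + G t)%C t (l + k)%C.
Proof.
  intros [H1 H2] [H3 H4]; split; apply (is_derive_plus (K := R_AbsRing) (V := R_NormedModule)); auto.
Qed.

Lemma is_Cderive_opp (F : R -> C) (t : R) (l : C) :
  is_Cderive F t l -> is_Cderive (fun t => - F t)%C t (- l)%C.
Proof.
  intros [H1 H2]; split; apply (is_derive_opp (K := R_AbsRing) (V := R_NormedModule)); auto.
Qed.

Lemma is_Cderive_minus (F G : R -> C) (t : R) (l k : C) :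
  is_Cderive F t l -> is_Cderive G t k -> is_Cderive (fun t => F t - G t)%C t (l - k)%C.
Proof. intros H1 H2; apply is_Cderive_plus; auto; now apply is_Cderive_opp. Qed.

Lemma is_derive_Rmult (f g : R -> R) (x df dg : R) :
  is_derive f x df -> is_derive g x dg -> is_derive (fun t => f t * g t) x (df * g x + f x * dg).
Proof. intros; apply (is_derive_mult (K := R_AbsRing)); auto. intros; apply Rmult_comm. Qed.

Lemma is_Cderive_mult (F G : R -> C) (t : R) (l k : C) :
  is_Cderive F t l -> is_Cderive G t k ->
  is_Cderive (fun t => F t * G t)%C t (l * G t + F t * k)%C.
Proof.
  intros [H1 H2] [H3 H4]; split.
  - eapply is_derive_eq.
    + apply (is_derive_minus (K := R_AbsRing) (V := R_NormedModule)
        (fun t => Re (F t) * Re (G t)) (fun t => Im (F t) * Im (G t))); apply is_derive_Rmult; eauto.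
    + unfold minus, plus, opp; simpl; unfold Re, Im; ring.
  - eapply is_derive_eq.
    + apply (is_derive_plus (K := R_AbsRing) (V := R_NormedModule)
        (fun t => Re (F t) * Im (G t)) (fun t => Im (F t) * Re (G t))); apply is_derive_Rmult; eauto.
    + unfold plus; simpl; unfold Re, Im; ring.
Qed.

Lemma is_Cderive_scal (c : C) (F : R -> C) (t : R) (l : C) :
  is_Cderive F t l -> is_Cderive (fun t => c * F t)%C t (c * l)%C.
Proof.
  intros H; eapply is_Cderive_eq; [apply is_Cderive_mult; [apply is_Cderive_const | exact H] |]. cbv beta; ring.
Qed.

Lemma is_Cderive_Cexp (F : R -> C) (t : R) (l : C) :
  is_Cderive F t l -> is_Cderive (fun t => Cexp (F t)) t (l * Cexp (F t))%C.
Proof.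
  intros [H1 H2].
  assert (He : is_derive (fun t => exp (Re (F t))) t (Re l * exp (Re (F t)))).
  { apply (is_derive_comp (K := R_AbsRing) (V := R_NormedModule) exp (fun t => Re (F t))); [apply is_derive_exp | exact H1]. }
  assert (Hc : is_derive (fun t => cos (Im (F t))) t (Im l * - sin (Im (F t)))).
  { apply (is_derive_comp (K := R_AbsRing) (V := R_NormedModule) cos (fun t => Im (F t))); [apply is_derive_cos | exact H2]. }
  assert (Hs : is_derive (fun t => sin (Im (F t))) t (Im l * cos (Im (F t)))).
  { apply (is_derive_comp (K := R_AbsRing) (V := R_NormedModule) sin (fun t => Im (F t))); [apply is_derive_sin | exact H2]. }
  split.
  - eapply is_derive_eq; [apply (is_derive_Rmult _ _ _ _ _ He Hc) |].
    unfold Cexp; autorewrite with reim; simpl; ring.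
  - eapply is_derive_eq; [apply (is_derive_Rmult _ _ _ _ _ He Hs) |].
    unfold Cexp; autorewrite with reim; simpl; ring.
Qed.

Lemma is_Cderive_pow (F : R -> C) (n : nat) (t : R) (l : C) :
  is_Cderive F t l ->
  is_Cderive (fun t => F t ^ S n)%C t (RtoC (INR (S n)) * F t ^ n * l)%C.
Proof.
  intros H; induction n as [|n IH].
  - apply (is_Cderive_ext F); [intros; simpl; ring |].
    apply (is_Cderive_eq _ _ _ _ H); simpl; ring.
  - apply (is_Cderive_ext (fun t => F t * F t ^ S n)%C); [reflexivity |].
    eapply is_Cderive_eq; [apply (is_Cderive_mult _ _ _ _ _ H IH) |].
    rewrite (S_INR (S n)), RtoC_plus, !Cpow_S; ring.
Qed.

Lemma is_Cderive_inv (F : R -> C) (t : R) (l : C) :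
  F t <> RtoC 0 -> is_Cderive F t l -> is_Cderive (fun t => / F t)%C t (- l / (F t * F t))%C.
Proof.
  intros Hn [H1 H2].
  assert (Hd : Re (F t) ^ 2 + Im (F t) ^ 2 <> 0).
  { intros E; apply Hn.
    assert (Re (F t) = 0) by nra. assert (Im (F t) = 0) by nra.
    now apply C_eq_parts. }
  assert (HD : is_derive (fun t => Re (F t) ^ 2 + Im (F t) ^ 2) t
      (2 * Re (F t) * Re l + 2 * Im (F t) * Im l)).
  { apply (is_derive_ext (fun t => Re (F t) * Re (F t) + Im (F t) * Im (F t))).
    - intros; simpl; ring.
    - eapply is_derive_eq.
      + apply (is_derive_plus (K := R_AbsRing) (V := R_NormedModule)); apply is_derive_Rmult; eauto.
      + unfold plus; simpl; ring. }
  assert (HI := is_derive_inv _ _ _ HD Hd).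
  (* The denominator F^2 is rationalised by d = |F|^2, to match the derivatives of the components Re
     F / d and - Im F / d of the inverse. *)
  assert (Hx : (- l / (F t * F t))%C =
    (let x := Re (F t) in let y := Im (F t) in let d := x ^ 2 + y ^ 2 in
     ((Re l * d - x * (2 * x * Re l + 2 * y * Im l)) / d ^ 2,
      - (Im l * d - y * (2 * x * Re l + 2 * y * Im l)) / d ^ 2))).
  { destruct (F t) as [x y] eqn:E; destruct l as [u v]; simpl in *.
    unfold Cdiv, Cinv, Cmult, Copp; simpl.
    assert (0 < x ^ 2 + y ^ 2) by (destruct (Rle_lt_dec (x ^ 2 + y ^ 2) 0); [exfalso; apply Hd; nra | assumption]).
    assert (Hq : (x * x - y * y) ^ 2 + (x * y + y * x) ^ 2 = (x ^ 2 + y ^ 2) ^ 2) by ring.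
    assert ((x * x - y * y) * ((x * x - y * y) * 1) + (x * y + y * x) * ((x * y + y * x) * 1) <> 0).
    { intro Z. apply Hd. nra. }
    f_equal; field; repeat split; auto; try (simpl in *; lra). }
  rewrite Hx; clear Hx; split.
  - eapply is_derive_eq; [apply (is_derive_Rmult _ _ _ _ _ H1 HI) |]. simpl; field.
    clear - Hd; simpl in Hd; intro Z; apply Hd; rewrite <- Z; simpl; ring.
  - eapply is_derive_eq.
    { apply (is_derive_Rmult (fun t => - Im (F t)) _ _ _ _
        (is_derive_opp (K := R_AbsRing) (V := R_NormedModule) _ _ _ H2) HI). }
    unfold opp; simpl; field. clear - Hd; simpl in Hd; intro Z; apply Hd; rewrite <- Z; simpl; ring.
Qed.

Lemma is_Cderive_sum_n (F : nat -> R -> C) (l : nat -> C) (t : R) (N : nat) :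
  (forall n, (n <= N)%nat -> is_Cderive (F n) t (l n)) ->
  is_Cderive (fun t => sum_n (fun n => F n t) N) t (sum_n l N).
Proof.
  induction N as [|N IH]; intros H.
  - rewrite sum_O. apply (is_Cderive_ext (F 0%nat)); [intros; now rewrite sum_O | auto].
  - rewrite sum_Sn. apply (is_Cderive_ext (fun t => sum_n (fun n => F n t) N + F (S N) t)%C).
    + intros; now rewrite sum_Sn.
    + apply is_Cderive_plus; [apply IH; intros; apply H; lia | apply H; lia].
Qed.

Lemma Re_sum_n (u : nat -> C) (N : nat) : Re (sum_n u N) = sum_n (fun n => Re (u n)) N.
Proof.
  induction N as [|N IH]; [now rewrite !sum_O |]. rewrite !sum_Sn, <- IH; reflexivity.
Qed.

Lemma Im_sum_n (u : nat -> C) (N : nat) : Im (sum_n u N) = sum_n (fun n => Im (u n)) N.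
Proof.
  induction N as [|N IH]; [now rewrite !sum_O |]. rewrite !sum_Sn, <- IH; reflexivity.
Qed.

(** * Complex series *)

(** Convergence by components mirrors [CSeries], which sums real and imaginary parts separately;
    [CSeries] equals the sum only once this is established. *)
Definition is_Cseries (u : nat -> C) (l : C) : Prop :=
  is_series (fun n => Re (u n)) (Re l) /\ is_series (fun n => Im (u n)) (Im l).

Lemma is_Cseries_unique (u : nat -> C) (l : C) : is_Cseries u l -> CSeries u = l.
Proof.
  intros [H1 H2]; apply C_eq_parts; simpl; now apply is_series_unique.
Qed.

Lemma CSeries_ext (u v : nat -> C) : (forall n, u n = v n) -> CSeries u = CSeries v.
Proof.
  intros E; unfold CSeries; f_equal; apply Series_ext; intros; now rewrite E.
Qed.

Lemma is_Cseries_ext (u v : nat -> C) (l : C) :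
  (forall n, u n = v n) -> is_Cseries u l -> is_Cseries v l.
Proof.
  intros E [H1 H2]; split; [eapply is_series_ext; [|exact H1] | eapply is_series_ext; [|exact H2]];
  intros; simpl; now rewrite E.
Qed.

Lemma ex_series_Rle (a b : nat -> R) :
  (forall n, Rabs (a n) <= b n) -> ex_series b -> ex_series a.
Proof. intros H; apply (ex_series_le (K := R_AbsRing) (V := R_CompleteNormedModule)); auto. Qed.

Lemma ex_series_Re_le (u : nat -> C) (b : nat -> R) :
  (forall n, Cmod (u n) <= b n) -> ex_series b -> ex_series (fun n => Re (u n)).
Proof.
  intros H; apply ex_series_Rle; intros n; eapply Rle_trans; [apply re_le_Cmod | apply H].
Qed.

Lemma ex_series_Im_le (u : nat -> C) (b : nat -> R) :
  (forall n, Cmod (u n) <= b n) -> ex_series b -> ex_series (fun n => Im (u n)).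
Proof.
  intros H; apply ex_series_Rle; intros n; eapply Rle_trans; [apply im_le_Cmod | apply H].
Qed.

Lemma CSeries_correct (u : nat -> C) (b : nat -> R) :
  (forall n, Cmod (u n) <= b n) -> ex_series b -> is_Cseries u (CSeries u).
Proof.
  intros H Hb; split; apply Series_correct; [eapply ex_series_Re_le | eapply ex_series_Im_le]; eauto.
Qed.

Lemma is_Cseries_plus (u v : nat -> C) (l k : C) :
  is_Cseries u l -> is_Cseries v k -> is_Cseries (fun n => u n + v n)%C (l + k)%C.
Proof.
  intros [H1 H2] [H3 H4]; split; apply (is_series_plus (K := R_AbsRing) (V := R_NormedModule)); auto.
Qed.

Lemma is_Cseries_scal (c : C) (u : nat -> C) (l : C) :
  is_Cseries u l -> is_Cseries (fun n => c * u n)%C (c * l)%C.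
Proof.
  intros [H1 H2]; split.
  - apply (is_series_minus (K := R_AbsRing) (V := R_NormedModule) (fun n => Re c * Re (u n)) (fun n => Im c * Im (u n)));
      apply (is_series_scal (K := R_AbsRing) (V := R_NormedModule)); auto.
  - apply (is_series_plus (K := R_AbsRing) (V := R_NormedModule) (fun n => Re c * Im (u n)) (fun n => Im c * Re (u n)));
      apply (is_series_scal (K := R_AbsRing) (V := R_NormedModule)); auto.
Qed.

(** The factor 2 comes from estimating the two components separately. Only orders of magnitude
    matter later. *)
Lemma Cmod_CSeries_le (u : nat -> C) (b : nat -> R) :
  (forall n, Cmod (u n) <= b n) -> ex_series b -> Cmod (CSeries u) <= 2 * Series b.
Proof.
  intros H Hb. eapply Rle_trans; [apply Cmod_le_parts |]. simpl.
  assert (A : forall f : nat -> R, (forall n, Rabs (f n) <= b n) -> Rabs (Series f) <= Series b).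
  { intros f Hf. eapply Rle_trans; [apply Series_Rabs |].
    - apply (ex_series_Rle _ b); auto. intros; now rewrite Rabs_Rabsolu.
    - apply Series_le; auto. intros; split; [apply Rabs_pos | auto]. }
  assert (A1 := A _ (fun n => Rle_trans _ _ _ (re_le_Cmod (u n)) (H n))).
  assert (A2 := A _ (fun n => Rle_trans _ _ _ (im_le_Cmod (u n)) (H n))). lra.
Qed.

(** Comparison with a telescoping series. Multiples of this series majorise nearly all the lattice
    sums below. *)
Lemma ex_series_inv_sqr : ex_series (fun n => / (INR n + 1) ^ 2).
Proof.
  apply ex_series_incr_1.
  apply (ex_series_Rle _ (fun n => / (INR n + 1) - / (INR (S n) + 1))).
  - intros n; rewrite S_INR.
    assert (0 <= INR n) by apply pos_INR.
    rewrite Rabs_pos_eq by (apply Rlt_le, Rinv_0_lt_compat; nra).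
    replace (/ (INR n + 1) - / (INR n + 1 + 1)) with (/ ((INR n + 1) * (INR n + 1 + 1))) by (field; lra).
    apply Rinv_le_contravar; nra.
  - exists 1.
    assert (L : is_lim_seq (fun n => 1 - / (INR n + 2)) 1).
    { replace (Finite 1) with (Finite (1 - 0)) by (f_equal; ring).
      apply is_lim_seq_minus'; [apply is_lim_seq_const |].
      apply (is_lim_seq_inv _ p_infty); [| discriminate].
      eapply is_lim_seq_plus; [apply is_lim_seq_INR | apply is_lim_seq_const | reflexivity]. }
    change (is_lim_seq (sum_n (fun n => / (INR n + 1) - / (INR (S n) + 1))) 1).
    eapply is_lim_seq_ext; [| exact L].
    intros n; induction n as [|n IH].
    + rewrite sum_O; simpl; field.
    + rewrite sum_Sn, <- IH, !S_INR. change plus with Rplus; cbn beta.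
      assert (0 <= INR n) by apply pos_INR; field; lra.
Qed.

Lemma ex_series_scal_Rl (c : R) (b : nat -> R) : ex_series b -> ex_series (fun n => c * b n).
Proof. apply (ex_series_scal (K := R_AbsRing) (V := R_NormedModule)). Qed.

(** * Tails of series, the mean value inequality and termwise differentiation *)

Lemma Series_tail_small (b : nat -> R) (eps : R) :
  ex_series b -> 0 < eps -> exists N, Rabs (Series (fun k => b (S N + k)%nat)) < eps.
Proof.
  intros Hb He. destruct (Series_correct b Hb (ball (Series b) (mkposreal eps He))) as [N HN].
  { exists (mkposreal eps He); auto. }
  exists N. specialize (HN N (le_n _)).
  rewrite (Series_incr_n b (S N)) in HN by (auto; lia).
  simpl pred in HN. rewrite sum_n_Reals in HN.
  unfold ball in HN; simpl in HN; unfold AbsRing_ball, abs, minus, plus, opp in HN; simpl in HN.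
  rewrite <- Rabs_Ropp in HN.
  match type of HN with Rabs ?x < _ => replace x with (Series (fun k => b (S N + k)%nat)) in HN end; auto.
  simpl; ring.
Qed.

Lemma Rabs_Series_le (f b : nat -> R) :
  (forall n, Rabs (f n) <= b n) -> ex_series b -> Rabs (Series f) <= Series b.
Proof.
  intros H Hb. eapply Rle_trans; [apply Series_Rabs |].
  - apply (ex_series_Rle _ b); auto. intros; now rewrite Rabs_Rabsolu.
  - apply Series_le; auto. intros; split; [apply Rabs_pos | auto].
Qed.

Lemma Rabs_le_of_derive (f g : R -> R) (x y B : R) :
  (forall t, Rmin x y <= t <= Rmax x y -> is_derive f t (g t)) ->
  (forall t, Rmin x y <= t <= Rmax x y -> Rabs (g t) <= B) ->
  Rabs (f y - f x) <= B * Rabs (y - x).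
Proof.
  intros H HB. destruct (MVT_gen f x y g) as [c [Hc E]].
  - intros t Ht; apply H; lra.
  - intros t Ht. apply continuity_pt_filterlim, (ex_derive_continuous f). eexists; apply H; auto.
  - rewrite E, Rabs_mult. apply Rmult_le_compat_r; [apply Rabs_pos | auto].
Qed.

Lemma is_derive_Series (f g : nat -> R -> R) (b : nat -> R) (x e : R) :
  0 < e ->
  (forall n t, Rabs (t - x) < e -> is_derive (f n) t (g n t)) ->
  (forall n t, Rabs (t - x) < e -> Rabs (g n t) <= b n) ->
  ex_series b ->
  (forall t, Rabs (t - x) < e -> ex_series (fun n => f n t)) ->
  is_derive (fun t => Series (fun n => f n t)) x (Series (fun n => g n x)).
Proof.
  intros He Hd Hg Hb Hf.
  assert (Hx : Rabs (x - x) < e) by (rewrite Rminus_diag, Rabs_R0; auto).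
  assert (Hgx : ex_series (fun n => g n x)) by (apply (ex_series_Rle _ b); auto).
  apply is_derive_Reals. intros eps Heps.
  destruct (Series_tail_small b (eps / 4) Hb) as [N HN]; [lra |].
  assert (HbN : ex_series (fun k => b (S N + k)%nat)) by (now apply (ex_series_incr_n b (S N))).
  apply Rabs_def2 in HN; destruct HN as [HN _].
  assert (HD : derivable_pt_lim (fun t => sum_n (fun n => f n t) N) x (sum_n (fun n => g n x) N)).
  { apply is_derive_Reals.
    apply (is_derive_sum_n (K := R_AbsRing) (V := R_NormedModule) (fun n t => f n t)). auto. }
  destruct (HD (eps / 4)) as [d Hdd]; [lra |].
  assert (Hm : 0 < Rmin d e) by (apply Rmin_pos; [apply cond_pos | auto]).
  exists (mkposreal _ Hm). intros h Hh0 Hh; simpl in Hh.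
  assert (Hh1 : Rabs h < d) by (eapply Rlt_le_trans; [exact Hh | apply Rmin_l]).
  assert (Hh2 : Rabs h < e) by (eapply Rlt_le_trans; [exact Hh | apply Rmin_r]).
  specialize (Hdd h Hh0 Hh1).
  assert (Hxh : Rabs (x + h - x) < e) by (replace (x + h - x) with h by ring; auto).
  rewrite (Series_incr_n (fun n => f n (x + h)) (S N)) by (auto; lia).
  rewrite (Series_incr_n (fun n => f n x) (S N)) by (auto; lia).
  rewrite (Series_incr_n (fun n => g n x) (S N)) by (auto; lia).
  simpl pred. rewrite <- !sum_n_Reals.
  set (SA := sum_n (fun n => f n (x + h)) N) in *. set (SB := sum_n (fun n => f n x) N) in *.
  set (SG := sum_n (fun n => g n x) N) in *.
  assert (T1 : Rabs (Series (fun k => f (S N + k)%nat (x + h)) - Series (fun k => f (S N + k)%nat x))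
     <= Rabs h * Series (fun k => b (S N + k)%nat)).
  { rewrite <- Series_minus.
    2:{ now apply (ex_series_incr_n (fun n => f n (x + h)) (S N)), Hf. }
    2:{ now apply (ex_series_incr_n (fun n => f n x) (S N)), Hf. }
    rewrite <- Series_scal_l. apply Rabs_Series_le; [| now apply ex_series_scal_Rl].
    intros n.
    assert (Hin : forall t, Rmin x (x + h) <= t <= Rmax x (x + h) -> Rabs (t - x) < e).
    { intros t Ht. apply Rabs_def2 in Hh2.
      apply Rabs_def1; revert Ht; unfold Rmin, Rmax; destruct (Rle_dec x (x + h)); lra. }
    rewrite Rmult_comm. replace (Rabs h) with (Rabs (x + h - x)) by (f_equal; ring).
    apply (Rabs_le_of_derive _ (g (S N + n)%nat)); auto. }
  assert (T2 : Rabs (Series (fun k => g (S N + k)%nat x)) <= Series (fun k => b (S N + k)%nat)).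
  { apply Rabs_Series_le; auto. }
  set (TA := Series (fun k => f (S N + k)%nat (x + h))) in *.
  set (TB := Series (fun k => f (S N + k)%nat x)) in *.
  set (TG := Series (fun k => g (S N + k)%nat x)) in *.
  set (Tb := Series (fun k => b (S N + k)%nat)) in *.
  replace ((SA + TA - (SB + TB)) / h - (SG + TG))
    with (((SA - SB) / h - SG) + (TA - TB) / h - TG) by (field; auto).
  assert (T3 : Rabs ((TA - TB) / h) <= Tb).
  { unfold Rdiv; rewrite Rabs_mult, Rabs_inv.
    assert (0 < Rabs h) by (now apply Rabs_pos_lt).
    apply (Rmult_le_reg_r (Rabs h)); auto. rewrite Rmult_assoc, Rinv_l by lra. lra. }
  apply Rabs_def2 in Hdd. apply Rabs_le_between in T3. apply Rabs_le_between in T2.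
  apply Rabs_def1; lra.
Qed.

Lemma is_Cderive_CSeries (f g : nat -> R -> C) (b : nat -> R) (x e : R) :
  0 < e ->
  (forall n t, Rabs (t - x) < e -> is_Cderive (f n) t (g n t)) ->
  (forall n t, Rabs (t - x) < e -> Cmod (g n t) <= b n) ->
  ex_series b ->
  (forall t, Rabs (t - x) < e -> exists c, ex_series c /\ forall n, Cmod (f n t) <= c n) ->
  is_Cderive (fun t => CSeries (fun n => f n t)) x (CSeries (fun n => g n x)).
Proof.
  intros He Hd Hg Hb Hf; split; simpl.
  - apply (is_derive_Series (fun n t => Re (f n t)) (fun n t => Re (g n t)) b x e); auto.
    + intros n t Ht; apply (Hd n t Ht).
    + intros n t Ht; eapply Rle_trans; [apply re_le_Cmod | auto].
    + intros t Ht; destruct (Hf t Ht) as [c [Hc1 Hc2]]; eapply ex_series_Re_le; eauto.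
  - apply (is_derive_Series (fun n t => Im (f n t)) (fun n t => Im (g n t)) b x e); auto.
    + intros n t Ht; apply (Hd n t Ht).
    + intros n t Ht; eapply Rle_trans; [apply im_le_Cmod | auto].
    + intros t Ht; destruct (Hf t Ht) as [c [Hc1 Hc2]]; eapply ex_series_Im_le; eauto.
Qed.

(** * Limits of complex functions *)

Definition is_Clim {T} (F : (T -> Prop) -> Prop) (G : T -> C) (l : C) : Prop :=
  filterlim (fun t => Re (G t)) F (locally (Re l)) /\
  filterlim (fun t => Im (G t)) F (locally (Im l)).

Lemma is_Clim_Cmod {T} (F : (T -> Prop) -> Prop) {FF : Filter F} (G : T -> C) (l : C) :
  is_Clim F G l <-> forall eps : posreal, F (fun t => Cmod (G t - l)%C < eps).
Proof.
  split.
  - intros [H1 H2] eps.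
    pose proof (proj1 (filterlim_locally (F := F) (U := R_UniformSpace) (fun t => Re (G t)) (Re l)) H1) as A1.
    pose proof (proj1 (filterlim_locally (F := F) (U := R_UniformSpace) (fun t => Im (G t)) (Im l)) H2) as A2.
    assert (He : 0 < eps / 2) by (destruct eps; simpl; lra).
    eapply filter_imp; [| apply filter_and; [exact (A1 (mkposreal _ He)) | exact (A2 (mkposreal _ He))]].
    intros t [B1 B2]. unfold ball in B1, B2; simpl in B1, B2.
    unfold AbsRing_ball, abs, minus, plus, opp in B1, B2; simpl in B1, B2.
    eapply Rle_lt_trans; [apply Cmod_le_parts |]. rewrite Re_minus, Im_minus. unfold Rminus; lra.
  - intros H; split; apply (filterlim_locally (U := R_UniformSpace)); intros eps; eapply filter_imp; [| exact (H eps) | | exact (H eps)];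
    intros t Ht; unfold ball; simpl; unfold AbsRing_ball, abs, minus, plus, opp; simpl;
    eapply Rle_lt_trans; [| exact Ht | | exact Ht].
    + apply (re_le_Cmod (G t - l)%C).
    + apply (im_le_Cmod (G t - l)%C).
Qed.

Lemma is_Clim_unique {T} (F : (T -> Prop) -> Prop) {FF : ProperFilter' F} (G : T -> C) (l k : C) :
  is_Clim F G l -> is_Clim F G k -> l = k.
Proof.
  intros [H1 H2] [H3 H4]; apply C_eq_parts.
  - eapply (filterlim_locally_unique (K := R_AbsRing) (V := R_NormedModule)); eauto.
  - eapply (filterlim_locally_unique (K := R_AbsRing) (V := R_NormedModule)); eauto.
Qed.

Lemma is_Clim_const {T} (F : (T -> Prop) -> Prop) {FF : Filter F} (l : C) : is_Clim F (fun _ => l) l.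
Proof. split; apply filterlim_const. Qed.

Lemma is_Clim_ext {T} (F : (T -> Prop) -> Prop) {FF : Filter F} (G H : T -> C) (l : C) :
  F (fun t => G t = H t) -> is_Clim F G l -> is_Clim F H l.
Proof.
  intros E [H1 H2]; split; (eapply filterlim_ext_loc; [| eassumption]);
  eapply filter_imp; [| exact E | | exact E]; intros t Ht; simpl; now rewrite Ht.
Qed.

Lemma is_Clim_eq {T} (F : (T -> Prop) -> Prop) (G : T -> C) (l l' : C) :
  is_Clim F G l -> l = l' -> is_Clim F G l'.
Proof. now intros H <-. Qed.

Lemma filterlim_Rplus {T} (F : (T -> Prop) -> Prop) {FF : Filter F} (f g : T -> R) (x y : R) :
  filterlim f F (locally x) -> filterlim g F (locally y) ->
  filterlim (fun t => f t + g t) F (locally (x + y)).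
Proof.
  intros A B; eapply filterlim_comp_2; [exact A | exact B |].
  apply (filterlim_plus (K := R_AbsRing) (V := R_NormedModule)).
Qed.

Lemma filterlim_Ropp {T} (F : (T -> Prop) -> Prop) {FF : Filter F} (f : T -> R) (x : R) :
  filterlim f F (locally x) -> filterlim (fun t => - f t) F (locally (- x)).
Proof.
  intros A; eapply filterlim_comp;
    [exact A | apply (filterlim_opp (K := R_AbsRing) (V := R_NormedModule))].
Qed.

Lemma filterlim_Rmult {T} (F : (T -> Prop) -> Prop) {FF : Filter F} (f g : T -> R) (x y : R) :
  filterlim f F (locally x) -> filterlim g F (locally y) ->
  filterlim (fun t => f t * g t) F (locally (x * y)).
Proof.
  intros A B; eapply filterlim_comp_2; [exact A | exact B |].
  apply (filterlim_mult (K := R_AbsRing)).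
Qed.

Lemma is_Clim_plus {T} (F : (T -> Prop) -> Prop) {FF : Filter F} (G H : T -> C) (l k : C) :
  is_Clim F G l -> is_Clim F H k -> is_Clim F (fun t => G t + H t)%C (l + k)%C.
Proof.
  intros [H1 H2] [H3 H4]; split.
  - apply (filterlim_Rplus F (fun t => Re (G t)) (fun t => Re (H t))); auto.
  - apply (filterlim_Rplus F (fun t => Im (G t)) (fun t => Im (H t))); auto.
Qed.

Lemma is_Clim_mult {T} (F : (T -> Prop) -> Prop) {FF : Filter F} (G H : T -> C) (l k : C) :
  is_Clim F G l -> is_Clim F H k -> is_Clim F (fun t => G t * H t)%C (l * k)%C.
Proof.
  intros [H1 H2] [H3 H4]; split.
  - apply (filterlim_Rplus F (fun t => Re (G t) * Re (H t)) (fun t => - (Im (G t) * Im (H t)))); auto;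
    [| apply filterlim_Ropp; auto]; apply filterlim_Rmult; auto.
  - apply (filterlim_Rplus F (fun t => Re (G t) * Im (H t)) (fun t => Im (G t) * Re (H t))); auto;
    apply filterlim_Rmult; auto.
Qed.

Lemma is_Clim_opp {T} (F : (T -> Prop) -> Prop) {FF : Filter F} (G : T -> C) (l : C) :
  is_Clim F G l -> is_Clim F (fun t => - G t)%C (- l)%C.
Proof.
  intros H. apply (is_Clim_ext F (fun t => RtoC (- 1) * G t)%C).
  - apply filter_forall; intros; apply C_eq_parts; autorewrite with reim; ring.
  - eapply is_Clim_eq; [apply (is_Clim_mult F (fun _ => RtoC (- 1)) G); [apply is_Clim_const; auto | exact H] |].
    apply C_eq_parts; autorewrite with reim; ring.
Qed.

Lemma is_Clim_minus {T} (F : (T -> Prop) -> Prop) {FF : Filter F} (G H : T -> C) (l k : C) :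
  is_Clim F G l -> is_Clim F H k -> is_Clim F (fun t => G t - H t)%C (l - k)%C.
Proof. intros; apply (is_Clim_plus F G (fun t => - H t)%C); auto; now apply is_Clim_opp. Qed.

Lemma is_Clim_RtoC {T} (F : (T -> Prop) -> Prop) {FF : Filter F} (f : T -> R) (l : R) :
  filterlim f F (locally l) -> is_Clim F (fun t => RtoC (f t)) (RtoC l).
Proof. intros H; split; [exact H | apply filterlim_const]. Qed.

Lemma is_Clim_0_le {T} (F : (T -> Prop) -> Prop) {FF : Filter F} (G : T -> C) (g : T -> R) :
  F (fun t => Cmod (G t) <= g t) -> filterlim g F (locally 0) -> is_Clim F G (RtoC 0).
Proof.
  intros H Hg; apply is_Clim_Cmod; auto. intros eps.
  pose proof (proj1 (filterlim_locally (F := F) (U := R_UniformSpace) g 0) Hg eps) as Hg'.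
  eapply filter_imp; [| apply filter_and; [exact H | exact Hg']].
  intros t [A B]. unfold ball in B; simpl in B; unfold AbsRing_ball, abs, minus, plus, opp in B; simpl in B.
  replace (G t - RtoC 0)%C with (G t) by ring. apply Rabs_def2 in B. lra.
Qed.

Lemma is_Clim_sum_n {T} (F : (T -> Prop) -> Prop) {FF : Filter F} (G : nat -> T -> C) (l : nat -> C) (N : nat) :
  (forall n, (n <= N)%nat -> is_Clim F (G n) (l n)) ->
  is_Clim F (fun t => sum_n (fun n => G n t) N) (sum_n l N).
Proof.
  induction N as [|N IH]; intros H.
  - rewrite sum_O. apply (is_Clim_ext F (G 0%nat)); [apply filter_forall; intros; now rewrite sum_O | auto].
  - rewrite sum_Sn. apply (is_Clim_ext F (fun t => sum_n (fun n => G n t) N + G (S N) t)%C).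
    + apply filter_forall; intros; now rewrite sum_Sn.
    + apply is_Clim_plus; auto.
Qed.

(* Tannery's theorem. *)
Lemma is_Clim_CSeries {T} (F : (T -> Prop) -> Prop) {FF : Filter F} (G : nat -> T -> C)
    (l : nat -> C) (b : nat -> R) :
  (forall n, is_Clim F (G n) (l n)) ->
  F (fun t => forall n, Cmod (G n t) <= b n) -> (forall n, Cmod (l n) <= b n) -> ex_series b ->
  is_Clim F (fun t => CSeries (fun n => G n t)) (CSeries l).
Proof.
  intros HG Hb Hl Hs. apply is_Clim_Cmod; auto. intros eps.
  destruct (Series_tail_small b (eps / 8) Hs) as [N HN]; [destruct eps; simpl; lra |].
  assert (HbN : ex_series (fun k => b (S N + k)%nat)) by (now apply (ex_series_incr_n b (S N))).
  assert (He : 0 < eps / 4) by (destruct eps; simpl; lra).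
  assert (A := proj1 (is_Clim_Cmod F _ _) (is_Clim_sum_n F G l N (fun n _ => HG n)) (mkposreal _ He)).
  eapply filter_imp; [| apply filter_and; [exact A | exact Hb]].
  intros t [B1 B2]. simpl in B1.
  assert (Split : forall u : nat -> C, (forall n, Cmod (u n) <= b n) ->
     CSeries u = (sum_n u N + CSeries (fun k => u (S N + k)%nat))%C).
  { intros u Hu. apply C_eq_parts; simpl.
    - rewrite (Series_incr_n _ (S N)) by (try lia; eapply ex_series_Re_le; eauto).
      simpl pred; rewrite <- sum_n_Reals, <- Re_sum_n; reflexivity.
    - rewrite (Series_incr_n _ (S N)) by (try lia; eapply ex_series_Im_le; eauto).
      simpl pred; rewrite <- sum_n_Reals, <- Im_sum_n; reflexivity. }
  rewrite (Split (fun n => G n t)), (Split l) by auto.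
  assert (T1 := Cmod_CSeries_le (fun k => G (S N + k)%nat t) _ (fun k => B2 (S N + k)%nat) HbN).
  assert (T2 := Cmod_CSeries_le (fun k => l (S N + k)%nat) _ (fun k => Hl (S N + k)%nat) HbN).
  match goal with |- Cmod (?a + ?x - (?c + ?y))%C < _ =>
    replace (a + x - (c + y))%C with ((a - c) + (x + - y))%C by ring end.
  eapply Rle_lt_trans; [apply Cmod_triangle |].
  eapply Rle_lt_trans; [apply Rplus_le_compat_l, Cmod_triangle |].
  rewrite Cmod_opp. apply Rabs_def2 in HN. simpl in *. lra.
Qed.

(** * Summation by the Dirichlet kernel *)

(* [dirichlet N] is 1 + 2 sum_{k<=N} cos(2 pi k x); [saw] and [parab] are its successive
   primitives of mean zero, i.e. the Fourier remainders of B_1(x) and B_2(x)/2. *)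
Fixpoint dirichlet (N : nat) (x : R) : R :=
  match N with
  | O => 1
  | S n => dirichlet n x + 2 * cos (2 * PI * INR (S n) * x)
  end.

Fixpoint saw (N : nat) (x : R) : R :=
  match N with
  | O => x - / 2
  | S n => saw n x + sin (2 * PI * INR (S n) * x) / (PI * INR (S n))
  end.

Fixpoint parab (N : nat) (x : R) : R :=
  match N with
  | O => / 12 + (x ^ 2 - x) / 2
  | S n => parab n x - cos (2 * PI * INR (S n) * x) / (2 * PI ^ 2 * INR (S n) ^ 2)
  end.

Lemma INR_S_pos (n : nat) : 0 < INR (S n).
Proof. apply lt_0_INR; lia. Qed.

Lemma INR_two : INR 2 = 2.
Proof. simpl; ring. Qed.

Lemma is_derive_saw (N : nat) (x : R) : is_derive (saw N) x (dirichlet N x).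
Proof.
  induction N as [|N IH]; [simpl; auto_derive; auto |].
  change (is_derive (fun x => saw N x + sin (2 * PI * INR (S N) * x) / (PI * INR (S N))) x
    (dirichlet N x + 2 * cos (2 * PI * INR (S N) * x))).
  apply (is_derive_plus (K := R_AbsRing) (V := R_NormedModule)); auto.
  assert (H := INR_S_pos N). assert (P := PI_RGT_0). set (k := INR (S N)) in *.
  auto_derive; auto. field; lra.
Qed.

Lemma is_derive_parab (N : nat) (x : R) : is_derive (parab N) x (saw N x).
Proof.
  induction N as [|N IH]; [simpl; auto_derive; auto; field |].
  change (is_derive (fun x => parab N x - cos (2 * PI * INR (S N) * x) / (2 * PI ^ 2 * INR (S N) ^ 2)) x
    (saw N x + sin (2 * PI * INR (S N) * x) / (PI * INR (S N)))).
  assert (H := INR_S_pos N). assert (P := PI_RGT_0). set (k := INR (S N)) in *.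
  eapply is_derive_eq.
  - apply (is_derive_minus (K := R_AbsRing) (V := R_NormedModule)); [exact IH |].
    auto_derive; auto; reflexivity.
  - unfold minus, plus, opp; simpl. field; lra.
Qed.

(** The closed form of the kernel, multiplied by the sine so that it also holds at the integers. *)
Lemma dirichlet_sin (N : nat) (x : R) :
  sin (PI * x) * dirichlet N x = sin ((2 * INR N + 1) * (PI * x)).
Proof.
  induction N as [|N IH].
  - simpl. rewrite Rmult_1_r; f_equal; ring.
  - change (dirichlet (S N) x) with (dirichlet N x + 2 * cos (2 * PI * INR (S N) * x)).
    rewrite Rmult_plus_distr_l, IH, S_INR.
    set (y := PI * x).
    replace ((2 * INR N + 1) * y) with (2 * (INR N + 1) * y - y) by ring.
    replace ((2 * (INR N + 1) + 1) * y) with (2 * (INR N + 1) * y + y) by ring.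
    replace (2 * PI * (INR N + 1) * x) with (2 * (INR N + 1) * y) by (unfold y; ring).
    rewrite sin_plus, sin_minus; ring.
Qed.

Lemma sin_INR_PI (n : nat) : sin (INR n * PI) = 0.
Proof.
  induction n as [|n IH]; [simpl; rewrite Rmult_0_l; apply sin_0 |].
  rewrite S_INR, Rmult_plus_distr_r, Rmult_1_l, neg_sin, IH; ring.
Qed.

Lemma saw_half (N : nat) : saw N (/ 2) = 0.
Proof.
  induction N as [|N IH]; [simpl; field |].
  change (saw (S N) (/ 2)) with (saw N (/ 2) + sin (2 * PI * INR (S N) * / 2) / (PI * INR (S N))).
  replace (2 * PI * INR (S N) * / 2) with (INR (S N) * PI) by field.
  rewrite IH, sin_INR_PI. unfold Rdiv; ring.
Qed.

Lemma saw_1 (N : nat) : saw N 1 = / 2.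
Proof.
  induction N as [|N IH]; [simpl; field |].
  change (saw (S N) 1) with (saw N 1 + sin (2 * PI * INR (S N) * 1) / (PI * INR (S N))).
  replace (2 * PI * INR (S N) * 1) with (INR (2 * S N) * PI) by (rewrite mult_INR; rewrite INR_two; ring).
  rewrite IH, sin_INR_PI. unfold Rdiv; ring.
Qed.

Lemma saw_0 (N : nat) : saw N 0 = - / 2.
Proof.
  induction N as [|N IH]; [simpl; field |].
  change (saw (S N) 0) with (saw N 0 + sin (2 * PI * INR (S N) * 0) / (PI * INR (S N))).
  rewrite Rmult_0_r, sin_0, IH. unfold Rdiv; ring.
Qed.

Lemma sin_PI_between (x t : R) :
  0 < x < 1 -> Rmin x (/ 2) <= t <= Rmax x (/ 2) -> sin (PI * x) <= sin (PI * t).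
Proof.
  intros Hx Ht. assert (P := PI_RGT_0).
  revert Ht; unfold Rmin, Rmax; destruct (Rle_dec x (/ 2)); intros Ht.
  - apply sin_incr_1; nra.
  - apply sin_decr_1; nra.
Qed.

(** One integration by parts of the kernel sin((2N+1) pi t) / sin(pi t), started at 1/2 where [saw]
    vanishes for every N. Inside (0,1) the remainder is thus O(1/N), with a constant that
    deteriorates at the end points. *)
Lemma saw_bound (N : nat) (x : R) :
  0 < x < 1 -> Rabs (saw N x) <= 2 / ((2 * INR N + 1) * sin (PI * x) ^ 2).
Proof.
  intros Hx. assert (P := PI_RGT_0). assert (P2 := PI2_1). assert (HN := pos_INR N).
  assert (Hs : 0 < sin (PI * x)) by (apply sin_gt_0; nra).
  assert (Hs1 := SIN_bound (PI * x)).
  set (s := sin (PI * x)) in *. set (M := 2 * INR N + 1).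
  assert (HM : 0 < M) by (unfold M; lra).
  assert (HMP : 0 < M * PI * s) by (apply Rmult_lt_0_compat; [apply Rmult_lt_0_compat |]; assumption).
  (* Adding the boundary term of the integration by parts cancels the oscillating kernel; the
     derivative of [V] carries a factor 1/(2N+1). *)
  set (V := fun t => saw N t + cos (M * (PI * t)) / (M * PI * sin (PI * t))).
  assert (Hst : forall t, Rmin x (/ 2) <= t <= Rmax x (/ 2) -> s <= sin (PI * t)).
  { intros; now apply sin_PI_between. }
  assert (B : Rabs (V (/ 2) - V x) <= / (M * s ^ 2) * Rabs (/ 2 - x)).
  { apply (Rabs_le_of_derive V (fun t => - cos (M * (PI * t)) * cos (PI * t) / (M * sin (PI * t) ^ 2))).
    - intros t Ht; specialize (Hst t Ht). unfold V.
      eapply is_derive_eq.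
      + apply (is_derive_plus (K := R_AbsRing) (V := R_NormedModule)); [apply is_derive_saw |].
        auto_derive; [|reflexivity]. repeat split; auto. apply Rgt_not_eq. apply Rmult_lt_0_compat; [apply Rmult_lt_0_compat |]; try assumption; clear - Hst Hs; lra.
      + assert (D := dirichlet_sin N t). fold M in D.
        replace (dirichlet N t) with (sin (M * (PI * t)) / sin (PI * t)) by (rewrite <- D; field; lra).
        unfold plus; simpl. field. lra.
    - intros t Ht; specialize (Hst t Ht).
      unfold Rdiv; rewrite Rabs_mult, Rabs_inv, Rabs_mult, Rabs_Ropp.
      rewrite (Rabs_pos_eq (M * _)) by nra.
      assert (C1 := COS_bound (M * (PI * t))). assert (C2 := COS_bound (PI * t)).
      assert (Rabs (cos (M * (PI * t))) <= 1) by (apply Rabs_le; lra).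
      assert (Rabs (cos (PI * t)) <= 1) by (apply Rabs_le; lra).
      assert (0 <= Rabs (cos (M * (PI * t)))) by apply Rabs_pos.
      assert (0 <= Rabs (cos (PI * t))) by apply Rabs_pos.
      assert (/ (M * sin (PI * t) ^ 2) <= / (M * s ^ 2)).
      { apply Rinv_le_contravar; [apply Rmult_lt_0_compat; nra |]. apply Rmult_le_compat_l; nra. }
      assert (0 < / (M * sin (PI * t) ^ 2)) by (apply Rinv_0_lt_compat, Rmult_lt_0_compat; nra).
      apply Rle_trans with (1 * / (M * sin (PI * t) ^ 2)); [| lra].
      apply Rmult_le_compat_r; nra. }
  assert (V2 : V (/ 2) = 0).
  { unfold V. rewrite saw_half. replace (M * (PI * / 2)) with (PI / 2 + INR N * PI) by (unfold M; field).
    rewrite cos_plus, cos_PI2, sin_INR_PI. unfold Rdiv; ring. }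
  rewrite V2 in B. unfold V in B. cbv beta in B. fold s in B.
  replace (0 - (saw N x + cos (M * (PI * x)) / (M * PI * s))) with
    (- (saw N x + cos (M * (PI * x)) / (M * PI * s))) in B by ring.
  rewrite Rabs_Ropp in B.
  assert (C1 := COS_bound (M * (PI * x))).
  assert (Q : Rabs (cos (M * (PI * x)) / (M * PI * s)) <= / (M * s ^ 2)).
  { unfold Rdiv; rewrite Rabs_mult, Rabs_inv.
    rewrite (Rabs_pos_eq (M * PI * s)) by lra.
    assert (Rabs (cos (M * (PI * x))) <= 1) by (apply Rabs_le; lra).
    assert (/ (M * PI * s) <= / (M * s ^ 2)).
    { apply Rinv_le_contravar; [apply Rmult_lt_0_compat; nra |]. rewrite Rmult_assoc. apply Rmult_le_compat_l; nra. }
    assert (0 < / (M * PI * s)) by (now apply Rinv_0_lt_compat).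
    apply Rle_trans with (1 * / (M * PI * s)); [| lra]. apply Rmult_le_compat_r; lra. }
  assert (Rabs (/ 2 - x) <= 1) by (apply Rabs_le; lra).
  assert (I0 : 0 < / (M * s ^ 2)) by (apply Rinv_0_lt_compat, Rmult_lt_0_compat; nra).
  replace (2 / (M * s ^ 2)) with (/ (M * s ^ 2) + / (M * s ^ 2)) by (unfold Rdiv; ring).
  assert (B1 : Rabs (saw N x + cos (M * (PI * x)) / (M * PI * s)) <= / (M * s ^ 2)).
  { eapply Rle_trans; [exact B |]. rewrite <- (Rmult_1_r (/ (M * s ^ 2))) at 2. apply Rmult_le_compat_l; lra. }
  apply Rabs_le_between in B1. apply Rabs_le_between in Q. apply Rabs_le; lra.
Qed.

Lemma parab_half (N : nat) (x : R) :
  0 < x < 1 -> Rabs (parab N x - parab N (/ 2)) <= 1 / ((2 * INR N + 1) * sin (PI * x) ^ 2).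
Proof.
  intros Hx. assert (P := PI_RGT_0). assert (HN := pos_INR N).
  assert (Hs : 0 < sin (PI * x)) by (apply sin_gt_0; nra).
  rewrite Rabs_minus_sym.
  apply Rle_trans with (2 / ((2 * INR N + 1) * sin (PI * x) ^ 2) * Rabs (/ 2 - x)).
  - apply (Rabs_le_of_derive _ (saw N)); intros t Ht; [apply is_derive_parab |].
    assert (0 < t < 1) by (revert Ht; unfold Rmin, Rmax; destruct (Rle_dec x (/ 2)); lra).
    eapply Rle_trans; [apply saw_bound; auto |]. unfold Rdiv; apply Rmult_le_compat_l; [lra |].
    assert (HH := sin_PI_between x t Hx Ht).
    apply Rinv_le_contravar; [apply Rmult_lt_0_compat; nra |]. apply Rmult_le_compat_l; nra.
  - assert (Rabs (/ 2 - x) <= / 2) by (apply Rabs_le; lra).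
    replace (1 / ((2 * INR N + 1) * sin (PI * x) ^ 2))
      with (2 / ((2 * INR N + 1) * sin (PI * x) ^ 2) * / 2) by (field; nra).
    apply Rmult_le_compat_l; auto. apply Rlt_le, Rdiv_lt_0_compat; [lra |]. apply Rmult_lt_0_compat; nra.
Qed.

(** The coefficients 1/(2 pi^2 k^2) are dominated by 1/(k-1) - 1/k, which telescopes. This bound is
    uniform in x, in contrast with the one in [parab_half]. *)
Lemma parab_tail (N j : nat) (x : R) :
  (1 <= N)%nat -> Rabs (parab (N + j) x - parab N x) <= / INR N - / INR (N + j).
Proof.
  intros HN. assert (P2 := PI2_1). induction j as [|j IH].
  - rewrite Nat.add_0_r, !Rminus_diag, Rabs_R0; lra.
  - rewrite Nat.add_succ_r.
    change (parab (S (N + j)) x) with (parab (N + j) x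
      - cos (2 * PI * INR (S (N + j)) * x) / (2 * PI ^ 2 * INR (S (N + j)) ^ 2)).
    assert (C1 := COS_bound (2 * PI * INR (S (N + j)) * x)).
    set (c := cos _) in *. rewrite S_INR.
    assert (Hk : 1 <= INR (N + j)) by (change 1 with (INR 1); apply le_INR; lia).
    set (k := INR (N + j)) in *.
    assert (T : Rabs (c / (2 * PI ^ 2 * (k + 1) ^ 2)) <= / k - / (k + 1)).
    { replace (/ k - / (k + 1)) with (/ (k * (k + 1))) by (field; lra).
      unfold Rdiv; rewrite Rabs_mult, Rabs_inv.
      assert (H8 : 1 <= 2 * PI ^ 2) by nra.
      rewrite (Rabs_pos_eq (2 * PI ^ 2 * (k + 1) ^ 2)) by (apply Rmult_le_pos; nra).
      assert (Rabs c <= 1) by (apply Rabs_le; lra).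
      assert (H9 : k * (k + 1) <= 2 * PI ^ 2 * (k + 1) ^ 2).
      { apply Rle_trans with (1 * (k + 1) ^ 2); [nra |]. apply Rmult_le_compat_r; nra. }
      assert (H10 : / (2 * PI ^ 2 * (k + 1) ^ 2) <= / (k * (k + 1))) by (apply Rinv_le_contravar; nra).
      assert (0 < / (2 * PI ^ 2 * (k + 1) ^ 2)) by (apply Rinv_0_lt_compat; nra).
      apply Rle_trans with (1 * / (2 * PI ^ 2 * (k + 1) ^ 2)); [| lra]. apply Rmult_le_compat_r; lra. }
    apply Rabs_le_between in T. apply Rabs_le_between in IH. apply Rabs_le. lra.
Qed.

Lemma cos_odd_PI2 (n : nat) : cos (INR (2 * n + 1) * (PI / 2)) = 0.
Proof.
  replace (INR (2 * n + 1) * (PI / 2)) with (PI / 2 + INR n * PI)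
    by (rewrite plus_INR, mult_INR; simpl; field).
  rewrite cos_plus, cos_PI2, sin_INR_PI; ring.
Qed.

(** The duplication relation of the second Bernoulli polynomial: at 1/4 the odd frequencies vanish
    and the even ones reproduce the frequencies at 1/2. *)
Lemma parab_quarter (N : nat) : parab (2 * N) (/ 4) = / 4 * parab N (/ 2).
Proof.
  induction N as [|N IH]; [simpl; field |].
  replace (2 * S N)%nat with (S (S (2 * N))) by lia.
  change (parab (S (S (2 * N))) (/ 4)) with (parab (2 * N) (/ 4)
    - cos (2 * PI * INR (S (2 * N)) * / 4) / (2 * PI ^ 2 * INR (S (2 * N)) ^ 2)
    - cos (2 * PI * INR (S (S (2 * N))) * / 4) / (2 * PI ^ 2 * INR (S (S (2 * N))) ^ 2)).
  change (parab (S N) (/ 2)) with (parab N (/ 2)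
    - cos (2 * PI * INR (S N) * / 2) / (2 * PI ^ 2 * INR (S N) ^ 2)).
  rewrite IH.
  replace (2 * PI * INR (S (2 * N)) * / 4) with (INR (2 * N + 1) * (PI / 2))
    by (replace (2 * N + 1)%nat with (S (2 * N)) by lia; field).
  rewrite cos_odd_PI2.
  replace (S (S (2 * N))) with (2 * S N)%nat by lia. rewrite (mult_INR 2 (S N)).
  assert (H := INR_S_pos N). assert (H1 := INR_S_pos (2 * N)). assert (P := PI_RGT_0).
  rewrite INR_two. replace (2 * PI * (2 * INR (S N)) * / 4) with (2 * PI * INR (S N) * / 2) by field.
  field. repeat split; lra.
Qed.

(** The value at 1/2 nearly equals the value at 1/4 by [parab_half], which is a quarter of the value
    at 1/2 by [parab_quarter]. Hence three quarters of it are O(1/N). In this way the constant 1/12,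
    equivalently the sum of 1/k^2, is confirmed without computing that sum. *)
Lemma parab_at_half (N : nat) : (1 <= N)%nat -> Rabs (parab N (/ 2)) <= 3 / INR N.
Proof.
  intros HN.
  assert (Hk : 1 <= INR N) by (change 1 with (INR 1); apply le_INR; lia).
  assert (A := parab_half (2 * N) (/ 4) ltac:(lra)).
  assert (B := parab_tail N N (/ 2) HN).
  replace (N + N)%nat with (2 * N)%nat in B by lia.
  rewrite parab_quarter in A.
  replace (PI * / 4) with (PI / 4) in A by reflexivity.
  rewrite sin_PI4 in A. rewrite mult_INR in A, B. rewrite INR_two in A, B.
  replace ((1 / sqrt 2) ^ 2) with (/ 2) in A.
  2:{ assert (0 < sqrt 2) by (apply sqrt_lt_R0; lra).
      replace ((1 / sqrt 2) ^ 2) with (/ (sqrt 2 ^ 2)) by (field; lra).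
      rewrite pow2_sqrt; lra. }
  assert (A' : 1 / ((2 * (2 * INR N) + 1) * / 2) <= / INR N).
  { replace (1 / ((2 * (2 * INR N) + 1) * / 2)) with (/ (2 * INR N + / 2)) by (field; lra).
    apply Rinv_le_contravar; lra. }
  assert (0 < / (2 * INR N)) by (apply Rinv_0_lt_compat; lra).
  assert (0 < / INR N) by (apply Rinv_0_lt_compat; lra).
  unfold Rdiv. apply Rabs_le_between in A. apply Rabs_le_between in B. apply Rabs_le. lra.
Qed.

Lemma is_lim_seq_inv_INR : is_lim_seq (fun n => / INR n) 0.
Proof. apply (is_lim_seq_inv _ p_infty); [apply is_lim_seq_INR | discriminate]. Qed.

Lemma parab_bound (N : nat) (x : R) :
  (1 <= N)%nat -> 0 <= x <= 1 -> Rabs (parab N x) <= / INR N.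
Proof.
  intros HN.
  assert (Int : forall x, 0 < x < 1 -> Rabs (parab N x) <= / INR N).
  { clear x; intros x Hx. assert (P := PI_RGT_0).
    assert (Hs : 0 < sin (PI * x)) by (apply sin_gt_0; nra).
    (* [K] collects the errors of [parab_at_half] and [parab_half] at the order N + j. They vanish
       as j grows, and only the tail bound 1/N remains. *)
    set (K := 3 + / sin (PI * x) ^ 2).
    assert (L : is_lim_seq (fun j => / INR N + K * / INR (j + N)) (/ INR N)).
    { replace (Finite (/ INR N)) with (Finite (/ INR N + K * 0)) by (f_equal; ring).
      apply is_lim_seq_plus'; [apply is_lim_seq_const |].
      apply (is_lim_seq_scal_l _ K 0). apply (is_lim_seq_incr_n (fun n => / INR n)), is_lim_seq_inv_INR. }
    assert (C : is_lim_seq (fun _ => Rabs (parab N x)) (Rabs (parab N x))) by apply is_lim_seq_const.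
    refine (is_lim_seq_le _ _ (Rabs (parab N x)) (/ INR N) _ C L). intros j.
    assert (T := parab_tail N j x HN). assert (Q := parab_at_half (N + j) ltac:(lia)).
    assert (V := parab_half (N + j) x Hx). rewrite (Nat.add_comm j N).
    assert (Hk : 1 <= INR (N + j)) by (change 1 with (INR 1); apply le_INR; lia).
    set (k := INR (N + j)) in *.
    assert (V1 : 1 / ((2 * k + 1) * sin (PI * x) ^ 2) <= / sin (PI * x) ^ 2 * / k).
    { unfold Rdiv; rewrite Rmult_1_l, Rinv_mult, Rmult_comm. apply Rmult_le_compat_l.
      - apply Rlt_le, Rinv_0_lt_compat; nra.
      - apply Rinv_le_contravar; lra. }
    assert (0 < / k) by (apply Rinv_0_lt_compat; lra).
    unfold K. unfold Rdiv in Q. apply Rabs_le_between in T. apply Rabs_le_between in Q.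
    apply Rabs_le_between in V. apply Rabs_le. lra. }
  (* The interior argument degenerates at 0 and 1. A crude Lipschitz constant 1/2 + N is enough to
     carry the bound, already free of x, to the end points. *)
  assert (Cont : forall x y, 0 <= x <= 1 -> 0 < y < 1 -> Rabs (parab N x) <= / INR N + (/ 2 + INR N) * Rabs (y - x)).
  { clear x; intros x y Hx Hy. assert (I := Int y Hy).
    assert (D : Rabs (parab N y - parab N x) <= (/ 2 + INR N) * Rabs (y - x)).
    { apply (Rabs_le_of_derive _ (saw N)); [intros; apply is_derive_parab |].
      intros t Ht. assert (0 <= t <= 1) by (revert Ht; unfold Rmin, Rmax; destruct (Rle_dec x y); lra).
      clear - H. induction N as [|n IH]; [simpl; apply Rabs_le; lra |].
      change (saw (S n) t) with (saw n t + sin (2 * PI * INR (S n) * t) / (PI * INR (S n))).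
      eapply Rle_trans; [apply Rabs_triang |]. rewrite S_INR.
      assert (P2 := PI2_1). assert (Hn := pos_INR n).
      assert (S1 := SIN_bound (2 * PI * (INR n + 1) * t)).
      assert (Rabs (sin (2 * PI * (INR n + 1) * t) / (PI * (INR n + 1))) <= 1).
      { unfold Rdiv; rewrite Rabs_mult, Rabs_inv, (Rabs_pos_eq (PI * (INR n + 1))) by nra.
        apply Rle_trans with (1 * / 1); [| lra].
        apply Rmult_le_compat; [apply Rabs_pos | apply Rlt_le, Rinv_0_lt_compat; nra | apply Rabs_le; lra |].
        apply Rinv_le_contravar; nra. }
      lra. }
    apply Rabs_le_between in D. apply Rabs_le_between in I. apply Rabs_le; lra. }
  intros Hx. destruct (Rle_lt_dec (Rabs (parab N x)) (/ INR N)) as [|Hlt]; auto.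
  exfalso. set (d := Rabs (parab N x) - / INR N) in *. assert (Hd : 0 < d) by (unfold d; lra).
  assert (HN0 := pos_INR N).
  set (t := Rmin (/ 2) (d / (2 * (/ 2 + INR N)))).
  assert (Ht : 0 < t <= / 2).
  { split; [apply Rmin_pos; [lra | apply Rdiv_lt_0_compat; lra] | apply Rmin_l]. }
  assert (Ht2 : (/ 2 + INR N) * t <= d / 2).
  { apply Rle_trans with ((/ 2 + INR N) * (d / (2 * (/ 2 + INR N)))); [apply Rmult_le_compat_l; [lra | apply Rmin_r] |].
    right; field; lra. }
  destruct (Rle_lt_dec x (/ 2)).
  - assert (Q := Cont x (x + t / 2) Hx ltac:(lra)).
    replace (x + t / 2 - x) with (t / 2) in Q by ring. rewrite (Rabs_pos_eq (t / 2)) in Q by lra. unfold d in *; lra.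
  - assert (Q := Cont x (x - t / 2) Hx ltac:(lra)).
    replace (x - t / 2 - x) with (- (t / 2)) in Q by ring. rewrite Rabs_Ropp, (Rabs_pos_eq (t / 2)) in Q by lra. unfold d in *; lra.
Qed.

(** * Trapezoidal sums from the Dirichlet kernel *)

(** Two integrations by parts against [saw] and [parab]: the values -1/2 and 1/2 of [saw] at the end
    points produce the trapezoidal term, and everything left carries a factor [parab], hence 1/N.
    [Phi] is any primitive of f times the kernel, so no integral has to be formed. *)
Lemma trapezoid_real (N : nat) (f f1 f2 Phi : R -> R) (B : R) :
  (1 <= N)%nat ->
  (forall x, 0 <= x <= 1 -> is_derive f x (f1 x)) ->
  (forall x, 0 <= x <= 1 -> is_derive f1 x (f2 x)) ->
  (forall x, 0 <= x <= 1 -> is_derive Phi x (f x * dirichlet N x)) ->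
  (forall x, 0 <= x <= 1 -> Rabs (f2 x) <= B) ->
  Rabs (Phi 1 - Phi 0 - (f 0 + f 1) / 2) <= (Rabs (f1 0) + Rabs (f1 1) + B) / INR N.
Proof.
  intros HN H1 H2 H3 HB.
  assert (Hk : 1 <= INR N) by (change 1 with (INR 1); apply le_INR; lia).
  set (Psi := fun x => Phi x - f x * saw N x + f1 x * parab N x).
  assert (D : Rabs (Psi 1 - Psi 0) <= B / INR N * Rabs (1 - 0)).
  { apply (Rabs_le_of_derive Psi (fun x => f2 x * parab N x)); intros t; rewrite Rmin_left, Rmax_right by lra; intros Ht.
    - unfold Psi. eapply is_derive_eq.
      + apply (is_derive_plus (K := R_AbsRing) (V := R_NormedModule)).
        * apply (is_derive_minus (K := R_AbsRing) (V := R_NormedModule)); [apply H3; auto |].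
          apply is_derive_Rmult; [apply H1; auto | apply is_derive_saw].
        * apply is_derive_Rmult; [apply H2; auto | apply is_derive_parab].
      + unfold minus, plus, opp; simpl; ring.
    - rewrite Rabs_mult. unfold Rdiv. apply Rmult_le_compat; try apply Rabs_pos; auto.
      now apply parab_bound. }
  rewrite Rminus_0_r, Rabs_R1, Rmult_1_r in D. unfold Psi in D. rewrite saw_0, saw_1 in D.
  assert (P0 := parab_bound N 0 HN ltac:(lra)). assert (P1 := parab_bound N 1 HN ltac:(lra)).
  replace (Phi 1 - Phi 0 - (f 0 + f 1) / 2) with
    ((Phi 1 - f 1 * / 2 + f1 1 * parab N 1 - (Phi 0 - f 0 * - / 2 + f1 0 * parab N 0))
     + - (f1 1 * parab N 1) + f1 0 * parab N 0) by field.
  eapply Rle_trans; [apply Rabs_triang |].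
  eapply Rle_trans; [apply Rplus_le_compat_r, Rabs_triang |].
  rewrite Rabs_Ropp, !Rabs_mult.
  assert (Rabs (f1 1) * Rabs (parab N 1) <= Rabs (f1 1) * / INR N) by (apply Rmult_le_compat_l; [apply Rabs_pos | auto]).
  assert (Rabs (f1 0) * Rabs (parab N 0) <= Rabs (f1 0) * / INR N) by (apply Rmult_le_compat_l; [apply Rabs_pos | auto]).
  unfold Rdiv in *. lra.
Qed.

Lemma trapezoid_unit (N : nat) (F F1 F2 Phi : R -> C) (B : R) :
  (1 <= N)%nat ->
  (forall x, 0 <= x <= 1 -> is_Cderive F x (F1 x)) ->
  (forall x, 0 <= x <= 1 -> is_Cderive F1 x (F2 x)) ->
  (forall x, 0 <= x <= 1 -> is_Cderive Phi x (F x * RtoC (dirichlet N x))%C) ->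
  (forall x, 0 <= x <= 1 -> Cmod (F1 x) <= B) ->
  (forall x, 0 <= x <= 1 -> Cmod (F2 x) <= B) ->
  Cmod (Phi 1 - Phi 0 - (F 0 + F 1) / RtoC 2)%C <= 6 * B / INR N.
Proof.
  intros HN H1 H2 H3 HB1 HB2.
  assert (Hk : 1 <= INR N) by (change 1 with (INR 1); apply le_INR; lia).
  assert (A : Rabs (Re (Phi 1) - Re (Phi 0) - (Re (F 0) + Re (F 1)) / 2) <= 3 * B / INR N).
  { eapply Rle_trans; [apply (trapezoid_real N (fun x => Re (F x)) (fun x => Re (F1 x)) (fun x => Re (F2 x)) (fun x => Re (Phi x)) B HN) |].
    - intros; now apply H1.
    - intros; now apply H2.
    - intros x Hx; eapply is_derive_eq; [now apply H3 |]. autorewrite with reim; ring.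
    - intros; eapply Rle_trans; [apply re_le_Cmod | auto].
    - unfold Rdiv; apply Rmult_le_compat_r; [apply Rlt_le, Rinv_0_lt_compat; lra |].
      assert (Q0 := Rle_trans _ _ _ (re_le_Cmod (F1 0)) (HB1 0 ltac:(lra))).
      assert (Q1 := Rle_trans _ _ _ (re_le_Cmod (F1 1)) (HB1 1 ltac:(lra))). lra. }
  assert (A' : Rabs (Im (Phi 1) - Im (Phi 0) - (Im (F 0) + Im (F 1)) / 2) <= 3 * B / INR N).
  { eapply Rle_trans; [apply (trapezoid_real N (fun x => Im (F x)) (fun x => Im (F1 x)) (fun x => Im (F2 x)) (fun x => Im (Phi x)) B HN) |].
    - intros; now apply H1.
    - intros; now apply H2.
    - intros x Hx; eapply is_derive_eq; [now apply H3 |]. autorewrite with reim; ring.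
    - intros; eapply Rle_trans; [apply im_le_Cmod | auto].
    - unfold Rdiv; apply Rmult_le_compat_r; [apply Rlt_le, Rinv_0_lt_compat; lra |].
      assert (Q0 := Rle_trans _ _ _ (im_le_Cmod (F1 0)) (HB1 0 ltac:(lra))).
      assert (Q1 := Rle_trans _ _ _ (im_le_Cmod (F1 1)) (HB1 1 ltac:(lra))). lra. }
  eapply Rle_trans; [apply Cmod_le_parts |].
  replace (Re (Phi 1 - Phi 0 - (F 0 + F 1) / RtoC 2)%C) with (Re (Phi 1) - Re (Phi 0) - (Re (F 0) + Re (F 1)) / 2)
    by (unfold Cdiv; rewrite <- RtoC_inv by lra; autorewrite with reim; field).
  replace (Im (Phi 1 - Phi 0 - (F 0 + F 1) / RtoC 2)%C) with (Im (Phi 1) - Im (Phi 0) - (Im (F 0) + Im (F 1)) / 2)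
    by (unfold Cdiv; rewrite <- RtoC_inv by lra; autorewrite with reim; field).
  lra.
Qed.

Lemma dirichlet_shift (N n : nat) (x : R) : dirichlet N (INR n + x) = dirichlet N x.
Proof.
  induction N as [|N IH]; [reflexivity |].
  change (dirichlet (S N) (INR n + x)) with (dirichlet N (INR n + x) + 2 * cos (2 * PI * INR (S N) * (INR n + x))).
  change (dirichlet (S N) x) with (dirichlet N x + 2 * cos (2 * PI * INR (S N) * x)).
  rewrite IH; f_equal; f_equal.
  replace (2 * PI * INR (S N) * (INR n + x)) with (2 * PI * INR (S N) * x + 2 * INR (S N * n) * PI)
    by (rewrite mult_INR; ring).
  apply cos_period.
Qed.

Lemma cos_2PI_nat (k : nat) : cos (2 * PI * INR k) = 1.
Proof.
  replace (2 * PI * INR k) with (0 + 2 * INR k * PI) by ring. rewrite cos_period; apply cos_0.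
Qed.

Lemma sin_2PI_nat (k : nat) : sin (2 * PI * INR k) = 0.
Proof.
  replace (2 * PI * INR k) with (0 + 2 * INR k * PI) by ring. rewrite sin_period; apply sin_0.
Qed.

(** * Partial sums of complex series and finite sums *)

Ltac cring := cbv beta; match goal with |- @eq _ ?x ?y => change (@eq C x y) end; ring.
Ltac cfield := cbv beta; match goal with |- @eq _ ?x ?y => change (@eq C x y) end; field.

Lemma is_Cseries_iff (u : nat -> C) (l : C) :
  is_Cseries u l <-> is_Clim eventually (sum_n u) l.
Proof.
  split; intros [H1 H2]; split.
  - eapply filterlim_ext; [| exact H1]; intros; symmetry; apply Re_sum_n.
  - eapply filterlim_ext; [| exact H2]; intros; symmetry; apply Im_sum_n.
  - eapply filterlim_ext; [| exact H1]; intros; apply Re_sum_n.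
  - eapply filterlim_ext; [| exact H2]; intros; apply Im_sum_n.
Qed.

Lemma is_Cseries_incr_1 (u : nat -> C) (l : C) :
  is_Cseries (fun n => u (S n)) l -> is_Cseries u (u 0%nat + l)%C.
Proof.
  intros [H1 H2]; split.
  - apply (is_series_decr_1 (K := R_AbsRing) (V := R_NormedModule)); simpl.
    apply (is_series_ext (fun n => Re (u (S n)))); [reflexivity |].
    replace (plus _ _) with (Re l); [exact H1 |]. unfold plus, opp; simpl; unfold Re, Im; ring.
  - apply (is_series_decr_1 (K := R_AbsRing) (V := R_NormedModule)); simpl.
    apply (is_series_ext (fun n => Im (u (S n)))); [reflexivity |].
    replace (plus _ _) with (Im l); [exact H2 |]. unfold plus, opp; simpl; unfold Re, Im; ring.
Qed.

Lemma sum_n_Cscal (c : C) (u : nat -> C) (N : nat) :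
  sum_n (fun n => c * u n)%C N = (c * sum_n u N)%C.
Proof.
  induction N as [|N IH]; [now rewrite !sum_O |]. rewrite !sum_Sn, IH.
  change plus with Cplus; cring.
Qed.

Lemma sum_n_Cplus (u v : nat -> C) (N : nat) :
  sum_n (fun n => u n + v n)%C N = (sum_n u N + sum_n v N)%C.
Proof.
  induction N as [|N IH]; [now rewrite !sum_O |]. rewrite !sum_Sn, IH.
  change plus with Cplus; cring.
Qed.

Lemma sum_n_CS (u : nat -> C) (N : nat) : sum_n u (S N) = (sum_n u N + u (S N))%C.
Proof. rewrite sum_Sn; reflexivity. Qed.

Lemma sum_n_RS (u : nat -> R) (N : nat) : sum_n u (S N) = sum_n u N + u (S N).
Proof. rewrite sum_Sn; reflexivity. Qed.

Lemma is_Clim_Cmod_le {T} (F : (T -> Prop) -> Prop) {FF : ProperFilter F} (G : T -> C) (l : C) (B : R) :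
  is_Clim F G l -> F (fun t => Cmod (G t) <= B) -> Cmod l <= B.
Proof.
  intros H HB. destruct (Rle_lt_dec (Cmod l) B) as [|Hlt]; auto. exfalso.
  assert (He : 0 < Cmod l - B) by lra.
  assert (A := proj1 (is_Clim_Cmod F G l) H (mkposreal _ He)).
  destruct (filter_ex _ (filter_and _ _ A HB)) as [t [A1 A2]]. simpl in A1.
  assert (Q := Cmod_triangle (G t) (- (G t - l))%C). rewrite Cmod_opp in Q.
  replace (G t + - (G t - l))%C with l in Q by ring. lra.
Qed.

(** * Partial fractions of the hyperbolic cotangent *)

Lemma is_Cderive_lin (b c : C) (t : R) : is_Cderive (fun t => b * RtoC t + c)%C t b.
Proof.
  eapply is_Cderive_eq.
  - apply is_Cderive_plus; [| apply is_Cderive_const].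
    apply is_Cderive_scal, is_Cderive_RtoC, (is_derive_id (K := R_AbsRing)).
  - change (one : R) with 1. ring.
Qed.

Lemma is_Cderive_exp_lin (b : C) (t : R) :
  is_Cderive (fun t => Cexp (b * RtoC t)%C) t (b * Cexp (b * RtoC t))%C.
Proof.
  apply (is_Cderive_Cexp (fun t => b * RtoC t)%C).
  apply (is_Cderive_ext (fun t => b * RtoC t + RtoC 0)%C); [intros; ring | apply is_Cderive_lin].
Qed.

(** A primitive of exp(b x) times the Dirichlet kernel. For b = -2 pi a the denominators are 4 pi^2
    (k^2 + a^2), the terms of the partial fraction series. *)
Fixpoint exp_cos_primitive (b : C) (N : nat) (x : R) : C :=
  match N with
  | O => (Cexp (b * RtoC x) / b)%C
  | S n => (exp_cos_primitive b n x + RtoC 2 * Cexp (b * RtoC x)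
      * (b * RtoC (cos (2 * PI * INR (S n) * x)) + RtoC (2 * PI * INR (S n) * sin (2 * PI * INR (S n) * x)))
      / (b * b + RtoC ((2 * PI * INR (S n)) ^ 2)))%C
  end.

Lemma exp_cos_primitive_S (b : C) (n : nat) (x : R) :
  exp_cos_primitive b (S n) x = (exp_cos_primitive b n x + RtoC 2 * Cexp (b * RtoC x)
      * (b * RtoC (cos (2 * PI * INR (S n) * x)) + RtoC (2 * PI * INR (S n) * sin (2 * PI * INR (S n) * x)))
      / (b * b + RtoC ((2 * PI * INR (S n)) ^ 2)))%C.
Proof. reflexivity. Qed.

Lemma is_Cderive_exp_cos (b : C) (N : nat) (x : R) :
  b <> RtoC 0 -> (forall k, b * b + RtoC ((2 * PI * INR (S k)) ^ 2) <> RtoC 0)%C ->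
  is_Cderive (exp_cos_primitive b N) x (Cexp (b * RtoC x) * RtoC (dirichlet N x))%C.
Proof.
  intros Hb Hk; induction N as [|N IH].
  - apply (is_Cderive_ext (fun x => / b * Cexp (b * RtoC x))%C); [intros; simpl; field; auto |].
    eapply is_Cderive_eq; [apply is_Cderive_scal, is_Cderive_exp_lin |]. simpl; field; auto.
  - specialize (Hk N). set (w := 2 * PI * INR (S N)) in *.
    apply (is_Cderive_ext (fun x => exp_cos_primitive b N x + RtoC 2 / (b * b + RtoC (w ^ 2)) * (Cexp (b * RtoC x)
      * (b * RtoC (cos (w * x)) + RtoC (w * sin (w * x)))))%C).
    { intros; rewrite exp_cos_primitive_S. fold w. field. auto. }
    eapply is_Cderive_eq.
    + apply is_Cderive_plus; [exact IH |]. apply is_Cderive_scal.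
      apply is_Cderive_mult; [apply is_Cderive_exp_lin |].
      apply is_Cderive_plus.
      * apply is_Cderive_scal, is_Cderive_RtoC. auto_derive; auto; reflexivity.
      * apply is_Cderive_RtoC. auto_derive; auto; reflexivity.
    + change (dirichlet (S N) x) with (dirichlet N x + 2 * cos (w * x)).
      rewrite !RtoC_plus, !RtoC_mult, !RtoC_opp, !RtoC_pow.
      rewrite RtoC_pow in Hk. field. auto.
Qed.

Lemma sqr_plus_nonzero (z : C) (w : R) : 0 < Re z -> (z * z + RtoC (w ^ 2))%C <> RtoC 0.
Proof.
  intros Hz E. assert (E1 := f_equal Re E). assert (E2 := f_equal Im E).
  autorewrite with reim in E1, E2. assert (Im z = 0) by nra. nra.
Qed.

Lemma ne_0_of_Re (z : C) : 0 < Re z -> z <> RtoC 0.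
Proof. intros H E; rewrite E in H; simpl in H; lra. Qed.

(** The trapezoidal estimate is applied to exp(-2 pi a x) on [0,1]. Between 0 and 1 the explicit
    primitive changes by a partial sum of the series, up to known factors, and letting N tend to
    infinity identifies the limit. The form with exp(-2 pi a) separates the algebraic part from the
    exponentially small one. *)
Lemma coth_series (a : C) :
  0 < Re a ->
  is_Clim eventually (sum_n (fun j => / (RtoC (INR (S j) ^ 2) + a * a))%C)
    (RtoC PI / (RtoC 2 * a) - / (RtoC 2 * (a * a))
     + RtoC PI / a * (Cexp (- (RtoC (2 * PI) * a)) / (RtoC 1 - Cexp (- (RtoC (2 * PI) * a)))))%C.
Proof.
  intros Ha. assert (P := PI_RGT_0).
  set (b := (- (RtoC (2 * PI) * a))%C).
  assert (Hb0 : Re b < 0) by (unfold b; autorewrite with reim; nra).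
  assert (Ha0 := ne_0_of_Re a Ha).
  assert (Hb : b <> RtoC 0) by (intro E; rewrite E in Hb0; simpl in Hb0; lra).
  assert (Hbk : forall k, (b * b + RtoC ((2 * PI * INR (S k)) ^ 2))%C <> RtoC 0).
  { intros k. replace (b * b)%C with ((- b) * (- b))%C by ring. apply sqr_plus_nonzero. rewrite Re_opp; lra. }
  assert (Hak : forall k, (RtoC (INR (S k) ^ 2) + a * a)%C <> RtoC 0).
  { intros k. rewrite Cplus_comm. now apply sqr_plus_nonzero. }
  assert (H1 : (RtoC 1 - Cexp b)%C <> RtoC 0).
  { intro E. assert (Cexp b = RtoC 1) by (transitivity (RtoC 1 - (RtoC 1 - Cexp b))%C; [ring | rewrite E; ring]).
    assert (Q : Cmod (Cexp b) = 1) by (rewrite H; apply Cmod_1). rewrite Cmod_Cexp in Q.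
    assert (exp (Re b) < exp 0) by (now apply exp_increasing). rewrite exp_0 in *; lra. }
  assert (HPC : RtoC PI <> RtoC 0) by (apply RtoC_neq; lra).
  assert (E : forall N, (exp_cos_primitive b (S N) 1 - exp_cos_primitive b (S N) 0)%C
     = ((Cexp b - RtoC 1) * (/ b - a / RtoC PI * sum_n (fun j => / (RtoC (INR (S j) ^ 2) + a * a))%C N))%C).
  { assert (St : forall N, (exp_cos_primitive b (S N) 1 - exp_cos_primitive b (S N) 0)%C =
      (exp_cos_primitive b N 1 - exp_cos_primitive b N 0
       - (Cexp b - RtoC 1) * (a / RtoC PI * / (RtoC (INR (S N) ^ 2) + a * a)))%C).
    { intros N. rewrite !exp_cos_primitive_S. specialize (Hbk N). specialize (Hak N).
      set (k := INR (S N)) in *.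
      replace (b * RtoC 1)%C with b by ring. replace (b * RtoC 0)%C with (RtoC 0) by ring.
      assert (Hc : cos (2 * PI * k) = 1) by apply cos_2PI_nat.
      assert (Hs : sin (2 * PI * k) = 0) by apply sin_2PI_nat.
      rewrite Cexp_0, !Rmult_0_r, cos_0, sin_0, !Rmult_1_r, Hc, Hs, !Rmult_0_r.
      replace (b * b + RtoC ((2 * PI * k) ^ 2))%C with (RtoC 4 * RtoC PI * RtoC PI * (RtoC (k ^ 2) + a * a))%C.
      2:{ unfold b. rewrite !RtoC_pow, !RtoC_mult.
          replace (RtoC 4) with (RtoC 2 * RtoC 2)%C by (rewrite <- RtoC_mult; f_equal; ring). ring. }
      replace (RtoC 4) with (RtoC 2 * RtoC 2)%C by (rewrite <- RtoC_mult; f_equal; ring).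
      set (X1 := exp_cos_primitive b N 1). set (X0 := exp_cos_primitive b N 0). set (e := Cexp b).
      unfold b. rewrite RtoC_mult. field. repeat split; auto; apply RtoC_neq; lra. }
    induction N as [|N IH].
    - rewrite St, sum_O. simpl exp_cos_primitive.
      replace (b * RtoC 1)%C with b by ring. replace (b * RtoC 0)%C with (RtoC 0) by ring.
      rewrite Cexp_0. specialize (Hak 0%nat). field. repeat split; auto.
    - rewrite St, IH, sum_n_CS. specialize (Hak (S N)). field. auto. }
  set (B := Cmod b * Cmod b + Cmod b).
  assert (Hcb := Cmod_ge_0 b).
  assert (Hc : forall x, 0 <= x <= 1 -> Cmod (Cexp (b * RtoC x)) <= 1).
  { intros x Hx; rewrite Cmod_Cexp, <- exp_0.
    destruct (Req_dec x 0) as [->|]; [right; f_equal; rewrite Re_mult, Re_RtoC, Im_RtoC; ring |].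
    left; apply exp_increasing. rewrite Re_mult, Re_RtoC, Im_RtoC; nra. }
  assert (T : forall N, Cmod ((exp_cos_primitive b (S N) 1 - exp_cos_primitive b (S N) 0) - (RtoC 1 + Cexp b) / RtoC 2)%C
     <= 6 * B * / INR (S N)).
  { intros N.
    assert (Q := trapezoid_unit (S N) (fun x => Cexp (b * RtoC x)) (fun x => b * Cexp (b * RtoC x))%C
      (fun x => b * (b * Cexp (b * RtoC x)))%C (exp_cos_primitive b (S N)) B ltac:(lia)).
    cbv beta in Q. replace (b * RtoC 1)%C with b in Q by ring. replace (b * RtoC 0)%C with (RtoC 0) in Q by ring.
    rewrite Cexp_0 in Q. apply Q.
    - intros; apply is_Cderive_exp_lin.
    - intros; apply is_Cderive_scal, is_Cderive_exp_lin.
    - intros; now apply is_Cderive_exp_cos.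
    - intros x Hx; rewrite Cmod_mult; specialize (Hc x Hx). unfold B.
      assert (0 <= Cmod (Cexp (b * RtoC x))) by apply Cmod_ge_0. nra.
    - intros x Hx; rewrite !Cmod_mult; specialize (Hc x Hx). unfold B.
      assert (0 <= Cmod (Cexp (b * RtoC x))) by apply Cmod_ge_0.
      rewrite <- Rmult_assoc. assert (0 <= Cmod b * Cmod b) by nra. nra. }
  assert (L : is_Clim eventually (fun N => (exp_cos_primitive b (S N) 1 - exp_cos_primitive b (S N) 0) - (RtoC 1 + Cexp b) / RtoC 2)%C (RtoC 0)).
  { apply (is_Clim_0_le eventually _ (fun N => 6 * B * / INR (S N))).
    - apply filter_forall; auto.
    - replace 0 with (6 * B * 0) by ring.
      apply (is_lim_seq_scal_l (fun N => / INR (S N)) (6 * B) 0).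
      apply (is_lim_seq_incr_1 (fun n => / INR n)), is_lim_seq_inv_INR. }
  assert (Key := is_Clim_mult eventually _ _ _ _ (is_Clim_const eventually (RtoC PI / (a * (RtoC 1 - Cexp b)))%C) L).
  assert (Key2 := is_Clim_plus eventually _ _ _ _ Key (is_Clim_const eventually
     (RtoC PI / (a * (RtoC 1 - Cexp b)) * ((RtoC 1 + Cexp b) / RtoC 2 - (Cexp b - RtoC 1) / b))%C)).
  assert (H2 : RtoC 2 <> RtoC 0) by (apply RtoC_neq; lra).
  eapply is_Clim_eq; [eapply is_Clim_ext; [| | exact Key2] |].
  - typeclasses eauto.
  - apply filter_forall. intros N. cbv beta. rewrite E. field. repeat split; auto.
  - set (e := Cexp b) in *. clearbody e. unfold b. rewrite RtoC_mult. field. repeat split; auto.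
Qed.

(** * Exponential bounds and the exponential series *)

Lemma exp_le (x y : R) : x <= y -> exp x <= exp y.
Proof. intros [H | ->]; [left; now apply exp_increasing | right; reflexivity]. Qed.

Lemma exp_INR_mult (n : nat) (x : R) : exp (INR n * x) = exp x ^ n.
Proof.
  induction n as [|n IH]; [simpl; rewrite Rmult_0_l; apply exp_0 |].
  rewrite S_INR, Rmult_plus_distr_r, exp_plus, IH, Rmult_1_l; simpl; ring.
Qed.

Lemma pow_exp_bound (c : R) (j : nat) :
  0 < c -> exists B, 0 < B /\ forall x, 0 <= x -> (1 + x) ^ j * exp (- (c * x)) <= B.
Proof.
  intros Hc. destruct j as [|j].
  - exists 1; split; [lra |]. intros x Hx; simpl. rewrite Rmult_1_l, <- exp_0. apply exp_le; nra.
  - assert (HJ := INR_S_pos j). set (J := INR (S j)) in *.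
    (* With this d, exp(c x / J) >= 1 + c x / J >= d (1 + x); the J-th power of this is the
       claim. *)
    set (d := Rmin 1 (c / J)).
    assert (Hd : 0 < d) by (apply Rmin_pos; [lra | apply Rdiv_lt_0_compat; auto]).
    exists (/ d ^ S j). assert (Hdj : 0 < d ^ S j) by (now apply pow_lt). split; [now apply Rinv_0_lt_compat |].
    intros x Hx.
    assert (E1 : (d * (1 + x)) ^ S j <= exp (c * x)).
    { replace (c * x) with (INR (S j) * (c / J * x)) by (unfold J; field; fold J; lra).
      rewrite exp_INR_mult. apply pow_incr.
      assert (d <= 1) by apply Rmin_l. assert (d <= c / J) by apply Rmin_r.
      assert (1 + c / J * x <= exp (c / J * x)) by (apply exp_ineq1_le). nra. }
    rewrite Rpow_mult_distr in E1. rewrite exp_Ropp.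
    assert (H0 := exp_pos (c * x)).
    apply (Rmult_le_reg_l (d ^ S j)); auto. rewrite Rinv_r by lra.
    apply (Rmult_le_reg_r (exp (c * x))); auto.
    replace (d ^ S j * ((1 + x) ^ S j * / exp (c * x)) * exp (c * x)) with (d ^ S j * (1 + x) ^ S j) by (field; lra).
    lra.
Qed.

(** Since x^2 >= x - 1, the Gaussian case follows from the exponential one at the price of a factor
    exp(c). *)
Lemma pow_gauss_bound (c : R) (j : nat) :
  0 < c -> exists B, 0 < B /\ forall x, 0 <= x -> (1 + x) ^ j * exp (- (c * x ^ 2)) <= B.
Proof.
  intros Hc. destruct (pow_exp_bound c j Hc) as [B [HB H]].
  exists (B * exp c). split; [apply Rmult_lt_0_compat; auto; apply exp_pos |].
  intros x Hx. apply Rle_trans with ((1 + x) ^ j * exp (- (c * x)) * exp c).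
  - rewrite Rmult_assoc, <- exp_plus. apply Rmult_le_compat_l; [apply pow_le; lra |].
    apply exp_le. assert (0 <= x ^ 2 - x + 1) by nra. nra.
  - apply Rmult_le_compat_r; [apply Rlt_le, exp_pos | auto].
Qed.

Lemma ex_series_exp (y : R) : ex_series (fun n => y ^ n / INR (fact n)).
Proof.
  exists (exp y). assert (H := is_exp_Reals y). unfold is_pseries in H.
  eapply is_series_ext; [| exact H]. intros n; simpl.
  rewrite pow_n_pow. unfold scal; simpl; unfold mult; simpl. unfold Rdiv; reflexivity.
Qed.

Lemma INR_le_pow2 (n : nat) : INR n <= 2 ^ n.
Proof.
  induction n as [|n IH]; [simpl; lra |]. rewrite S_INR; simpl.
  assert (1 <= 2 ^ n) by (apply pow_R1_Rle; lra). lra.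
Qed.

Lemma is_Cderive_zero_const (G : R -> C) (x y : R) :
  (forall t, Rmin x y <= t <= Rmax x y -> is_Cderive G t (RtoC 0)) -> G x = G y.
Proof.
  intros H. apply C_eq_parts.
  - assert (Q := Rabs_le_of_derive (fun t => Re (G t)) (fun _ => 0) x y 0 (fun t Ht => proj1 (H t Ht))
      ltac:(intros; cbv beta; rewrite Rabs_R0; lra)). rewrite Rmult_0_l in Q.
    assert (Q2 := Rabs_pos (Re (G y) - Re (G x))). assert (Q3 : Rabs (Re (G y) - Re (G x)) = 0) by lra.
    apply Rabs_eq_0 in Q3. lra.
  - assert (Q := Rabs_le_of_derive (fun t => Im (G t)) (fun _ => 0) x y 0 (fun t Ht => proj2 (H t Ht))
      ltac:(intros; cbv beta; rewrite Rabs_R0; lra)). rewrite Rmult_0_l in Q.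
    assert (Q2 := Rabs_pos (Im (G y) - Im (G x))). assert (Q3 : Rabs (Im (G y) - Im (G x)) = 0) by lra.
    apply Rabs_eq_0 in Q3. lra.
Qed.

Lemma is_series_zero : is_series (fun _ : nat => 0) 0.
Proof.
  eapply filterlim_ext; [| apply filterlim_const]. intros n; simpl. now rewrite sum_n_const, Rmult_0_r.
Qed.

(** [Cexp] is given by real exponential, sine and cosine. The sum F(t) of the series in t w
    satisfies F' = w F, so F(t) exp(-w t) is constant, and t = 1 gives the claim. *)
Lemma Cexp_series (w : C) : is_Cseries (fun n => RtoC (/ INR (fact n)) * w ^ n)%C (Cexp w).
Proof.
  set (f := fun (n : nat) (t : R) => (RtoC (t ^ n / INR (fact n)) * w ^ n)%C).
  set (g := fun (n : nat) (t : R) => (RtoC (INR n * t ^ pred n / INR (fact n)) * w ^ n)%C).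
  assert (Hw := Cmod_ge_0 w).
  assert (Bf : forall n t, Rabs t <= 2 -> Cmod (f n t) <= (2 * Cmod w) ^ n / INR (fact n)).
  { intros n t Ht. unfold f. rewrite Cmod_mult, Cmod_pow, Cmod_R, Rpow_mult_distr.
    unfold Rdiv; rewrite Rabs_mult, <- RPow_abs, Rabs_inv, (Rabs_pos_eq (INR _)) by apply pos_INR.
    assert (Rabs t ^ n <= 2 ^ n) by (apply pow_incr; split; [apply Rabs_pos | auto]).
    assert (0 <= / INR (fact n)) by (apply Rlt_le, Rinv_0_lt_compat, INR_fact_lt_0).
    assert (0 <= Cmod w ^ n) by (now apply pow_le).
    assert (0 <= / INR (fact n) * Cmod w ^ n) by nra. nra. }
  (* For |t| <= 2 the factor n t^(n-1) is at most 2^n 2^n, which explains the 4. *)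
  assert (Bg : forall n t, Rabs t <= 2 -> Cmod (g n t) <= (4 * Cmod w) ^ n / INR (fact n)).
  { intros n t Ht. unfold g. rewrite Cmod_mult, Cmod_pow, Cmod_R.
    unfold Rdiv; rewrite !Rabs_mult, <- RPow_abs, Rabs_inv, !(Rabs_pos_eq (INR _)) by apply pos_INR.
    replace (4 * Cmod w) with (2 * 2 * Cmod w) by ring. rewrite !Rpow_mult_distr.
    assert (Rabs t ^ pred n <= 2 ^ n).
    { apply Rle_trans with (2 ^ pred n); [apply pow_incr; split; [apply Rabs_pos | auto] |].
      apply Rle_pow; [lra | lia]. }
    assert (0 <= Rabs t ^ pred n) by (apply pow_le, Rabs_pos).
    assert (L := INR_le_pow2 n). assert (L0 := pos_INR n).
    assert (0 <= / INR (fact n)) by (apply Rlt_le, Rinv_0_lt_compat, INR_fact_lt_0).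
    assert (0 <= Cmod w ^ n) by (now apply pow_le).
    assert (INR n * Rabs t ^ pred n <= 2 ^ n * 2 ^ n) by (apply Rmult_le_compat; auto).
    assert (0 <= / INR (fact n) * Cmod w ^ n) by nra.
    replace (2 ^ n * 2 ^ n * Cmod w ^ n * / INR (fact n)) with (2 ^ n * 2 ^ n * (/ INR (fact n) * Cmod w ^ n)) by ring.
    rewrite Rmult_assoc. apply Rmult_le_compat_r; auto. }
  assert (Sum : forall t, Rabs t <= 2 -> is_Cseries (fun n => f n t) (CSeries (fun n => f n t))).
  { intros t Ht. eapply CSeries_correct; [intros; now apply Bf | apply ex_series_exp]. }
  assert (Der : forall t, Rabs t < 3 / 2 -> is_Cderive (fun t => CSeries (fun n => f n t)) t (w * CSeries (fun n => f n t))%C).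
  { intros t Ht. eapply is_Cderive_eq.
    - apply (is_Cderive_CSeries f g (fun n => (4 * Cmod w) ^ n / INR (fact n)) t (/ 2)); [lra | | | apply ex_series_exp |].
      + intros n s Hs. unfold f, g.
        eapply is_Cderive_eq; [apply (is_Cderive_ext (fun s => w ^ n * RtoC (s ^ n / INR (fact n)))%C); [intros; ring |];
          apply is_Cderive_scal, is_Cderive_RtoC; auto_derive; auto; reflexivity |].
        rewrite Cmult_comm; f_equal; f_equal. unfold Rdiv. destruct n; [simpl; ring |]. ring.
      + intros n s Hs. apply Bg. apply Rabs_def2 in Hs. apply Rabs_def2 in Ht. apply Rabs_le; lra.
      + intros s Hs. exists (fun n => (2 * Cmod w) ^ n / INR (fact n)). split; [apply ex_series_exp |].
        intros n. apply Bf. apply Rabs_def2 in Hs. apply Rabs_def2 in Ht. apply Rabs_le; lra.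
    - apply is_Cseries_unique.
      replace (w * CSeries (fun n => f n t))%C with (g 0%nat t + w * CSeries (fun n => f n t))%C.
      2:{ unfold g; simpl. replace (0 * 1 / 1) with 0 by field. ring. }
      apply (is_Cseries_incr_1 (fun n => g n t)).
      apply (is_Cseries_ext (fun n => w * f n t)%C).
      + intros n. unfold f, g. simpl pred. rewrite Cpow_S.
        replace (INR (S n) * t ^ n / INR (fact (S n))) with (t ^ n / INR (fact n)).
        * ring.
        * rewrite fact_simpl, mult_INR. field. split; [apply INR_fact_neq_0 | apply not_0_INR; lia].
      + apply is_Cseries_scal, Sum. apply Rlt_le. apply Rlt_trans with (3 / 2); lra. }
  assert (Con : CSeries (fun n => f n 0) = (CSeries (fun n => f n 1) * Cexp (- w))%C).
  { assert (Z := is_Cderive_zero_const (fun t => CSeries (fun n => f n t) * Cexp (- w * RtoC t))%C 0 1).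
    cbv beta in Z. replace (- w * RtoC 1)%C with (- w)%C in Z by ring. replace (- w * RtoC 0)%C with (RtoC 0) in Z by ring.
    rewrite Cexp_0, Cmult_1_r in Z. apply Z. intros t; rewrite Rmin_left, Rmax_right by lra; intros Ht.
    eapply is_Cderive_eq.
    - apply is_Cderive_mult; [apply Der, Rabs_def1; lra | apply is_Cderive_exp_lin].
    - cbv beta. ring. }
  assert (F0 : CSeries (fun n => f n 0) = RtoC 1).
  { apply is_Cseries_unique. replace (RtoC 1) with (f 0%nat 0 + RtoC 0)%C.
    2:{ unfold f; simpl. replace (1 / 1) with 1 by field. ring. }
    apply (is_Cseries_incr_1 (fun n => f n 0)).
    split; simpl; apply (is_series_ext (fun _ => 0)); try apply is_series_zero;
      intros n; unfold f; autorewrite with reim; simpl; unfold Rdiv; ring. }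
  rewrite F0 in Con.
  assert (F1 : CSeries (fun n => f n 1) = Cexp w).
  { rewrite <- (Cmult_1_r (CSeries _)), <- (Cexp_opp w), Cmult_assoc, <- Con; ring. }
  rewrite <- F1. eapply is_Cseries_ext; [| apply Sum; rewrite Rabs_R1; lra].
  intros n; unfold f. rewrite pow1. unfold Rdiv; now rewrite Rmult_1_l.
Qed.

(** * The error function as an entire function *)

Definition erf_coef (n : nat) : R := (-1) ^ n / (INR (fact n) * (2 * INR n + 1)).

(* erf without its factor 2/sqrt(pi). *)
Definition Cerf (z : C) : C := CSeries (fun n => RtoC (erf_coef n) * z ^ S (2 * n))%C.

Lemma Rabs_pow_m1 (n : nat) : Rabs ((-1) ^ n) = 1.
Proof. rewrite <- RPow_abs, Rabs_left by lra. replace (- -1) with 1 by ring. apply pow1. Qed.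

Lemma Cerf_term_bound (n : nat) (z : C) (r : R) :
  Cmod z <= r -> Cmod (RtoC (erf_coef n) * z ^ S (2 * n))%C <= r * ((r ^ 2) ^ n / INR (fact n)).
Proof.
  intros Hz. assert (H0 := Cmod_ge_0 z). assert (Hn := pos_INR n). assert (HF := INR_fact_lt_0 n).
  rewrite Cmod_mult, Cmod_R, Cmod_pow. unfold erf_coef, Rdiv.
  rewrite Rabs_mult, Rabs_pow_m1, Rabs_inv, Rmult_1_l, Rabs_pos_eq by nra.
  assert (H1 : / (INR (fact n) * (2 * INR n + 1)) <= / INR (fact n)) by (apply Rinv_le_contravar; nra).
  assert (H2 : Cmod z ^ S (2 * n) <= r * (r ^ 2) ^ n).
  { rewrite <- pow_mult. change (r * r ^ (2 * n)) with (r ^ S (2 * n)). apply pow_incr; lra. }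
  assert (0 <= Cmod z ^ S (2 * n)) by (now apply pow_le).
  assert (0 < / (INR (fact n) * (2 * INR n + 1))) by (apply Rinv_0_lt_compat; nra).
  rewrite (Rmult_comm (/ _)). replace (r * ((r ^ 2) ^ n * / INR (fact n))) with (r * (r ^ 2) ^ n * / INR (fact n)) by ring.
  apply Rmult_le_compat; lra.
Qed.

Lemma ex_series_erf (r : R) : ex_series (fun n => r * ((r ^ 2) ^ n / INR (fact n))).
Proof. apply ex_series_scal_Rl, ex_series_exp. Qed.

(** Termwise differentiation along a line in the plane. Lines of varying direction and offset are
    what the ray to infinity and the shifted Gaussians require. *)
Lemma is_Cderive_Cerf (b c : C) (x : R) :
  is_Cderive (fun t => Cerf (b * RtoC t + c)%C) x
    (b * Cexp (- ((b * RtoC x + c) * (b * RtoC x + c))))%C.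
Proof.
  set (z := fun t => (b * RtoC t + c)%C).
  set (r := Cmod b * (Rabs x + 1) + Cmod c).
  assert (Hb := Cmod_ge_0 b). assert (Hc := Cmod_ge_0 c). assert (Hx := Rabs_pos x).
  assert (Hz : forall t, Rabs (t - x) < 1 -> Cmod (z t) <= r).
  { intros t Ht. unfold z, r. eapply Rle_trans; [apply Cmod_triangle |]. apply Rplus_le_compat_r.
    rewrite Cmod_mult, Cmod_R. apply Rmult_le_compat_l; auto.
    replace t with (x + (t - x)) by ring. eapply Rle_trans; [apply Rabs_triang |]. lra. }
  assert (Hx0 : Rabs (x - x) < 1) by (rewrite Rminus_diag, Rabs_R0; lra).
  eapply is_Cderive_eq.
  - apply (is_Cderive_CSeries (fun n t => RtoC (erf_coef n) * z t ^ S (2 * n))%C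
      (fun n t => b * (RtoC (/ INR (fact n)) * (- (z t * z t)) ^ n))%C
      (fun n => Cmod b * ((r ^ 2) ^ n / INR (fact n))) x 1); [lra | | | apply ex_series_scal_Rl, ex_series_exp |].
    + intros n t Ht. eapply is_Cderive_eq.
      * apply is_Cderive_scal. apply is_Cderive_pow, is_Cderive_lin.
      * cbv beta.
        replace ((- (z t * z t)) ^ n)%C with (RtoC ((-1) ^ n) * z t ^ (2 * n))%C.
        2:{ replace (- (z t * z t))%C with (RtoC (-1) * z t ^ 2)%C by (simpl; ring).
            rewrite Cpow_mult_l, Cpow_mult_r, RtoC_pow; reflexivity. }
        fold (z t). unfold erf_coef. rewrite S_INR, mult_INR, INR_two.
        transitivity (b * z t ^ (2 * n) * (RtoC ((-1) ^ n / (INR (fact n) * (2 * INR n + 1))) * RtoC (2 * INR n + 1)))%C; [ring |].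
        rewrite <- RtoC_mult.
        replace ((-1) ^ n / (INR (fact n) * (2 * INR n + 1)) * (2 * INR n + 1)) with (/ INR (fact n) * (-1) ^ n).
        2:{ assert (Hn := pos_INR n). field. split; [lra | apply INR_fact_neq_0]. }
        rewrite RtoC_mult; ring.
    + intros n t Ht. specialize (Hz t Ht). rewrite !Cmod_mult, Cmod_pow, Cmod_opp, Cmod_mult, Cmod_R.
      apply Rmult_le_compat_l; auto. rewrite Rabs_pos_eq by (apply Rlt_le, Rinv_0_lt_compat, INR_fact_lt_0).
      unfold Rdiv; rewrite Rmult_comm. apply Rmult_le_compat_r; [apply Rlt_le, Rinv_0_lt_compat, INR_fact_lt_0 |].
      assert (H0 := Cmod_ge_0 (z t)). apply pow_incr; split; nra.
    + intros t Ht. exists (fun n => r * ((r ^ 2) ^ n / INR (fact n))). split; [apply ex_series_erf |].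
      intros n; apply Cerf_term_bound; auto.
  - apply is_Cseries_unique. apply is_Cseries_scal. apply Cexp_series.
Qed.

Lemma Cerf_opp (z : C) : Cerf (- z) = (- Cerf z)%C.
Proof.
  apply is_Cseries_unique.
  replace (- Cerf z)%C with (RtoC (-1) * Cerf z)%C by ring.
  apply (is_Cseries_ext (fun n => RtoC (-1) * (RtoC (erf_coef n) * z ^ S (2 * n)))%C).
  - intros n. rewrite !Cpow_S, !Cpow_mult_r. replace ((- z) ^ 2)%C with (z ^ 2)%C by (simpl; ring). ring.
  - apply is_Cseries_scal. eapply CSeries_correct; [intros n; apply (Cerf_term_bound n z _ (Rle_refl _)) | apply ex_series_erf].
Qed.

Lemma Cerf_0 : Cerf (RtoC 0) = RtoC 0.
Proof.
  assert (H := Cerf_opp (RtoC 0)). replace (- RtoC 0)%C with (RtoC 0) in H by ring.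
  apply C_eq_parts; [assert (E := f_equal Re H) | assert (E := f_equal Im H)]; autorewrite with reim in E; rewrite ?Re_RtoC, ?Im_RtoC; lra.
Qed.

(** Both g - f and g + f are nondecreasing. The variable majorant g' replaces the constant of the
    mean value inequality; it is what makes integration of decaying bounds possible. *)
Lemma Rabs_le_of_derive_le (f g f' g' : R -> R) (x y : R) :
  x <= y ->
  (forall t, x <= t <= y -> is_derive f t (f' t)) ->
  (forall t, x <= t <= y -> is_derive g t (g' t)) ->
  (forall t, x <= t <= y -> Rabs (f' t) <= g' t) ->
  Rabs (f y - f x) <= g y - g x.
Proof.
  intros Hxy Hf Hg Hb.
  assert (P : forall h h', (forall t, x <= t <= y -> is_derive h t (h' t)) ->
      (forall t, x <= t <= y -> 0 <= h' t) -> h x <= h y).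
  { intros h h' H1 H2. destruct (MVT_gen h x y h') as [c [Hc E]].
    - intros t; rewrite Rmin_left, Rmax_right by auto; intros; apply H1; lra.
    - intros t; rewrite Rmin_left, Rmax_right by auto; intros.
      apply continuity_pt_filterlim, (ex_derive_continuous h). eexists; apply H1; auto.
    - rewrite Rmin_left, Rmax_right in Hc by auto. specialize (H2 c Hc). nra. }
  assert (A1 := P (fun t => g t - f t) (fun t => g' t - f' t)).
  assert (A2 := P (fun t => g t + f t) (fun t => g' t + f' t)). cbv beta in A1, A2.
  assert (B1 : g x - f x <= g y - f y).
  { apply A1; intros t Ht.
    - apply (is_derive_minus (K := R_AbsRing) (V := R_NormedModule)); auto.
    - specialize (Hb t Ht). apply Rabs_le_between in Hb; lra. }
  assert (B2 : g x + f x <= g y + f y).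
  { apply A2; intros t Ht.
    - apply (is_derive_plus (K := R_AbsRing) (V := R_NormedModule)); auto.
    - specialize (Hb t Ht). apply Rabs_le_between in Hb; lra. }
  apply Rabs_le; lra.
Qed.

Lemma Cerf_real_derive (x : R) : is_Cderive (fun t => Cerf (RtoC t)) x (RtoC (exp (- (x * x)))).
Proof.
  apply (is_Cderive_ext (fun t => Cerf (RtoC 1 * RtoC t + RtoC 0)%C)); [intros; f_equal; ring |].
  eapply is_Cderive_eq; [apply is_Cderive_Cerf |].
  rewrite <- Cexp_RtoC, RtoC_opp, RtoC_mult, Cmult_1_l; f_equal; ring.
Qed.

(** Beyond 1 the derivative exp(-t^2) is at most exp(-t), whose primitive is explicit. *)
Lemma Cerf_real_cauchy (x y : R) :
  1 <= x <= y -> Rabs (Re (Cerf (RtoC y)) - Re (Cerf (RtoC x))) <= exp (- x).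
Proof.
  intros Hxy. apply Rle_trans with (- exp (- y) - - exp (- x)); [| assert (H := exp_pos (- y)); lra].
  apply (Rabs_le_of_derive_le (fun t => Re (Cerf (RtoC t))) (fun t => - exp (- t)) (fun t => exp (- (t * t))) (fun t => exp (- t))); [lra | | |].
  - intros t _; apply (proj1 (Cerf_real_derive t)).
  - intros t _. auto_derive; auto; ring.
  - intros t Ht. rewrite Rabs_pos_eq by (apply Rlt_le, exp_pos). apply exp_le; nra.
Qed.

(** The integral of exp(-t^2) over the positive axis. Its value is kept as an unknown through the
    proof of the theta relation and read off afterwards in [erf_limit_eq]. *)
Definition erf_limit : R := real (Lim_seq (fun n => Re (Cerf (RtoC (INR n))))).

Lemma exp_opp_le_inv (x : R) : 0 < x -> exp (- x) <= / x.
Proof.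
  intros Hx. rewrite exp_Ropp. apply Rinv_le_contravar; auto.
  assert (1 + x <= exp x) by apply exp_ineq1_le. lra.
Qed.

Lemma erf_limit_bound (x : R) : 1 <= x -> Rabs (erf_limit - Re (Cerf (RtoC x))) <= exp (- x).
Proof.
  intros Hx.
  assert (Hl : is_lim_seq (fun n => Re (Cerf (RtoC (INR n)))) erf_limit).
  { apply Lim_seq_correct'. apply ex_lim_seq_cauchy_corr. intros eps.
    assert (He := cond_pos eps).
    destruct (INR_unbounded (/ eps + 1)) as [N HN].
    assert (Hie : 0 < / eps) by (now apply Rinv_0_lt_compat).
    assert (HB : forall n, (N <= n)%nat -> exp (- INR n) < eps).
    { intros n Hn. assert (INR N <= INR n) by (apply le_INR; auto).
      eapply Rle_lt_trans; [apply exp_opp_le_inv; lra |].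
      rewrite <- (Rinv_inv eps). apply Rinv_lt_contravar; [apply Rmult_lt_0_compat; lra | lra]. }
    exists N. intros n m Hn Hm.
    assert (Hn1 : INR N <= INR n) by (apply le_INR; auto). assert (Hm1 : INR N <= INR m) by (apply le_INR; auto).
    destruct (Rle_lt_dec (INR n) (INR m)).
    - rewrite Rabs_minus_sym. eapply Rle_lt_trans; [apply Cerf_real_cauchy; lra | auto].
    - eapply Rle_lt_trans; [apply Cerf_real_cauchy; lra | auto]. }
  assert (L2 : is_lim_seq (fun n => Rabs (Re (Cerf (RtoC (INR n))) - Re (Cerf (RtoC x)))) (Rabs (erf_limit - Re (Cerf (RtoC x))))).
  { apply (is_lim_seq_abs _ (Finite _)). apply is_lim_seq_minus'; [auto | apply is_lim_seq_const]. }
  refine (is_lim_seq_le_loc _ _ (Rabs _) (exp (- x)) _ L2 (is_lim_seq_const _)).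
  destruct (INR_unbounded x) as [N HN]. exists N. intros n Hn.
  assert (INR N <= INR n) by (apply le_INR; auto). apply Cerf_real_cauchy; lra.
Qed.

Lemma Im_Cerf_real (x : R) : Im (Cerf (RtoC x)) = 0.
Proof.
  assert (Z := is_Cderive_zero_const (fun t => RtoC (Im (Cerf (RtoC t)))) 0 x).
  cbv beta in Z. rewrite Cerf_0 in Z. apply RtoC_inj. rewrite <- Z; [reflexivity |].
  intros t _. apply is_Cderive_RtoC. apply (proj2 (Cerf_real_derive t)).
Qed.

Lemma Re_sqr_le (z w : C) : Re z = Re w -> Rabs (Im w) <= Rabs (Im z) -> Re (z * z)%C <= Re (w * w)%C.
Proof.
  intros E H. rewrite !Re_mult, E. apply Rsqr_le_abs_1 in H. unfold Rsqr in H. lra.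
Qed.

(** The path runs along the real axis to Re z and then vertically to z. On the vertical piece
    Re(w^2) decreases as |Im w| grows, so the integrand is largest at z. *)
Lemma Cerf_far (z : C) :
  1 <= Re z -> Cmod (Cerf z - RtoC erf_limit)%C <= exp (- Re z) + 2 * (Cmod z * exp (- Re (z * z)%C)).
Proof.
  intros Hz. set (X := Re z) in *. set (Y := Im z).
  assert (D : forall t, is_Cderive (fun t => Cerf (Ci * RtoC t + RtoC X)%C) t
     (Ci * Cexp (- ((Ci * RtoC t + RtoC X) * (Ci * RtoC t + RtoC X))))%C) by (intros; apply is_Cderive_Cerf).
  assert (E1 : (Ci * RtoC Y + RtoC X)%C = z).
  { apply C_eq_parts; unfold X, Y, Ci; autorewrite with reim; simpl; ring. }
  assert (E0 : (Ci * RtoC 0 + RtoC X)%C = RtoC X) by ring.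
  assert (Bd : forall t, Rmin 0 Y <= t <= Rmax 0 Y ->
     Cmod (Ci * Cexp (- ((Ci * RtoC t + RtoC X) * (Ci * RtoC t + RtoC X))))%C <= exp (- Re (z * z)%C)).
  { intros t Ht. rewrite Cmod_mult, Cmod_Ci, Rmult_1_l, Cmod_Cexp, Re_opp. apply exp_le, Ropp_le_contravar.
    apply Re_sqr_le.
    - unfold Ci; autorewrite with reim; simpl. unfold X; ring.
    - replace (Im (Ci * RtoC t + RtoC X)%C) with t by (unfold Ci; autorewrite with reim; simpl; ring).
      fold Y. revert Ht; unfold Rmin, Rmax, Rabs; destruct (Rle_dec 0 Y), (Rcase_abs t), (Rcase_abs Y); lra. }
  assert (R1 := Rabs_le_of_derive _ _ 0 Y _ (fun t _ => proj1 (D t)) (fun t Ht => Rle_trans _ _ _ (re_le_Cmod _) (Bd t Ht))).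
  assert (R2 := Rabs_le_of_derive _ _ 0 Y _ (fun t _ => proj2 (D t)) (fun t Ht => Rle_trans _ _ _ (im_le_Cmod _) (Bd t Ht))).
  cbv beta in R1, R2. rewrite E0, E1, Rminus_0_r in R1, R2.
  assert (L := erf_limit_bound X Hz). assert (I := Im_Cerf_real X).
  assert (HY : Rabs Y <= Cmod z) by (unfold Y; apply im_le_Cmod).
  assert (He := exp_pos (- Re (z * z)%C)).
  eapply Rle_trans; [apply Cmod_le_parts |]. rewrite Re_minus, Im_minus, Re_RtoC, Im_RtoC.
  assert (exp (- Re (z * z)%C) * Rabs Y <= exp (- Re (z * z)%C) * Cmod z) by (apply Rmult_le_compat_l; lra).
  rewrite I in R2.
  assert (T1 : Rabs (Re (Cerf z) - erf_limit) <= Rabs (Re (Cerf z) - Re (Cerf X)) + Rabs (erf_limit - Re (Cerf X))).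
  { replace (Re (Cerf z) - erf_limit) with ((Re (Cerf z) - Re (Cerf X)) - (erf_limit - Re (Cerf X))) by ring.
    eapply Rle_trans; [apply Rabs_triang |]. rewrite Rabs_Ropp; lra. }
  lra.
Qed.

Lemma is_lim_seq_inv_S : is_lim_seq (fun n => / (1 + INR n)) 0.
Proof.
  apply (is_lim_seq_ext (fun n => / INR (S n))); [intros; rewrite S_INR; f_equal; ring |].
  apply (is_lim_seq_incr_1 (fun n => / INR n)), is_lim_seq_inv_INR.
Qed.

Lemma Cerf_limit (b w : C) :
  0 < Re b -> 0 < Re (b * b)%C ->
  is_Clim eventually (fun L => Cerf (b * RtoC (INR L) + w)%C) (RtoC erf_limit).
Proof.
  intros Hb Hb2.
  destruct (pow_exp_bound (Re b) 1 Hb) as [B1 [HB1 H1]].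
  destruct (pow_exp_bound 1 2 Rlt_0_1) as [B2 [HB2 H2]].
  assert (Hc := Cmod_ge_0 b). assert (Hw := Cmod_ge_0 w).
  (* [K] comes from completing the square: the quadratic lower bound for Re((b x + w)^2) is at least
     x - [K], so the vertical error decays like exp(-x). *)
  set (K := (2 * (Cmod b * Cmod w) + 1) ^ 2 / (4 * Re (b * b)%C) + Cmod w * Cmod w).
  set (A := exp (Cmod w) * B1 + 2 * ((Cmod b + Cmod w) * (exp K * B2))).
  assert (Lz : is_Clim eventually (fun L => Cerf (b * RtoC (INR L) + w) - RtoC erf_limit)%C (RtoC 0)).
  { apply (is_Clim_0_le eventually _ (fun L => A * / (1 + INR L))).
    2:{ replace 0 with (A * 0) by ring. apply (is_lim_seq_scal_l _ A 0), is_lim_seq_inv_S. }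
    destruct (INR_unbounded ((1 + Cmod w) / Re b)) as [N HN].
    exists N. intros L HL. assert (HNL : INR N <= INR L) by (apply le_INR; auto). assert (HL0 := pos_INR L).
    set (x := INR L) in *. set (z := (b * RtoC x + w)%C).
    assert (Hrw := proj1 (Rabs_le_between _ _) (re_le_Cmod w)).
    assert (Hx : 1 + Cmod w <= Re b * x).
    { apply Rlt_le. apply Rlt_le_trans with (Re b * INR N); [| apply Rmult_le_compat_l; lra].
      apply (Rmult_lt_reg_l (/ Re b)); [now apply Rinv_0_lt_compat |].
      rewrite <- Rmult_assoc, Rinv_l, Rmult_1_l by lra. unfold Rdiv in HN; lra. }
    assert (Rz : Re z = Re b * x + Re w) by (unfold z; autorewrite with reim; ring).
    eapply Rle_trans; [apply Cerf_far; lra |].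
    assert (Q1 : exp (- Re z) <= exp (Cmod w) * B1 * / (1 + x)).
    { specialize (H1 x HL0). rewrite pow_1 in H1.
      apply (Rmult_le_reg_l (1 + x)); [lra |].
      replace ((1 + x) * (exp (Cmod w) * B1 * / (1 + x))) with (exp (Cmod w) * B1) by (field; lra).
      apply Rle_trans with (exp (Cmod w) * ((1 + x) * exp (- (Re b * x)))).
      - replace (exp (Cmod w) * ((1 + x) * exp (- (Re b * x)))) with ((1 + x) * exp (Cmod w + - (Re b * x))) by (rewrite exp_plus; ring).
        apply Rmult_le_compat_l; [lra |]. apply exp_le; lra.
      - apply Rmult_le_compat_l; [apply Rlt_le, exp_pos | auto]. }
    assert (Q2 : Cmod z <= (Cmod b + Cmod w) * (1 + x)).
    { unfold z. eapply Rle_trans; [apply Cmod_triangle |]. rewrite Cmod_mult, Cmod_nneg by auto. nra. }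
    assert (Q3 : exp (- Re (z * z)%C) <= exp K * exp (- x)).
    { rewrite <- exp_plus. apply exp_le.
      assert (Z : (z * z = RtoC (x ^ 2) * (b * b) + RtoC (2 * x) * (b * w) + w * w)%C).
      { unfold z. rewrite RtoC_pow, RtoC_mult; ring. }
      rewrite Z, !Re_plus, !Re_scal.
      assert (P1 := proj1 (Rabs_le_between _ _) (re_le_Cmod (b * w)%C)).
      assert (P2 := proj1 (Rabs_le_between _ _) (re_le_Cmod (w * w)%C)).
      rewrite Cmod_mult in P1, P2. unfold K.
      set (c := Re (b * b)%C) in *. set (d := Cmod b * Cmod w) in *. set (e := Cmod w * Cmod w) in *.
      assert (0 <= (2 * c * x - (2 * d + 1)) ^ 2 / (4 * c)).
      { apply Rmult_le_pos; [apply pow2_ge_0 | apply Rlt_le, Rinv_0_lt_compat; lra]. }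
      replace ((2 * c * x - (2 * d + 1)) ^ 2 / (4 * c)) with (c * x ^ 2 - (2 * d + 1) * x + (2 * d + 1) ^ 2 / (4 * c)) in H by (field; lra).
      nra. }
    assert (Q4 : exp (- x) <= B2 * / (1 + x) * / (1 + x)).
    { specialize (H2 x HL0). rewrite Rmult_1_l in H2.
      apply (Rmult_le_reg_l ((1 + x) ^ 2)); [apply pow_lt; lra |].
      replace ((1 + x) ^ 2 * (B2 * / (1 + x) * / (1 + x))) with B2 by (field; lra). auto. }
    assert (HK := exp_pos K). assert (Hz0 := Cmod_ge_0 z). assert (He := exp_pos (- Re (z * z)%C)).
    assert (Q5 : Cmod z * exp (- Re (z * z)%C) <= (Cmod b + Cmod w) * (1 + x) * (exp K * (B2 * / (1 + x) * / (1 + x)))).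
    { apply Rmult_le_compat; auto; [lra |]. eapply Rle_trans; [exact Q3 |]. apply Rmult_le_compat_l; lra. }
    replace ((Cmod b + Cmod w) * (1 + x) * (exp K * (B2 * / (1 + x) * / (1 + x)))) with
      ((Cmod b + Cmod w) * (exp K * B2) * / (1 + x)) in Q5 by (field; lra).
    unfold A. lra. }
  eapply is_Clim_eq; [eapply is_Clim_ext; [| | apply (is_Clim_plus eventually _ _ _ _ Lz (is_Clim_const eventually (RtoC erf_limit)))] |].
  - typeclasses eauto.
  - apply filter_forall. intros L. cbv beta. ring.
  - ring.
Qed.

(** * Jacobi's theta transformation for complex parameters *)

Definition gauss_shift (b : C) (k : nat) : C := (Ci * RtoC (PI * INR k) / b)%C.

(** A primitive of exp(-(b x)^2) times the Dirichlet kernel. Completing the square moves the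
    frequency k into the argument of the error function as the shift i pi k / b, and leaves the
    factor exp(-(pi k / b)^2), the k-th term of the dual theta series. *)
Fixpoint gauss_cos_primitive (b : C) (N : nat) (x : R) : C :=
  match N with
  | O => (Cerf (b * RtoC x + RtoC 0) / b)%C
  | S n => (gauss_cos_primitive b n x +
      Cexp (gauss_shift b (S n) * gauss_shift b (S n)) / b *
      (Cerf (b * RtoC x + gauss_shift b (S n)) + Cerf (b * RtoC x + - gauss_shift b (S n))))%C
  end.

Lemma Cexp_cos (x : R) : (Cexp (Ci * RtoC x) + Cexp (- (Ci * RtoC x)))%C = RtoC (2 * cos x).
Proof.
  apply C_eq_parts; unfold Cexp, Ci; simpl; rewrite ?Rmult_0_l, ?Rmult_0_r, ?Rmult_1_l, ?Rplus_0_l, ?Rminus_0_r, ?Ropp_0.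
  - rewrite exp_0, cos_neg; ring.
  - rewrite exp_0, sin_neg; ring.
Qed.

Lemma is_Cderive_gauss_cos (b : C) (N : nat) (x : R) :
  b <> RtoC 0 ->
  is_Cderive (gauss_cos_primitive b N) x (Cexp (- ((b * RtoC x) * (b * RtoC x))) * RtoC (dirichlet N x))%C.
Proof.
  intros Hb; induction N as [|N IH].
  - apply (is_Cderive_ext (fun x => / b * Cerf (b * RtoC x + RtoC 0))%C); [intros; simpl; field; auto |].
    eapply is_Cderive_eq; [apply is_Cderive_scal, is_Cderive_Cerf |].
    replace (b * RtoC x + RtoC 0)%C with (b * RtoC x)%C by ring. simpl; field; auto.
  - set (w := gauss_shift b (S N)).
    apply (is_Cderive_ext (fun x => gauss_cos_primitive b N x + Cexp (w * w) / b *
      (Cerf (b * RtoC x + w) + Cerf (b * RtoC x + - w)))%C); [reflexivity |].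
    eapply is_Cderive_eq.
    + apply is_Cderive_plus; [exact IH |]. apply is_Cderive_scal, is_Cderive_plus; apply is_Cderive_Cerf.
    + change (dirichlet (S N) x) with (dirichlet N x + 2 * cos (2 * PI * INR (S N) * x)).
      rewrite RtoC_plus, <- Cexp_cos.
      set (th := (Ci * RtoC (2 * PI * INR (S N) * x))%C).
      assert (Eth : th = (RtoC 2 * (b * RtoC x) * w)%C).
      { unfold th, w, gauss_shift. rewrite !RtoC_mult. field; auto. }
      transitivity (Cexp (- (b * RtoC x * (b * RtoC x))) * RtoC (dirichlet N x) +
        (Cexp (w * w) * Cexp (- ((b * RtoC x + w) * (b * RtoC x + w)))
         + Cexp (w * w) * Cexp (- ((b * RtoC x + - w) * (b * RtoC x + - w)))))%C; [field; auto |].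
      set (g := Cexp (- (b * RtoC x * (b * RtoC x)))%C).
      transitivity (g * RtoC (dirichlet N x) + (g * Cexp (- th) + g * Cexp th))%C; [| ring].
      unfold g; rewrite <- !Cexp_plus. f_equal. f_equal; f_equal; rewrite Eth; ring.
Qed.

Lemma gauss_cos_primitive_0 (b : C) (N : nat) : gauss_cos_primitive b N 0 = RtoC 0.
Proof.
  induction N as [|N IH].
  - simpl. replace (b * RtoC 0 + RtoC 0)%C with (RtoC 0) by ring. rewrite Cerf_0. unfold Cdiv; ring.
  - simpl gauss_cos_primitive. rewrite IH.
    replace (b * RtoC 0 + gauss_shift b (S N))%C with (gauss_shift b (S N)) by ring.
    replace (b * RtoC 0 + - gauss_shift b (S N))%C with (- gauss_shift b (S N))%C by ring.
    rewrite Cerf_opp; ring.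
Qed.

Lemma gauss_cos_primitive_limit (b : C) (N : nat) :
  0 < Re b -> 0 < Re (b * b)%C ->
  is_Clim eventually (fun L => gauss_cos_primitive b (S N) (INR L))
    (RtoC erf_limit / b * (RtoC 1 + RtoC 2 * sum_n (fun j => Cexp (gauss_shift b (S j) * gauss_shift b (S j))) N))%C.
Proof.
  intros Hb Hb2. assert (Hb0 := ne_0_of_Re b Hb).
  assert (St : forall n l, is_Clim eventually (fun L => gauss_cos_primitive b n (INR L)) l ->
    is_Clim eventually (fun L => gauss_cos_primitive b (S n) (INR L))
      (l + Cexp (gauss_shift b (S n) * gauss_shift b (S n)) / b * (RtoC erf_limit + RtoC erf_limit))%C).
  { intros n l Hl. simpl gauss_cos_primitive.
    apply (is_Clim_plus eventually _ _ _ _ Hl).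
    apply (is_Clim_mult eventually _ _ _ _ (is_Clim_const eventually _)).
    apply is_Clim_plus; [typeclasses eauto | apply Cerf_limit; auto | apply Cerf_limit; auto]. }
  assert (Z : is_Clim eventually (fun L => gauss_cos_primitive b 0 (INR L)) (RtoC erf_limit / b)%C).
  { simpl. unfold Cdiv. apply is_Clim_mult; [typeclasses eauto | apply Cerf_limit; auto | apply is_Clim_const; typeclasses eauto]. }
  induction N as [|N IH].
  - eapply is_Clim_eq; [apply (St _ _ Z) |]. rewrite sum_O. cfield; auto.
  - eapply is_Clim_eq; [apply (St _ _ IH) |]. rewrite sum_n_CS. cfield; auto.
Qed.

Lemma is_Cderive_shift (G : R -> C) (c x : R) (l : C) :
  is_Cderive G (c + x) l -> is_Cderive (fun x => G (c + x)) x l.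
Proof.
  intros [H1 H2]; split.
  - eapply is_derive_eq; [apply (is_derive_comp (K := R_AbsRing) (V := R_NormedModule) (fun t => Re (G t)) (fun x => c + x)); [exact H1 |] |].
    + auto_derive; auto; reflexivity.
    + unfold scal; simpl; unfold mult; simpl; ring.
  - eapply is_derive_eq; [apply (is_derive_comp (K := R_AbsRing) (V := R_NormedModule) (fun t => Im (G t)) (fun x => c + x)); [exact H2 |] |].
    + auto_derive; auto; reflexivity.
    + unfold scal; simpl; unfold mult; simpl; ring.
Qed.

Definition gauss (b : C) (x : R) : C := Cexp (- ((b * RtoC x) * (b * RtoC x)))%C.
Definition gauss1 (b : C) (x : R) : C := (- RtoC 2 * (b * b) * RtoC x * gauss b x)%C.
Definition gauss2 (b : C) (x : R) : C :=
  ((RtoC 4 * (b * b) * (b * b) * RtoC (x ^ 2) - RtoC 2 * (b * b)) * gauss b x)%C.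

Lemma is_Cderive_gauss (b : C) (x : R) : is_Cderive (gauss b) x (gauss1 b x).
Proof.
  assert (L : is_Cderive (fun t => b * RtoC t)%C x b).
  { apply (is_Cderive_ext (fun t => b * RtoC t + RtoC 0)%C); [intros; ring | apply is_Cderive_lin]. }
  eapply is_Cderive_eq.
  - apply is_Cderive_Cexp, is_Cderive_opp, is_Cderive_mult; exact L.
  - unfold gauss1, gauss. cbv beta. ring.
Qed.

Lemma is_Cderive_gauss1 (b : C) (x : R) : is_Cderive (gauss1 b) x (gauss2 b x).
Proof.
  unfold gauss1. eapply is_Cderive_eq.
  - apply is_Cderive_mult; [| apply is_Cderive_gauss].
    apply (is_Cderive_ext (fun t => (- RtoC 2 * (b * b)) * RtoC t + RtoC 0)%C); [intros; ring | apply is_Cderive_lin].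
  - unfold gauss2, gauss1. rewrite RtoC_pow.
    replace (RtoC 4) with (RtoC 2 * RtoC 2)%C by (rewrite <- RtoC_mult; f_equal; ring). ring.
Qed.

Lemma Cmod_gauss (b : C) (x : R) : Cmod (gauss b x) = exp (- (Re (b * b)%C * x ^ 2)).
Proof.
  unfold gauss; rewrite Cmod_Cexp. f_equal.
  replace (- (b * RtoC x * (b * RtoC x)))%C with (RtoC (- x ^ 2) * (b * b))%C by (rewrite RtoC_opp, RtoC_pow; ring).
  rewrite Re_scal; ring.
Qed.

(** Of the four powers of 1 + x taken from [pow_gauss_bound], two pay for the polynomial factors of
    the derivatives and two give the decay that makes the errors summable over unit intervals. *)
Lemma gauss_bounds (b : C) :
  0 < Re (b * b)%C -> exists B, 0 < B /\ forall x, 0 <= x ->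
    Cmod (gauss b x) <= B * / (x + 1) ^ 2 /\ Cmod (gauss1 b x) <= B * / (x + 1) ^ 2 /\ Cmod (gauss2 b x) <= B * / (x + 1) ^ 2.
Proof.
  intros Hb. destruct (pow_gauss_bound _ 4 Hb) as [B [HB H]].
  assert (Hc := Cmod_ge_0 b). set (q := Cmod b * Cmod b). assert (Hq : 0 <= q) by (unfold q; nra).
  exists (B * (1 + 4 * (q * q) + 2 * q)). split; [apply Rmult_lt_0_compat; nra |].
  intros x Hx. specialize (H x Hx). rewrite <- Cmod_gauss in H.
  assert (H0 := Cmod_ge_0 (gauss b x)). set (g := Cmod (gauss b x)) in *.
  assert (Hx2 : 1 <= (1 + x) ^ 2) by nra.
  assert (K : forall y z, 0 <= y -> 0 <= z -> y <= (1 + x) ^ 2 * z -> z <= 1 + 4 * (q * q) + 2 * q ->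
     y * g <= B * (1 + 4 * (q * q) + 2 * q) * / (x + 1) ^ 2).
  { intros y z Hy Hz Hyz Hz2.
    apply (Rmult_le_reg_l ((x + 1) ^ 2)); [apply pow_lt; lra |].
    replace ((x + 1) ^ 2 * (B * (1 + 4 * (q * q) + 2 * q) * / (x + 1) ^ 2)) with (B * (1 + 4 * (q * q) + 2 * q)) by (field; lra).
    apply Rle_trans with ((1 + x) ^ 4 * g * z).
    - replace ((1 + x) ^ 4 * g * z) with ((1 + x) ^ 2 * g * ((1 + x) ^ 2 * z)) by ring.
      replace ((x + 1) ^ 2 * (y * g)) with ((1 + x) ^ 2 * g * y) by ring. apply Rmult_le_compat_l; nra.
    - apply Rmult_le_compat; auto. apply Rmult_le_pos; auto. apply pow_le; lra. }
  repeat split.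
  - fold g. rewrite <- (Rmult_1_l g). apply (K 1 1); nra.
  - unfold gauss1. rewrite !Cmod_mult, Cmod_opp, !Cmod_nneg by lra. fold g.
    replace (Cmod b * Cmod b) with q by reflexivity.
    apply (K _ (2 * q)); nra.
  - unfold gauss2. rewrite Cmod_mult. fold g.
    apply Rle_trans with ((4 * q * q * x ^ 2 + 2 * q) * g).
    + apply Rmult_le_compat_r; auto. eapply Rle_trans; [apply Cmod_triangle |]. rewrite Cmod_opp, !Cmod_mult, !Cmod_nneg by nra.
      unfold q; right; ring.
    + assert (0 <= q * q) by nra. assert (0 <= x ^ 2) by nra. apply (K _ (4 * (q * q) + 2 * q)); try nra.
Qed.

Lemma Series_nonneg (b : nat -> R) : (forall n, 0 <= b n) -> ex_series b -> 0 <= Series b.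
Proof.
  intros Hb He. eapply Rle_trans; [apply (Rabs_pos (Series (fun _ => 0))) |].
  apply Rabs_Series_le; auto. intros n; now rewrite Rabs_R0.
Qed.

Lemma sum_n_le_Series (b : nat -> R) (N : nat) :
  (forall n, 0 <= b n) -> ex_series b -> sum_n b N <= Series b.
Proof.
  intros Hb He. rewrite (Series_incr_n b (S N)) by (auto; lia). simpl pred. rewrite <- sum_n_Reals.
  assert (Q : 0 <= Series (fun k => b (S N + k)%nat)).
  { apply Series_nonneg; auto. now apply (ex_series_incr_n b (S N)). }
  lra.
Qed.

(** The unit-interval estimates for [n, n+1] are added up; the kernel has period 1 and the half
    weights at interior points combine. The bound stays controlled as the number of intervals grows,
    since the sums of 1/(n+1)^2 are bounded. *)
Lemma theta_finite (b : C) (B : R) (N L : nat) :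
  b <> RtoC 0 ->
  (forall x, 0 <= x ->
    Cmod (gauss b x) <= B * / (x + 1) ^ 2 /\ Cmod (gauss1 b x) <= B * / (x + 1) ^ 2 /\ Cmod (gauss2 b x) <= B * / (x + 1) ^ 2) ->
  Cmod (gauss_cos_primitive b (S N) (INR (S L)) -
    (/ RtoC 2 + sum_n (fun j => gauss b (INR (S j))) L - gauss b (INR (S L)) / RtoC 2))%C
  <= 6 * B / INR (S N) * sum_n (fun n => / (INR n + 1) ^ 2) L.
Proof.
  intros Hb HB. assert (HN := INR_S_pos N). assert (H2 : RtoC 2 <> RtoC 0) by (apply RtoC_neq; lra).
  assert (U : forall n, Cmod (gauss_cos_primitive b (S N) (INR (S n)) - gauss_cos_primitive b (S N) (INR n)
      - (gauss b (INR n) + gauss b (INR (S n))) / RtoC 2)%C <= 6 * B / INR (S N) * / (INR n + 1) ^ 2).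
  { intros n. assert (Hn := pos_INR n).
    assert (Q := trapezoid_unit (S N) (fun x => gauss b (INR n + x)) (fun x => gauss1 b (INR n + x)) (fun x => gauss2 b (INR n + x))
      (fun x => gauss_cos_primitive b (S N) (INR n + x)) (B * / (INR n + 1) ^ 2) ltac:(lia)).
    cbv beta in Q. rewrite Rplus_0_r in Q. rewrite S_INR.
    replace (6 * B / INR (S N) * / (INR n + 1) ^ 2) with (6 * (B * / (INR n + 1) ^ 2) / INR (S N)) by (field; lra).
    assert (Mono : forall x, 0 <= x -> B * / (INR n + x + 1) ^ 2 <= B * / (INR n + 1) ^ 2).
    { intros x Hx. assert (0 <= B).
      { assert (Z := proj1 (HB 0 (Rle_refl 0))). assert (Z1 := Cmod_ge_0 (gauss b 0)).
        replace (B * / (0 + 1) ^ 2) with B in Z by field. lra. }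
      apply Rmult_le_compat_l; auto. apply Rinv_le_contravar; [apply pow_lt; lra |]. apply pow_incr; lra. }
    apply Q.
    - intros; apply is_Cderive_shift, is_Cderive_gauss.
    - intros; apply is_Cderive_shift, is_Cderive_gauss1.
    - intros x Hx; apply is_Cderive_shift. rewrite <- (dirichlet_shift (S N) n x). now apply is_Cderive_gauss_cos.
    - intros x Hx. eapply Rle_trans; [apply (HB (INR n + x)); lra | apply Mono; lra].
    - intros x Hx. eapply Rle_trans; [apply (HB (INR n + x)); lra | apply Mono; lra]. }
  induction L as [|L IH].
  - specialize (U 0%nat). simpl (INR 0) in U. rewrite gauss_cos_primitive_0 in U. rewrite !sum_O.
    assert (G0 : gauss b 0 = RtoC 1).
    { unfold gauss. replace (- (b * RtoC 0 * (b * RtoC 0)))%C with (RtoC 0) by ring. apply Cexp_0. }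
    rewrite G0 in U. eapply Rle_trans; [| exact U]. right; f_equal. field; auto.
  - rewrite sum_n_RS, sum_n_CS, Rmult_plus_distr_l. specialize (U (S L)).
    match goal with |- Cmod ?z <= _ => replace z with
      ((gauss_cos_primitive b (S N) (INR (S L)) -
    (/ RtoC 2 + sum_n (fun j => gauss b (INR (S j))) L - gauss b (INR (S L)) / RtoC 2)) +
     (gauss_cos_primitive b (S N) (INR (S (S L))) - gauss_cos_primitive b (S N) (INR (S L))
      - (gauss b (INR (S L)) + gauss b (INR (S (S L)))) / RtoC 2))%C by (field; auto) end.
    eapply Rle_trans; [apply Cmod_triangle |]. apply Rplus_le_compat; auto.
Qed.

(** Poisson summation for a Gaussian. With N fixed, the interval is extended to infinity and each
    shifted error function tends to [erf_limit]; then N tends to infinity. The order of the limits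
    is justified by an error bound of order 1/N that is uniform in the length of the interval. *)
Lemma theta_with_erf_limit (b : C) :
  0 < Re b -> 0 < Re (b * b)%C ->
  (/ RtoC 2 + CSeries (fun j => gauss b (INR (S j))))%C =
  (RtoC erf_limit / b * (RtoC 1 + RtoC 2 * CSeries (fun j => gauss (RtoC PI / b) (INR (S j)))))%C.
Proof.
  intros Hb Hb2. assert (Hb0 := ne_0_of_Re b Hb). assert (P := PI_RGT_0).
  assert (H2 : RtoC 2 <> RtoC 0) by (apply RtoC_neq; lra).
  destruct (gauss_bounds b Hb2) as [B [HB0 HB]].
  assert (Hd2 : 0 < Re (RtoC PI / b * (RtoC PI / b))%C).
  { replace (RtoC PI / b * (RtoC PI / b))%C with (RtoC (PI ^ 2) * / (b * b))%C by (rewrite RtoC_pow; field; auto).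
    rewrite Re_scal. apply Rmult_lt_0_compat; [nra |].
    destruct (b * b)%C as [u v]; simpl in *. apply Rdiv_lt_0_compat; nra. }
  destruct (gauss_bounds _ Hd2) as [D [HD0 HD]].
  assert (Sb : forall n, Cmod (gauss b (INR (S n))) <= B * / (INR n + 1) ^ 2).
  { intros n. eapply Rle_trans; [apply HB, pos_INR |]. apply Rmult_le_compat_l; [lra |]. rewrite S_INR.
    assert (Hn := pos_INR n). apply Rinv_le_contravar; [apply pow_lt; lra |]. apply pow_incr; lra. }
  assert (Sd : forall n, Cmod (gauss (RtoC PI / b) (INR (S n))) <= D * / (INR n + 1) ^ 2).
  { intros n. eapply Rle_trans; [apply HD, pos_INR |]. apply Rmult_le_compat_l; [lra |]. rewrite S_INR.
    assert (Hn := pos_INR n). apply Rinv_le_contravar; [apply pow_lt; lra |]. apply pow_incr; lra. }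
  assert (L1 := proj1 (is_Cseries_iff _ _) (CSeries_correct _ _ Sb (ex_series_scal_Rl _ _ ex_series_inv_sqr))).
  assert (L2 := proj1 (is_Cseries_iff _ _) (CSeries_correct _ _ Sd (ex_series_scal_Rl _ _ ex_series_inv_sqr))).
  set (Th := CSeries (fun j => gauss b (INR (S j)))) in *. set (Td := CSeries (fun j => gauss (RtoC PI / b) (INR (S j)))) in *.
  set (Q := Series (fun n => / (INR n + 1) ^ 2)).
  assert (E : forall j, Cexp (gauss_shift b (S j) * gauss_shift b (S j)) = gauss (RtoC PI / b) (INR (S j))).
  { intros j. unfold gauss, gauss_shift. f_equal. rewrite !RtoC_mult.
    replace (Ci * (RtoC PI * RtoC (INR (S j))) / b * (Ci * (RtoC PI * RtoC (INR (S j))) / b))%C with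
      ((Ci * Ci) * ((RtoC PI * RtoC (INR (S j))) / b * (RtoC PI * RtoC (INR (S j))) / b))%C by (field; auto).
    replace (Ci * Ci)%C with (RtoC (-1)) by (apply C_eq_parts; unfold Ci; simpl; ring). field; auto. }
  assert (G0 : is_Clim eventually (fun L => gauss b (INR (S L))) (RtoC 0)).
  { apply (is_Clim_0_le eventually _ (fun L => B * / (1 + INR L))).
    - apply filter_forall. intros n. eapply Rle_trans; [apply Sb |]. assert (Hn := pos_INR n).
      apply Rmult_le_compat_l; [lra |]. apply Rinv_le_contravar; nra.
    - replace 0 with (B * 0) by ring. apply (is_lim_seq_scal_l _ B 0), is_lim_seq_inv_S. }
  assert (Est : forall N, Cmod (RtoC erf_limit / b * (RtoC 1 + RtoC 2 * sum_n (fun j => gauss (RtoC PI / b) (INR (S j))) N)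
      - (/ RtoC 2 + Th))%C <= 6 * B * Q * / INR (S N)).
  { intros N.
    assert (A1 := gauss_cos_primitive_limit b N Hb Hb2).
    assert (A2 : is_Clim eventually (fun L => gauss_cos_primitive b (S N) (INR (S L)))
      (RtoC erf_limit / b * (RtoC 1 + RtoC 2 * sum_n (fun j => gauss (RtoC PI / b) (INR (S j))) N))%C).
    { rewrite <- (sum_n_ext _ _ N E). destruct A1 as [A1 A1']; split.
      - apply (is_lim_seq_incr_1 (fun L => Re (gauss_cos_primitive b (S N) (INR L))) (Finite _)); exact A1.
      - apply (is_lim_seq_incr_1 (fun L => Im (gauss_cos_primitive b (S N) (INR L))) (Finite _)); exact A1'. }
    refine (is_Clim_Cmod_le eventually (fun L => gauss_cos_primitive b (S N) (INR (S L)) -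
    (/ RtoC 2 + sum_n (fun j => gauss b (INR (S j))) L - gauss b (INR (S L)) / RtoC 2))%C _ _ _ _).
    - eapply is_Clim_eq.
      + apply is_Clim_minus; [typeclasses eauto | exact A2 |].
        apply is_Clim_minus; [typeclasses eauto | apply is_Clim_plus; [typeclasses eauto | apply is_Clim_const; typeclasses eauto | exact L1] |].
        apply is_Clim_mult; [typeclasses eauto | exact G0 | apply is_Clim_const; typeclasses eauto].
      + unfold Cdiv. ring.
    - apply filter_forall. intros L. eapply Rle_trans; [apply (theta_finite b B); auto |].
      assert (HN := INR_S_pos N).
      replace (6 * B * Q * / INR (S N)) with (6 * B / INR (S N) * Q) by (field; lra).
      apply Rmult_le_compat_l; [apply Rlt_le, Rdiv_lt_0_compat; lra |].
      apply sum_n_le_Series; [| apply ex_series_inv_sqr]. intros n. assert (Hn := pos_INR n). apply Rlt_le, Rinv_0_lt_compat, pow_lt; lra. }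
  symmetry. eapply (is_Clim_unique eventually (fun N => RtoC erf_limit / b * (RtoC 1 + RtoC 2 * sum_n (fun j => gauss (RtoC PI / b) (INR (S j))) N))%C).
  - apply is_Clim_mult; [typeclasses eauto | apply is_Clim_const; typeclasses eauto |].
    apply is_Clim_plus; [typeclasses eauto | apply is_Clim_const; typeclasses eauto |].
    apply is_Clim_mult; [typeclasses eauto | apply is_Clim_const; typeclasses eauto | exact L2].
  - assert (Z : is_Clim eventually (fun N => RtoC erf_limit / b * (RtoC 1 + RtoC 2 * sum_n (fun j => gauss (RtoC PI / b) (INR (S j))) N)
      - (/ RtoC 2 + Th))%C (RtoC 0)).
    { apply (is_Clim_0_le eventually _ (fun N => 6 * B * Q * / INR (S N))).
      - apply filter_forall; auto.
      - replace 0 with (6 * B * Q * 0) by ring.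
        apply (is_lim_seq_scal_l (fun N => / INR (S N)) (6 * B * Q) 0).
        apply (is_lim_seq_incr_1 (fun n => / INR n)), is_lim_seq_inv_INR. }
    eapply is_Clim_eq; [eapply is_Clim_ext; [| | apply (is_Clim_plus eventually _ _ _ _ Z (is_Clim_const eventually (/ RtoC 2 + Th)%C))] |].
    + typeclasses eauto.
    + apply filter_forall. intros L. cbv beta. ring.
    + ring.
Qed.

(** At the self-dual point b = sqrt(pi) both theta sums are the same positive number, so the unknown
    factor has to be 1. *)
Lemma erf_limit_eq : erf_limit = sqrt PI / 2.
Proof.
  assert (P := PI_RGT_0). assert (Hs : 0 < sqrt PI) by (now apply sqrt_lt_R0).
  assert (Hss : sqrt PI * sqrt PI = PI) by (apply sqrt_sqrt; lra).
  assert (T := theta_with_erf_limit (RtoC (sqrt PI)) Hs).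
  assert (E : (RtoC PI / RtoC (sqrt PI))%C = RtoC (sqrt PI)).
  { rewrite <- RtoC_div by lra. f_equal. rewrite <- Hss at 1. field; lra. }
  rewrite E in T.
  assert (T' := f_equal Re (T ltac:(autorewrite with reim; nra))). clear T.
  unfold Cdiv in T'. rewrite <- !RtoC_inv, <- RtoC_mult in T' by lra.
  rewrite Re_scal, !Re_plus, Re_scal, !Re_RtoC in T'.
  set (S0 := Re (CSeries _)) in *.
  assert (0 <= S0).
  { unfold S0. change (0 <= Series (fun j => Re (gauss (RtoC (sqrt PI)) (INR (S j))))).
    assert (Hb : 0 < Re (RtoC (sqrt PI) * RtoC (sqrt PI))%C) by (autorewrite with reim; nra).
    destruct (gauss_bounds (RtoC (sqrt PI)) Hb) as [B [HB0 HB]].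
    apply Series_nonneg.
    - intros n. unfold gauss. rewrite <- RtoC_mult, <- RtoC_mult, <- RtoC_opp, Cexp_RtoC, Re_RtoC. apply Rlt_le, exp_pos.
    - eapply ex_series_Re_le; [| apply (ex_series_scal_Rl B), ex_series_inv_sqr]. intros n; cbv beta.
      eapply Rle_trans; [apply HB, pos_INR |]. apply Rmult_le_compat_l; [lra |]. rewrite S_INR.
      assert (Hn := pos_INR n). apply Rinv_le_contravar; [apply pow_lt; lra |]. apply pow_incr; lra. }
  assert (Q : / 2 + S0 = (2 * erf_limit * / sqrt PI) * (/ 2 + S0)) by (rewrite T' at 1; field; lra).
  assert (Q2 : 2 * erf_limit * / sqrt PI = 1) by (apply (Rmult_eq_reg_r (/ 2 + S0)); lra).
  assert (erf_limit = (2 * erf_limit * / sqrt PI) * (sqrt PI / 2)) by (field; lra). rewrite Q2 in H0. lra.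
Qed.

Lemma theta_transform (b : C) :
  0 < Re b -> 0 < Re (b * b)%C ->
  (/ RtoC 2 + CSeries (fun j => gauss b (INR (S j))))%C =
  (RtoC (sqrt PI) / b * (/ RtoC 2 + CSeries (fun j => gauss (RtoC PI / b) (INR (S j)))))%C.
Proof.
  intros Hb Hb2. rewrite theta_with_erf_limit, erf_limit_eq, RtoC_div by (auto; lra).
  assert (Hb0 := ne_0_of_Re b Hb). assert (H2 : RtoC 2 <> RtoC 0) by (apply RtoC_neq; lra). field; auto.
Qed.

(** * Gauss' limit for the reciprocal Gamma function *)

Lemma poch_S (x : R) (n : nat) : poch x (S n) = poch x n * (x + INR n).
Proof. reflexivity. Qed.

Lemma poch_shift (x : R) (n : nat) : poch x (S n) = x * poch (x + 1) n.
Proof.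
  induction n as [|n IH]; [simpl; ring |].
  rewrite poch_S, IH, (poch_S (x + 1)), S_INR; ring.
Qed.

Lemma poch_pos (x : R) (n : nat) : 0 < x -> 0 < poch x n.
Proof.
  intros Hx; induction n as [|n IH]; [simpl; lra |]. rewrite poch_S.
  assert (H := pos_INR n). apply Rmult_lt_0_compat; lra.
Qed.

Definition gauss_seq (x : R) (n : nat) : R := poch x (S n) / (INR (fact n) * Rpower (INR n) x).

Lemma Rpower_INR_pos (x y : R) : 0 < Rpower x y.
Proof. apply exp_pos. Qed.

(** The functional equation of 1/Gamma holds at finite n up to a factor tending to 1, so that limits
    can be moved between x and x + 1 in both directions. *)
Lemma gauss_seq_shift (x : R) (n : nat) :
  (1 <= n)%nat -> x * gauss_seq (x + 1) n = gauss_seq x n * (1 + (x + 1) * / INR n).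
Proof.
  intros Hn. unfold gauss_seq.
  assert (H1 : 0 < INR n) by (apply lt_0_INR; lia).
  rewrite Rpower_plus, Rpower_1 by auto.
  assert (H2 := Rpower_INR_pos (INR n) x). assert (H3 := INR_fact_neq_0 n).
  replace (x * (poch (x + 1) (S n) / (INR (fact n) * (Rpower (INR n) x * INR n))))
    with (x * poch (x + 1) (S n) / (INR (fact n) * (Rpower (INR n) x * INR n))) by (field; lra).
  rewrite <- poch_shift, (poch_S x (S n)), S_INR. field; lra.
Qed.

Lemma is_lim_seq_one_plus (c : R) : is_lim_seq (fun n => 1 + c * / INR n) 1.
Proof.
  replace (Finite 1) with (Finite (1 + c * 0)) by (f_equal; ring).
  apply is_lim_seq_plus'; [apply is_lim_seq_const |].
  apply (is_lim_seq_scal_l _ c 0), is_lim_seq_inv_INR.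
Qed.

Lemma gauss_lim_up (x l : R) :
  x <> 0 -> is_lim_seq (gauss_seq x) l -> is_lim_seq (gauss_seq (x + 1)) (l / x).
Proof.
  intros Hx H. apply (is_lim_seq_ext_loc (fun n => / x * (gauss_seq x n * (1 + (x + 1) * / INR n)))).
  - exists 1%nat. intros n Hn. rewrite <- gauss_seq_shift by auto. field; auto.
  - replace (Finite (l / x)) with (Rbar_mult (/ x) (Finite (l * 1))) by (simpl; f_equal; field; auto).
    apply is_lim_seq_scal_l. apply is_lim_seq_mult'; auto. apply is_lim_seq_one_plus.
Qed.

Lemma gauss_lim_down (x l : R) :
  is_lim_seq (gauss_seq (x + 1)) l -> is_lim_seq (gauss_seq x) (x * l).
Proof.
  intros H.
  assert (L1 := is_lim_seq_one_plus (x + 1)).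
  apply (is_lim_seq_ext_loc (fun n => x * gauss_seq (x + 1) n / (1 + (x + 1) * / INR n))).
  - apply is_lim_seq_spec in L1. destruct (L1 (mkposreal (/ 2) ltac:(lra))) as [N HN]. simpl in HN.
    exists (S N). intros n Hn. specialize (HN n ltac:(lia)). rewrite gauss_seq_shift by lia.
    apply Rabs_def2 in HN. field. split; [apply not_0_INR; lia |].
    assert (0 < INR n) by (apply lt_0_INR; lia).
    intro E. assert (Z : 1 + (x + 1) * / INR n = (INR n + (x + 1)) * / INR n) by (field; lra).
    rewrite Z, E, Rmult_0_l in HN. lra.
  - replace (Finite (x * l)) with (Finite (x * l / 1)) by (f_equal; field).
    apply is_lim_seq_div'; [| auto | lra].
    apply (is_lim_seq_scal_l _ x l); auto.
Qed.

Lemma exp_le_of_ln (a b : R) : 0 < a -> b <= ln a -> exp b <= a.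
Proof. intros Ha H. rewrite <- (exp_ln a) by auto. now apply exp_le. Qed.

(* Bernoulli's inequality for exponents in (0,1). *)
Lemma Rpower_bernoulli (x y : R) : 0 < x < 1 -> 0 < 1 + y -> Rpower (1 + y) x <= 1 + x * y.
Proof.
  intros Hx Hy.
  assert (Hxy : 0 < 1 + x * y) by nra.
  set (u := (1 + y) / (1 + x * y)). set (v := / (1 + x * y)).
  assert (Hu : 0 < u) by (apply Rdiv_lt_0_compat; auto).
  assert (Hv : 0 < v) by (now apply Rinv_0_lt_compat).
  assert (LN : forall t, 0 < t -> ln t <= t - 1).
  { intros t Ht. assert (Q := exp_ineq1_le (ln t)). rewrite exp_ln in Q by auto. lra. }
  assert (L1 := LN u Hu). assert (L2 := LN v Hv).
  assert (E1 : ln u = ln (1 + y) - ln (1 + x * y)) by (unfold u, Rdiv; rewrite ln_mult, ln_Rinv by (auto; now apply Rinv_0_lt_compat); ring).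
  assert (E2 : ln v = - ln (1 + x * y)) by (unfold v; rewrite ln_Rinv by auto; ring).
  unfold Rpower. apply exp_le_of_ln; auto.
  assert (E : x * (u - 1) + (1 - x) * (v - 1) = 0) by (unfold u, v; field; lra).
  rewrite E1 in L1. rewrite E2 in L2.
  assert (x * (ln (1 + y) - ln (1 + x * y)) <= x * (u - 1)) by (apply Rmult_le_compat_l; lra).
  assert ((1 - x) * - ln (1 + x * y) <= (1 - x) * (v - 1)) by (apply Rmult_le_compat_l; lra).
  lra.
Qed.

(** Bernoulli's inequality makes the sequence decreasing, and makes the variant with (n+1)^x in
    place of n^x increasing. The second lies below the first, so its first term is a positive lower
    bound for the limit. *)
Lemma gauss_lim_01 (x : R) : 0 < x < 1 -> exists l, 0 < l /\ is_lim_seq (gauss_seq x) l.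
Proof.
  intros Hx.
  assert (Pos : forall n, 0 < gauss_seq x n).
  { intros n. unfold gauss_seq. apply Rdiv_lt_0_compat; [apply poch_pos; lra |].
    apply Rmult_lt_0_compat; [apply INR_fact_lt_0 | apply exp_pos]. }
  set (g := fun n => gauss_seq x (S n)).
  set (g' := fun n => poch x (S (S n)) / (INR (fact (S n)) * Rpower (INR (S (S n))) x)).
  assert (Dec : forall n, g (S n) <= g n).
  { intros n. unfold g, gauss_seq.
    assert (H1 := INR_S_pos n). assert (H2 := INR_S_pos (S n)).
    rewrite (poch_S x (S (S n))), (fact_simpl (S n)), mult_INR.
    assert (HB := Rpower_bernoulli x (- / INR (S (S n))) Hx).
    assert (HI : / INR (S (S n)) < 1).
    { rewrite <- Rinv_1. apply Rinv_lt_contravar; [lra |]. rewrite S_INR. lra. }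
    assert (HI0 : 0 < / INR (S (S n))) by (now apply Rinv_0_lt_compat).
    specialize (HB ltac:(lra)).
    assert (ER : Rpower (INR (S n)) x = Rpower (1 + - / INR (S (S n))) x * Rpower (INR (S (S n))) x).
    { rewrite Rpower_mult_distr by lra. f_equal. rewrite (S_INR (S n)). rewrite (S_INR (S n)) in H2. field; lra. }
    rewrite ER. set (R1 := Rpower (1 + - / INR (S (S n))) x) in *. set (R2 := Rpower (INR (S (S n))) x) in *.
    assert (HR1 : 0 < R1) by apply exp_pos. assert (HR2 : 0 < R2) by apply exp_pos.
    assert (HP := poch_pos x (S (S n)) ltac:(lra)). assert (HF := INR_fact_lt_0 (S n)).
    set (k := INR (S (S n))) in *. set (f := INR (fact (S n))) in *. set (p := poch x (S (S n))) in *.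
    apply (Rmult_le_reg_r (f * R2 * R1)); [repeat apply Rmult_lt_0_compat; auto |].
    replace (p / (f * (R1 * R2)) * (f * R2 * R1)) with p by (field; lra).
    replace (p * (x + k) / (k * f * R2) * (f * R2 * R1)) with (p * ((1 + x * / k) * R1)) by (field; lra).
    rewrite <- (Rmult_1_r p) at 2. apply Rmult_le_compat_l; [lra |].
    assert (0 < x * / k) by (apply Rmult_lt_0_compat; lra).
    apply Rle_trans with ((1 + x * / k) * (1 + x * - / k)); [apply Rmult_le_compat_l; lra | nra]. }
  assert (Inc : forall n, g' n <= g' (S n)).
  { intros n. unfold g'.
    assert (H1 := INR_S_pos (S n)). assert (H2 := INR_S_pos (S (S n))).
    rewrite (poch_S x (S (S n))), (fact_simpl (S n)), mult_INR.
    assert (HB := Rpower_bernoulli x (/ INR (S (S n))) Hx).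
    assert (HI0 : 0 < / INR (S (S n))) by (now apply Rinv_0_lt_compat).
    specialize (HB ltac:(lra)).
    assert (ER : Rpower (INR (S (S (S n)))) x = Rpower (1 + / INR (S (S n))) x * Rpower (INR (S (S n))) x).
    { rewrite Rpower_mult_distr by lra. f_equal. rewrite (S_INR (S (S n))). field; lra. }
    rewrite ER. set (R1 := Rpower (1 + / INR (S (S n))) x) in *. set (R2 := Rpower (INR (S (S n))) x) in *.
    assert (HR1 : 0 < R1) by apply exp_pos. assert (HR2 : 0 < R2) by apply exp_pos.
    assert (HP := poch_pos x (S (S n)) ltac:(lra)). assert (HF := INR_fact_lt_0 (S n)).
    set (k := INR (S (S n))) in *. set (f := INR (fact (S n))) in *. set (p := poch x (S (S n))) in *.
    apply (Rmult_le_reg_r (f * R2 * R1)); [repeat apply Rmult_lt_0_compat; auto |].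
    replace (p / (f * R2) * (f * R2 * R1)) with (p * R1) by (field; lra).
    replace (p * (x + k) / (k * f * (R1 * R2)) * (f * R2 * R1)) with (p * (1 + x * / k)) by (field; lra).
    apply Rmult_le_compat_l; lra. }
  assert (Ord : forall n, g' n <= g n).
  { intros n. unfold g, g', gauss_seq.
    assert (HP := poch_pos x (S (S n)) ltac:(lra)). assert (HF := INR_fact_lt_0 (S n)).
    unfold Rdiv; apply Rmult_le_compat_l; [lra |]. apply Rinv_le_contravar; [apply Rmult_lt_0_compat; auto; apply exp_pos |].
    apply Rmult_le_compat_l; [lra |]. apply Rle_Rpower_l; [lra |]. split; [apply INR_S_pos | apply le_INR; lia]. }
  assert (Low : forall n, g' 0%nat <= g n).
  { intros n. eapply Rle_trans; [| apply Ord]. induction n as [|n IH]; [lra | eapply Rle_trans; [exact IH | apply Inc]]. }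
  destruct (ex_finite_lim_seq_decr g (g' 0%nat) Dec Low) as [l Hl].
  exists l. split.
  - apply Rlt_le_trans with (g' 0%nat).
    + unfold g'. apply Rdiv_lt_0_compat; [apply poch_pos; lra |].
      apply Rmult_lt_0_compat; [apply INR_fact_lt_0 | apply exp_pos].
    + apply (is_lim_seq_le (fun _ => g' 0%nat) g (g' 0%nat) l); auto. apply is_lim_seq_const.
  - apply is_lim_seq_incr_1. exact Hl.
Qed.

(** The limit must also be nonzero, because [Gamma] is the inverse of it. *)
Definition gauss_good (x : R) : Prop := exists l, l <> 0 /\ is_lim_seq (gauss_seq x) l.

Lemma gauss_good_up (x : R) : x <> 0 -> gauss_good x -> gauss_good (x + 1).
Proof.
  intros Hx [l [H1 H2]]. exists (l / x). split; [| now apply gauss_lim_up].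
  intro E. apply H1. replace l with (l / x * x) by (field; auto). rewrite E; ring.
Qed.

Lemma gauss_good_down (x : R) : x <> 0 -> gauss_good (x + 1) -> gauss_good x.
Proof. intros Hx [l [H1 H2]]. exists (x * l). split; [nra | now apply gauss_lim_down]. Qed.

Lemma gauss_good_nonint (x : R) : (forall z : Z, x <> IZR z) -> gauss_good x.
Proof.
  assert (Up : forall n x, INR n < x < INR n + 1 -> gauss_good x).
  { induction n as [|n IH]; intros y Hy.
    - simpl in Hy. destruct (gauss_lim_01 y) as [l [H1 H2]]; [lra |]. exists l; split; auto; lra.
    - rewrite S_INR in Hy. replace y with (y - 1 + 1) by ring. assert (Hn := pos_INR n).
      apply gauss_good_up; [lra | apply IH; lra]. }
  assert (Down : forall n x, - INR n < x < - INR n + 1 -> gauss_good x).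
  { induction n as [|n IH]; intros y Hy.
    - simpl in Hy. apply (Up 0%nat); simpl; lra.
    - rewrite S_INR in Hy. assert (Hn := pos_INR n).
      apply gauss_good_down; [lra | apply IH; lra]. }
  intros Hx. destruct (archimed x) as [A1 A2]. set (z := up x) in *.
  assert (Hz : IZR (z - 1) < x < IZR (z - 1) + 1).
  { rewrite minus_IZR. split; [| lra]. destruct (Rle_lt_or_eq_dec (IZR z - 1) x); [lra | lra |].
    exfalso; apply (Hx (z - 1)%Z). rewrite minus_IZR; lra. }
  set (w := (z - 1)%Z) in *. destruct (Z_le_gt_dec 0 w).
  - apply (Up (Z.to_nat w)). rewrite INR_IZR_INZ, Z2Nat.id by lia. auto.
  - apply (Down (Z.to_nat (- w))). rewrite INR_IZR_INZ, Z2Nat.id, opp_IZR by lia. lra.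
Qed.

Lemma gauss_lim_1 : is_lim_seq (gauss_seq 1) 1.
Proof.
  apply (is_lim_seq_ext_loc (fun n => 1 + 1 * / INR n)); [| apply is_lim_seq_one_plus].
  exists 1%nat. intros n Hn. unfold gauss_seq.
  assert (H1 : 0 < INR n) by (apply lt_0_INR; lia).
  rewrite Rpower_1 by auto.
  assert (E : forall k, poch 1 k = INR (fact k)).
  { induction k as [|k IH]; [reflexivity |]. rewrite poch_S, IH, fact_simpl, mult_INR, S_INR; ring. }
  rewrite E, fact_simpl, mult_INR, S_INR. assert (H2 := INR_fact_neq_0 n). field; lra.
Qed.

(** The real number extracted in [rGamma] is meaningful only when the limit exists and is finite.
    Noninteger arguments are reached from (0,1) by unit steps, integers from 1. *)
Lemma rGamma_is_lim (x : R) : is_lim_seq (gauss_seq x) (rGamma x).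
Proof.
  assert (K : forall l, is_lim_seq (gauss_seq x) (Finite l) -> is_lim_seq (gauss_seq x) (rGamma x)).
  { intros l Hl. change (rGamma x) with (real (Lim_seq (gauss_seq x))). rewrite (is_lim_seq_unique _ _ Hl). exact Hl. }
  assert (D : (forall z : Z, x <> IZR z) \/ exists z : Z, x = IZR z).
  { destruct (Req_dec x (IZR (up x - 1))) as [E | N]; [right; eauto | left].
    intros z Hz. apply N. rewrite Hz. f_equal.
    destruct (archimed x) as [A1 A2]. rewrite Hz in A1, A2 at 2. rewrite Hz in *.
    assert (z < up (IZR z))%Z by (apply lt_IZR; lra). assert (up (IZR z) <= z + 1)%Z by (apply le_IZR; rewrite plus_IZR; lra). lia. }
  destruct D as [D | [z ->]].
  - destruct (gauss_good_nonint x D) as [l [_ Hl]]. now apply (K l).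
  - assert (U : forall n, exists l, is_lim_seq (gauss_seq (INR (S n))) (Finite l)).
    { induction n as [|n [l Hl]]; [exists 1; apply gauss_lim_1 |].
      exists (l / INR (S n)). rewrite (S_INR (S n)). apply gauss_lim_up; auto. apply not_0_INR; lia. }
    assert (W : forall n, exists l, is_lim_seq (gauss_seq (1 - INR n)) (Finite l)).
    { induction n as [|n [l Hl]]; [exists 1; simpl; replace (1 - 0) with 1 by ring; apply gauss_lim_1 |].
      exists ((1 - INR (S n)) * l). apply gauss_lim_down. rewrite S_INR. replace (1 - (INR n + 1) + 1) with (1 - INR n) by ring; auto. }
    destruct (Z_le_gt_dec 1 z).
    + destruct (U (Z.to_nat (z - 1))) as [l0 Hl]. apply (K l0).
      replace (INR (S (Z.to_nat (z - 1)))) with (IZR z) in Hl; auto. rewrite INR_IZR_INZ; f_equal; lia.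
    + destruct (W (Z.to_nat (1 - z))) as [l0 Hl]. apply (K l0).
      replace (1 - INR (Z.to_nat (1 - z))) with (IZR z) in Hl; auto.
      rewrite INR_IZR_INZ, Z2Nat.id, minus_IZR by lia; ring.
Qed.

Lemma rGamma_lim_eq (x l : R) : is_lim_seq (gauss_seq x) l -> rGamma x = l.
Proof. intros H. change (rGamma x) with (real (Lim_seq (gauss_seq x))). rewrite (is_lim_seq_unique _ _ H). reflexivity. Qed.

Lemma rGamma_rec (x : R) : rGamma x = x * rGamma (x + 1).
Proof. apply rGamma_lim_eq, gauss_lim_down, rGamma_is_lim. Qed.

Lemma rGamma_1 : rGamma 1 = 1.
Proof. apply rGamma_lim_eq, gauss_lim_1. Qed.

Lemma rGamma_0 : rGamma 0 = 0.
Proof. rewrite rGamma_rec; ring. Qed.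

Lemma rGamma_nonpos (j : nat) : rGamma (- INR j) = 0.
Proof.
  induction j as [|j IH]; [simpl; rewrite Ropp_0; apply rGamma_0 |].
  rewrite rGamma_rec, S_INR. replace (- (INR j + 1) + 1) with (- INR j) by ring. rewrite IH; ring.
Qed.

Lemma rGamma_nonint_neq_0 (x : R) : (forall z : Z, x <> IZR z) -> rGamma x <> 0.
Proof. intros H. destruct (gauss_good_nonint x H) as [l [H1 H2]]. now rewrite (rGamma_lim_eq _ _ H2). Qed.

Lemma Gamma_rec (x : R) : (forall z : Z, x <> IZR z) -> Gamma (x + 1) = x * Gamma x.
Proof.
  intros H. unfold Gamma. assert (N := rGamma_nonint_neq_0 x H). assert (R0 := rGamma_rec x). rewrite R0 in N |- *.
  field. split; [intro E; apply N; rewrite E; ring | apply (H 0%Z)].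
Qed.

(** * Wallis' product *)

(** Primitives of sin^n by the usual reduction formula, with the even and the odd exponents starting
    from x and - cos x. *)
Fixpoint sin_pow_primitive (n : nat) (x : R) : R :=
  match n with
  | O => x
  | S O => - cos x
  | S (S k) => (- cos x * sin x ^ S k + INR (S k) * sin_pow_primitive k x) / INR (S (S k))
  end.

Lemma sin_pow_primitive_SS (n : nat) (x : R) :
  sin_pow_primitive (S (S n)) x
  = (- cos x * sin x ^ S n + INR (S n) * sin_pow_primitive n x) / INR (S (S n)).
Proof. reflexivity. Qed.

Lemma is_derive_sin_pow (n : nat) (x : R) : is_derive (sin_pow_primitive n) x (sin x ^ n).
Proof.
  assert (H : is_derive (sin_pow_primitive n) x (sin x ^ n) /\ is_derive (sin_pow_primitive (S n)) x (sin x ^ S n)).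
  { induction n as [|n [IH1 IH2]].
    - split; simpl; auto_derive; auto; ring.
    - split; [exact IH2 |].
      apply (is_derive_ext (fun x => / INR (S (S n)) * (- cos x * sin x ^ S n + INR (S n) * sin_pow_primitive n x))).
      + intros t. rewrite sin_pow_primitive_SS. unfold Rdiv. match goal with |- @eq _ ?a ?b => change (@eq R a b) end. ring.
      + assert (Hk := INR_S_pos (S n)).
        eapply is_derive_eq.
        * apply (is_derive_scal (fun x => - cos x * sin x ^ S n + INR (S n) * sin_pow_primitive n x)).
          apply (is_derive_plus (K := R_AbsRing) (V := R_NormedModule)).
          -- auto_derive; auto; reflexivity.
          -- apply is_derive_scal; exact IH1.
        * change plus with Rplus. change (match n with O => 1 | S _ => INR n + 1 end) with (INR (S n)). rewrite (S_INR (S n)) in *. set (k := INR (S n)) in *.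
          assert (HC : cos x * cos x = 1 - sin x * sin x).
          { assert (Q := sin2_cos2 x). unfold Rsqr in Q. lra. }
          change (pred (S n)) with n. change (sin x ^ S n) with (sin x * sin x ^ n). change (sin x ^ S (S n)) with (sin x * (sin x * sin x ^ n)).
          apply (Rmult_eq_reg_l (k + 1)); [| lra].
          match goal with |- _ * (/ _ * ?y) = _ => transitivity y; [field; lra |] end.
          transitivity (k * (sin x ^ n) * (1 - cos x * cos x) + sin x * (sin x * sin x ^ n)); [ring |].
          rewrite HC; ring. }
  apply H.
Qed.

(** The integral of sin^n over [0, pi/2]. *)
Definition wallis (n : nat) : R := sin_pow_primitive n (PI / 2) - sin_pow_primitive n 0.

Lemma wallis_0 : wallis 0 = PI / 2.
Proof. unfold wallis; simpl; ring. Qed.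

Lemma wallis_1 : wallis 1 = 1.
Proof. unfold wallis; simpl. rewrite cos_PI2, cos_0; ring. Qed.

Lemma wallis_SS (n : nat) : wallis (S (S n)) = INR (S n) / INR (S (S n)) * wallis n.
Proof.
  unfold wallis. rewrite !sin_pow_primitive_SS. rewrite cos_PI2, sin_0.
  assert (Hk := INR_S_pos (S n)). rewrite pow_ne_zero by lia. unfold Rdiv; ring.
Qed.

Lemma wallis_decr (n : nat) : wallis (S n) <= wallis n.
Proof.
  assert (P := PI_RGT_0). unfold wallis.
  destruct (MVT_gen (fun x => sin_pow_primitive n x - sin_pow_primitive (S n) x) 0 (PI / 2) (fun x => sin x ^ n - sin x ^ S n)) as [c [Hc E]].
  - intros; apply (is_derive_minus (K := R_AbsRing) (V := R_NormedModule)); apply is_derive_sin_pow.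
  - intros t _. apply continuity_pt_filterlim, (ex_derive_continuous (fun x => sin_pow_primitive n x - sin_pow_primitive (S n) x)).
    eexists; apply (is_derive_minus (K := R_AbsRing) (V := R_NormedModule)); apply is_derive_sin_pow.
  - rewrite Rmin_left, Rmax_right in Hc by lra.
    assert (0 <= sin c) by (apply sin_ge_0; lra). assert (S1 := SIN_bound c).
    assert (0 <= sin c ^ n) by (now apply pow_le). cbv beta in E. change (sin c ^ S n) with (sin c * sin c ^ n) in E.
    assert (0 <= (sin c ^ n - sin c * sin c ^ n) * (PI / 2 - 0)) by (apply Rmult_le_pos; nra). lra.
Qed.

Lemma wallis_even (n : nat) : wallis (2 * n) = PI / 2 * (poch (/ 2) n / INR (fact n)).
Proof.
  induction n as [|n IH]; [simpl (2 * 0)%nat; rewrite wallis_0; simpl; field |].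
  replace (2 * S n)%nat with (S (S (2 * n))) by lia.
  rewrite wallis_SS, IH, poch_S, fact_simpl, mult_INR.
  assert (H := INR_fact_neq_0 n). rewrite (S_INR (S (2 * n))), (S_INR (2 * n)), (S_INR n), mult_INR, INR_two.
  assert (Hn := pos_INR n). field. lra.
Qed.

Lemma wallis_odd (n : nat) : wallis (S (2 * n)) = INR (fact n) / (2 * poch (/ 2) (S n)).
Proof.
  induction n as [|n IH]; [simpl (S (2 * 0)); rewrite wallis_1; simpl; field |].
  replace (S (2 * S n)) with (S (S (S (2 * n)))) by lia.
  rewrite wallis_SS, IH, (poch_S _ (S n)), fact_simpl, mult_INR.
  assert (H := poch_pos (/ 2) (S n) ltac:(lra)). rewrite (S_INR (S (S (2 * n)))), (S_INR (S (2 * n))), (S_INR (2 * n)), (S_INR n), mult_INR, INR_two.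
  assert (Hn := pos_INR n). field. lra.
Qed.

(** Monotonicity of the Wallis integrals at 2n - 1, 2n and 2n + 1 encloses the square of the Gauss
    sequence between 1/pi and (1 + 1/(2n))^2 / pi. Positivity of the sequence selects the root. *)
Lemma rGamma_half : rGamma (/ 2) = / sqrt PI.
Proof.
  assert (P := PI_RGT_0).
  assert (E : forall n, (1 <= n)%nat -> / PI <= gauss_seq (/ 2) n * gauss_seq (/ 2) n <= / PI * ((1 + / 2 * / INR n) * (1 + / 2 * / INR n))).
  { intros n Hn. assert (Hn0 : 0 < INR n) by (apply lt_0_INR; lia).
    assert (HP := poch_pos (/ 2) n ltac:(lra)). assert (HF := INR_fact_lt_0 n).
    assert (W1 := wallis_decr (2 * n)).
    assert (W2 : wallis (2 * n) <= (1 + / 2 * / INR n) * wallis (S (2 * n))).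
    { destruct n as [|n]; [lia |]. replace (2 * S n)%nat with (S (S (2 * n))) in * by lia.
      eapply Rle_trans; [apply wallis_decr |]. rewrite (wallis_SS (S (2 * n))).
      right. rewrite (S_INR (S (S (2 * n)))), (S_INR (S (2 * n))), (S_INR (2 * n)), (S_INR n), mult_INR, INR_two.
      rewrite S_INR in Hn0. field. lra. }
    rewrite wallis_even, wallis_odd, poch_S in W1, W2.
    assert (G : gauss_seq (/ 2) n * gauss_seq (/ 2) n = (poch (/ 2) n / INR (fact n)) ^ 2 * (/ 2 + INR n) ^ 2 / INR n).
    { unfold gauss_seq. rewrite poch_S.
      assert (R2 : Rpower (INR n) (/ 2) * Rpower (INR n) (/ 2) = INR n).
      { rewrite <- Rpower_plus. replace (/ 2 + / 2) with 1 by field. now apply Rpower_1. }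
      assert (0 < Rpower (INR n) (/ 2)) by apply exp_pos.
      transitivity ((poch (/ 2) n / INR (fact n)) ^ 2 * (/ 2 + INR n) ^ 2 / (Rpower (INR n) (/ 2) * Rpower (INR n) (/ 2))); [field; lra | now rewrite R2]. }
    rewrite G. set (q := poch (/ 2) n / INR (fact n)) in *.
    assert (Hq : 0 < q) by (now apply Rdiv_lt_0_compat).
    assert (Q1 : INR (fact n) / (2 * (poch (/ 2) n * (/ 2 + INR n))) = / (2 * q * (/ 2 + INR n))) by (unfold q; field; lra).
    rewrite Q1 in W1, W2. set (k := INR n) in *.
    assert (Hk : 0 < / 2 + k) by lra.
    assert (A1 : 1 <= PI * q ^ 2 * (/ 2 + k)).
    { apply (Rmult_le_compat_r (2 * q * (/ 2 + k))) in W1; [| nra]. rewrite Rinv_l in W1 by nra. lra. }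
    assert (A2 : PI * q ^ 2 * (/ 2 + k) <= 1 + / 2 * / k).
    { apply (Rmult_le_compat_r (2 * q * (/ 2 + k))) in W2; [| nra]. rewrite (Rmult_assoc (1 + / 2 * / k)), Rinv_l in W2 by nra. lra. }
    assert (EE : q ^ 2 * (/ 2 + k) ^ 2 / k = / PI * (PI * q ^ 2 * (/ 2 + k)) * (1 + / 2 * / k)) by (field; lra).
    rewrite EE. assert (0 < / PI) by (now apply Rinv_0_lt_compat). assert (0 < / k) by (now apply Rinv_0_lt_compat).
    split.
    - rewrite Rmult_assoc. rewrite <- (Rmult_1_r (/ PI)) at 1. apply Rmult_le_compat_l; [lra |]. nra.
    - rewrite Rmult_assoc. apply Rmult_le_compat_l; [lra |]. apply Rmult_le_compat_r; lra. }
  assert (L := rGamma_is_lim (/ 2)).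
  assert (L2 : is_lim_seq (fun n => gauss_seq (/ 2) n * gauss_seq (/ 2) n) (rGamma (/ 2) * rGamma (/ 2))) by (apply is_lim_seq_mult'; auto).
  assert (L3 : is_lim_seq (fun n => gauss_seq (/ 2) n * gauss_seq (/ 2) n) (/ PI)).
  { apply (is_lim_seq_le_le_loc (fun _ => / PI) _ (fun n => / PI * ((1 + / 2 * / INR n) * (1 + / 2 * / INR n)))).
    - exists 1%nat; auto.
    - apply is_lim_seq_const.
    - replace (Finite (/ PI)) with (Rbar_mult (/ PI) (Finite (1 * 1))) by (simpl; f_equal; ring).
      apply is_lim_seq_scal_l, is_lim_seq_mult'; apply is_lim_seq_one_plus. }
  assert (EQ : rGamma (/ 2) * rGamma (/ 2) = / PI).
  { assert (U2 := is_lim_seq_unique _ _ L2). rewrite (is_lim_seq_unique _ _ L3) in U2. now injection U2. }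
  assert (NN : 0 <= rGamma (/ 2)).
  { apply (is_lim_seq_le (fun _ => 0) (gauss_seq (/ 2)) 0 (rGamma (/ 2))); auto; [| apply is_lim_seq_const].
    intros n. unfold gauss_seq. apply Rlt_le, Rdiv_lt_0_compat; [apply poch_pos; lra |].
    apply Rmult_lt_0_compat; [apply INR_fact_lt_0 | apply exp_pos]. }
  rewrite <- sqrt_inv, <- EQ. symmetry. now apply sqrt_square.
Qed.

Lemma Gamma_half : Gamma (/ 2) = sqrt PI.
Proof. unfold Gamma. rewrite rGamma_half. apply Rinv_inv. Qed.

(** * The algebraic main term *)

Lemma half_int_neq (p z : Z) : IZR p + / 2 <> IZR z.
Proof.
  intro E. assert (H : IZR (2 * p + 1) = IZR (2 * z)).
  { rewrite plus_IZR, !mult_IZR, <- E. field. }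
  apply eq_IZR in H. lia.
Qed.

(** Half-integers are never poles, so the recurrence holds for every integer p and the index can be
    shifted freely in both directions. *)
Definition half_gamma (p : Z) : R := Gamma (IZR p + / 2).

Lemma half_gamma_rec (p : Z) : half_gamma (p + 1) = (IZR p + / 2) * half_gamma p.
Proof.
  unfold half_gamma. rewrite plus_IZR.
  replace (IZR p + 1 + / 2) with (IZR p + / 2 + 1) by ring.
  apply Gamma_rec. intros z; apply half_int_neq.
Qed.

Lemma half_gamma_0 : half_gamma 0 = sqrt PI.
Proof. unfold half_gamma. rewrite Rplus_0_l. apply Gamma_half. Qed.

Lemma half_gamma_up (p : Z) (n : nat) :
  half_gamma (p + Z.of_nat n) = poch (IZR p + / 2) n * half_gamma p.
Proof.
  induction n as [|n IH]; [simpl; rewrite Z.add_0_r; ring |].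
  replace (p + Z.of_nat (S n))%Z with (p + Z.of_nat n + 1)%Z by lia.
  rewrite half_gamma_rec, IH, poch_S, plus_IZR, <- INR_IZR_INZ; ring.
Qed.

Lemma half_gamma_down (p : Z) (n : nat) :
  (-1) ^ n * poch (/ 2 - IZR p) n * half_gamma (p - Z.of_nat n) = half_gamma p.
Proof.
  induction n as [|n IH]; [simpl; rewrite Z.sub_0_r; ring |].
  rewrite <- IH. assert (E := half_gamma_rec (p - Z.of_nat (S n))).
  replace (p - Z.of_nat (S n) + 1)%Z with (p - Z.of_nat n)%Z in E by lia.
  rewrite E, poch_S, minus_IZR, <- INR_IZR_INZ, S_INR; simpl; field.
Qed.

Lemma poch_half_neq_0 (p : Z) (n : nat) : poch (IZR p + / 2) n <> 0.
Proof.
  induction n as [|n IH]; [simpl; lra |]. rewrite poch_S.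
  apply Rmult_integral_contrapositive; split; auto.
  rewrite INR_IZR_INZ. replace (IZR p + / 2 + IZR (Z.of_nat n)) with (IZR (p + Z.of_nat n) + / 2) by (rewrite plus_IZR; ring).
  apply (half_int_neq _ 0).
Qed.

Lemma half_int_abs (p : Z) : / 2 <= Rabs (IZR p + / 2).
Proof.
  destruct (Z_le_gt_dec 0 p).
  - assert (0 <= IZR p) by (apply IZR_le; lia). rewrite Rabs_pos_eq; lra.
  - assert (IZR p <= -1) by (apply IZR_le; lia). rewrite Rabs_left; lra.
Qed.

(** A half-integer has absolute value at least 1/2, so each quotient of consecutive factors is at
    most 2 |x - (p + 1/2)| + 1. The 1/n! of the Kummer coefficients then gives infinite radius of
    convergence. *)
Lemma poch_ratio_bound (x : R) (p : Z) :
  exists A, 0 <= A /\ forall n, Rabs (poch x n / poch (IZR p + / 2) n) <= A ^ n.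
Proof.
  set (A := 2 * Rabs (x - (IZR p + / 2)) + 1). exists A.
  assert (HA := Rabs_pos (x - (IZR p + / 2))). split; [unfold A; lra |].
  induction n as [|n IH]; [simpl; replace (1 / 1) with 1 by field; rewrite Rabs_R1; lra |].
  rewrite !poch_S. assert (H := poch_half_neq_0 p n). assert (H2 := poch_half_neq_0 p (S n)). rewrite poch_S in H2.
  assert (Hn : IZR p + / 2 + INR n <> 0) by (intro E; apply H2; rewrite E; ring).
  replace (poch x n * (x + INR n) / (poch (IZR p + / 2) n * (IZR p + / 2 + INR n)))
    with ((x + INR n) / (IZR p + / 2 + INR n) * (poch x n / poch (IZR p + / 2) n))
    by (clear - H Hn; set (h := IZR p + / 2) in *; clearbody h; field; auto).
  rewrite Rabs_mult. simpl. apply Rmult_le_compat; auto; try apply Rabs_pos.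
  assert (HB := half_int_abs (p + Z.of_nat n)). rewrite plus_IZR, <- INR_IZR_INZ in HB.
  replace (IZR p + INR n + / 2) with (IZR p + / 2 + INR n) in HB by ring.
  set (d := IZR p + / 2 + INR n) in *.
  unfold Rdiv; rewrite Rabs_mult, Rabs_inv.
  apply (Rmult_le_reg_r (Rabs d)); [lra |]. rewrite Rmult_assoc, Rinv_l, Rmult_1_r by lra.
  replace (x + INR n) with ((x - (IZR p + / 2)) + d) by (unfold d; ring).
  eapply Rle_trans; [apply Rabs_triang |]. unfold A. nra.
Qed.

Lemma CV_radius_infinite (a : nat -> R) (K A : R) :
  0 <= A -> (forall n, Rabs (a n) <= K * (A ^ n / INR (fact n))) -> CV_radius a = p_infty.
Proof.
  intros HA H.
  assert (S0 : forall x, ex_series (fun n => Rabs (a n * x ^ n))).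
  { intros x. apply (ex_series_Rle _ (fun n => K * ((A * Rabs x) ^ n / INR (fact n)))).
    - intros n. rewrite Rabs_Rabsolu, Rabs_mult, <- RPow_abs, Rpow_mult_distr.
      replace (K * (A ^ n * Rabs x ^ n / INR (fact n))) with (K * (A ^ n / INR (fact n)) * Rabs x ^ n) by (field; apply INR_fact_neq_0).
      apply Rmult_le_compat_r; [apply pow_le, Rabs_pos | auto].
    - apply ex_series_scal_Rl, ex_series_exp. }
  assert (Out := CV_disk_outside a). assert (Nn := CV_radius_ge_0 a).
  destruct (CV_radius a) as [r | |] eqn:E; [| reflexivity | simpl in Nn; contradiction].
  exfalso. simpl in Nn. apply (Out (r + 1)).
  - simpl. rewrite Rabs_pos_eq; lra.
  - apply is_lim_seq_abs_0. apply ex_series_lim_0, S0.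
Qed.

(* Coefficients of the two Frobenius solutions at lambda = 0 whose sum is twice [calH1]. *)
Definition main_coef1 (m : nat) (p : Z) (n : nat) : R :=
  rGamma (INR m) * ((-1) ^ n * (half_gamma (p + Z.of_nat n) * half_gamma (Z.of_nat m - p - 1 - Z.of_nat n)) / INR (fact n)).

Definition main_coef2 (m : nat) (p : Z) (n : nat) : R :=
  (-1) ^ n * half_gamma (p - Z.of_nat m - Z.of_nat n) * poch (INR m) n / INR (fact n).

Definition main_term (m : nat) (p : Z) (lambda : R) : R :=
  / 2 * (PSeries (main_coef1 m p) lambda
         + Rpower lambda (INR m - IZR p - / 2) * PSeries (main_coef2 m p) lambda).

Lemma half_gamma_down_eq (p : Z) (n : nat) :
  half_gamma (p - Z.of_nat n) = (-1) ^ n * half_gamma p / poch (IZR (- p) + / 2) n.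
Proof.
  assert (E := half_gamma_down p n). assert (N := poch_half_neq_0 (- p) n).
  rewrite opp_IZR in *. replace (/ 2 - IZR p) with (- IZR p + / 2) in E by ring.
  assert (S1 : (-1) ^ n * (-1) ^ n = 1) by (rewrite <- Rpow_mult_distr; replace (-1 * -1) with 1 by ring; apply pow1).
  rewrite <- E.
  replace ((-1) ^ n * ((-1) ^ n * poch (- IZR p + / 2) n * half_gamma (p - Z.of_nat n)))
    with (((-1) ^ n * (-1) ^ n) * (poch (- IZR p + / 2) n * half_gamma (p - Z.of_nat n))) by ring.
  rewrite S1. field; auto.
Qed.

Lemma main_coef1_eq (m : nat) (p : Z) (n : nat) :
  main_coef1 m p n = rGamma (INR m) * half_gamma p * half_gamma (Z.of_nat m - p - 1)
    * (poch (IZR p + / 2) n / (poch (IZR (p + 1 - Z.of_nat m) + / 2) n * INR (fact n))).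
Proof.
  unfold main_coef1. rewrite half_gamma_up, (half_gamma_down_eq (Z.of_nat m - p - 1)).
  replace (- (Z.of_nat m - p - 1))%Z with (p + 1 - Z.of_nat m)%Z by lia.
  assert (N := poch_half_neq_0 (p + 1 - Z.of_nat m) n). assert (F := INR_fact_neq_0 n).
  assert (S1 : (-1) ^ n * (-1) ^ n = 1) by (rewrite <- Rpow_mult_distr; replace (-1 * -1) with 1 by ring; apply pow1).
  transitivity (((-1) ^ n * (-1) ^ n) * (rGamma (INR m) * half_gamma p * half_gamma (Z.of_nat m - p - 1)
    * (poch (IZR p + / 2) n / (poch (IZR (p + 1 - Z.of_nat m) + / 2) n * INR (fact n))))); [field; auto | rewrite S1; ring].
Qed.

Lemma main_coef2_eq (m : nat) (p : Z) (n : nat) :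
  main_coef2 m p n = half_gamma (p - Z.of_nat m)
    * (poch (INR m) n / (poch (IZR (Z.of_nat m - p) + / 2) n * INR (fact n))).
Proof.
  unfold main_coef2. rewrite half_gamma_down_eq.
  replace (- (p - Z.of_nat m))%Z with (Z.of_nat m - p)%Z by lia.
  assert (N := poch_half_neq_0 (Z.of_nat m - p) n). assert (F := INR_fact_neq_0 n).
  assert (S1 : (-1) ^ n * (-1) ^ n = 1) by (rewrite <- Rpow_mult_distr; replace (-1 * -1) with 1 by ring; apply pow1).
  transitivity (((-1) ^ n * (-1) ^ n) * (half_gamma (p - Z.of_nat m)
    * (poch (INR m) n / (poch (IZR (Z.of_nat m - p) + / 2) n * INR (fact n))))); [field; auto | rewrite S1; ring].
Qed.

Lemma CV_radius_kummer (c x : R) (q : Z) :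
  CV_radius (fun n => c * (poch x n / (poch (IZR q + / 2) n * INR (fact n)))) = p_infty.
Proof.
  destruct (poch_ratio_bound x q) as [A [HA H]].
  apply (CV_radius_infinite _ (Rabs c) A HA). intros n.
  assert (F := INR_fact_lt_0 n). assert (N := poch_half_neq_0 q n).
  replace (c * (poch x n / (poch (IZR q + / 2) n * INR (fact n)))) with
    (c * (poch x n / poch (IZR q + / 2) n * / INR (fact n))) by (field; split; [lra | auto]).
  rewrite !Rabs_mult, Rabs_inv, (Rabs_pos_eq (INR _)) by lra.
  apply Rmult_le_compat_l; [apply Rabs_pos |].
  unfold Rdiv at 2; apply Rmult_le_compat_r; [apply Rlt_le, Rinv_0_lt_compat; lra | auto].
Qed.

Lemma CV_main_coef1 (m : nat) (p : Z) : CV_radius (main_coef1 m p) = p_infty.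
Proof. rewrite (CV_radius_ext _ _ (main_coef1_eq m p)). apply CV_radius_kummer. Qed.

Lemma CV_main_coef2 (m : nat) (p : Z) : CV_radius (main_coef2 m p) = p_infty.
Proof. rewrite (CV_radius_ext _ _ (main_coef2_eq m p)). apply CV_radius_kummer. Qed.

Lemma frac_part_half (p : Z) : frac_part (IZR p + / 2) <> 0.
Proof.
  unfold frac_part. intro E. apply (half_int_neq p (Int_part (IZR p + / 2))). lra.
Qed.

Lemma PSeries_Rscal (c : R) (a : nat -> R) (x : R) : PSeries (fun n => c * a n) x = c * PSeries a x.
Proof.
  unfold PSeries. rewrite <- Series_scal_l. apply Series_ext; intros n; ring.
Qed.

(** The two Kummer series are the Frobenius solutions with exponents 0 and m - p - 1/2. The
    prefactor Gamma(p + 1/2) cancels the reciprocal Gamma value in the second and multiplies the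
    first. *)
Lemma calH1_main_term (m : nat) (p : Z) (lambda : R) :
  calH1 (INR m) (2 * IZR p) lambda = main_term m p lambda.
Proof.
  unfold calH1, main_term.
  replace ((1 + 2 * IZR p) / 2) with (IZR p + / 2) by field.
  assert (Eb : 1 + (IZR p + / 2) - INR m = IZR (p + 1 - Z.of_nat m) + / 2).
  { rewrite minus_IZR, plus_IZR, INR_IZR_INZ; ring. }
  (* The second parameter is a half-integer, so the general formula applies directly and no limit in
     the parameter is involved. *)
  rewrite Eb. unfold TricomiU. destruct (Req_EM_T _ 0) as [E | _]; [exfalso; now apply (frac_part_half (p + 1 - Z.of_nat m)) |].
  unfold TricomiU_gen, KummerM.
  assert (N : rGamma (IZR p + / 2) <> 0) by (apply rGamma_nonint_neq_0; intros z; apply half_int_neq).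
  rewrite (PSeries_ext _ _ lambda (main_coef1_eq m p)), (PSeries_ext _ _ lambda (main_coef2_eq m p)).
  replace (IZR p + / 2 - (IZR (p + 1 - Z.of_nat m) + / 2) + 1) with (INR m)
    by (rewrite minus_IZR, plus_IZR, INR_IZR_INZ; ring).
  replace (1 - (IZR (p + 1 - Z.of_nat m) + / 2)) with (INR m - IZR p - / 2)
    by (rewrite minus_IZR, plus_IZR, INR_IZR_INZ; ring).
  replace (2 - (IZR (p + 1 - Z.of_nat m) + / 2)) with (IZR (Z.of_nat m - p) + / 2)
    by (rewrite !minus_IZR, plus_IZR; field).
  change (Gamma (IZR p + / 2)) with (half_gamma p).
  replace (Gamma (INR m - IZR p - / 2)) with (half_gamma (Z.of_nat m - p - 1))
    by (unfold half_gamma; f_equal; rewrite !minus_IZR, INR_IZR_INZ; field).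
  replace (Gamma (IZR (p + 1 - Z.of_nat m) + / 2 - 1)) with (half_gamma (p - Z.of_nat m))
    by (unfold half_gamma; f_equal; rewrite !minus_IZR, plus_IZR; field).
  set (a1 := fun n => poch (IZR p + / 2) n / (poch (IZR (p + 1 - Z.of_nat m) + / 2) n * INR (fact n))).
  set (a2 := fun n => poch (INR m) n / (poch (IZR (Z.of_nat m - p) + / 2) n * INR (fact n))).
  rewrite (PSeries_Rscal _ a1), (PSeries_Rscal _ a2).
  assert (G : half_gamma p * rGamma (IZR p + / 2) = 1) by (unfold half_gamma, Gamma; now apply Rinv_l).
  set (X := PSeries a1 lambda). set (Y := PSeries a2 lambda).
  transitivity (/ 2 * (rGamma (INR m) * half_gamma p * half_gamma (Z.of_nat m - p - 1) * X +
     (half_gamma p * rGamma (IZR p + / 2)) * (Rpower lambda (INR m - IZR p - / 2) * (half_gamma (p - Z.of_nat m) * Y)))); [ring | rewrite G; ring].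
Qed.

Lemma ex_pseries_infinite (a : nat -> R) (x : R) : CV_radius a = p_infty -> ex_pseries a x.
Proof. intros H. apply CV_radius_inside. rewrite H. exact I. Qed.

Lemma rGamma_INR_rec (m : nat) : rGamma (INR m) = INR m * rGamma (INR (S m)).
Proof. rewrite S_INR. apply rGamma_rec. Qed.

(** A contiguous relation, checked coefficient by coefficient. Of the two summands on the right the
    second has a power of lambda higher by one, which shifts its second series by one index. *)
Lemma main_term_rec (m : nat) (p : Z) (lambda : R) :
  0 < lambda -> main_term m p lambda = main_term (S m) (p + 1) lambda + main_term (S m) p lambda.
Proof.
  intros Hl. unfold main_term.
  replace (INR (S m) - IZR (p + 1) - / 2) with (INR m - IZR p - / 2) by (rewrite S_INR, plus_IZR; ring).
  replace (INR (S m) - IZR p - / 2) with (INR m - IZR p - / 2 + 1) by (rewrite S_INR; ring).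
  rewrite Rpower_plus, Rpower_1 by auto.
  assert (E1 : PSeries (main_coef1 m p) lambda = PSeries (main_coef1 (S m) (p + 1)) lambda + PSeries (main_coef1 (S m) p) lambda).
  { rewrite <- PSeries_plus by (apply ex_pseries_infinite, CV_main_coef1).
    apply PSeries_ext. intros n. unfold PS_plus, main_coef1. change plus with Rplus.
    replace (Z.of_nat (S m) - (p + 1) - 1 - Z.of_nat n)%Z with (Z.of_nat m - p - 1 - Z.of_nat n)%Z by lia.
    replace (Z.of_nat (S m) - p - 1 - Z.of_nat n)%Z with (Z.of_nat m - p - 1 - Z.of_nat n + 1)%Z by lia.
    replace (p + 1 + Z.of_nat n)%Z with (p + Z.of_nat n + 1)%Z by lia.
    rewrite !half_gamma_rec, rGamma_INR_rec, !minus_IZR, plus_IZR, <- !INR_IZR_INZ.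
    assert (F := INR_fact_neq_0 n). field; auto. }
  assert (E2 : PSeries (main_coef2 m p) lambda = PSeries (main_coef2 (S m) (p + 1)) lambda + lambda * PSeries (main_coef2 (S m) p) lambda).
  { rewrite <- PSeries_incr_1, <- PSeries_plus.
    2:{ apply ex_pseries_infinite, CV_main_coef2. }
    2:{ apply ex_pseries_incr_1, ex_pseries_infinite, CV_main_coef2. }
    apply PSeries_ext. intros n. unfold PS_plus, PS_incr_1, main_coef2. change plus with Rplus.
    destruct n as [|n].
    - replace (p + 1 - Z.of_nat (S m) - Z.of_nat 0)%Z with (p - Z.of_nat m - Z.of_nat 0)%Z by lia.
      change zero with 0. simpl; field.
    - replace (p + 1 - Z.of_nat (S m) - Z.of_nat (S n))%Z with (p - Z.of_nat (S m) - Z.of_nat n)%Z by lia.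
      replace (p - Z.of_nat m - Z.of_nat (S n))%Z with (p - Z.of_nat (S m) - Z.of_nat n)%Z by lia.
      rewrite (poch_S (INR (S m)) n), poch_shift, <- S_INR, fact_simpl, mult_INR.
      assert (F := INR_fact_neq_0 n). assert (F2 := INR_S_pos n). simpl pow. rewrite !S_INR in *. field; split; auto; lra. }
  rewrite E1, E2; ring.
Qed.

Lemma is_derive_Rpower (x e : R) : 0 < x -> is_derive (fun x => Rpower x e) x (e * Rpower x (e - 1)).
Proof. intros Hx. apply is_derive_Reals, derivable_pt_lim_power; auto. Qed.

Lemma PSeries_minus1 (a : nat -> R) (x : R) : PSeries (fun n => - a n) x = - PSeries a x.
Proof.
  rewrite (PSeries_ext _ (fun n => -1 * a n)) by (intros; ring). rewrite PSeries_Rscal; ring.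
Qed.

Lemma main_term_derive (m : nat) (p : Z) (lambda : R) :
  0 < lambda -> is_derive (main_term m p) lambda (- main_term m (p + 1) lambda).
Proof.
  intros Hl. unfold main_term.
  set (e := INR m - IZR p - / 2).
  assert (D1 : is_derive (PSeries (main_coef1 m p)) lambda (- PSeries (main_coef1 m (p + 1)) lambda)).
  { eapply is_derive_eq; [apply is_derive_PSeries; rewrite CV_main_coef1; exact I |].
    rewrite <- PSeries_minus1. apply PSeries_ext. intros n. unfold PS_derive, main_coef1.
    replace (p + Z.of_nat (S n))%Z with (p + 1 + Z.of_nat n)%Z by lia.
    replace (Z.of_nat m - p - 1 - Z.of_nat (S n))%Z with (Z.of_nat m - (p + 1) - 1 - Z.of_nat n)%Z by lia.
    rewrite fact_simpl, mult_INR. assert (F := INR_fact_neq_0 n). assert (F2 := INR_S_pos n). simpl pow. field; lra. }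
  assert (CP : CV_radius (PS_derive (main_coef2 m p)) = p_infty) by (rewrite CV_radius_derive; apply CV_main_coef2).
  assert (D2 := is_derive_Rmult _ _ _ _ _ (is_derive_Rpower lambda e Hl)
     (is_derive_PSeries (main_coef2 m p) lambda ltac:(rewrite CV_main_coef2; exact I))).
  eapply is_derive_eq.
  - apply is_derive_scal. apply (is_derive_plus (K := R_AbsRing) (V := R_NormedModule)); [exact D1 | exact D2].
  - change plus with Rplus.
    replace (INR m - IZR (p + 1) - / 2) with (e - 1) by (unfold e; rewrite plus_IZR; ring).
    (* Differentiating lambda^e times a power series multiplies the n-th coefficient by e + n, which
       is the factor in [half_gamma_rec]. *)
    assert (E : e * PSeries (main_coef2 m p) lambda + lambda * PSeries (PS_derive (main_coef2 m p)) lambda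
       = - PSeries (main_coef2 m (p + 1)) lambda).
    { rewrite <- PSeries_incr_1, <- PSeries_Rscal, <- PSeries_plus, <- PSeries_minus1.
      2:{ apply (ex_pseries_scal (K := R_AbsRing) (V := R_NormedModule) e); [apply Rmult_comm | apply ex_pseries_infinite, CV_main_coef2]. }
      2:{ apply ex_pseries_incr_1, ex_pseries_infinite, CP. }
      apply PSeries_ext. intros n. unfold PS_plus, PS_incr_1, PS_scal, PS_derive, main_coef2.
      change plus with Rplus. change scal with Rmult. change zero with 0.
      replace (p + 1 - Z.of_nat m - Z.of_nat n)%Z with (p - Z.of_nat m - Z.of_nat n + 1)%Z by lia.
      rewrite half_gamma_rec, !minus_IZR, <- !INR_IZR_INZ. unfold e.
      destruct n as [|n]; [simpl; field |].
      rewrite fact_simpl, mult_INR. assert (F := INR_fact_neq_0 n). assert (F2 := INR_S_pos n).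
      field. split; auto; lra. }
    replace (Rpower lambda e) with (Rpower lambda (e - 1) * lambda).
    2:{ rewrite <- (Rpower_1 lambda) at 2 by auto. rewrite <- Rpower_plus; f_equal; ring. }
    transitivity (/ 2 * (- PSeries (main_coef1 m (p + 1)) lambda + Rpower lambda (e - 1) *
      (e * PSeries (main_coef2 m p) lambda + lambda * PSeries (PS_derive (main_coef2 m p)) lambda))); [ring | rewrite E; ring].
Qed.

Lemma PSeries_lim_right (a : nat -> R) :
  CV_radius a = p_infty -> filterlim (PSeries a) (at_right 0) (locally (a 0%nat)).
Proof.
  intros H. assert (C := PSeries_continuity a 0). rewrite Rabs_R0, H in C. specialize (C I).
  apply continuity_pt_filterlim in C. rewrite PSeries_0 in C.
  intros P HP. destruct (C P HP) as [eps He]. exists eps. intros y Hy _. now apply He.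
Qed.

Lemma at_right_pos (P : R -> Prop) : (forall x, 0 < x -> P x) -> at_right 0 P.
Proof. intros H. exists (mkposreal 1 Rlt_0_1). intros y _ Hy. now apply H. Qed.

Lemma Rpower_lim_right (e : R) : 0 < e -> filterlim (fun x => Rpower x e) (at_right 0) (locally 0).
Proof.
  intros He. apply (filterlim_locally (U := R_UniformSpace)). intros eps.
  assert (Hd := exp_pos (ln eps / e)).
  exists (mkposreal _ Hd). intros y Hy Hy0.
  change (Rabs (y - 0) < exp (ln eps / e)) in Hy. rewrite Rminus_0_r, Rabs_pos_eq in Hy by lra.
  change (Rabs (Rpower y e - 0) < eps). rewrite Rminus_0_r, Rabs_pos_eq by (apply Rlt_le, exp_pos).
  rewrite <- (exp_ln eps) by apply cond_pos. unfold Rpower. apply exp_increasing.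
  assert (L : ln y < ln eps / e) by (rewrite <- (ln_exp (ln eps / e)); apply ln_increasing; auto).
  apply (Rmult_lt_compat_l e) in L; auto. replace (e * (ln eps / e)) with (ln eps) in L by (field; lra). auto.
Qed.

(** A positive exponent kills the second Frobenius solution at 0 and leaves the constant term of the
    first. *)
Lemma main_term_lim (m : nat) (p : Z) :
  0 < INR m - IZR p - / 2 ->
  filterlim (main_term m p) (at_right 0) (locally (/ 2 * main_coef1 m p 0)).
Proof.
  intros He. unfold main_term.
  replace (/ 2 * main_coef1 m p 0) with (/ 2 * (main_coef1 m p 0 + 0 * main_coef2 m p 0)) by ring.
  apply (filterlim_Rmult (at_right 0) (fun _ => / 2)); [apply filterlim_const |].
  apply (filterlim_Rplus (at_right 0)); [apply PSeries_lim_right, CV_main_coef1 |].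
  apply (filterlim_Rmult (at_right 0)); [now apply Rpower_lim_right | apply PSeries_lim_right, CV_main_coef2].
Qed.

Lemma main_term_0_0 (lambda : R) : main_term 0 0 lambda = / 2 * sqrt PI * Rpower lambda (- / 2).
Proof.
  unfold main_term.
  assert (E1 : PSeries (main_coef1 0 0) lambda = 0).
  { rewrite (PSeries_ext _ (fun _ => 0)); [apply PSeries_const_0 |].
    intros n. unfold main_coef1. simpl (INR 0). rewrite rGamma_0; ring. }
  assert (E2 : PSeries (main_coef2 0 0) lambda = sqrt PI).
  { rewrite PSeries_decr_1 by (apply ex_pseries_infinite, CV_main_coef2).
    rewrite (PSeries_ext _ (fun _ => 0)), PSeries_const_0.
    - unfold main_coef2. simpl. rewrite half_gamma_0. field.
    - intros n. unfold PS_decr_1, main_coef2. simpl (INR 0). rewrite poch_shift. unfold Rdiv; ring. }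
  rewrite E1, E2. simpl (INR 0). replace (0 - 0 - / 2) with (- / 2) by ring. ring.
Qed.

(** * The zeta-function term *)

Ltac rring := cbv beta; match goal with |- @eq _ ?x ?y => change (@eq R x y) end; ring.
Ltac rtype := cbv beta; match goal with |- @eq _ ?x ?y => change (@eq R x y) end.

(** * Pochhammer symbols and terminating Tricomi functions *)

Lemma poch_add (x : R) (n k : nat) : poch x (n + k) = poch x n * poch (x + INR n) k.
Proof.
  induction k as [|k IH]; [rewrite Nat.add_0_r; simpl; ring |].
  rewrite Nat.add_succ_r, !poch_S, IH, plus_INR; ring.
Qed.

Lemma poch_reflect (x : R) (j : nat) : poch (1 - x - INR j) j = (-1) ^ j * poch x j.
Proof.
  induction j as [|j IH]; [simpl; ring |].
  rewrite poch_shift, poch_S, S_INR.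
  replace (1 - x - (INR j + 1) + 1) with (1 - x - INR j) by ring. rewrite IH. simpl; ring.
Qed.

Lemma poch_neg (j i : nat) : (i <= j)%nat -> poch (- INR j) i = (-1) ^ i * INR (fact j) / INR (fact (j - i)).
Proof.
  intros H; induction i as [|i IH].
  - rewrite Nat.sub_0_r. simpl. field. apply INR_fact_neq_0.
  - rewrite poch_S, IH by lia. replace (j - i)%nat with (S (j - S i)) by lia.
    rewrite fact_simpl, mult_INR.
    replace (INR (S (j - S i))) with (INR j - INR i) by (rewrite <- minus_INR by lia; f_equal; lia).
    assert (F := INR_fact_neq_0 (j - S i)).
    assert (INR j - INR i <> 0) by (rewrite <- minus_INR by lia; apply not_0_INR; lia).
    simpl. field; auto.
Qed.

Lemma poch_neg_0 (j i : nat) : (j < i)%nat -> poch (- INR j) i = 0.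
Proof.
  intros H. replace i with (S j + (i - S j))%nat by lia. rewrite poch_add, poch_S. ring.
Qed.

Lemma poch_0_S (n : nat) : poch 0 (S n) = 0.
Proof. rewrite poch_shift; ring. Qed.

Lemma PSeries_finite (a : nat -> R) (N : nat) (x : R) :
  (forall n, (N < n)%nat -> a n = 0) -> PSeries a x = sum_n (fun n => a n * x ^ n) N.
Proof.
  intros H. unfold PSeries.
  assert (S0 : is_series (fun n => a n * x ^ n) (sum_n (fun n => a n * x ^ n) N)).
  { assert (E : forall M, sum_n (fun n => a n * x ^ n) (N + M) = sum_n (fun n => a n * x ^ n) N).
    { induction M as [|M IH]; [now rewrite Nat.add_0_r |]. rewrite Nat.add_succ_r, sum_n_RS, IH, H by lia. rring. }
    apply (is_lim_seq_ext_loc (fun _ => sum_n (fun n => a n * x ^ n) N) _ (Finite _)).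
    - exists N. intros n Hn. rewrite <- (E (n - N)%nat). f_equal; lia.
    - apply is_lim_seq_const. }
  now apply is_series_unique.
Qed.

Lemma rGamma_poch (x : R) (j : nat) : rGamma x = poch x j * rGamma (x + INR j).
Proof.
  induction j as [|j IH]; [simpl; rewrite Rplus_0_r; ring |].
  rewrite IH, poch_S, (rGamma_rec (x + INR j)), S_INR. rewrite <- Rplus_assoc. ring.
Qed.

(* Coefficient of y^j in exp(- lambda y) (1 + y)^(-m). *)
Definition taylor_coef (m j : nat) (lambda : R) : R :=
  (-1) ^ j * sum_n (fun i => lambda ^ i / INR (fact i) * (poch (INR m) (j - i) / INR (fact (j - i)))) j.

(** For a = -j the reciprocal Gamma value removes the second solution and the first series
    terminates. The Gamma quotient in front equals (-1)^j (b)_j; dividing it by (b)_n leaves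
    (b+n)_(j-n). The result is a polynomial in b, which is what allows integer b to be reached. *)
Lemma TricomiU_gen_poly (j : nat) (b lambda : R) :
  (forall z : Z, b <> IZR z) ->
  TricomiU_gen (- INR j) b lambda =
  sum_n (fun n => (-1) ^ j * poch (- INR j) n / INR (fact n) * lambda ^ n * poch (b + INR n) (j - n)) j.
Proof.
  intros Hb. unfold TricomiU_gen. rewrite rGamma_nonpos.
  replace (- INR j - b + 1) with (1 - b - INR j) by ring.
  rewrite (rGamma_poch _ j). replace (1 - b - INR j + INR j) with (1 - b) by ring.
  rewrite poch_reflect.
  assert (N : rGamma (1 - b) <> 0).
  { apply rGamma_nonint_neq_0. intros z E. apply (Hb (1 - z)%Z). rewrite minus_IZR; lra. }
  assert (Pn : forall n, poch b n <> 0).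
  { induction n as [|n IH]; [simpl; lra |]. rewrite poch_S. apply Rmult_integral_contrapositive; split; auto.
    intro E. apply (Hb (- Z.of_nat n)%Z). rewrite opp_IZR, <- INR_IZR_INZ; lra. }
  unfold KummerM. rewrite (PSeries_finite _ j).
  2:{ intros n Hn. rewrite poch_neg_0 by auto. unfold Rdiv; ring. }
  unfold Gamma.
  match goal with |- ?x + ?y = _ => replace y with 0 by ring end. rewrite Rplus_0_r.
  replace (/ rGamma (1 - b) * ((-1) ^ j * poch b j * rGamma (1 - b))) with ((-1) ^ j * poch b j) by (field; auto).
  rewrite <- (sum_n_mult_l (K := R_Ring)).
  apply sum_n_ext_loc. intros n Hn. change mult with Rmult. rtype.
  replace j with (n + (j - n))%nat at 2 by lia. rewrite poch_add.
  assert (F := INR_fact_neq_0 n). specialize (Pn n). field; auto.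
Qed.

Lemma continuous_poch (c : R) (k : nat) (x : R) : continuity_pt (fun b => poch (b + c) k) x.
Proof.
  induction k as [|k IH]; [apply continuity_pt_const; intros ? ?; reflexivity |].
  apply (continuity_pt_mult (fun b => poch (b + c) k) (fun b => b + c + INR k)); auto.
  apply continuity_pt_plus; [apply continuity_pt_plus; [apply derivable_continuous_pt, derivable_pt_id |] |];
    apply continuity_pt_const; intros ? ?; reflexivity.
Qed.

Lemma frac_part_IZR (z : Z) : frac_part (IZR z) = 0.
Proof.
  unfold frac_part, Int_part. destruct (archimed (IZR z)) as [A1 A2].
  assert (z < up (IZR z))%Z by (apply lt_IZR; lra).
  assert (up (IZR z) <= z + 1)%Z by (apply le_IZR; rewrite plus_IZR; lra).
  replace (up (IZR z)) with (z + 1)%Z by lia. rewrite minus_IZR, plus_IZR; ring.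
Qed.

Lemma continuity_pt_sum_n (f : nat -> R -> R) (N : nat) (x : R) :
  (forall n, (n <= N)%nat -> continuity_pt (f n) x) -> continuity_pt (fun t => sum_n (fun n => f n t) N) x.
Proof.
  induction N as [|N IH]; intros H.
  - apply (continuity_pt_ext (f 0%nat)); [intros; now rewrite sum_O | auto].
  - apply (continuity_pt_ext (fun t => sum_n (fun n => f n t) N + f (S N) t)); [intros; now rewrite sum_n_RS |].
    apply continuity_pt_plus; auto.
Qed.

(** This identifies the coefficients R_k with Taylor coefficients of exp(-lambda y) (1+y)^(-m), from
    which their recurrences are immediate. Here b is an integer, so the value is the limit of the
    polynomial above. *)
Lemma TricomiU_poly (m j : nat) (lambda : R) :
  (-1) ^ j / INR (fact j) * TricomiU (- INR j) (1 - INR j - INR m) lambda = taylor_coef m j lambda.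
Proof.
  set (b := 1 - INR j - INR m).
  assert (Hb : b = IZR (1 - Z.of_nat j - Z.of_nat m)) by (unfold b; rewrite !minus_IZR, <- !INR_IZR_INZ; reflexivity).
  unfold TricomiU. destruct (Req_EM_T (frac_part b) 0) as [_ | N]; [| exfalso; apply N; rewrite Hb; apply frac_part_IZR].
  set (G := fun b => sum_n (fun n => (-1) ^ j * poch (- INR j) n / INR (fact n) * lambda ^ n * poch (b + INR n) (j - n)) j).
  assert (L : is_lim (fun b' => TricomiU_gen (- INR j) b' lambda) b (G b)).
  { apply (is_lim_ext_loc G).
    (* Within distance 1 of the integer b no other integer occurs, so the noninteger formula holds
       on the whole punctured neighbourhood. *)
    - exists (mkposreal 1 Rlt_0_1). intros y Hy Hne. change (Rabs (y - b) < 1) in Hy.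
      symmetry. apply TricomiU_gen_poly. intros z Hz. subst y. rewrite Hb, <- minus_IZR in Hy.
      rewrite <- abs_IZR in Hy. apply lt_IZR in Hy. apply Hne. rewrite Hb. f_equal. lia.
    - apply is_lim_continuity. unfold G.
      apply (continuity_pt_sum_n (fun n b => (-1) ^ j * poch (- INR j) n / INR (fact n) * lambda ^ n * poch (b + INR n) (j - n))).
      intros n _. apply (continuity_pt_scal (fun b => poch (b + INR n) (j - n))). apply continuous_poch. }
  rewrite (is_lim_unique _ _ _ L). simpl real. unfold G, taylor_coef.
  assert (S1 : forall n, (-1) ^ n * (-1) ^ n = 1) by (intros n; rewrite <- Rpow_mult_distr; replace (-1 * -1) with 1 by ring; apply pow1).
  unfold Rdiv; rewrite Rmult_assoc. f_equal.
  rewrite <- (sum_n_mult_l (K := R_Ring)).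
  apply sum_n_ext_loc. intros n Hn. change mult with Rmult. rtype.
  rewrite poch_neg by auto.
  replace (b + INR n) with (1 - INR m - INR (j - n)) by (unfold b; rewrite minus_INR by auto; ring).
  rewrite poch_reflect.
  assert (F := INR_fact_neq_0 n). assert (F2 := INR_fact_neq_0 j). assert (F3 := INR_fact_neq_0 (j - n)).
  assert (S2 : (-1) ^ j * (-1) ^ n * (-1) ^ (j - n) = 1).
  { rewrite Rmult_assoc, <- pow_add. replace (n + (j - n))%nat with j by lia. apply S1. }
  transitivity (((-1) ^ j * (-1) ^ n * (-1) ^ (j - n)) * (lambda ^ n * / INR (fact n) * (poch (INR m) (j - n) * / INR (fact (j - n)))));
    [field; auto | rewrite S2; ring].
Qed.

Lemma sum_n_shift (f : nat -> R) (N : nat) : sum_n f (S N) = f 0%nat + sum_n (fun n => f (S n)) N.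
Proof.
  induction N as [|N IH]; [now rewrite sum_n_RS, !sum_O |].
  rewrite sum_n_RS, IH, (sum_n_RS (fun n => f (S n))); rring.
Qed.

Lemma taylor_coef_0 (m : nat) (lambda : R) : taylor_coef m 0 lambda = 1.
Proof. unfold taylor_coef. rewrite sum_O. simpl. field. Qed.

(** Coefficients of (1+y)^(-m) = (1+y) (1+y)^(-m-1). *)
Lemma taylor_coef_rec (m j : nat) (lambda : R) :
  taylor_coef m (S j) lambda = taylor_coef (S m) j lambda + taylor_coef (S m) (S j) lambda.
Proof.
  unfold taylor_coef. rewrite !sum_n_RS, Nat.sub_diag. simpl pow.
  assert (E : sum_n (fun i => lambda ^ i / INR (fact i) * (poch (INR m) (S j - i) / INR (fact (S j - i)))) j =
     sum_n (fun i => lambda ^ i / INR (fact i) * (poch (INR (S m)) (S j - i) / INR (fact (S j - i)))) j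
     - sum_n (fun i => lambda ^ i / INR (fact i) * (poch (INR (S m)) (j - i) / INR (fact (j - i)))) j).
  { replace (_ - _) with (sum_n (fun i => lambda ^ i / INR (fact i) * (poch (INR (S m)) (S j - i) / INR (fact (S j - i)))) j
     + (-1) * sum_n (fun i => lambda ^ i / INR (fact i) * (poch (INR (S m)) (j - i) / INR (fact (j - i)))) j) by ring.
    rewrite <- (sum_n_mult_l (K := R_Ring)).
    rewrite <- (sum_n_plus (G := R_AbelianMonoid)). apply sum_n_ext_loc. intros i Hi.
    change mult with Rmult. change plus with Rplus. rtype.
    replace (S j - i)%nat with (S (j - i)) by lia.
    rewrite (poch_shift (INR m)), (poch_S (INR (S m))), <- S_INR, fact_simpl, mult_INR.
    assert (F := INR_fact_neq_0 i). assert (F2 := INR_fact_neq_0 (j - i)). assert (F3 := INR_S_pos (j - i)).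
    rewrite S_INR in F3. rewrite !S_INR. field. repeat split; auto; lra. }
  rewrite E. simpl poch. simpl fact. simpl INR. ring.
Qed.

Lemma taylor_coef_derive_0 (m : nat) (lambda : R) : is_derive (taylor_coef m 0) lambda 0.
Proof.
  apply (is_derive_ext (fun _ => 1)); [intros; now rewrite taylor_coef_0 |].
  apply (is_derive_const (K := R_AbsRing) (V := R_NormedModule)).
Qed.

(** Differentiation in lambda multiplies exp(-lambda y) by -y and so shifts the coefficients. *)
Lemma taylor_coef_derive (m j : nat) (lambda : R) :
  is_derive (taylor_coef m (S j)) lambda (- taylor_coef m j lambda).
Proof.
  unfold taylor_coef. eapply is_derive_eq.
  - apply is_derive_scal.
    apply (is_derive_sum_n (K := R_AbsRing) (V := R_NormedModule) (fun i lambda => lambda ^ i / INR (fact i) * (poch (INR m) (S j - i) / INR (fact (S j - i))))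
      (S j) lambda (fun i => INR i * lambda ^ pred i / INR (fact i) * (poch (INR m) (S j - i) / INR (fact (S j - i))))).
    intros i Hi. set (c := poch (INR m) (S j - i) / INR (fact (S j - i))). auto_derive; auto. unfold Rdiv; ring.
  - change (sum_n (G := AbelianGroup.AbelianMonoid R_NormedModule)) with (sum_n (G := R_AbelianMonoid)).
    rewrite sum_n_shift. simpl pow. simpl (INR 0).
    assert (E : sum_n (fun n => INR (S n) * lambda ^ pred (S n) / INR (fact (S n)) * (poch (INR m) (S j - S n) / INR (fact (S j - S n)))) j
      = sum_n (fun i => lambda ^ i / INR (fact i) * (poch (INR m) (j - i) / INR (fact (j - i)))) j).
    { apply sum_n_ext. intros n. replace (S j - S n)%nat with (j - n)%nat by lia. simpl pred.
      rewrite fact_simpl, mult_INR. assert (F := INR_fact_neq_0 n). assert (F2 := INR_fact_neq_0 (j - n)).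
      assert (F3 := INR_S_pos n). rtype. field. repeat split; auto; lra. }
    etransitivity; [apply f_equal, f_equal, E |]. unfold Rdiv; rring.
Qed.

Lemma taylor_coef_zero_at_0 (j : nat) : taylor_coef 0 (S j) 0 = 0.
Proof.
  unfold taylor_coef. rewrite sum_n_RS, Nat.sub_diag.
  rewrite (sum_n_ext_loc _ (fun _ => 0) j).
  - rewrite sum_n_const. simpl. unfold Rdiv; ring.
  - intros n Hn. replace (S j - n)%nat with (S (j - n)) by lia. simpl (INR 0). rewrite poch_0_S. unfold Rdiv; rring.
Qed.

(** * Values of zeta and the zeta polynomial *)

(** The N terms equal to 1 cancel against the first correction N / (0 - 1), and the second
    correction is the value. *)
Lemma zeta_0 : zeta 0 = - / 2.
Proof.
  unfold zeta.
  assert (L : is_lim_seq (fun N => sum_n_m (fun k => Rpower (INR k) (- 0)) 1 N + Rpower (INR N) (1 - 0) / (0 - 1) - Rpower (INR N) (- 0) / 2) (- / 2)).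
  { apply (is_lim_seq_ext_loc (fun _ => - / 2)); [| apply is_lim_seq_const].
    exists 1%nat. intros n Hn. assert (Hn0 : 0 < INR n) by (apply lt_0_INR; lia).
    assert (E0 : forall x, Rpower x (- 0) = 1) by (intros; rewrite Ropp_0; unfold Rpower; rewrite Rmult_0_l; apply exp_0).
    rewrite E0, Rminus_0_r, Rpower_1 by auto.
    rewrite (sum_n_m_ext _ (fun _ => 1)) by (intros; apply E0).
    rewrite sum_n_m_const. replace (S n - 1)%nat with n by lia. field. }
  now rewrite (is_lim_seq_unique _ _ L).
Qed.

Lemma Rpower_INR_inv (n q : nat) : (1 <= n)%nat -> Rpower (INR n) (- INR q) = / INR n ^ q.
Proof.
  intros Hn. rewrite Rpower_Ropp, Rpower_pow; auto. apply lt_0_INR; lia.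
Qed.

Lemma is_lim_seq_inv_pow (q : nat) : is_lim_seq (fun n => / INR n ^ S q) 0.
Proof.
  apply (is_lim_seq_ext (fun n => (/ INR n) ^ S q)); [intros; apply pow_inv |].
  replace (Finite 0) with (Finite (0 ^ S q)) by (f_equal; simpl; ring).
  induction q as [|q IH].
  - apply (is_lim_seq_ext (fun n => / INR n)); [intros; simpl; ring |].
    replace (0 ^ 1) with 0 by (simpl; ring). apply is_lim_seq_inv_INR.
  - apply (is_lim_seq_mult' (fun n => / INR n) (fun n => (/ INR n) ^ S q)); [apply is_lim_seq_inv_INR | exact IH].
Qed.

Lemma ex_series_zeta (q : nat) : ex_series (fun n => / INR (S n) ^ (2 * S q)).
Proof.
  apply (ex_series_Rle _ (fun n => / (INR n + 1) ^ 2)); [| apply ex_series_inv_sqr].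
  intros n. assert (Hn := pos_INR n). rewrite S_INR.
  rewrite Rabs_pos_eq by (apply Rlt_le, Rinv_0_lt_compat, pow_lt; lra).
  apply Rinv_le_contravar; [apply pow_lt; lra |]. apply Rle_pow; [lra | lia].
Qed.

Lemma zeta_even (q : nat) : zeta (INR (2 * S q)) = Series (fun n => / INR (S n) ^ (2 * S q)).
Proof.
  unfold zeta. set (s := (2 * S q)%nat).
  assert (Hs : 2 <= INR s) by (unfold s; change 2 with (INR 2) at 1; apply le_INR; lia).
  assert (L : is_lim_seq (fun N => sum_n_m (fun k => Rpower (INR k) (- INR s)) 1 N + Rpower (INR N) (1 - INR s) / (INR s - 1) - Rpower (INR N) (- INR s) / 2)
     (Series (fun n => / INR (S n) ^ s))).
  { replace (Series (fun n => / INR (S n) ^ s)) with (Series (fun n => / INR (S n) ^ s) + 0 / (INR s - 1) - 0 / 2) by (field; lra).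
    apply is_lim_seq_minus'; [apply is_lim_seq_plus' |].
    - apply is_lim_seq_incr_1.
      apply (is_lim_seq_ext (sum_n (fun n => / INR (S n) ^ s))).
      + intros n. induction n as [|n IH].
        * rewrite sum_O, sum_n_n, Rpower_INR_inv; auto.
        * rewrite sum_n_RS, (sum_n_Sm _ 1 (S n)), IH, Rpower_INR_inv by lia. reflexivity.
      + apply (Series_correct (fun n => / INR (S n) ^ s)), ex_series_zeta.
    - apply is_lim_seq_div'; [| apply is_lim_seq_const | lra].
      apply (is_lim_seq_ext_loc (fun n => / INR n ^ S (2 * q))); [| apply is_lim_seq_inv_pow].
      exists 1%nat. intros n Hn. rewrite <- Rpower_INR_inv by auto. f_equal. unfold s.
      replace (2 * S q)%nat with (S (S (2 * q))) by lia. rewrite !S_INR; ring.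
    - apply is_lim_seq_div'; [| apply is_lim_seq_const | lra].
      apply (is_lim_seq_ext_loc (fun n => / INR n ^ s)); [| unfold s; replace (2 * S q)%nat with (S (S (2 * q))) by lia; apply is_lim_seq_inv_pow].
      exists 1%nat. intros n Hn. now rewrite Rpower_INR_inv. }
  now rewrite (is_lim_seq_unique _ _ L).
Qed.

Definition zeta_sum (m q : nat) (a : C) (lambda : R) : C :=
  sum_n (fun k => RtoC (zeta (INR (2 * k)) * taylor_coef m (q - k) lambda) * a ^ (2 * k))%C q.

(** a^delta times [Hfun]. Since zeta(0) = -1/2, the separate case p = 0 is the case q = 0 of the
    general polynomial, which leaves only two branches. *)
Definition zeta_term (m : nat) (p : Z) (a : C) (lambda : R) : C :=
  if (1 <=? p)%Z then RtoC 0 else zeta_sum m (Z.to_nat (- p)) a lambda.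

Lemma zeta_sum_0 (m : nat) (a : C) (lambda : R) : zeta_sum m 0 a lambda = RtoC (- / 2).
Proof.
  unfold zeta_sum. rewrite sum_O, taylor_coef_0. simpl (INR (2 * 0)). rewrite zeta_0, Rmult_1_r.
  simpl. ring.
Qed.

Lemma Hfun_zeta_term (m : nat) (p : Z) (a : C) (lambda : R) :
  Hfun (INR m) p a lambda = (Cpower a (- (2 * (INR m - IZR p))) * zeta_term m p a lambda)%C.
Proof.
  unfold Hfun, zeta_term. destruct (1 <=? p)%Z eqn:E1; [ring |].
  destruct (p =? 0)%Z eqn:E2.
  - apply Z.eqb_eq in E2; subst p. simpl (Z.to_nat (- 0)). rewrite zeta_sum_0, RtoC_opp. ring.
  - apply Z.leb_gt in E1. apply Z.eqb_neq in E2. f_equal.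
    replace (Z.abs_nat p) with (Z.to_nat (- p)) by lia. set (q := Z.to_nat (- p)).
    unfold zeta_sum. apply sum_n_ext_loc. intros k Hk. do 3 f_equal. unfold Rcoef.
    rewrite <- (TricomiU_poly m (q - k)). rewrite minus_INR by auto. f_equal. f_equal; ring.
Qed.

Lemma zeta_sum_rec (m q : nat) (a : C) (lambda : R) :
  zeta_sum m (S q) a lambda = (zeta_sum (S m) q a lambda + zeta_sum (S m) (S q) a lambda)%C.
Proof.
  unfold zeta_sum. rewrite !sum_n_CS, !Nat.sub_diag, !taylor_coef_0.
  rewrite Cplus_assoc, <- sum_n_Cplus. f_equal. apply sum_n_ext_loc. intros k Hk.
  replace (S q - k)%nat with (S (q - k)) by lia. rewrite taylor_coef_rec.
  rewrite Rmult_plus_distr_l, RtoC_plus; cring.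
Qed.

Lemma zeta_sum_derive_0 (m : nat) (a : C) (lambda : R) :
  is_Cderive (zeta_sum m 0 a) lambda (RtoC 0).
Proof.
  apply (is_Cderive_ext (fun _ => RtoC (- / 2))); [intros; now rewrite zeta_sum_0 | apply is_Cderive_const].
Qed.

Lemma zeta_sum_derive (m q : nat) (a : C) (lambda : R) :
  is_Cderive (zeta_sum m (S q) a) lambda (- zeta_sum m q a lambda)%C.
Proof.
  apply (is_Cderive_ext (fun lambda => sum_n (fun k => RtoC (zeta (INR (2 * k)) * taylor_coef m (S q - k) lambda) * a ^ (2 * k))%C q
    + RtoC (zeta (INR (2 * S q))) * a ^ (2 * S q))%C).
  { intros t. unfold zeta_sum. rewrite sum_n_CS, Nat.sub_diag, taylor_coef_0, Rmult_1_r. reflexivity. }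
  eapply is_Cderive_eq.
  - apply is_Cderive_plus; [| apply is_Cderive_const].
    apply (is_Cderive_sum_n (fun k lambda => RtoC (zeta (INR (2 * k)) * taylor_coef m (S q - k) lambda) * a ^ (2 * k))%C
      (fun k => - (RtoC (zeta (INR (2 * k)) * taylor_coef m (q - k) lambda) * a ^ (2 * k)))%C).
    intros k Hk. replace (S q - k)%nat with (S (q - k)) by lia.
    apply (is_Cderive_ext (fun lambda => a ^ (2 * k) * RtoC (zeta (INR (2 * k)) * taylor_coef m (S (q - k)) lambda))%C); [intros; ring |].
    eapply is_Cderive_eq; [apply is_Cderive_scal, is_Cderive_RtoC, is_derive_scal, taylor_coef_derive |].
    rewrite !RtoC_mult, RtoC_opp; ring.
  - unfold zeta_sum. replace (- sum_n _ q)%C with (RtoC (-1) * sum_n (fun k => RtoC (zeta (INR (2 * k)) * taylor_coef m (q - k) lambda) * a ^ (2 * k))%C q)%C by ring.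
    rewrite <- sum_n_Cscal, Cplus_0_r. apply sum_n_ext. intros; cring.
Qed.

Lemma zeta_term_rec (m : nat) (p : Z) (a : C) (lambda : R) :
  zeta_term m p a lambda = (zeta_term (S m) (p + 1) a lambda + zeta_term (S m) p a lambda)%C.
Proof.
  unfold zeta_term. destruct (1 <=? p)%Z eqn:E1.
  - apply Z.leb_le in E1. assert (E2 : (1 <=? p + 1)%Z = true) by (apply Z.leb_le; lia). rewrite E2; ring.
  - apply Z.leb_gt in E1. destruct (Z.eq_dec p 0) as [-> | N].
    + simpl. rewrite !zeta_sum_0; ring.
    + assert (E2 : (1 <=? p + 1)%Z = false) by (apply Z.leb_gt; lia). rewrite E2.
      replace (Z.to_nat (- p)) with (S (Z.to_nat (- (p + 1)))) by lia. apply zeta_sum_rec.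
Qed.

Lemma zeta_term_derive (m : nat) (p : Z) (a : C) (lambda : R) :
  is_Cderive (zeta_term m p a) lambda (- zeta_term m (p + 1) a lambda)%C.
Proof.
  unfold zeta_term. destruct (1 <=? p)%Z eqn:E1.
  - apply Z.leb_le in E1. assert (E2 : (1 <=? p + 1)%Z = true) by (apply Z.leb_le; lia). rewrite E2.
    eapply is_Cderive_eq; [apply is_Cderive_const | ring].
  - apply Z.leb_gt in E1. destruct (Z.eq_dec p 0) as [-> | N].
    + simpl. eapply is_Cderive_eq; [apply zeta_sum_derive_0 | ring].
    + assert (E2 : (1 <=? p + 1)%Z = false) by (apply Z.leb_gt; lia). rewrite E2.
      replace (Z.to_nat (- p)) with (S (Z.to_nat (- (p + 1)))) by lia. apply zeta_sum_derive.
Qed.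

Lemma taylor_coef_lim (m j : nat) : filterlim (taylor_coef m j) (at_right 0) (locally (taylor_coef m j 0)).
Proof.
  assert (C : continuity_pt (taylor_coef m j) 0).
  { apply continuity_pt_filterlim, (ex_derive_continuous (taylor_coef m j)).
    destruct j; eexists; [apply taylor_coef_derive_0 | apply taylor_coef_derive]. }
  apply continuity_pt_filterlim in C.
  intros P HP. destruct (C P HP) as [eps He]. exists eps. intros y Hy _. now apply He.
Qed.

(** For m = 0 and lambda = 0 the generating function of the Taylor coefficients is 1, so only the
    summand k = q survives. *)
Lemma zeta_sum_lim (q : nat) (a : C) :
  is_Clim (at_right 0) (zeta_sum 0 q a) (RtoC (zeta (INR (2 * q))) * a ^ (2 * q))%C.
Proof.
  eapply is_Clim_eq.
  - apply (is_Clim_sum_n (at_right 0) (fun k lambda => RtoC (zeta (INR (2 * k)) * taylor_coef 0 (q - k) lambda) * a ^ (2 * k))%C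
      (fun k => RtoC (zeta (INR (2 * k)) * taylor_coef 0 (q - k) 0) * a ^ (2 * k))%C).
    intros k Hk. apply is_Clim_mult; [typeclasses eauto | | apply is_Clim_const; typeclasses eauto].
    apply is_Clim_RtoC; [typeclasses eauto |].
    apply (filterlim_Rmult (at_right 0) (fun _ => zeta (INR (2 * k)))); [apply filterlim_const | apply taylor_coef_lim].
  - destruct q as [|q].
    + rewrite sum_O. rewrite taylor_coef_0, Rmult_1_r; reflexivity.
    + rewrite sum_n_CS, Nat.sub_diag, taylor_coef_0, Rmult_1_r.
      assert (Z : forall N, (N <= q)%nat -> sum_n (fun k => RtoC (zeta (INR (2 * k)) * taylor_coef 0 (S q - k) 0) * a ^ (2 * k))%C N = RtoC 0).
      { induction N as [|N IH]; intros HN.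
        - rewrite sum_O. replace (S q - 0)%nat with (S q) by lia. rewrite taylor_coef_zero_at_0, Rmult_0_r. cring.
        - rewrite sum_n_CS, IH by lia. replace (S q - S N)%nat with (S (q - S N)) by lia. rewrite taylor_coef_zero_at_0, Rmult_0_r. cring. }
      rewrite Z by lia. ring.
Qed.

(** * The residue sum *)

(** The numbers B_{rl}, with arguments in the order p, l, r. The recursion comes from 1 - p + s/2 +
    l = (1 - p + l - (r+1)/2) + (s+1+r)/2, whose last summand raises (s+1)_r to (s+1)_(r+1). *)
Fixpoint basis_coef (p : Z) (l r : nat) : R :=
  match l with
  | O => match r with O => 1 | S _ => 0 end
  | S k => (1 - IZR p + INR k - (INR r + 1) / 2) * basis_coef p k r
           + match r with O => 0 | S r' => / 2 * basis_coef p k r' end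
  end.

Lemma basis_coef_S_0 (p : Z) (l : nat) :
  basis_coef p (S l) 0 = (1 - IZR p + INR l - (0 + 1) / 2) * basis_coef p l 0.
Proof. simpl. ring. Qed.

Lemma basis_coef_S_S (p : Z) (l r : nat) :
  basis_coef p (S l) (S r) =
  (1 - IZR p + INR l - (INR (S r) + 1) / 2) * basis_coef p l (S r) + / 2 * basis_coef p l r.
Proof. reflexivity. Qed.

Lemma basis_coef_gt (p : Z) (l r : nat) : (l < r)%nat -> basis_coef p l r = 0.
Proof.
  revert r; induction l as [|l IH]; intros r H; destruct r as [|r]; try lia; [reflexivity |].
  rewrite basis_coef_S_S, !IH by lia. ring.
Qed.

Lemma basis_coef_spec (p : Z) (l : nat) (s : R) :
  poch (1 - IZR p + s / 2) l = sum_n (fun r => basis_coef p l r * poch (s + 1) r) l.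
Proof.
  induction l as [|l IH]; [rewrite sum_O; simpl; ring |].
  rewrite poch_S, IH.
  rewrite (sum_n_shift (fun r => basis_coef p (S l) r * poch (s + 1) r)), basis_coef_S_0.
  rewrite (sum_n_ext (fun n => basis_coef p (S l) (S n) * poch (s + 1) (S n)) (fun n => (1 - IZR p + INR l - (INR (S n) + 1) / 2) * basis_coef p l (S n) * poch (s + 1) (S n)
     + / 2 * basis_coef p l n * poch (s + 1) (S n))).
  2:{ intros n. rewrite basis_coef_S_S. rring. }
  rewrite (sum_n_plus (G := R_AbelianMonoid)). change plus with Rplus. cbv beta.
  assert (E1 : (1 - IZR p + INR l - (0 + 1) / 2) * basis_coef p l 0 * poch (s + 1) 0 +
     sum_n (fun n => (1 - IZR p + INR l - (INR (S n) + 1) / 2) * basis_coef p l (S n) * poch (s + 1) (S n)) l =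
     sum_n (fun n => (1 - IZR p + INR l - (INR n + 1) / 2) * basis_coef p l n * poch (s + 1) n) l).
  { transitivity (sum_n (fun n => (1 - IZR p + INR l - (INR n + 1) / 2) * basis_coef p l n * poch (s + 1) n) (S l)).
    - rewrite sum_n_shift. reflexivity.
    - rewrite sum_n_RS, (basis_coef_gt p l (S l)) by lia. rring. }
  rewrite <- Rplus_assoc, E1.
  rewrite <- (sum_n_plus (G := R_AbelianMonoid)). change plus with Rplus.
  rewrite <- (sum_n_mult_r (K := R_Ring)). change mult with Rmult. apply sum_n_ext. intros n. rewrite poch_S. rtype. field.
Qed.

Lemma sum_n_single (f : nat -> R) (N r : nat) :
  (r <= N)%nat -> (forall n, (n <= N)%nat -> n <> r -> f n = 0) -> sum_n f N = f r.
Proof.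
  intros Hr. induction N as [|N IH]; intros H.
  - replace r with 0%nat by lia. apply sum_O.
  - rewrite sum_n_RS. destruct (Nat.eq_dec r (S N)) as [-> | Hne].
    + rewrite (sum_n_ext_loc _ (fun _ => 0)) by (intros n Hn; apply H; lia).
      rewrite sum_n_const. rring.
    + rewrite IH, (H (S N)) by (try lia; intros; apply H; lia). rring.
Qed.

(** At s = -r - 1 the basis polynomials of index above r vanish and the r-th does not, so the system
    is triangular. *)
Lemma basis_unique (c d : nat -> R) (l : nat) :
  (forall s, sum_n (fun r => c r * poch (s + 1) r) l = sum_n (fun r => d r * poch (s + 1) r) l) ->
  forall r, (r <= l)%nat -> c r = d r.
Proof.
  intros H r. induction r as [r IH] using (well_founded_induction lt_wf). intros Hr.
  specialize (H (- INR r - 1)). replace (- INR r - 1 + 1) with (- INR r) in H by ring.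
  assert (E : sum_n (fun i => (c i - d i) * poch (- INR r) i) l = 0).
  { transitivity (sum_n (fun i => c i * poch (- INR r) i) l + -1 * sum_n (fun i => d i * poch (- INR r) i) l).
    - rewrite <- (sum_n_mult_l (K := R_Ring)), <- (sum_n_plus (G := R_AbelianMonoid)). apply sum_n_ext. intros i.
      change mult with Rmult; change plus with Rplus. rring.
    - rewrite H. rring. }
  rewrite (sum_n_single _ l r Hr) in E.
  - assert (N : poch (- INR r) r <> 0).
    { rewrite poch_neg, Nat.sub_diag by auto. simpl (INR (fact 0)).
      assert (F := INR_fact_neq_0 r). assert (P1 := pow_nonzero (-1) r ltac:(lra)). unfold Rdiv. rewrite Rinv_1, Rmult_1_r.
      now apply Rmult_integral_contrapositive. }
    apply Rmult_integral in E. destruct E; [lra | contradiction].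
  - intros n Hn Hne. destruct (Nat.lt_ge_cases n r) as [L | G].
    + rewrite IH by lia. ring.
    + rewrite poch_neg_0 by lia. ring.
Qed.

Lemma is_Bcoef_unique (p : Z) (B : nat -> nat -> R) (l r : nat) :
  is_Bcoef p B -> (r <= l)%nat -> B r l = basis_coef p l r.
Proof.
  intros H Hr. apply (basis_unique (fun r => B r l) (fun r => basis_coef p l r) l); auto.
  intros s. rewrite <- H, <- basis_coef_spec. reflexivity.
Qed.

(** Comparison of coefficients in (x-1)_(l+1) = (x)_(l+1) - (l+1) (x)_l with x = 1 - p + s/2. *)
Lemma basis_coef_succ (p : Z) (l r : nat) :
  (r <= S l)%nat ->
  basis_coef (p + 1) (S l) r = basis_coef p (S l) r - INR (S l) * basis_coef p l r.
Proof.
  intros Hr.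
  apply (basis_unique (fun r => basis_coef (p + 1) (S l) r) (fun r => basis_coef p (S l) r - INR (S l) * basis_coef p l r) (S l)); auto.
  intros s. rewrite <- basis_coef_spec.
  transitivity (sum_n (fun r => basis_coef p (S l) r * poch (s + 1) r) (S l) + (- INR (S l)) * sum_n (fun r => basis_coef p l r * poch (s + 1) r) (S l)).
  - rewrite <- basis_coef_spec, sum_n_RS, (basis_coef_gt p l (S l)), <- basis_coef_spec by lia.
    rewrite plus_IZR. set (x := 1 - IZR p + s / 2).
    replace (1 - (IZR p + 1) + s / 2) with (x - 1) by (unfold x; ring).
    rewrite poch_shift. replace (x - 1 + 1) with x by ring. rewrite poch_S, S_INR. rring.
  - rewrite <- (sum_n_mult_l (K := R_Ring)), <- (sum_n_plus (G := R_AbelianMonoid)). apply sum_n_ext. intros i.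
    change mult with Rmult; change plus with Rplus. rring.
Qed.

(* The polynomial sum_r B_{r l} X^r with X^r replaced by [y r]. *)
Definition basis_sum (y : nat -> C) (p : Z) (l : nat) : C :=
  sum_n (fun r => RtoC (basis_coef p l r) * y r)%C l.

Lemma basis_sum_succ_0 (y : nat -> C) (p : Z) : basis_sum y (p + 1) 0 = basis_sum y p 0.
Proof. unfold basis_sum. rewrite !sum_O. reflexivity. Qed.

Lemma basis_sum_succ (y : nat -> C) (p : Z) (l : nat) :
  basis_sum y (p + 1) (S l) = (basis_sum y p (S l) - RtoC (INR (S l)) * basis_sum y p l)%C.
Proof.
  unfold basis_sum.
  replace (sum_n (fun r => RtoC (basis_coef p l r) * y r)%C l) with (sum_n (fun r => RtoC (basis_coef p l r) * y r)%C (S l)).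
  2:{ rewrite sum_n_CS, (basis_coef_gt p l (S l)) by lia. cring. }
  transitivity (sum_n (fun r => RtoC (basis_coef p (S l) r) * y r)%C (S l) + (RtoC (- INR (S l)) * sum_n (fun r => RtoC (basis_coef p l r) * y r) (S l)))%C.
  - rewrite <- sum_n_Cscal, <- sum_n_Cplus. apply sum_n_ext_loc. intros r Hr. rewrite basis_coef_succ by auto.
    rewrite RtoC_minus, RtoC_mult, RtoC_opp. cring.
  - rewrite RtoC_opp. cring.
Qed.

Lemma basis_sum_S (y : nat -> C) (p : Z) (l : nat) :
  basis_sum y p (S l) = sum_n (fun r => RtoC (basis_coef p l r) *
     (RtoC (1 - IZR p + INR l - (INR r + 1) / 2) * y r + RtoC (/ 2) * y (S r)))%C l.
Proof.
  unfold basis_sum.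
  assert (Sh : forall (f : nat -> C) N, sum_n f (S N) = (f 0%nat + sum_n (fun n => f (S n)) N)%C).
  { intros f N. induction N as [|N IH]; [now rewrite sum_n_CS, !sum_O |].
    rewrite sum_n_CS, IH, (sum_n_CS (fun n => f (S n))); cring. }
  rewrite Sh, basis_coef_S_0.
  rewrite (sum_n_ext (fun n => RtoC (basis_coef p (S l) (S n)) * y (S n))%C (fun n => RtoC ((1 - IZR p + INR l - (INR (S n) + 1) / 2) * basis_coef p l (S n)) * y (S n)
     + RtoC (/ 2 * basis_coef p l n) * y (S n))%C).
  2:{ intros n. rewrite basis_coef_S_S, RtoC_plus. cring. }
  rewrite sum_n_Cplus, Cplus_assoc.
  assert (E1 : (RtoC ((1 - IZR p + INR l - (0 + 1) / 2) * basis_coef p l 0) * y 0%nat +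
     sum_n (fun n => RtoC ((1 - IZR p + INR l - (INR (S n) + 1) / 2) * basis_coef p l (S n)) * y (S n)) l =
     sum_n (fun n => RtoC ((1 - IZR p + INR l - (INR n + 1) / 2) * basis_coef p l n) * y n) l)%C).
  { transitivity (sum_n (fun n => RtoC ((1 - IZR p + INR l - (INR n + 1) / 2) * basis_coef p l n) * y n)%C (S l)).
    - rewrite Sh. reflexivity.
    - rewrite sum_n_CS, (basis_coef_gt p l (S l)), Rmult_0_r by lia. cring. }
  rewrite E1, <- sum_n_Cplus. apply sum_n_ext. intros n. rewrite !RtoC_mult. cring.
Qed.

(** * The weights A and the full residue term *)

(** The double sum with l outermost and an arbitrary sequence y. The recurrences below are
    identities between the numbers A and B, valid for every y. *)
Definition tail_sum (y : nat -> C) (m : nat) (p : Z) (lambda : R) : C :=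
  match m with
  | O => RtoC 0
  | S k => sum_n (fun l => RtoC (Acoef m lambda l) * basis_sum y p l)%C k
  end.

Lemma Acoef_top (m : nat) (lambda : R) : Acoef (S m) lambda m = (-1) ^ m / INR (fact m).
Proof.
  unfold Acoef. replace (S m - 1 - m)%nat with 0%nat by lia. simpl. unfold Rdiv. rewrite Rmult_1_r, Rmult_1_l. reflexivity.
Qed.

Lemma Acoef_rec (m l : nat) (lambda : R) : Acoef (S m) lambda (S l) * INR (S l) = - Acoef m lambda l.
Proof.
  unfold Acoef. replace (S m - 1 - S l)%nat with (m - 1 - l)%nat by lia.
  rewrite (fact_simpl l), mult_INR. assert (F := INR_fact_neq_0 l). assert (F2 := INR_fact_neq_0 (m - 1 - l)).
  assert (F3 := INR_S_pos l). simpl pow. field. repeat split; auto; lra.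
Qed.

Lemma Acoef_derive (m l : nat) (lambda : R) :
  (l < m)%nat -> is_derive (fun t => Acoef (S m) t l) lambda (Acoef m lambda l).
Proof.
  intros H. unfold Acoef. replace (S m - 1 - l)%nat with (S (m - 1 - l)) by lia.
  set (k := (m - 1 - l)%nat). rewrite fact_simpl, mult_INR.
  assert (F := INR_fact_neq_0 l). assert (F2 := INR_fact_neq_0 k). assert (F3 := INR_S_pos k).
  apply (is_derive_ext (fun t => (-1) ^ l / (INR (S k) * INR (fact k) * INR (fact l)) * t ^ S k)).
  { intros t. rtype. field. repeat split; auto; lra. }
  eapply is_derive_eq; [apply is_derive_scal; auto_derive; auto; reflexivity |].
  simpl pred. change (match k with O => 1 | S _ => INR k + 1 end) with (INR (S k)). field. repeat split; auto; lra.
Qed.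

(** By [Acoef_rec] the weights of orders m + 1 and m differ by a factor -(l+1) and a shift of l.
    This turns the correction in [basis_sum_succ] into the sum of order m. *)
Lemma tail_sum_rec (y : nat -> C) (m : nat) (p : Z) (lambda : R) :
  tail_sum y (S m) (p + 1) lambda = (tail_sum y (S m) p lambda + tail_sum y m p lambda)%C.
Proof.
  unfold tail_sum.
  assert (K : forall N, sum_n (fun l => RtoC (Acoef (S m) lambda l) * basis_sum y (p + 1) l)%C (S N) =
    (sum_n (fun l => RtoC (Acoef (S m) lambda l) * basis_sum y p l) (S N) + sum_n (fun l => RtoC (Acoef m lambda l) * basis_sum y p l) N)%C).
  { assert (St : forall l, (RtoC (Acoef (S m) lambda (S l)) * basis_sum y (p + 1) (S l))%C =
      (RtoC (Acoef (S m) lambda (S l)) * basis_sum y p (S l) + RtoC (Acoef m lambda l) * basis_sum y p l)%C).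
    { intros l. rewrite basis_sum_succ. replace (Acoef m lambda l) with (- (Acoef (S m) lambda (S l) * INR (S l))) by (rewrite Acoef_rec; ring).
      rewrite RtoC_opp, RtoC_mult. ring. }
    induction N as [|N IH].
    - rewrite !sum_n_CS, !sum_O, St, basis_sum_succ_0. cring.
    - rewrite (sum_n_CS _ (S N)), IH, St, !sum_n_CS. cring. }
  destruct m as [|m].
  - rewrite !sum_O, basis_sum_succ_0. cring.
  - apply K.
Qed.

Lemma tail_sum_derive (y : nat -> C) (m : nat) (p : Z) (lambda : R) :
  is_Cderive (tail_sum y (S m) p) lambda (tail_sum y m p lambda).
Proof.
  destruct m as [|m].
  - apply (is_Cderive_ext (fun _ => basis_sum y p 0)); [| apply is_Cderive_const].
    intros t. unfold tail_sum. rewrite sum_O, Acoef_top. simpl. unfold Rdiv. rewrite Rinv_1, Rmult_1_r. ring.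
  - apply (is_Cderive_ext (fun t => sum_n (fun l => basis_sum y p l * RtoC (Acoef (S (S m)) t l)) m + RtoC ((-1) ^ S m / INR (fact (S m))) * basis_sum y p (S m))%C).
    { intros t. unfold tail_sum. rewrite sum_n_CS, Acoef_top. f_equal. apply sum_n_ext; intros; cring. }
    eapply is_Cderive_eq.
    + apply is_Cderive_plus; [| apply is_Cderive_const].
      apply (is_Cderive_sum_n (fun l t => basis_sum y p l * RtoC (Acoef (S (S m)) t l))%C (fun l => RtoC (Acoef (S m) lambda l) * basis_sum y p l)%C).
      intros l Hl. eapply is_Cderive_eq; [apply is_Cderive_scal, is_Cderive_RtoC, Acoef_derive; lia | ring].
    + unfold tail_sum. cring.
Qed.

Definition neg1_pow (z : Z) : R := powerRZ (-1) z.

Lemma neg1_pow_succ (z : Z) : neg1_pow (z + 1) = - neg1_pow z.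
Proof. unfold neg1_pow. rewrite powerRZ_add by lra. simpl. ring. Qed.

Definition scaled_sigma (a : C) (r : nat) : C := (Defs.sigma r a * (RtoC (2 * PI) * a) ^ r)%C.

(** a^delta times the residue sum of the statement: the powers a^delta, a^(2p+1) and a^(-2m) leave a
    single factor a, and (2 pi)^r a^r is absorbed in [scaled_sigma]. *)
Definition tail_term (m : nat) (p : Z) (a : C) (lambda : R) : C :=
  (RtoC (neg1_pow (Z.of_nat m - p) * PI) * a * Cexp (RtoC lambda - RtoC (2 * PI) * a)
   * tail_sum (scaled_sigma a) m p lambda)%C.

Lemma tail_term_rec (m : nat) (p : Z) (a : C) (lambda : R) :
  tail_term m p a lambda = (tail_term (S m) (p + 1) a lambda + tail_term (S m) p a lambda)%C.
Proof.
  unfold tail_term. rewrite tail_sum_rec.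
  replace (Z.of_nat (S m) - (p + 1))%Z with (Z.of_nat m - p)%Z by lia.
  replace (Z.of_nat (S m) - p)%Z with (Z.of_nat m - p + 1)%Z by lia. rewrite neg1_pow_succ, !RtoC_mult, RtoC_opp. ring.
Qed.

(** The factor exp(lambda) contributes the sum at p, and the derivative of the sum is the difference
    between p + 1 and p. The two contributions at p cancel. *)
Lemma tail_term_derive (m : nat) (p : Z) (a : C) (lambda : R) :
  is_Cderive (tail_term m p a) lambda (- tail_term m (p + 1) a lambda)%C.
Proof.
  unfold tail_term.
  assert (D : is_Cderive (tail_sum (scaled_sigma a) m p) lambda (tail_sum (scaled_sigma a) m (p + 1) lambda - tail_sum (scaled_sigma a) m p lambda)%C).
  { destruct m as [|m].
    - eapply is_Cderive_eq; [apply is_Cderive_const | simpl; ring].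
    - eapply is_Cderive_eq; [apply tail_sum_derive |]. rewrite tail_sum_rec; ring. }
  eapply is_Cderive_eq.
  - apply is_Cderive_mult; [| exact D]. apply is_Cderive_scal, is_Cderive_Cexp.
    apply is_Cderive_minus; [apply is_Cderive_RtoC, (is_derive_id (K := R_AbsRing)) | apply is_Cderive_const].
  - cbv beta. change (one : R) with 1. replace (Z.of_nat m - p)%Z with (Z.of_nat m - (p + 1) + 1)%Z by lia.
    rewrite neg1_pow_succ, !RtoC_mult, RtoC_opp. ring.
Qed.

Lemma sum_n_m_zero_head (f : nat -> C) (r N : nat) :
  (r <= N)%nat -> (forall l, (l < r)%nat -> f l = RtoC 0) -> sum_n_m f r N = sum_n f N.
Proof.
  intros Hr H. destruct r as [|r]; [reflexivity |].
  unfold sum_n. rewrite (sum_n_m_Chasles f 0 r N) by lia.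
  assert (Z : sum_n_m f 0 r = RtoC 0).
  { change (sum_n f r = RtoC 0). assert (Q : forall k, (k <= r)%nat -> sum_n f k = RtoC 0).
    { induction k as [|k IH]; intros Hk; [rewrite sum_O; apply H; lia |]. rewrite sum_n_CS, IH, H by lia. cring. }
    now apply Q. }
  rewrite Z. symmetry. apply (Cplus_0_l (sum_n_m f (S r) N)).
Qed.

(** Since [basis_coef] vanishes for l < r, the triangular range may be filled up to a square, the
    summations exchanged, and the surplus dropped again. *)
Lemma ABsum_eq (m : nat) (p : Z) (B : nat -> nat -> R) (lambda : R) (a : C) :
  a <> RtoC 0 -> is_Bcoef p B ->
  ABsum m B lambda a = (tail_sum (scaled_sigma a) m p lambda / a ^ (2 * m))%C.
Proof.
  intros Ha HB. destruct m as [|m]; [simpl; field; apply RtoC_neq; lra |].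
  assert (Hap : forall n, (a ^ n)%C <> RtoC 0) by (intros; now apply Cpow_nz).
  unfold ABsum, tail_sum.
  set (g := fun r l => (/ a ^ (2 * S m) * (RtoC (Acoef (S m) lambda l) * (RtoC (basis_coef p l r) * scaled_sigma a r)))%C).
  transitivity (sum_n (fun r => sum_n (fun l => g r l) m) m).
  - apply sum_n_ext_loc. intros r Hr.
    cbv beta. change (sum_n (fun l => g r l) m) with (sum_n (g r) m). rewrite <- (sum_n_m_zero_head (g r) r m Hr).
    + apply sum_n_m_ext_loc. intros l Hl. unfold g, scaled_sigma.
      rewrite (is_Bcoef_unique p B l r HB) by lia. rewrite RtoC_mult, Cpow_mult_l, RtoC_pow.
      assert (E : (a ^ (2 * S m))%C = (a ^ (2 * S m - r) * a ^ r)%C) by (rewrite <- Cpow_add_r; f_equal; lia).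
      rewrite E. assert (H1 := Hap r). assert (H2 := Hap (2 * S m - r)%nat). cfield; auto.
    + intros l Hl. unfold g. rewrite basis_coef_gt by auto. ring.
  - rewrite (sum_n_switch g). unfold Cdiv. rewrite Cmult_comm, <- sum_n_Cscal. apply sum_n_ext_loc. intros l Hl.
    unfold g. rewrite sum_n_Cscal, sum_n_Cscal. do 2 f_equal. unfold basis_sum.
    assert (Q : forall k, (l <= k)%nat -> sum_n (fun r => RtoC (basis_coef p l r) * scaled_sigma a r)%C k = sum_n (fun r => RtoC (basis_coef p l r) * scaled_sigma a r)%C l).
    { induction k as [|k IH]; intros Hk; [now replace l with 0%nat by lia |].
      destruct (Nat.eq_dec l (S k)) as [-> | Hne]; [reflexivity |]. rewrite sum_n_CS, IH, (basis_coef_gt p l (S k)) by lia. cring. }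
    now apply Q.
Qed.

(** * Lattice sums *)

Ltac mul_pos := repeat first [assumption | lra | apply pos_INR | apply Rmult_lt_0_compat].
Ltac mul_nonneg := repeat first [assumption | lra | apply pos_INR | apply Rmult_le_pos].

Lemma is_Clim_of_derive (G : R -> C) (l : C) : is_Cderive G 0 l -> is_Clim (at_right 0) G (G 0).
Proof.
  intros [H1 H2]; split.
  - assert (C : continuity_pt (fun t => Re (G t)) 0) by (apply continuity_pt_filterlim, (ex_derive_continuous (fun t => Re (G t))); eexists; exact H1).
    apply continuity_pt_filterlim in C.
    intros P HP. destruct (C P HP) as [eps He]. exists eps. intros y Hy _. now apply He.
  - assert (C : continuity_pt (fun t => Im (G t)) 0) by (apply continuity_pt_filterlim, (ex_derive_continuous (fun t => Im (G t))); eexists; exact H2).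
    apply continuity_pt_filterlim in C.
    intros P HP. destruct (C P HP) as [eps He]. exists eps. intros y Hy _. now apply He.
Qed.

Lemma geometric_Cseries (q : C) : Cmod q < 1 -> CSeries (fun j => q ^ S j)%C = (q / (RtoC 1 - q))%C.
Proof.
  intros Hq. assert (H0 := Cmod_ge_0 q).
  assert (Hb : ex_series (fun n => Cmod q ^ n)).
  { exists (/ (1 - Cmod q)). apply is_series_geom. rewrite Rabs_pos_eq; lra. }
  assert (S0 : is_Cseries (fun n => q ^ n)%C (CSeries (fun n => q ^ n)%C)).
  { eapply CSeries_correct; [| exact Hb]. intros n; rewrite Cmod_pow; lra. }
  set (X := CSeries (fun n => q ^ n)%C) in *.
  assert (S1 : is_Cseries (fun n => q ^ S n)%C (q * X)%C).
  { apply (is_Cseries_ext (fun n => q * q ^ n)%C); [reflexivity | now apply is_Cseries_scal]. }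
  assert (E : X = (RtoC 1 + q * X)%C).
  { unfold X at 1. apply is_Cseries_unique. apply (is_Cseries_incr_1 (fun n => q ^ n)%C). exact S1. }
  assert (N : (RtoC 1 - q)%C <> RtoC 0).
  { intro Z. assert (q = RtoC 1) by (transitivity (RtoC 1 - (RtoC 1 - q))%C; [ring | rewrite Z; ring]).
    rewrite H, Cmod_1 in Hq. lra. }
  rewrite (is_Cseries_unique _ _ S1).
  assert (EX : X = (/ (RtoC 1 - q))%C).
  { transitivity ((X - q * X) / (RtoC 1 - q))%C; [field; auto |].
    replace (X - q * X)%C with (RtoC 1) by (rewrite E at 1; ring). unfold Cdiv; ring. }
  rewrite EX. unfold Cdiv; ring.
Qed.

(** The sector |arg a| < pi/4 in algebraic form; the second condition is the one that makes the
    Gaussian factors decay. *)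
Definition right_sector (a : C) : Prop := 0 < Re a /\ 0 < Re (a * a)%C.

Lemma right_sector_scal (a : C) (u : R) : 0 < u -> right_sector a -> right_sector (a * RtoC u)%C.
Proof.
  intros Hu [H1 H2]; split.
  - rewrite Cmult_comm, Re_scal. now apply Rmult_lt_0_compat.
  - replace (a * RtoC u * (a * RtoC u))%C with (RtoC (u * u) * (a * a))%C by (rewrite RtoC_mult; ring).
    rewrite Re_scal. apply Rmult_lt_0_compat; auto. nra.
Qed.

Lemma Cmod_lattice_ge (x : R) (z : C) : 0 <= Re z -> x <= Cmod (RtoC x + z)%C.
Proof.
  intros H. eapply Rle_trans; [| apply (Rle_trans _ _ _ (Rle_abs _) (re_le_Cmod _))].
  rewrite Re_plus, Re_RtoC; lra.
Qed.

Lemma INR_S_ge_1 (j : nat) : 1 <= INR (S j).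
Proof. rewrite S_INR. assert (H := pos_INR j). lra. Qed.

Lemma lattice_neq_0 (j : nat) (z : C) : 0 <= Re z -> (RtoC (INR (S j) ^ 2) + z)%C <> RtoC 0.
Proof.
  intros H. apply Cmod_gt_0. assert (Q := Cmod_lattice_ge (INR (S j) ^ 2) z H). assert (Q2 := INR_S_ge_1 j). nra.
Qed.

Lemma lattice_inv_bound (j m : nat) (z : C) :
  0 <= Re z -> Cmod (/ (RtoC (INR (S j) ^ 2) + z) ^ S m)%C <= / (INR j + 1) ^ 2.
Proof.
  intros H. assert (N := lattice_neq_0 j z H).
  rewrite Cmod_inv by (now apply Cpow_nz). rewrite Cmod_pow.
  assert (Q := Cmod_lattice_ge (INR (S j) ^ 2) z H). assert (Q2 := INR_S_ge_1 j). rewrite <- S_INR.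
  set (c := Cmod _) in *. set (n := INR (S j)) in *.
  apply Rinv_le_contravar; [nra |]. simpl pow in *.
  assert (1 <= c) by nra. assert (1 <= c ^ m) by (now apply pow_R1_Rle). nra.
Qed.

Lemma exp_term_bound (c D : R) (r : nat) :
  0 < c -> 0 < D -> exists B, 0 < B /\ forall j z,
    Cmod z <= D * (INR j + 1) -> c * (INR j + 1) <= Re z ->
    Cmod (z ^ r * Cexp (- z))%C <= B * / (INR j + 1) ^ 2.
Proof.
  intros Hc HD. destruct (pow_exp_bound c (r + 2) Hc) as [B [HB H]].
  exists (D ^ r * B). split; [apply Rmult_lt_0_compat; auto; now apply pow_lt |].
  intros j z H1 H2. assert (Hj := pos_INR j). specialize (H (INR j) Hj).
  rewrite Cmod_mult, Cmod_pow, Cmod_Cexp, Re_opp.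
  assert (A1 : Cmod z ^ r <= D ^ r * (1 + INR j) ^ r).
  { rewrite <- Rpow_mult_distr. apply pow_incr. split; [apply Cmod_ge_0 | lra]. }
  assert (A2 : exp (- Re z) <= exp (- (c * INR j))) by (apply exp_le; nra).
  assert (0 <= Cmod z ^ r) by (apply pow_le, Cmod_ge_0). assert (0 < exp (- Re z)) by apply exp_pos.
  apply Rle_trans with (D ^ r * (1 + INR j) ^ r * exp (- (c * INR j))).
  - apply Rmult_le_compat; lra.
  - rewrite !Rmult_assoc. apply Rmult_le_compat_l; [apply pow_le; lra |].
    apply (Rmult_le_reg_r ((INR j + 1) ^ 2)); [apply pow_lt; lra |].
    rewrite (Rmult_assoc B), Rinv_l, Rmult_1_r by (apply pow_nonzero; lra).
    replace ((1 + INR j) ^ r * exp (- (c * INR j)) * (INR j + 1) ^ 2) with ((1 + INR j) ^ (r + 2) * exp (- (c * INR j)))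
      by (rewrite pow_add, (Rplus_comm (INR j) 1); ring). auto.
Qed.

(* sigma_r(a u) exp(-2 pi a u) (2 pi a u)^r *)
Definition exp_moment (a : C) (u : R) (r : nat) : C :=
  CSeries (fun j => let z := (RtoC (2 * PI * INR (S j)) * a * RtoC u)%C in z ^ r * Cexp (- z))%C.

Lemma exp_moment_bound (a : C) (lo hi : R) (r : nat) :
  0 < lo -> 0 < Re a -> exists B, 0 < B /\ forall j u, lo <= u <= hi ->
    Cmod (let z := (RtoC (2 * PI * INR (S j)) * a * RtoC u)%C in z ^ r * Cexp (- z))%C <= B * / (INR j + 1) ^ 2.
Proof.
  intros Hlo Ha. assert (P := PI_RGT_0). assert (Hc := Cmod_ge_0 a).
  destruct (exp_term_bound (2 * PI * Re a * lo) (2 * PI * (Cmod a + 1) * (Rabs hi + 1)) r) as [B [HB H]].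
  - mul_pos.
  - assert (Q := Rabs_pos hi). mul_pos.
  - exists B. split; auto. intros j u Hu. apply H.
    + rewrite !Cmod_mult, !Cmod_nneg by mul_nonneg.
      rewrite S_INR. assert (Hj := pos_INR j). assert (Q := Rle_abs hi).
      replace (2 * PI * (Cmod a + 1) * (Rabs hi + 1) * (INR j + 1)) with (2 * PI * (INR j + 1) * (Cmod a + 1) * (Rabs hi + 1)) by ring.
      apply Rmult_le_compat; try lra.
      * mul_nonneg.
      * apply Rmult_le_compat_l; [mul_nonneg | lra].
    + rewrite (Cmult_comm _ (RtoC u)), Re_scal, Re_scal, S_INR. assert (Hj := pos_INR j).
      replace (u * (2 * PI * (INR j + 1) * Re a)) with (2 * PI * Re a * (INR j + 1) * u) by ring.
      replace (2 * PI * Re a * lo * (INR j + 1)) with (2 * PI * Re a * (INR j + 1) * lo) by ring.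
      apply Rmult_le_compat_l; [| lra]. mul_nonneg.
Qed.

Lemma exp_moment_correct (a : C) (u : R) (r : nat) :
  0 < u -> 0 < Re a ->
  is_Cseries (fun j => let z := (RtoC (2 * PI * INR (S j)) * a * RtoC u)%C in z ^ r * Cexp (- z))%C (exp_moment a u r).
Proof.
  intros Hu Ha. destruct (exp_moment_bound a u u r Hu Ha) as [B [HB H]].
  eapply CSeries_correct; [intros n; apply H; lra |]. apply ex_series_scal_Rl, ex_series_inv_sqr.
Qed.

(** With z proportional to u, the operator u d/du maps z^r exp(-z) to r z^r exp(-z) - z^(r+1)
    exp(-z). *)
Lemma exp_moment_derive (a : C) (u : R) (r : nat) :
  0 < u -> 0 < Re a ->
  is_Cderive (fun u => exp_moment a u r) u (RtoC (/ u) * (RtoC (INR r) * exp_moment a u r - exp_moment a u (S r)))%C.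
Proof.
  intros Hu Ha.
  set (b := fun j => (RtoC (2 * PI * INR (S j)) * a)%C).
  assert (Hr : forall t, Rabs (t - u) < u / 2 -> u / 2 <= t <= 2 * u).
  { intros t Ht. apply Rabs_def2 in Ht. lra. }
  destruct (exp_moment_bound a (u / 2) (2 * u) r ltac:(lra) Ha) as [B1 [HB1 H1]].
  destruct (exp_moment_bound a (u / 2) (2 * u) (S r) ltac:(lra) Ha) as [B2 [HB2 H2]].
  eapply is_Cderive_eq.
  - apply (is_Cderive_CSeries (fun j t => (b j * RtoC t) ^ r * Cexp (- (b j * RtoC t)))%C
      (fun j t => RtoC (/ t) * (RtoC (INR r) * ((b j * RtoC t) ^ r * Cexp (- (b j * RtoC t))) - (b j * RtoC t) ^ S r * Cexp (- (b j * RtoC t))))%C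
      (fun j => 2 / u * (INR r * B1 + B2) * / (INR j + 1) ^ 2) u (u / 2)); [lra | | | apply ex_series_scal_Rl, ex_series_inv_sqr |].
    + intros j t Ht. specialize (Hr t Ht). assert (Ht0 : t <> 0) by lra. assert (Htc := RtoC_neq t Ht0).
      assert (L : is_Cderive (fun t => b j * RtoC t)%C t (b j)).
      { apply (is_Cderive_ext (fun t => b j * RtoC t + RtoC 0)%C); [intros; ring | apply is_Cderive_lin]. }
      eapply is_Cderive_eq.
      * apply (is_Cderive_mult (fun t => (b j * RtoC t) ^ r)%C (fun t => Cexp (- (b j * RtoC t)))%C).
        (* The derivative of the power is written r z^r / t, so that one formula also covers r =
           0. *)
        -- instantiate (1 := (RtoC (INR r) * RtoC (/ t) * (b j * RtoC t) ^ r)%C).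
           destruct r as [|r].
           ++ change (is_Cderive (fun _ => RtoC 1) t (RtoC 0 * RtoC (/ t) * RtoC 1)%C). eapply is_Cderive_eq; [apply is_Cderive_const | ring].
           ++ eapply is_Cderive_eq; [apply is_Cderive_pow; exact L |]. rewrite (Cpow_S _ r), RtoC_inv by auto. field. auto.
        -- apply is_Cderive_Cexp, is_Cderive_opp; exact L.
      * cbv beta. rewrite Cpow_S, RtoC_inv by auto. field. auto.
    + intros j t Ht. specialize (Hr t Ht). specialize (H1 j t Hr). specialize (H2 j t Hr). cbv zeta in H1, H2.
      fold (b j) in H1, H2. set (X1 := ((b j * RtoC t) ^ r * Cexp (- (b j * RtoC t)))%C) in *.
      set (X2 := ((b j * RtoC t) ^ S r * Cexp (- (b j * RtoC t)))%C) in *.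
      assert (Hi : 0 < / t) by (apply Rinv_0_lt_compat; lra).
      rewrite Cmod_mult, Cmod_nneg by lra.
      assert (Hi2 : / t <= 2 / u).
      { replace (2 / u) with (/ (u / 2)) by (field; lra). apply Rinv_le_contravar; lra. }
      assert (M : Cmod (RtoC (INR r) * X1 - X2)%C <= (INR r * B1 + B2) * / (INR j + 1) ^ 2).
      { eapply Rle_trans; [apply Cmod_triangle |]. rewrite Cmod_opp, Cmod_mult, Cmod_nneg by apply pos_INR.
        assert (INR r * Cmod X1 <= INR r * (B1 * / (INR j + 1) ^ 2)) by (apply Rmult_le_compat_l; [apply pos_INR | auto]). lra. }
      rewrite Rmult_assoc. apply Rmult_le_compat; [lra | apply Cmod_ge_0 | lra | exact M].
    + intros t Ht. specialize (Hr t Ht). exists (fun j => B1 * / (INR j + 1) ^ 2). split; [apply ex_series_scal_Rl, ex_series_inv_sqr |].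
      intros j. apply (H1 j t Hr).
  - apply is_Cseries_unique. apply is_Cseries_scal.
    apply (is_Cseries_ext (fun j => RtoC (INR r) * ((b j * RtoC u) ^ r * Cexp (- (b j * RtoC u))) + RtoC (-1) * ((b j * RtoC u) ^ S r * Cexp (- (b j * RtoC u))))%C).
    + intros j. ring.
    + replace (RtoC (INR r) * exp_moment a u r - exp_moment a u (S r))%C with (RtoC (INR r) * exp_moment a u r + RtoC (-1) * exp_moment a u (S r))%C by ring.
      apply is_Cseries_plus; apply is_Cseries_scal, exp_moment_correct; auto.
Qed.

(** Equivalently, l + 1/2 - (u/2) d/du raises l by one. This is the origin of the numbers B in the
    residue sum: they record repeated differentiation of the exponential part of coth. *)
Lemma basis_sum_derive (a : C) (u : R) (l : nat) :
  0 < u -> 0 < Re a ->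
  is_Cderive (fun u => basis_sum (exp_moment a u) 0 l) u
    (RtoC (/ u) * (RtoC (2 * INR l + 1) * basis_sum (exp_moment a u) 0 l - RtoC 2 * basis_sum (exp_moment a u) 0 (S l)))%C.
Proof.
  intros Hu Ha. rewrite basis_sum_S. unfold basis_sum.
  eapply is_Cderive_eq.
  - apply (is_Cderive_sum_n (fun r u => RtoC (basis_coef 0 l r) * exp_moment a u r)%C
      (fun r => RtoC (basis_coef 0 l r) * (RtoC (/ u) * (RtoC (INR r) * exp_moment a u r - exp_moment a u (S r))))%C).
    intros r Hr. apply is_Cderive_scal, exp_moment_derive; auto.
  - replace (RtoC (2 * INR l + 1) * sum_n (fun r => RtoC (basis_coef 0 l r) * exp_moment a u r) l - _)%C with
      (RtoC (2 * INR l + 1) * sum_n (fun r => RtoC (basis_coef 0 l r) * exp_moment a u r) l + RtoC (-2) *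
       sum_n (fun r => RtoC (basis_coef 0 l r) *
     (RtoC (1 - IZR 0 + INR l - (INR r + 1) / 2) * exp_moment a u r + RtoC (/ 2) * exp_moment a u (S r))) l)%C.
    2:{ replace (RtoC (-2)) with (- RtoC 2)%C by (rewrite <- RtoC_opp; reflexivity). cring. }
    rewrite <- !sum_n_Cscal, <- sum_n_Cplus, <- sum_n_Cscal. apply sum_n_ext. intros r.
    set (X := exp_moment a u r). set (Y := exp_moment a u (S r)).
    replace (RtoC (1 - IZR 0 + INR l - (INR r + 1) / 2)) with (RtoC (/ 2) * (RtoC (2 * INR l + 1) - RtoC (INR r)))%C
      by (rewrite <- RtoC_minus, <- RtoC_mult; f_equal; field).
    replace (RtoC (-2)) with (- RtoC 2)%C by (rewrite <- RtoC_opp; reflexivity).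
    rewrite (RtoC_inv 2) by lra. cfield.
Qed.

(** * Sums of inverse powers *)

(** The integral of (1 + x^2)^(-k-1) over the positive axis, by its recursion. It is the algebraic
    leading coefficient of the inverse-power sums and must agree with the main term at lambda =
    0. *)
Fixpoint lattice_coef (k : nat) : R :=
  match k with
  | O => PI / 2
  | S n => (INR n + / 2) / (INR n + 1) * lattice_coef n
  end.

Lemma lattice_coef_main (k : nat) : lattice_coef k = / 2 * main_coef1 (S k) 0 0.
Proof.
  assert (P := PI_RGT_0). unfold main_coef1.
  induction k as [|k IH].
  - simpl. rewrite rGamma_1, half_gamma_0.
    replace (sqrt PI * sqrt PI) with PI by (symmetry; apply sqrt_sqrt; lra). field.
  - change (lattice_coef (S k)) with ((INR k + / 2) / (INR k + 1) * lattice_coef k). rewrite IH.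
    replace (Z.of_nat (S (S k)) - 0 - 1 - Z.of_nat 0)%Z with (Z.of_nat (S k) - 0 - 1 - Z.of_nat 0 + 1)%Z by lia.
    rewrite (half_gamma_rec (Z.of_nat (S k) - 0 - 1 - Z.of_nat 0)), (rGamma_INR_rec (S k)).
    replace (IZR (Z.of_nat (S k) - 0 - 1 - Z.of_nat 0)) with (INR k) by (rewrite INR_IZR_INZ; f_equal; lia).
    assert (Hk := pos_INR k). rewrite (S_INR k). simpl (INR (fact 0)). field. lra.
Qed.

Lemma inverse_power_sum_derive (a : C) (u : R) (k : nat) :
  0 < u -> right_sector a ->
  is_Cderive (fun u => CSeries (fun j => / (RtoC (INR (S j) ^ 2) + (a * RtoC u) * (a * RtoC u)) ^ S k)%C) u
   (- RtoC (2 * INR (S k) * u) * (a * a) * CSeries (fun j => / (RtoC (INR (S j) ^ 2) + (a * RtoC u) * (a * RtoC u)) ^ S (S k)))%C.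
Proof.
  intros Hu Ha.
  assert (Re0 : forall t, 0 < t -> 0 <= Re (a * RtoC t * (a * RtoC t))%C).
  { intros t Ht. apply Rlt_le, (right_sector_scal a t Ht Ha). }
  assert (Hr : forall t, Rabs (t - u) < u / 2 -> 0 < t <= 2 * u) by (intros t Ht; apply Rabs_def2 in Ht; lra).
  eapply is_Cderive_eq.
  - apply (is_Cderive_CSeries (fun j t => / (RtoC (INR (S j) ^ 2) + (a * RtoC t) * (a * RtoC t)) ^ S k)%C
      (fun j t => - RtoC (2 * INR (S k) * t) * (a * a) * / (RtoC (INR (S j) ^ 2) + (a * RtoC t) * (a * RtoC t)) ^ S (S k))%C
      (fun j => 2 * INR (S k) * (2 * u) * (Cmod a * Cmod a) * / (INR j + 1) ^ 2) u (u / 2)); [lra | | | apply ex_series_scal_Rl, ex_series_inv_sqr |].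
    + intros j t Ht. destruct (Hr t Ht) as [Ht0 _]. assert (N := lattice_neq_0 j _ (Re0 t Ht0)).
      assert (L : is_Cderive (fun t => a * RtoC t)%C t a).
      { apply (is_Cderive_ext (fun t => a * RtoC t + RtoC 0)%C); [intros; ring | apply is_Cderive_lin]. }
      set (v := (RtoC (INR (S j) ^ 2) + a * RtoC t * (a * RtoC t))%C) in *.
      eapply is_Cderive_eq.
      * apply is_Cderive_inv; [apply Cpow_nz; exact N |]. apply is_Cderive_pow.
        apply is_Cderive_plus; [apply is_Cderive_const | apply is_Cderive_mult; exact L].
      * cbv beta. fold v. assert (N2 := Cpow_nz v k N). rewrite !Cpow_S, !RtoC_mult. field. auto.
    + intros j t Ht. destruct (Hr t Ht) as [Ht0 Ht1]. rewrite !Cmod_mult, Cmod_opp, Cmod_nneg by mul_nonneg.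
      assert (Hk := pos_INR (S k)). assert (Hca := Cmod_ge_0 a).
      apply Rmult_le_compat; [| apply Cmod_ge_0 | | apply (lattice_inv_bound j (S k)), Re0; auto].
      * mul_nonneg.
      * apply Rmult_le_compat_r; [nra |]. apply Rmult_le_compat_l; lra.
    + intros t Ht. destruct (Hr t Ht) as [Ht0 Ht1]. exists (fun j => / (INR j + 1) ^ 2). split; [apply ex_series_inv_sqr |].
      intros j. apply lattice_inv_bound, Re0; auto.
  - apply is_Cseries_unique. apply is_Cseries_scal.
    eapply CSeries_correct; [intros j; apply lattice_inv_bound, Re0; auto | apply ex_series_inv_sqr].
Qed.

(* Differentiating the partial fractions of coth along the ray through [a]. *)
Lemma inverse_power_sum (a : C) (k : nat) : right_sector a -> forall u, 0 < u ->
  CSeries (fun j => / (RtoC (INR (S j) ^ 2) + (a * RtoC u) * (a * RtoC u)) ^ S k)%C =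
  ((RtoC (lattice_coef k) + RtoC (PI / INR (fact k)) * basis_sum (exp_moment a u) 0 k) / (a * RtoC u) ^ S (2 * k)
   - / (RtoC 2 * (a * RtoC u) ^ (2 * S k)))%C.
Proof.
  intros Ha. assert (P := PI_RGT_0). assert (H2 : RtoC 2 <> RtoC 0) by (apply RtoC_neq; lra).
  induction k as [|k IH]; intros u Hu.
  - assert (Hw := right_sector_scal a u Hu Ha). set (w := (a * RtoC u)%C) in *.
    destruct Hw as [Hw1 Hw2]. assert (Hw0 := ne_0_of_Re w Hw1).
    assert (T : is_Cseries (fun j => / (RtoC (INR (S j) ^ 2) + w * w) ^ 1)%C
      (RtoC PI / (RtoC 2 * w) - / (RtoC 2 * (w * w))
     + RtoC PI / w * (Cexp (- (RtoC (2 * PI) * w)) / (RtoC 1 - Cexp (- (RtoC (2 * PI) * w)))))%C).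
    { apply (is_Cseries_ext (fun j => / (RtoC (INR (S j) ^ 2) + w * w))%C); [intros; simpl; now rewrite Cmult_1_r |].
      apply is_Cseries_iff, coth_series; auto. }
    rewrite (is_Cseries_unique _ _ T).
    assert (Y : exp_moment a u 0 = (Cexp (- (RtoC (2 * PI) * w)) / (RtoC 1 - Cexp (- (RtoC (2 * PI) * w))))%C).
    { rewrite <- geometric_Cseries.
      - apply CSeries_ext. intros j. cbv zeta. rewrite <- Cexp_INR. simpl (_ ^ 0)%C. rewrite Cmult_1_l. f_equal. unfold w. rewrite !RtoC_mult; ring.
      - rewrite Cmod_Cexp, Re_opp, Re_scal, <- exp_0. apply exp_increasing. nra. }
    unfold basis_sum. rewrite sum_O, Y. simpl basis_coef. simpl lattice_coef. simpl fact. simpl (INR 1).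
    rewrite !Rdiv_1_r, RtoC_div by lra.
    set (e := Cexp _). unfold Cdiv. simpl Cpow.
    set (e' := (e * / (RtoC 1 - e))%C). field; auto.
  - assert (Hw := right_sector_scal a u Hu Ha).
    set (G := fun u => CSeries (fun j => / (RtoC (INR (S j) ^ 2) + (a * RtoC u) * (a * RtoC u)) ^ S k)%C).
    assert (D1 := inverse_power_sum_derive a u k Hu Ha). destruct Ha as [Ha1 Ha2].
    assert (Ha0 := ne_0_of_Re a Ha1). assert (Hu0 := RtoC_neq u ltac:(lra)).
    assert (Hw0 := ne_0_of_Re _ (proj1 Hw)).
    assert (L : is_Cderive (fun t => a * RtoC t)%C u a).
    { apply (is_Cderive_ext (fun t => a * RtoC t + RtoC 0)%C); [intros; ring | apply is_Cderive_lin]. }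
    assert (DQ := basis_sum_derive a u k Hu Ha1).
    assert (D2 : is_Cderive G u
      (RtoC (PI / INR (fact k)) * (RtoC (/ u) * (RtoC (2 * INR k + 1) * basis_sum (exp_moment a u) 0 k - RtoC 2 * basis_sum (exp_moment a u) 0 (S k))) * / (a * RtoC u) ^ S (2 * k)
       + (RtoC (lattice_coef k) + RtoC (PI / INR (fact k)) * basis_sum (exp_moment a u) 0 k) * (- (RtoC (INR (S (2 * k))) * (a * RtoC u) ^ (2 * k) * a) / ((a * RtoC u) ^ S (2 * k) * (a * RtoC u) ^ S (2 * k)))
       - / RtoC 2 * (- (RtoC (INR (S (S (2 * k)))) * (a * RtoC u) ^ (S (2 * k)) * a) / ((a * RtoC u) ^ S (S (2 * k)) * (a * RtoC u) ^ S (S (2 * k)))))%C).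
    { apply (is_Cderive_ext_loc (fun u => (RtoC (lattice_coef k) + RtoC (PI / INR (fact k)) * basis_sum (exp_moment a u) 0 k) * / (a * RtoC u) ^ S (2 * k)
          - / RtoC 2 * / (a * RtoC u) ^ S (S (2 * k)))%C).
      - exists (mkposreal u Hu). intros t Ht. change (Rabs (t - u) < u) in Ht. apply Rabs_def2 in Ht.
        unfold G. rewrite IH by lra. replace (2 * S k)%nat with (S (S (2 * k))) by lia.
        assert (Hwt := ne_0_of_Re _ (proj1 (right_sector_scal a t ltac:(lra) (conj Ha1 Ha2)))).
        assert (N1 := Cpow_nz _ (S (S (2 * k))) Hwt). assert (N2 := Cpow_nz _ (S (2 * k)) Hwt).
        field. auto.
      - apply is_Cderive_minus; [eapply is_Cderive_eq; [apply is_Cderive_mult |] |].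
        + apply is_Cderive_plus; [apply is_Cderive_const | apply is_Cderive_scal; exact DQ].
        + apply is_Cderive_inv; [now apply Cpow_nz | apply is_Cderive_pow; exact L].
        + cbv beta. rewrite Cplus_0_l. reflexivity.
        + apply is_Cderive_scal, is_Cderive_inv; [now apply Cpow_nz | apply is_Cderive_pow; exact L]. }
    (* The termwise derivative contains the next inverse-power sum, the derivative of the closed
       form does not; equating the two allows that sum to be solved for. *)
    assert (E := is_Cderive_unique _ _ _ _ D1 D2). clear D1 D2 DQ IH G.
    set (X := CSeries _) in E |- *. set (w := (a * RtoC u)%C) in *.
    assert (NW : forall n, (w ^ n)%C <> RtoC 0) by (intros; now apply Cpow_nz).
    change (lattice_coef (S k)) with ((INR k + / 2) / (INR k + 1) * lattice_coef k).
    set (q0 := basis_sum (exp_moment a u) 0 k) in *. set (q1 := basis_sum (exp_moment a u) 0 (S k)) in *.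
    rewrite fact_simpl, mult_INR. rewrite (S_INR k) in *.
    assert (Hk := pos_INR k). assert (HF := INR_fact_neq_0 k).
    replace (S (2 * S k)) with (S (S (S (2 * k)))) by lia. replace (2 * S (S k))%nat with (S (S (S (S (2 * k))))) by lia.
    assert (NF := RtoC_neq _ HF). assert (NK : RtoC (INR k + 1) <> RtoC 0) by (apply RtoC_neq; lra).
    replace X with ((- RtoC (2 * (INR k + 1) * u) * (a * a) * X) * (- / (RtoC (2 * (INR k + 1) * u) * (a * a))))%C.
    2:{ assert (NKU : RtoC (2 * (INR k + 1) * u) <> RtoC 0) by (apply RtoC_neq; assert (0 < (INR k + 1) * u) by nra; lra).
        field. auto. }
    rewrite E.
    replace (RtoC ((INR k + / 2) / (INR k + 1) * lattice_coef k)) with ((RtoC (INR (S (2 * k))) / (RtoC 2 * RtoC (INR k + 1))) * RtoC (lattice_coef k))%C.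
    2:{ rewrite <- RtoC_mult, <- RtoC_div, <- RtoC_mult by lra. f_equal. f_equal. rewrite S_INR, mult_INR, INR_two. field. lra. }
    replace (2 * INR k + 1) with (INR (S (2 * k))) by (rewrite S_INR, mult_INR, INR_two; ring).
    replace (RtoC (INR (S (S (2 * k))))) with (RtoC 2 * RtoC (INR k + 1))%C by (rewrite <- RtoC_mult; f_equal; rewrite !S_INR, mult_INR, INR_two; ring).
    replace (PI / ((INR k + 1) * INR (fact k))) with (PI * / INR (fact k) * / (INR k + 1)) by (field; lra).
    unfold Rdiv. rewrite !RtoC_mult, !RtoC_inv by (auto; lra).
    rewrite !Cpow_S. assert (N := NW (2 * k)%nat). unfold w in *. set (W := ((a * RtoC u) ^ (2 * k))%C) in *.
    field. auto 10.
Qed.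

(** * Principal powers *)

Lemma Re_over_Cmod (z : C) : z <> RtoC 0 -> -1 <= Re z / Cmod z <= 1.
Proof.
  intros H. assert (Hz : 0 < Cmod z) by (now apply Cmod_gt_0).
  assert (Q := proj1 (Rabs_le_between _ _) (re_le_Cmod z)).
  split; apply (Rmult_le_reg_r (Cmod z)); auto; unfold Rdiv; rewrite Rmult_assoc, Rinv_l by lra; lra.
Qed.

Lemma Cexp_Clog (z : C) : z <> RtoC 0 -> Cexp (Clog z) = z.
Proof.
  intros H. assert (Hz : 0 < Cmod z) by (now apply Cmod_gt_0).
  assert (HB := Re_over_Cmod z H). assert (HM := Cmod2_alt z).
  assert (S1 : sin (acos (Re z / Cmod z)) = Rabs (Im z) / Cmod z).
  { rewrite sin_acos by auto.
    replace (1 - (Re z / Cmod z)²) with ((Rabs (Im z) / Cmod z)²).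
    - apply sqrt_Rsqr. apply Rmult_le_pos; [apply Rabs_pos | apply Rlt_le, Rinv_0_lt_compat; auto].
    - unfold Rsqr, Rdiv.
      transitivity (Rabs (Im z) * Rabs (Im z) * / Cmod z * / Cmod z); [ring |].
      rewrite <- Rabs_mult, Rabs_pos_eq by nra.
      replace (Im z * Im z) with (Cmod z ^ 2 - Re z * Re z) by (rewrite HM; ring). field. lra. }
  apply C_eq_parts; unfold Cexp, Clog, Carg; simpl; rewrite exp_ln by auto; destruct (Rle_dec 0 (Im z)).
  - rewrite cos_acos by auto. field; lra.
  - rewrite cos_neg, cos_acos by auto. field; lra.
  - rewrite S1, Rabs_pos_eq by auto. field; lra.
  - rewrite sin_neg, S1, Rabs_left by lra. field; lra.
Qed.

Lemma Cpower_plus (z : C) (s t : R) : Cpower z (s + t) = (Cpower z s * Cpower z t)%C.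
Proof. unfold Cpower. rewrite <- Cexp_plus, RtoC_plus. f_equal; ring. Qed.

Lemma Cpower_INR (z : C) (n : nat) : z <> RtoC 0 -> Cpower z (INR n) = (z ^ n)%C.
Proof. intros H. unfold Cpower. now rewrite Cexp_INR, Cexp_Clog. Qed.

Lemma Cpower_0 (z : C) : Cpower z 0 = RtoC 1.
Proof. unfold Cpower. rewrite <- Cexp_0. f_equal; ring. Qed.

Lemma Cpower_1 (z : C) : z <> RtoC 0 -> Cpower z 1 = z.
Proof. intros H. change 1 with (INR 1). rewrite Cpower_INR by auto. simpl; ring. Qed.

Lemma Cpower_opp (z : C) (s : R) : (Cpower z (- s) * Cpower z s)%C = RtoC 1.
Proof. rewrite <- Cpower_plus. replace (- s + s) with 0 by ring. apply Cpower_0. Qed.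

Lemma Cmod_Cpower (z : C) (s : R) : Cmod (Cpower z s) = Rpower (Cmod z) s.
Proof. unfold Cpower. rewrite Cmod_Cexp, Re_scal. reflexivity. Qed.

Lemma Carg_polar (rho th : R) : 0 < rho -> - PI < th < PI -> Carg (rho * cos th, rho * sin th) = th.
Proof.
  intros Hr Ht.
  assert (EM : Cmod (rho * cos th, rho * sin th) = rho).
  { unfold Cmod; simpl. replace (_ + _) with (rho²).
    - apply sqrt_Rsqr; lra.
    - assert (Q := sin2_cos2 th). unfold Rsqr in *.
      transitivity (rho * rho * (sin th * sin th + cos th * cos th)); [rewrite Q |]; ring. }
  unfold Carg. rewrite EM. simpl. replace (rho * cos th / rho) with (cos th) by (field; lra).
  destruct (Rle_dec 0 (rho * sin th)) as [H | H].
  - assert (Hs : 0 <= sin th) by (apply (Rmult_le_reg_l rho); lra).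
    apply acos_cos. split; [| lra]. destruct (Rle_lt_dec 0 th); auto. exfalso.
    assert (0 < sin (- th)) by (apply sin_gt_0; lra). rewrite sin_neg in H0. lra.
  - assert (Hs : sin th < 0) by nra.
    rewrite <- cos_neg, acos_cos; [ring |]. split; [| lra].
    destruct (Rle_lt_dec th 0); [lra |]. exfalso. assert (0 < sin th) by (apply sin_gt_0; lra). lra.
Qed.

Lemma polar_form (z : C) : z <> RtoC 0 -> z = (Cmod z * cos (Carg z), Cmod z * sin (Carg z)).
Proof.
  intros H. rewrite <- (Cexp_Clog z H) at 1. unfold Cexp, Clog; simpl.
  now rewrite exp_ln by (now apply Cmod_gt_0).
Qed.

(** With t = arg a, Re(a^2) = |a|^2 cos 2t, and |t| <= pi/4 - eps gives cos 2t >= sin 2 eps. This is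
    the quantitative form of the closed subsector. *)
Lemma Carg_sector (a : C) (eps : R) :
  a <> RtoC 0 -> 0 < eps -> Rabs (Carg a) <= PI / 4 - eps ->
  0 < Re a /\ 0 < sin (2 * eps) /\ sin (2 * eps) * Cmod a ^ 2 <= Re (a * a)%C.
Proof.
  intros Ha He Hc. assert (P := PI_RGT_0). assert (Hm : 0 < Cmod a) by (now apply Cmod_gt_0).
  assert (Hp := Rabs_pos (Carg a)).
  assert (Hs : 0 < sin (2 * eps)) by (apply sin_gt_0; lra).
  assert (E := polar_form a Ha). set (t := Carg a) in *. set (r := Cmod a) in *.
  assert (Hct : cos (2 * eps - PI / 2) <= cos (2 * t)).
  { rewrite <- (cos_neg (2 * eps - PI / 2)).
    destruct (Rle_lt_dec 0 t).
    - rewrite Rabs_pos_eq in Hc by auto. apply cos_decr_1; lra.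
    - rewrite Rabs_left in Hc by auto. rewrite <- (cos_neg (2 * t)). apply cos_decr_1; lra. }
  replace (cos (2 * eps - PI / 2)) with (sin (2 * eps)) in Hct.
  2:{ rewrite cos_minus, cos_PI2, sin_PI2; ring. }
  split; [| split; auto].
  - rewrite E. simpl. apply Rmult_lt_0_compat; auto. apply cos_gt_0; unfold Rabs in Hc; destruct (Rcase_abs t); lra.
  - rewrite E. rewrite Re_mult. simpl. replace (r * cos t * (r * cos t) - r * sin t * (r * sin t)) with (r ^ 2 * cos (2 * t)).
    + rewrite Rmult_comm. apply Rmult_le_compat_l; [nra | simpl; lra].
    + rewrite cos_2a; ring.
Qed.

(** For a in the right half-plane the argument -2 arg a lies in (-pi, pi), so the principal
    logarithm of c / a^2 crosses no branch cut. *)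
Lemma Clog_inv_sqr (a : C) (c : R) :
  a <> RtoC 0 -> 0 < c -> - PI / 2 < Carg a < PI / 2 ->
  Clog (RtoC c / (a * a))%C = (RtoC (ln c) - RtoC 2 * Clog a)%C.
Proof.
  intros Ha Hc Ht. assert (Hm : 0 < Cmod a) by (now apply Cmod_gt_0).
  assert (Haa : (a * a)%C <> RtoC 0) by (intro E; apply Ha; destruct (Ceq_dec a (RtoC 0)); auto; exfalso; revert E; now apply Cmult_neq_0).
  set (t := Carg a) in *. set (r := Cmod a) in *.
  assert (E : (RtoC c / (a * a))%C = (c / r ^ 2 * cos (- 2 * t), c / r ^ 2 * sin (- 2 * t))).
  { assert (H1 : Cexp (RtoC (ln c) - RtoC 2 * Clog a)%C = (RtoC c / (a * a))%C).
    { replace (RtoC (ln c) - RtoC 2 * Clog a)%C with (RtoC (ln c) + (- (Clog a) + - Clog a))%C by ring.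
      rewrite !Cexp_plus, Cexp_RtoC, exp_ln, !Cexp_opp_inv, Cexp_Clog by auto. field; auto. }
    rewrite <- H1. unfold Cexp, Clog; simpl. fold t. fold r.
    assert (X : exp (ln c + - (2 * ln r - 0 * t)) = c / r ^ 2).
    { rewrite exp_plus, exp_Ropp, exp_ln by auto. replace (2 * ln r - 0 * t) with (ln r + ln r) by ring.
      rewrite exp_plus, exp_ln by auto. field. lra. }
    rewrite X. f_equal; f_equal; f_equal; ring. }
  assert (Hcr : 0 < c / r ^ 2) by (apply Rdiv_lt_0_compat; auto; nra).
  unfold Clog at 1. rewrite E at 2. rewrite Carg_polar by (auto; lra).
  rewrite Cmod_div, Cmod_nneg, Cmod_mult by (auto; lra). fold r.
  unfold Rdiv. rewrite ln_mult, ln_Rinv, ln_mult by (auto; try apply Rinv_0_lt_compat; nra).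
  apply C_eq_parts; unfold Clog; simpl; fold t; fold r; ring.
Qed.

Lemma Cpower_inv_sqr (a : C) (c s : R) :
  a <> RtoC 0 -> 0 < c -> - PI / 2 < Carg a < PI / 2 ->
  Cpower (RtoC c / (a * a))%C s = (RtoC (Rpower c s) * Cpower a (- (2 * s)))%C.
Proof.
  intros Ha Hc Ht. unfold Cpower. rewrite Clog_inv_sqr by auto.
  unfold Rpower. rewrite <- Cexp_RtoC, <- Cexp_plus. f_equal. rewrite RtoC_opp, !RtoC_mult. ring.
Qed.

(** * The series S as a function of lambda *)

Definition lattice_term (m : nat) (p : Z) (a : C) (lambda : R) (j : nat) : C :=
  (RtoC (Rpower (INR (S j)) (2 * IZR p)) * Cexp (- (RtoC (lambda * INR (S j) ^ 2) * / (a * a)))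
   * / (RtoC (INR (S j) ^ 2) + a * a) ^ m)%C.

Definition lattice_sum (m : nat) (p : Z) (a : C) (lambda : R) : C := CSeries (lattice_term m p a lambda).

Lemma right_sector_neq_0 (a : C) : right_sector a -> a <> RtoC 0.
Proof. intros [H _]; now apply ne_0_of_Re. Qed.

Lemma Ssum_lattice_sum (m : nat) (p : Z) (a : C) (lambda : R) :
  right_sector a -> Ssum (INR m) (2 * IZR p) a lambda = lattice_sum m p a lambda.
Proof.
  intros Ha. assert (Ha0 := right_sector_neq_0 a Ha). apply CSeries_ext. intros j. unfold lattice_term.
  replace (a ^ 2)%C with (a * a)%C by (simpl; ring).
  rewrite Cpower_INR by (apply lattice_neq_0, Rlt_le, Ha). reflexivity.
Qed.

(** The denominator of order m is expanded by n^2 + a^2; the part n^2 raises p by one. *)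
Lemma lattice_term_rec (m : nat) (p : Z) (a : C) (lambda : R) (j : nat) :
  right_sector a ->
  lattice_term m p a lambda j = (lattice_term (S m) (p + 1) a lambda j + a * a * lattice_term (S m) p a lambda j)%C.
Proof.
  intros Ha. unfold lattice_term. assert (N := lattice_neq_0 j _ (Rlt_le _ _ (proj2 Ha))).
  assert (Hn := INR_S_pos j).
  rewrite plus_IZR, Rmult_plus_distr_l, Rmult_1_r, Rpower_plus.
  replace (Rpower (INR (S j)) 2) with (INR (S j) ^ 2) by (rewrite <- (Rpower_pow 2) by auto; reflexivity).
  rewrite (RtoC_mult (Rpower (INR (S j)) (2 * IZR p))). assert (N2 := Cpow_nz _ m N). rewrite Cpow_S.
  set (e := Cexp _). set (v := (RtoC (INR (S j) ^ 2) + a * a)%C) in *.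
  replace (RtoC (INR (S j) ^ 2)) with (v - a * a)%C by (unfold v; ring). field. auto.
Qed.

Lemma inv_sqr_Re (a : C) : right_sector a -> 0 < Re (/ (a * a))%C.
Proof.
  intros [_ H]. destruct (a * a)%C as [u v]; simpl in *. apply Rdiv_lt_0_compat; nra.
Qed.

(** The bound is uniform for lambda away from 0, as termwise differentiation requires. At 0 itself
    it is lost for general p, which is why limits at 0 are taken only in two special families. *)
Lemma lattice_term_bound (m : nat) (p : Z) (a : C) (lo : R) :
  right_sector a -> 0 < lo -> exists B, 0 < B /\ forall lambda j, lo <= lambda ->
    Cmod (lattice_term m p a lambda j) <= B * / (INR j + 1) ^ 2.
Proof.
  intros Ha Hlo. assert (Hk := inv_sqr_Re a Ha). set (k := Re (/ (a * a))%C) in *.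
  set (q := (2 * Z.abs_nat p)%nat).
  destruct (pow_gauss_bound (lo * k) (q + 2) ltac:(nra)) as [B [HB H]].
  exists B. split; auto. intros lambda j Hl. assert (Hn := INR_S_ge_1 j).
  unfold lattice_term. rewrite !Cmod_mult, Cmod_nneg, Cmod_Cexp, Re_opp, Re_scal by (apply Rlt_le, exp_pos). fold k.
  assert (A1 : Rpower (INR (S j)) (2 * IZR p) <= (1 + INR (S j)) ^ q).
  { apply Rle_trans with (INR (S j) ^ q); [| apply pow_incr; lra].
    rewrite <- Rpower_pow by lra. apply Rle_Rpower; auto. unfold q. rewrite mult_INR, INR_two.
    apply Rmult_le_compat_l; [lra |]. rewrite INR_IZR_INZ. apply IZR_le. lia. }
  assert (A2 : Cmod (/ (RtoC (INR (S j) ^ 2) + a * a) ^ m)%C <= 1).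
  { assert (N := lattice_neq_0 j _ (Rlt_le _ _ (proj2 Ha))). rewrite Cmod_inv by (now apply Cpow_nz). rewrite Cmod_pow.
    assert (Q := Cmod_lattice_ge (INR (S j) ^ 2) _ (Rlt_le _ _ (proj2 Ha))).
    rewrite <- Rinv_1. apply Rinv_le_contravar; [lra |]. apply pow_R1_Rle. nra. }
  assert (A3 : exp (- (lambda * INR (S j) ^ 2 * k)) <= exp (- (lo * k * INR (S j) ^ 2))).
  { apply exp_le. assert (0 < INR (S j) ^ 2) by nra. assert (0 < INR (S j) ^ 2 * k) by nra. nra. }
  specialize (H (INR (S j)) ltac:(lra)).
  assert (0 < Rpower (INR (S j)) (2 * IZR p)) by apply exp_pos.
  assert (0 < exp (- (lambda * INR (S j) ^ 2 * k))) by apply exp_pos.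
  assert (0 <= (1 + INR (S j)) ^ q) by (apply pow_le; lra).
  apply Rle_trans with ((1 + INR (S j)) ^ q * exp (- (lo * k * INR (S j) ^ 2)) * 1).
  - apply Rmult_le_compat; auto; [nra | apply Cmod_ge_0 |]. apply Rmult_le_compat; lra.
  - rewrite Rmult_1_r. rewrite <- S_INR.
    apply (Rmult_le_reg_r ((INR (S j)) ^ 2)); [nra |].
    rewrite (Rmult_assoc B), Rinv_l, Rmult_1_r by nra.
    eapply Rle_trans; [| exact H]. rewrite pow_add.
    assert (0 <= exp (- (lo * k * INR (S j) ^ 2))) by apply Rlt_le, exp_pos.
    replace ((1 + INR (S j)) ^ q * (1 + INR (S j)) ^ 2 * exp (- (lo * k * INR (S j) ^ 2))) with
      ((1 + INR (S j)) ^ q * exp (- (lo * k * INR (S j) ^ 2)) * (1 + INR (S j)) ^ 2) by ring.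
    apply Rmult_le_compat_l; [nra |]. apply pow_incr; lra.
Qed.

Lemma lattice_sum_correct (m : nat) (p : Z) (a : C) (lambda : R) :
  right_sector a -> 0 < lambda -> is_Cseries (lattice_term m p a lambda) (lattice_sum m p a lambda).
Proof.
  intros Ha Hl. destruct (lattice_term_bound m p a lambda Ha Hl) as [B [HB H]].
  eapply CSeries_correct; [intros j; apply H; lra | apply ex_series_scal_Rl, ex_series_inv_sqr].
Qed.

Lemma lattice_sum_rec (m : nat) (p : Z) (a : C) (lambda : R) :
  right_sector a -> 0 < lambda ->
  lattice_sum m p a lambda = (lattice_sum (S m) (p + 1) a lambda + a * a * lattice_sum (S m) p a lambda)%C.
Proof.
  intros Ha Hl. apply is_Cseries_unique.
  apply (is_Cseries_ext (fun j => lattice_term (S m) (p + 1) a lambda j + a * a * lattice_term (S m) p a lambda j)%C).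
  - intros j. symmetry. now apply lattice_term_rec.
  - apply is_Cseries_plus; [| apply is_Cseries_scal]; now apply lattice_sum_correct.
Qed.

Lemma lattice_term_derive (m : nat) (p : Z) (a : C) (lambda : R) (j : nat) :
  right_sector a ->
  is_Cderive (fun t => lattice_term m p a t j) lambda (- / (a * a) * lattice_term m (p + 1) a lambda j)%C.
Proof.
  intros Ha. assert (Hn := INR_S_pos j). unfold lattice_term.
  set (n := INR (S j)) in *. set (c := (/ (RtoC (n ^ 2) + a * a) ^ m)%C). set (K := Rpower n (2 * IZR p)).
  apply (is_Cderive_ext (fun t => (RtoC K * c) * Cexp ((RtoC (- n ^ 2) * / (a * a)) * RtoC t))%C).
  { intros t. replace (RtoC (- n ^ 2) * / (a * a) * RtoC t)%C with (- (RtoC (t * n ^ 2) * / (a * a)))%C by (rewrite RtoC_opp, RtoC_mult; ring). ring. }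
  eapply is_Cderive_eq; [apply is_Cderive_scal, is_Cderive_exp_lin |].
  rewrite plus_IZR, Rmult_plus_distr_l, Rmult_1_r, Rpower_plus. fold K.
  replace (Rpower n 2) with (n ^ 2) by (rewrite <- (Rpower_pow 2) by auto; reflexivity).
  replace (RtoC (- n ^ 2) * / (a * a) * RtoC lambda)%C with (- (RtoC (lambda * n ^ 2) * / (a * a)))%C by (rewrite RtoC_opp, RtoC_mult; ring).
  rewrite RtoC_opp, (RtoC_mult K). ring.
Qed.

Lemma lattice_sum_derive (m : nat) (p : Z) (a : C) (lambda : R) :
  right_sector a -> 0 < lambda ->
  is_Cderive (lattice_sum m p a) lambda (- / (a * a) * lattice_sum m (p + 1) a lambda)%C.
Proof.
  intros Ha Hl. assert (Hr : forall t, Rabs (t - lambda) < lambda / 2 -> lambda / 2 <= t) by (intros t Ht; apply Rabs_def2 in Ht; lra).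
  destruct (lattice_term_bound m p a (lambda / 2) Ha ltac:(lra)) as [B1 [HB1 H1]].
  destruct (lattice_term_bound m (p + 1) a (lambda / 2) Ha ltac:(lra)) as [B2 [HB2 H2]].
  eapply is_Cderive_eq.
  - apply (is_Cderive_CSeries (fun j t => lattice_term m p a t j) (fun j t => - / (a * a) * lattice_term m (p + 1) a t j)%C
      (fun j => Cmod (- / (a * a))%C * (B2 * / (INR j + 1) ^ 2)) lambda (lambda / 2)); [lra | | | |].
    + intros j t Ht. now apply lattice_term_derive.
    + intros j t Ht. rewrite Cmod_mult. apply Rmult_le_compat_l; [apply Cmod_ge_0 |]. apply H2; auto.
    + apply ex_series_scal_Rl, ex_series_scal_Rl, ex_series_inv_sqr.
    + intros t Ht. exists (fun j => B1 * / (INR j + 1) ^ 2). split; [apply ex_series_scal_Rl, ex_series_inv_sqr |].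
      intros j; apply H1; auto.
  - apply is_Cseries_unique, is_Cseries_scal. now apply lattice_sum_correct.
Qed.

Lemma lattice_term_lim (m : nat) (p : Z) (a : C) (j : nat) :
  right_sector a ->
  is_Clim (at_right 0) (fun t => lattice_term m p a t j) (RtoC (Rpower (INR (S j)) (2 * IZR p)) * / (RtoC (INR (S j) ^ 2) + a * a) ^ m)%C.
Proof.
  intros Ha. eapply is_Clim_eq; [eapply (is_Clim_of_derive (fun t => lattice_term m p a t j)), lattice_term_derive; auto |].
  unfold lattice_term. rewrite Rmult_0_l. replace (- (RtoC 0 * / (a * a)))%C with (RtoC 0) by ring. rewrite Cexp_0. ring.
Qed.

Lemma lattice_exp_le_1 (a : C) (lambda : R) (j : nat) :
  right_sector a -> 0 < lambda -> Cmod (Cexp (- (RtoC (lambda * INR (S j) ^ 2) * / (a * a)))%C) <= 1.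
Proof.
  intros Ha Hl. assert (Hk := inv_sqr_Re a Ha). rewrite Cmod_Cexp, Re_opp, Re_scal, <- exp_0. apply exp_le.
  assert (0 < INR (S j) ^ 2) by (assert (Q := INR_S_pos j); nra). assert (0 < lambda * INR (S j) ^ 2) by nra. nra.
Qed.

(** For p = 0 the inverse powers alone are summable and the exponentials have modulus at most 1, so
    there is a majorant independent of lambda. *)
Lemma lattice_sum_lim_0 (m : nat) (a : C) :
  right_sector a ->
  is_Clim (at_right 0) (lattice_sum (S m) 0 a)
    ((RtoC (lattice_coef m) + RtoC (PI / INR (fact m)) * basis_sum (exp_moment a 1) 0 m) / a ^ S (2 * m)
   - / (RtoC 2 * a ^ (2 * S m)))%C.
Proof.
  intros Ha. assert (E := inverse_power_sum a m Ha 1 Rlt_0_1). rewrite Cmult_1_r in E. rewrite <- E.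
  assert (P1 : forall j, Rpower (INR (S j)) (2 * IZR 0) = 1).
  { intros j. replace (2 * IZR 0) with 0 by ring. unfold Rpower. rewrite Rmult_0_l. apply exp_0. }
  apply (is_Clim_CSeries (at_right 0) (fun j t => lattice_term (S m) 0 a t j) _ (fun j => / (INR j + 1) ^ 2)).
  - intros j. eapply is_Clim_eq; [apply lattice_term_lim; auto |]. rewrite P1. ring.
  - apply at_right_pos. intros t Ht j. unfold lattice_term. rewrite P1, !Cmod_mult, Cmod_1, Rmult_1_l.
    rewrite <- (Rmult_1_l (/ (INR j + 1) ^ 2)). apply Rmult_le_compat; try apply Cmod_ge_0.
    + now apply lattice_exp_le_1.
    + apply lattice_inv_bound, Rlt_le, Ha.
  - intros j. apply lattice_inv_bound, Rlt_le, Ha.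
  - apply ex_series_inv_sqr.
Qed.

Lemma lattice_sum_lim_zeta (q : nat) (a : C) :
  right_sector a ->
  is_Clim (at_right 0) (lattice_sum 0 (- Z.of_nat (S q)) a) (RtoC (zeta (INR (2 * S q)))).
Proof.
  intros Ha. rewrite zeta_even.
  assert (P1 : forall j, Rpower (INR (S j)) (2 * IZR (- Z.of_nat (S q))) = / INR (S j) ^ (2 * S q)).
  { intros j. rewrite <- Rpower_INR_inv by lia. f_equal. rewrite opp_IZR, <- INR_IZR_INZ, mult_INR, INR_two. ring. }
  assert (Pp : forall j, 0 < / INR (S j) ^ (2 * S q)) by (intros j; apply Rinv_0_lt_compat, pow_lt, INR_S_pos).
  replace (RtoC (Series (fun n => / INR (S n) ^ (2 * S q)))) with (CSeries (fun n => RtoC (/ INR (S n) ^ (2 * S q)))).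
  2:{ apply C_eq_parts; simpl Re; simpl Im; [reflexivity |]. apply is_series_unique, is_series_zero. }
  apply (is_Clim_CSeries (at_right 0) (fun j t => lattice_term 0 (- Z.of_nat (S q)) a t j) _ (fun n => / INR (S n) ^ (2 * S q))).
  - intros j. eapply is_Clim_eq; [apply lattice_term_lim; auto |]. rewrite P1. simpl (_ ^ 0)%C. field.
  - apply at_right_pos. intros t Ht j. unfold lattice_term. rewrite P1, !Cmod_mult. simpl (_ ^ 0)%C.
    rewrite Cmod_inv, Cmod_1, Rinv_1, Rmult_1_r, Cmod_nneg by (try apply RtoC_neq; try lra; apply Rlt_le, Pp).
    rewrite <- (Rmult_1_r (/ INR (S j) ^ (2 * S q))) at 2. apply Rmult_le_compat_l; [apply Rlt_le, Pp | now apply lattice_exp_le_1].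
  - intros j. rewrite Cmod_nneg; [lra | apply Rlt_le, Pp].
  - apply ex_series_zeta.
Qed.

(** * The saddle-point expansion *)

Definition gauss_zeta_term (x : R) (a : C) (lambda : R) (j : nat) : C :=
  (Cexp (- (RtoC (PI ^ 2 * INR (S j) ^ 2) * (a * a) * RtoC (/ lambda))) * RtoC (Rpower (INR (S j)) (- x)))%C.

(** The inner sum over k of the expansion, with a single exponent x so that differentiation in
    lambda simply lowers x by 2. *)
Definition gauss_zeta (x : R) (a : C) (lambda : R) : C := CSeries (gauss_zeta_term x a lambda).

Definition saddle_exponent (a : C) : R := PI ^ 2 * Re (a * a)%C.

Lemma Esum_gauss_zeta (delta lambda : R) (r : nat) (a : C) :
  0 < lambda -> Esum delta lambda r a = gauss_zeta (delta + 2 * INR r) a lambda.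
Proof.
  intros Hl. apply CSeries_ext. intros j. unfold gauss_zeta_term.
  assert (Hp := exp_pos ((2 * INR r + delta) * ln (INR (S j)))).
  rewrite Rpower_Ropp, (Rplus_comm delta).
  rewrite RtoC_inv, RtoC_inv by (try (apply Rgt_not_eq, Hp); lra). unfold Cdiv. simpl (a ^ 2)%C. do 4 f_equal. ring.
Qed.

(** With Y = [saddle_exponent] / lambda >= y0, one has n^2 Y >= Y + (n^2 - 1) y0. The factor exp(-Y)
    is split off, and a Gaussian in n independent of a and lambda remains for the summation. *)
Lemma gauss_zeta_term_bound (x y0 : R) :
  0 < y0 -> exists B, 0 < B /\ forall a lambda j, 0 < lambda -> y0 <= saddle_exponent a / lambda ->
    Cmod (gauss_zeta_term x a lambda j) <= exp (- (saddle_exponent a / lambda)) * (B * / (INR j + 1) ^ 2).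
Proof.
  intros Hy. destruct (INR_unbounded (Rabs x)) as [q Hq].
  destruct (pow_gauss_bound y0 (q + 2) Hy) as [B [HB H]].
  exists (exp y0 * B). split; [apply Rmult_lt_0_compat; auto; apply exp_pos |].
  intros a lambda j Hl Hyl. assert (Hn := INR_S_ge_1 j). set (Y := saddle_exponent a / lambda) in *.
  unfold gauss_zeta_term. set (n := INR (S j)) in *.
  rewrite Cmod_mult, Cmod_Cexp, Cmod_nneg by apply Rlt_le, exp_pos.
  replace (Re (- (RtoC (PI ^ 2 * n ^ 2) * (a * a) * RtoC (/ lambda)))%C) with (- (n ^ 2 * Y)).
  2:{ unfold Y, saddle_exponent, Rdiv. rewrite Re_opp, (Cmult_comm _ (RtoC (/ lambda))), Re_scal, Re_scal. ring. }
  assert (A1 : Rpower n (- x) <= (1 + n) ^ q).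
  { apply Rle_trans with (n ^ q); [| apply pow_incr; lra]. rewrite <- Rpower_pow by lra. apply Rle_Rpower; auto.
    assert (Q := Rle_abs (- x)). rewrite Rabs_Ropp in Q. lra. }
  assert (A2 : exp (- (n ^ 2 * Y)) <= exp (- Y) * (exp y0 * exp (- (y0 * n ^ 2)))).
  { rewrite <- !exp_plus. apply exp_le. assert (0 <= (n ^ 2 - 1) * (Y - y0)) by (apply Rmult_le_pos; nra). lra. }
  specialize (H n ltac:(lra)).
  assert (0 < Rpower n (- x)) by apply exp_pos. assert (0 < exp (- (n ^ 2 * Y))) by apply exp_pos.
  assert (0 < exp (- (y0 * n ^ 2))) by apply exp_pos. assert (0 < exp y0) by apply exp_pos. assert (0 < exp (- Y)) by apply exp_pos.
  assert (A3 : exp (- (y0 * n ^ 2)) * (1 + n) ^ q <= B * / n ^ 2).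
  { apply (Rmult_le_reg_r (n ^ 2)); [nra |]. rewrite (Rmult_assoc B), Rinv_l, Rmult_1_r by nra.
    eapply Rle_trans; [| exact H]. rewrite pow_add.
    assert (0 <= (1 + n) ^ q) by (apply pow_le; lra).
    replace ((1 + n) ^ q * (1 + n) ^ 2 * exp (- (y0 * n ^ 2))) with (exp (- (y0 * n ^ 2)) * (1 + n) ^ q * (1 + n) ^ 2) by ring.
    apply Rmult_le_compat_l; [nra | apply pow_incr; lra]. }
  rewrite <- S_INR. fold n.
  apply Rle_trans with (exp (- Y) * (exp y0 * exp (- (y0 * n ^ 2))) * (1 + n) ^ q).
  - apply Rmult_le_compat; lra.
  - replace (exp (- Y) * (exp y0 * exp (- (y0 * n ^ 2))) * (1 + n) ^ q) with (exp (- Y) * exp y0 * (exp (- (y0 * n ^ 2)) * (1 + n) ^ q)) by ring.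
    replace (exp (- Y) * (exp y0 * B * / n ^ 2)) with (exp (- Y) * exp y0 * (B * / n ^ 2)) by ring.
    apply Rmult_le_compat_l; nra.
Qed.

Lemma gauss_zeta_bound (x y0 : R) :
  0 < y0 -> exists B, 0 < B /\ forall a lambda, 0 < lambda -> y0 <= saddle_exponent a / lambda ->
    Cmod (gauss_zeta x a lambda) <= B * exp (- (saddle_exponent a / lambda)).
Proof.
  intros Hy. destruct (gauss_zeta_term_bound x y0 Hy) as [B [HB H]].
  set (Q := Series (fun n => / (INR n + 1) ^ 2)).
  assert (HQ : 0 <= Q).
  { apply Series_nonneg; [| apply ex_series_inv_sqr]. intros n. assert (Hn := pos_INR n). apply Rlt_le, Rinv_0_lt_compat, pow_lt; lra. }
  exists (2 * B * Q + 1). split; [nra |]. intros a lambda Hl Hyl.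
  eapply Rle_trans; [apply (Cmod_CSeries_le _ _ (fun j => H a lambda j Hl Hyl)); apply ex_series_scal_Rl, ex_series_scal_Rl, ex_series_inv_sqr |].
  rewrite Series_scal_l, Series_scal_l. fold Q. assert (E := exp_pos (- (saddle_exponent a / lambda))). nra.
Qed.

Lemma saddle_exponent_pos (a : C) : right_sector a -> 0 < saddle_exponent a.
Proof. intros [_ H]. assert (P := PI_RGT_0). unfold saddle_exponent. apply Rmult_lt_0_compat; auto. nra. Qed.

Lemma gauss_zeta_correct (x : R) (a : C) (lambda : R) :
  right_sector a -> 0 < lambda -> is_Cseries (gauss_zeta_term x a lambda) (gauss_zeta x a lambda).
Proof.
  intros Ha Hl. assert (Hs := saddle_exponent_pos a Ha).
  destruct (gauss_zeta_term_bound x (saddle_exponent a / lambda)) as [B [HB H]]; [now apply Rdiv_lt_0_compat |].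
  eapply CSeries_correct; [intros j; apply H; lra |]. apply ex_series_scal_Rl, ex_series_scal_Rl, ex_series_inv_sqr.
Qed.

Lemma gauss_zeta_term_derive (x : R) (a : C) (lambda : R) (j : nat) :
  0 < lambda ->
  is_Cderive (fun t => gauss_zeta_term x a t j) lambda
    (RtoC (PI ^ 2 * / lambda ^ 2) * (a * a) * gauss_zeta_term (x - 2) a lambda j)%C.
Proof.
  intros Hl. assert (Hn := INR_S_pos j). unfold gauss_zeta_term. set (n := INR (S j)) in *.
  assert (D : is_derive (fun t => / t) lambda (- / lambda ^ 2)).
  { auto_derive; [lra | field; lra]. }
  eapply is_Cderive_eq.
  - apply is_Cderive_mult; [| apply is_Cderive_const]. apply is_Cderive_Cexp, is_Cderive_opp, is_Cderive_scal, is_Cderive_RtoC. exact D.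
  - cbv beta. replace (- (x - 2)) with (- x + 2) by ring. rewrite Rpower_plus.
    replace (Rpower n 2) with (n ^ 2) by (rewrite <- (Rpower_pow 2) by auto; reflexivity).
    set (e := Cexp _). rewrite !RtoC_mult, RtoC_opp. ring.
Qed.

Lemma gauss_zeta_derive (x : R) (a : C) (lambda : R) :
  right_sector a -> 0 < lambda ->
  is_Cderive (gauss_zeta x a) lambda (RtoC (PI ^ 2 * / lambda ^ 2) * (a * a) * gauss_zeta (x - 2) a lambda)%C.
Proof.
  intros Ha Hl. assert (Hs := saddle_exponent_pos a Ha). assert (P := PI_RGT_0).
  set (y0 := saddle_exponent a / (2 * lambda)). assert (Hy0 : 0 < y0) by (apply Rdiv_lt_0_compat; lra).
  assert (Hr : forall t, Rabs (t - lambda) < lambda / 2 -> lambda / 2 <= t /\ 0 < t /\ y0 <= saddle_exponent a / t).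
  { intros t Ht. apply Rabs_def2 in Ht. assert (0 < t <= 2 * lambda) by lra. repeat split; try lra.
    unfold y0, Rdiv. apply Rmult_le_compat_l; [lra |]. apply Rinv_le_contravar; lra. }
  destruct (gauss_zeta_term_bound x y0 Hy0) as [B1 [HB1 H1]].
  destruct (gauss_zeta_term_bound (x - 2) y0 Hy0) as [B2 [HB2 H2]].
  assert (E1 : forall t, 0 < t -> exp (- (saddle_exponent a / t)) <= 1).
  { intros t Ht. rewrite <- exp_0. apply exp_le. assert (0 < saddle_exponent a / t) by (now apply Rdiv_lt_0_compat). lra. }
  assert (Hin : forall (B : R) n, 0 < B -> 0 < B * / (INR n + 1) ^ 2).
  { intros B n HB. assert (Hn := pos_INR n). apply Rmult_lt_0_compat; auto. apply Rinv_0_lt_compat, pow_lt; lra. }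
  set (L := PI ^ 2 * / (lambda / 2) ^ 2 * Cmod (a * a)%C).
  eapply is_Cderive_eq.
  - apply (is_Cderive_CSeries (fun j t => gauss_zeta_term x a t j) (fun j t => RtoC (PI ^ 2 * / t ^ 2) * (a * a) * gauss_zeta_term (x - 2) a t j)%C
      (fun j => L * (B2 * / (INR j + 1) ^ 2)) lambda (lambda / 2)); [lra | | | |].
    + intros j t Ht. apply gauss_zeta_term_derive, Hr, Ht.
    + intros j t Ht. destruct (Hr t Ht) as [T1 [T2 T3]]. rewrite !Cmod_mult. unfold L. rewrite Cmod_mult.
      assert (0 < / t ^ 2) by (apply Rinv_0_lt_compat, pow_lt; lra).
      rewrite Cmod_nneg by nra.
      assert (/ t ^ 2 <= / (lambda / 2) ^ 2) by (apply Rinv_le_contravar; [apply pow_lt; lra | apply pow_incr; lra]).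
      assert (Hca := Cmod_ge_0 a).
      apply Rmult_le_compat; [apply Rmult_le_pos; nra | apply Cmod_ge_0 | |].
      * apply Rmult_le_compat_r; [nra |]. apply Rmult_le_compat_l; nra.
      * eapply Rle_trans; [apply H2; auto |]. specialize (E1 t T2). specialize (Hin B2 j HB2).
        rewrite <- (Rmult_1_l (B2 * / (INR j + 1) ^ 2)) at 2. apply Rmult_le_compat_r; lra.
    + apply ex_series_scal_Rl, ex_series_scal_Rl, ex_series_inv_sqr.
    + intros t Ht. destruct (Hr t Ht) as [T1 [T2 T3]].
      exists (fun j => exp (- (saddle_exponent a / t)) * (B1 * / (INR j + 1) ^ 2)).
      split; [apply ex_series_scal_Rl, ex_series_scal_Rl, ex_series_inv_sqr |]. intros j; apply H1; auto.
  - apply is_Cseries_unique, is_Cseries_scal. now apply gauss_zeta_correct.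
Qed.

(** * Terms and partial sums of the expansion *)

(** a^delta times the r-th term of the expansion, without its sign and C_r; [d] is delta, which is
    always an even integer. *)
Definition saddle_term (d : Z) (r : nat) (a : C) (lambda : R) : C :=
  (RtoC (Rpower lambda (IZR d + INR r - / 2) * Rpower PI (/ 2 - (IZR d + 2 * INR r)))
   * Cpower a (1 - (IZR d + 2 * INR r)) * gauss_zeta (IZR d + 2 * INR r) a lambda)%C.

Lemma Cpower_2 (a : C) : a <> RtoC 0 -> Cpower a 2 = (a * a)%C.
Proof. intros H. change 2 with (1 + 1). rewrite Cpower_plus, Cpower_1; auto. Qed.

Lemma Rpower_2 (x : R) : 0 < x -> Rpower x 2 = x ^ 2.
Proof. intros H. rewrite <- (Rpower_pow 2) by auto. reflexivity. Qed.

(** The quantity d + 2 r, on which everything but the power of lambda depends, is unchanged. This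
    lets the derivative be written again with terms of one delta. *)
Lemma saddle_term_div (d : Z) (r : nat) (a : C) (lambda : R) :
  0 < lambda -> (RtoC (/ lambda) * saddle_term d r a lambda)%C = saddle_term (d - 2) (S r) a lambda.
Proof.
  intros Hl. unfold saddle_term. rewrite minus_IZR, S_INR.
  replace (IZR d - 2 + 2 * (INR r + 1)) with (IZR d + 2 * INR r) by ring.
  replace (IZR d + INR r - / 2) with (IZR d - 2 + (INR r + 1) - / 2 + 1) by ring.
  rewrite Rpower_plus, Rpower_1 by auto. set (u := Rpower lambda _). set (v := Rpower PI _).
  replace (RtoC (u * lambda * v)) with (RtoC lambda * RtoC (u * v))%C by (rewrite <- RtoC_mult; f_equal; ring).
  rewrite RtoC_inv by lra. field. apply RtoC_neq; lra.
Qed.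

(** Differentiating the power of lambda gives the summand with [S r]. Differentiating the
    exponentials gives the one with r: the factor pi^2 k^2 a^2 / lambda^2 is exactly the change from
    d to d - 2. *)
Lemma saddle_term_derive (d : Z) (r : nat) (a : C) (lambda : R) :
  right_sector a -> 0 < lambda ->
  is_Cderive (saddle_term d r a) lambda
    (RtoC (IZR d + INR r - / 2) * saddle_term (d - 2) (S r) a lambda + saddle_term (d - 2) r a lambda)%C.
Proof.
  intros Ha Hl. assert (Ha0 := right_sector_neq_0 a Ha). assert (P := PI_RGT_0).
  rewrite <- saddle_term_div by auto. unfold saddle_term.
  set (e := IZR d + INR r - / 2). set (x := IZR d + 2 * INR r). set (q := Rpower PI (/ 2 - x)). set (w := Cpower a (1 - x)).
  assert (D : is_derive (fun t => Rpower t e * q) lambda (e * Rpower lambda (e - 1) * q)).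
  { apply (is_derive_ext (fun t => q * Rpower t e)); [intros; apply Rmult_comm |].
    eapply is_derive_eq; [apply is_derive_scal, is_derive_Rpower; auto | ring]. }
  apply (is_Cderive_ext (fun t => w * (RtoC (Rpower t e * q) * gauss_zeta x a t))%C); [intros; ring |].
  eapply is_Cderive_eq.
  - apply is_Cderive_scal, is_Cderive_mult; [apply is_Cderive_RtoC, D | apply gauss_zeta_derive; auto].
  - cbv beta. rewrite minus_IZR.
    replace (IZR d - 2 + INR r - / 2) with (e - 2) by (unfold e; ring).
    replace (IZR d - 2 + 2 * INR r) with (x - 2) by (unfold x; ring).
    replace (/ 2 - (x - 2)) with (/ 2 - x + 2) by ring. replace (1 - (x - 2)) with (1 - x + 2) by ring.
    rewrite Cpower_plus, Cpower_2, (Rpower_plus (/ 2 - x)), (Rpower_2 PI) by auto. fold q. fold w.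
    replace (e * Rpower lambda (e - 1) * q) with (e * / lambda * (Rpower lambda e * q)).
    2:{ replace (Rpower lambda e) with (Rpower lambda (e - 1) * lambda). 2:{ rewrite <- (Rpower_1 lambda) at 2 by auto. rewrite <- Rpower_plus; f_equal; ring. } field. lra. }
    replace (Rpower lambda (e - 2) * (q * PI ^ 2)) with (Rpower lambda e * q * (PI ^ 2 * / lambda ^ 2)).
    2:{ replace (Rpower lambda e) with (Rpower lambda (e - 2) * lambda ^ 2). 2:{ rewrite <- (Rpower_2 lambda) by auto. rewrite <- Rpower_plus; f_equal; ring. } field. lra. }
    set (g := gauss_zeta x a lambda). set (g2 := gauss_zeta (x - 2) a lambda). set (k := Rpower lambda e * q).
    rewrite !(RtoC_mult _ k), !(RtoC_mult k), (RtoC_mult e). ring.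
Qed.

(** The order of magnitude of [saddle_term], jointly in a and lambda. Errors are measured on this
    scale, with r the index of the first omitted term. *)
Definition saddle_size (d : Z) (r : nat) (a : C) (lambda : R) : R :=
  Rpower lambda (IZR d + INR r - / 2) * Rpower (Cmod a) (1 - (IZR d + 2 * INR r))
  * exp (- (saddle_exponent a / lambda)).

Lemma saddle_size_pos (d : Z) (r : nat) (a : C) (lambda : R) : 0 < saddle_size d r a lambda.
Proof. unfold saddle_size. repeat apply Rmult_lt_0_compat; apply exp_pos. Qed.

Lemma saddle_term_bound (d : Z) (r : nat) (y0 : R) :
  0 < y0 -> exists B, 0 < B /\ forall a lambda, 0 < lambda -> y0 <= saddle_exponent a / lambda ->
    Cmod (saddle_term d r a lambda) <= B * saddle_size d r a lambda.
Proof.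
  intros Hy. destruct (gauss_zeta_bound (IZR d + 2 * INR r) y0 Hy) as [B [HB H]].
  set (q := Rpower PI (/ 2 - (IZR d + 2 * INR r))). assert (Hq : 0 < q) by apply exp_pos.
  exists (q * B). split; [nra |]. intros a lambda Hl Hyl. specialize (H a lambda Hl Hyl).
  unfold saddle_term, saddle_size. fold q. rewrite !Cmod_mult, Cmod_Cpower.
  set (u := Rpower lambda _). set (v := Rpower (Cmod a) _). assert (0 < u) by apply exp_pos. assert (0 < v) by apply exp_pos.
  rewrite Cmod_nneg by nra.
  replace (q * B * (u * v * exp (- (saddle_exponent a / lambda)))) with (u * q * v * (B * exp (- (saddle_exponent a / lambda)))) by ring.
  apply Rmult_le_compat_l; auto. repeat apply Rmult_le_pos; lra.
Qed.

Lemma Rpower_exp_lim (e Y : R) :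
  0 < Y -> filterlim (fun t => Rpower t e * exp (- (Y / t))) (at_right 0) (locally 0).
Proof.
  intros HY. destruct (INR_unbounded (Rabs e)) as [q Hq].
  destruct (pow_exp_bound Y (S q) HY) as [B [HB H]].
  apply (filterlim_locally (U := R_UniformSpace)). intros eps.
  assert (Hd : 0 < Rmin 1 (eps / B)) by (apply Rmin_pos; [lra | apply Rdiv_lt_0_compat; auto; apply cond_pos]).
  exists (mkposreal _ Hd). intros t Ht Ht0.
  change (Rabs (t - 0) < Rmin 1 (eps / B)) in Ht. rewrite Rminus_0_r, Rabs_pos_eq in Ht by lra.
  assert (Ht1 : t < 1) by (eapply Rlt_le_trans; [exact Ht | apply Rmin_l]).
  assert (Ht2 : t < eps / B) by (eapply Rlt_le_trans; [exact Ht | apply Rmin_r]).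
  change (Rabs (Rpower t e * exp (- (Y / t)) - 0) < eps).
  assert (Hp : 0 < Rpower t e * exp (- (Y / t))) by (apply Rmult_lt_0_compat; apply exp_pos).
  rewrite Rminus_0_r, Rabs_pos_eq by lra.
  assert (Hx : 1 < / t) by (rewrite <- Rinv_1; apply Rinv_lt_contravar; lra).
  set (x := / t) in *. assert (Etx : t = / x) by (unfold x; rewrite Rinv_inv; auto).
  assert (A1 : Rpower t e <= (1 + x) ^ q).
  { apply Rle_trans with (x ^ q); [| apply pow_incr; lra]. rewrite <- Rpower_pow by lra.
    replace (Rpower t e) with (Rpower x (- e)).
    - apply Rle_Rpower; [lra |]. assert (Q := Rle_abs (- e)). rewrite Rabs_Ropp in Q. lra.
    - rewrite Etx. unfold Rpower. rewrite ln_Rinv by lra. f_equal; ring. }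
  specialize (H x ltac:(lra)). replace (Y / t) with (Y * x) in * by reflexivity.
  assert (E := exp_pos (- (Y * x))).
  apply Rle_lt_trans with (B * t).
  - rewrite Etx. apply (Rmult_le_reg_r (1 + x)); [lra |].
    apply Rle_trans with ((1 + x) ^ S q * exp (- (Y * x))).
    + simpl. replace ((1 + x) * (1 + x) ^ q * exp (- (Y * x))) with ((1 + x) ^ q * exp (- (Y * x)) * (1 + x)) by ring.
      rewrite <- Etx. apply Rmult_le_compat_r; [lra |]. apply Rmult_le_compat_r; lra.
    + eapply Rle_trans; [exact H |]. replace (B * / x * (1 + x)) with (B + B * / x) by (field; lra).
      assert (0 < / x) by (apply Rinv_0_lt_compat; lra). nra.
  - apply (Rmult_lt_compat_l B) in Ht2; auto. replace (B * (eps / B)) with (pos eps) in Ht2 by (field; lra). lra.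
Qed.

Lemma saddle_term_lim (d : Z) (r : nat) (a : C) :
  right_sector a -> is_Clim (at_right 0) (saddle_term d r a) (RtoC 0).
Proof.
  intros Ha. assert (Hs := saddle_exponent_pos a Ha).
  destruct (saddle_term_bound d r (saddle_exponent a) Hs) as [B [HB H]].
  set (v := Rpower (Cmod a) (1 - (IZR d + 2 * INR r))).
  apply (is_Clim_0_le (at_right 0) _ (fun t => B * v * (Rpower t (IZR d + INR r - / 2) * exp (- (saddle_exponent a / t))))).
  - exists (mkposreal 1 Rlt_0_1). intros t Ht Ht0. change (Rabs (t - 0) < 1) in Ht. rewrite Rminus_0_r, Rabs_pos_eq in Ht by lra.
    eapply Rle_trans; [apply H; auto |].
    + rewrite <- (Rmult_1_r (saddle_exponent a)) at 1. unfold Rdiv. apply Rmult_le_compat_l; [lra |].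
      rewrite <- Rinv_1. apply Rinv_le_contravar; lra.
    + unfold saddle_size. fold v. right; ring.
  - assert (L := filterlim_Rmult (at_right 0) (fun _ => B * v) _ (B * v) 0 (filterlim_const _)
      (Rpower_exp_lim (IZR d + INR r - / 2) (saddle_exponent a) Hs)).
    rewrite Rmult_0_r in L. exact L.
Qed.

Definition saddle_sum (c : nat -> R -> R) (d : Z) (N : nat) (a : C) (lambda : R) : C :=
  sum_n (fun r => RtoC ((-1) ^ r * c r lambda) * saddle_term d r a lambda)%C N.

(** The hypothesis on [c0] states that the coefficients satisfy the differential equation as a
    formal series. After truncation each derivative sends part of its value to the next index, and
    only the part leaving the last index N is left over. *)
Lemma saddle_sum_derive (c c' c0 : nat -> R -> R) (d : Z) (N : nat) (a : C) (lambda : R) :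
  right_sector a -> 0 < lambda ->
  (forall r, is_derive (c r) lambda (c' r lambda)) ->
  c0 0%nat lambda = c 0%nat lambda ->
  (forall r, c0 (S r) lambda = c (S r) lambda - ((IZR d + INR r - / 2) * c r lambda + lambda * c' r lambda)) ->
  is_Cderive (saddle_sum c d N a) lambda
    (saddle_sum c0 (d - 2) N a lambda
     + RtoC ((-1) ^ N * ((IZR d + INR N - / 2) * c N lambda + lambda * c' N lambda)) * saddle_term (d - 2) (S N) a lambda)%C.
Proof.
  intros Ha Hl Hc H0 HS.
  assert (T : forall r, is_Cderive (fun t => RtoC ((-1) ^ r * c r t) * saddle_term d r a t)%C lambda
    (RtoC ((-1) ^ r * c r lambda) * saddle_term (d - 2) r a lambda
      + RtoC ((-1) ^ r * ((IZR d + INR r - / 2) * c r lambda + lambda * c' r lambda)) * saddle_term (d - 2) (S r) a lambda)%C).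
  { intros r. eapply is_Cderive_eq.
    - apply is_Cderive_mult; [apply is_Cderive_RtoC, is_derive_scal, Hc | apply saddle_term_derive; auto].
    - replace (saddle_term d r a lambda) with (RtoC lambda * saddle_term (d - 2) (S r) a lambda)%C.
      2:{ rewrite <- saddle_term_div by auto. rewrite Cmult_assoc, <- RtoC_mult, Rinv_r by lra. ring. }
      rewrite !RtoC_mult, RtoC_plus, !RtoC_mult. ring. }
  unfold saddle_sum. induction N as [|N IH].
  - apply (is_Cderive_ext (fun t => RtoC ((-1) ^ 0 * c 0%nat t) * saddle_term d 0 a t)%C); [intros; now rewrite sum_O |].
    eapply is_Cderive_eq; [apply T |]. rewrite sum_O, H0. reflexivity.
  - apply (is_Cderive_ext (fun t => sum_n (fun r => RtoC ((-1) ^ r * c r t) * saddle_term d r a t)%C N + RtoC ((-1) ^ S N * c (S N) t) * saddle_term d (S N) a t)%C);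
      [intros; now rewrite sum_n_CS |].
    eapply is_Cderive_eq; [apply is_Cderive_plus; [exact IH | apply T] |].
    rewrite sum_n_CS, HS. set (X := (IZR d + INR N - / 2) * c N lambda + lambda * c' N lambda).
    change ((-1) ^ S N) with (-1 * (-1) ^ N).
    rewrite !RtoC_mult, RtoC_minus. replace (RtoC (-1)) with (- RtoC 1)%C by (rewrite <- RtoC_opp; reflexivity). cring.
Qed.

(** * The coefficients C_r *)

Definition half_poch (x : R) (s : nat) : R := poch x (2 * s) / (2 ^ (2 * s) * INR (fact s)).

Lemma half_poch_0 (x : R) : half_poch x 0 = 1.
Proof. unfold half_poch. simpl. field. Qed.

(** With s as index this is already the coefficient recurrence for m = 0; for general m it is
    applied to each power of lambda separately. *)
Lemma half_poch_rec (x : R) (s : nat) :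
  half_poch x (S s) = half_poch (x - 2) (S s) + (x + INR s - / 2) * half_poch x s.
Proof.
  unfold half_poch. replace (2 * S s)%nat with (S (S (2 * s))) by lia.
  rewrite (poch_shift (x - 2)), (poch_shift (x - 2 + 1)), (poch_S x (S (2 * s))), (poch_S x (2 * s)).
  replace (x - 2 + 1 + 1) with x by ring. rewrite S_INR, mult_INR, INR_two, fact_simpl, mult_INR, S_INR.
  change (2 ^ S (S (2 * s))) with (2 * (2 * 2 ^ (2 * s))).
  assert (F := INR_fact_neq_0 s). assert (Hs := pos_INR s). assert (P2 := pow_nonzero 2 (2 * s) ltac:(lra)).
  field. repeat split; auto; lra.
Qed.

Definition C_delta (m : nat) (p : Z) : R := 2 * INR m - 2 * IZR p.

Lemma Ccoef_eq (m : nat) (p : Z) (lambda : R) (r : nat) :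
  Ccoef m p lambda r = sum_n (fun n => (- lambda) ^ n * (poch (INR m) n / INR (fact n) * half_poch (C_delta m p + 2 * INR n) (r - n))) r.
Proof.
  unfold Ccoef. apply sum_n_ext_loc. intros n Hn. unfold half_poch, C_delta.
  replace (2 * r - 2 * n)%nat with (2 * (r - n))%nat by lia. rtype. unfold Rdiv. ring.
Qed.

Definition Ccoef_derive (m : nat) (p : Z) (lambda : R) (r : nat) : R :=
  sum_n (fun n => - INR n * (- lambda) ^ pred n * (poch (INR m) n / INR (fact n) * half_poch (C_delta m p + 2 * INR n) (r - n))) r.

Lemma is_derive_Ccoef (m : nat) (p : Z) (lambda : R) (r : nat) :
  is_derive (fun t => Ccoef m p t r) lambda (Ccoef_derive m p lambda r).
Proof.
  apply (is_derive_ext (fun t => sum_n (fun n => (- t) ^ n * (poch (INR m) n / INR (fact n) * half_poch (C_delta m p + 2 * INR n) (r - n))) r));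
    [intros; now rewrite Ccoef_eq |].
  apply (is_derive_sum_n (K := R_AbsRing) (V := R_NormedModule) (fun n t => (- t) ^ n * (poch (INR m) n / INR (fact n) * half_poch (C_delta m p + 2 * INR n) (r - n)))).
  intros n _. set (k := poch (INR m) n / INR (fact n) * half_poch (C_delta m p + 2 * INR n) (r - n)).
  auto_derive; auto. ring.
Qed.

Lemma Ccoef_0 (m : nat) (p : Z) (lambda : R) : Ccoef m p lambda 0 = 1.
Proof. rewrite Ccoef_eq, sum_O, half_poch_0. simpl. field. Qed.

(** The hypothesis of [saddle_sum_derive] for the coefficients exp(-lambda) C_r of order m + 1,
    which accounts for the derivative minus the coefficient itself. It is proved by comparing powers
    of -lambda, using [half_poch_rec] and Pascal's rule for (m)_n / n!. *)
Lemma Ccoef_rec (m : nat) (p : Z) (lambda : R) (r : nat) :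
  Ccoef m p lambda (S r) = Ccoef (S m) p lambda (S r)
    - ((C_delta (S m) p + INR r - / 2) * Ccoef (S m) p lambda r
       + lambda * (Ccoef_derive (S m) p lambda r - Ccoef (S m) p lambda r)).
Proof.
  set (d := C_delta (S m) p).
  assert (Ed : C_delta m p = d - 2) by (unfold d, C_delta; rewrite S_INR; ring).
  set (e := fun m n => poch (INR m) n / INR (fact n)).
  assert (Ee : forall n, e (S m) (S n) = e m (S n) + e (S m) n).
  { intros n. unfold e. rewrite (poch_shift (INR m)), (poch_S (INR (S m))), <- S_INR, fact_simpl, mult_INR, !S_INR.
    assert (F := INR_fact_neq_0 n). assert (Hn := pos_INR n). field. split; auto; lra. }
  assert (E1 : (d + INR r - / 2) * Ccoef (S m) p lambda r + lambda * (Ccoef_derive (S m) p lambda r - Ccoef (S m) p lambda r) =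
    sum_n (fun n => (- lambda) ^ n * (e (S m) n * ((d + INR r - / 2 + INR n) * half_poch (d + 2 * INR n) (r - n)))) r
    + sum_n (fun n => (- lambda) ^ S n * (e (S m) n * half_poch (d + 2 * INR n) (r - n))) r).
  { rewrite Ccoef_eq. unfold Ccoef_derive. fold d.
    transitivity ((d + INR r - / 2 + - lambda) * sum_n (fun n => (- lambda) ^ n * (e (S m) n * half_poch (d + 2 * INR n) (r - n))) r
      + lambda * sum_n (fun n => - INR n * (- lambda) ^ pred n * (e (S m) n * half_poch (d + 2 * INR n) (r - n))) r); [unfold e; ring |].
    rewrite <- !(sum_n_mult_l (K := R_Ring)), <- !(sum_n_plus (G := R_AbelianMonoid)).
    apply sum_n_ext. intros n. change mult with Rmult. change plus with Rplus. rtype.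
    destruct n as [|n]; [simpl; ring |]. simpl pred. change ((- lambda) ^ S (S n)) with (- lambda * (- lambda * (- lambda) ^ n)). change ((- lambda) ^ S n) with (- lambda * (- lambda) ^ n). ring. }
  rewrite E1, !Ccoef_eq, Ed. fold d.
  rewrite (sum_n_shift (fun n => (- lambda) ^ n * (poch (INR m) n / INR (fact n) * half_poch (d - 2 + 2 * INR n) (S r - n)))).
  rewrite (sum_n_shift (fun n => (- lambda) ^ n * (poch (INR (S m)) n / INR (fact n) * half_poch (d + 2 * INR n) (S r - n)))).
  (* The sum is re-indexed to start at the power 1; the conditional supplies a zero at the top,
     where n + 1 would exceed r. *)
  assert (E2 : sum_n (fun n => (- lambda) ^ n * (e (S m) n * ((d + INR r - / 2 + INR n) * half_poch (d + 2 * INR n) (r - n)))) r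
     = (d + INR r - / 2) * half_poch d r
       + sum_n (fun n => if (S n <=? r)%nat then (- lambda) ^ S n * (e (S m) (S n) * ((d + INR r - / 2 + INR (S n)) * half_poch (d + 2 * INR (S n)) (r - S n))) else 0) r).
  { transitivity (sum_n (fun n => if (n <=? r)%nat then (- lambda) ^ n * (e (S m) n * ((d + INR r - / 2 + INR n) * half_poch (d + 2 * INR n) (r - n))) else 0) (S r)).
    - rewrite sum_n_RS. replace (S r <=? r)%nat with false by (symmetry; apply Nat.leb_gt; lia).
      rewrite (sum_n_ext_loc (fun n => if (n <=? r)%nat then (- lambda) ^ n * (e (S m) n * ((d + INR r - / 2 + INR n) * half_poch (d + 2 * INR n) (r - n))) else 0)
        (fun n => (- lambda) ^ n * (e (S m) n * ((d + INR r - / 2 + INR n) * half_poch (d + 2 * INR n) (r - n))))).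
      + symmetry; apply Rplus_0_r.
      + intros n Hn. replace (n <=? r)%nat with true by (symmetry; apply Nat.leb_le; lia). reflexivity.
    - rewrite sum_n_shift. f_equal. simpl (0 <=? r)%nat. cbv iota. unfold e. simpl pow. simpl poch. simpl fact. simpl (INR 0). simpl (INR 1).
      rewrite Nat.sub_0_r. replace (d + 2 * 0) with d by ring. rtype. field. }
  rewrite E2. clear E1 E2.
  transitivity ((half_poch d (S r) - (d + INR r - / 2) * half_poch d r) +
    (sum_n (fun n => (- lambda) ^ S n * (poch (INR (S m)) (S n) / INR (fact (S n)) * half_poch (d + 2 * INR (S n)) (S r - S n))) r
     + -1 * sum_n (fun n => if (S n <=? r)%nat then (- lambda) ^ S n * (e (S m) (S n) * ((d + INR r - / 2 + INR (S n)) * half_poch (d + 2 * INR (S n)) (r - S n))) else 0) r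
     + -1 * sum_n (fun n => (- lambda) ^ S n * (e (S m) n * half_poch (d + 2 * INR n) (r - n))) r)).
  2:{ rewrite !Nat.sub_0_r. simpl pow. simpl poch. simpl fact. simpl (INR 0). simpl (INR 1). replace (d + 2 * 0) with d by ring. rewrite Rdiv_1_r. ring. }
  f_equal.
  - rewrite (half_poch_rec d r), Nat.sub_0_r. simpl pow. simpl poch. simpl fact. simpl (INR 0). simpl (INR 1).
    replace (d - 2 + 2 * 0) with (d - 2) by ring. field.
  - rewrite <- !(sum_n_mult_l (K := R_Ring)), <- !(sum_n_plus (G := R_AbelianMonoid)).
    apply sum_n_ext_loc. intros n Hn. change mult with Rmult. change plus with Rplus. rtype.
    fold (e m (S n)). fold (e (S m) (S n)). rewrite Nat.sub_succ.
    replace (d - 2 + 2 * INR (S n)) with (d + 2 * INR n) by (rewrite S_INR; ring).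
    destruct (S n <=? r)%nat eqn:L.
    + apply Nat.leb_le in L. set (s := (r - S n)%nat). replace (r - n)%nat with (S s) by (unfold s; lia).
      replace (INR r) with (INR s + INR n + 1) by (unfold s; rewrite minus_INR, S_INR by lia; ring).
      assert (HP := half_poch_rec (d + 2 * INR (S n)) s).
      replace (d + 2 * INR (S n) - 2) with (d + 2 * INR n) in HP by (rewrite S_INR; ring).
      rewrite HP, Ee, S_INR. ring.
    + apply Nat.leb_gt in L. replace n with r by lia. rewrite Nat.sub_diag, !half_poch_0, Ee. ring.
Qed.

Lemma Ccoef_m0 (p : Z) (lambda : R) (r : nat) : Ccoef 0 p lambda r = half_poch (- 2 * IZR p) r.
Proof.
  rewrite Ccoef_eq. rewrite (sum_n_single _ r 0); [| lia | intros n Hn Hne; destruct n as [|n]; [lia |]; simpl (INR 0); rewrite poch_0_S; unfold Rdiv; rring].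
  rewrite Nat.sub_0_r. unfold C_delta. simpl pow. simpl poch. simpl fact. simpl (INR 0). simpl (INR 1). replace (2 * 0 - 2 * IZR p + 2 * 0) with (- 2 * IZR p) by ring. rtype. field.
Qed.

Lemma Ccoef_m0_derive (p : Z) (lambda : R) (r : nat) : is_derive (fun t => Ccoef 0 p t r) lambda 0.
Proof.
  apply (is_derive_ext (fun _ => half_poch (- 2 * IZR p) r)); [intros; now rewrite Ccoef_m0 |].
  apply (is_derive_const (K := R_AbsRing) (V := R_NormedModule)).
Qed.

(** For m = 0 the coefficients are constant in lambda; the term [lambda * 0] keeps the shape of the
    hypothesis of [saddle_sum_derive]. *)
Lemma Ccoef_m0_rec (p : Z) (lambda : R) (r : nat) :
  Ccoef 0 (p + 1) lambda (S r) = Ccoef 0 p lambda (S r) - ((- 2 * IZR p + INR r - / 2) * Ccoef 0 p lambda r + lambda * 0).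
Proof.
  rewrite !Ccoef_m0, plus_IZR, (half_poch_rec (- 2 * IZR p)). replace (-2 * (IZR p + 1)) with (-2 * IZR p - 2) by ring. ring.
Qed.

(** (-2n)_(2r) contains the factor 0. For m = 0 and p >= 0 the expansion therefore terminates and
    becomes an exact identity. *)
Lemma Ccoef_m0_vanish (n : nat) (lambda : R) (r : nat) : (n < r)%nat -> Ccoef 0 (Z.of_nat n) lambda r = 0.
Proof.
  intros H. rewrite Ccoef_m0. unfold half_poch. replace (- 2 * IZR (Z.of_nat n)) with (- INR (2 * n)) by (rewrite mult_INR, INR_two, INR_IZR_INZ; ring).
  rewrite poch_neg_0 by lia. unfold Rdiv; ring.
Qed.

(** * The exponentially small remainder *)

(** delta as an integer, so that the shifts by 2 in the recurrences are exact equalities of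
    indices. *)
Definition zdelta (m : nat) (p : Z) : Z := (2 * (Z.of_nat m - p))%Z.

Lemma IZR_zdelta (m : nat) (p : Z) : IZR (zdelta m p) = 2 * (INR m - IZR p).
Proof. unfold zdelta. rewrite mult_IZR, minus_IZR, <- INR_IZR_INZ. reflexivity. Qed.

(* a^delta times (J + residue sum). *)
Definition remainder (m : nat) (p : Z) (a : C) (lambda : R) : C :=
  (Cpower a (IZR (zdelta m p)) * lattice_sum m p a lambda - a * RtoC (main_term m p lambda)
   - zeta_term m p a lambda + tail_term m p a lambda)%C.

Lemma remainder_rec (m : nat) (p : Z) (a : C) (lambda : R) :
  right_sector a -> 0 < lambda ->
  remainder m p a lambda = (remainder (S m) (p + 1) a lambda + remainder (S m) p a lambda)%C.
Proof.
  intros Ha Hl. assert (Ha0 := right_sector_neq_0 a Ha). unfold remainder.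
  rewrite (lattice_sum_rec m p), (main_term_rec m p), (zeta_term_rec m p), (tail_term_rec m p), RtoC_plus by auto.
  replace (zdelta (S m) (p + 1)) with (zdelta m p) by (unfold zdelta; lia).
  replace (IZR (zdelta (S m) p)) with (IZR (zdelta m p) + 2) by (rewrite !IZR_zdelta, S_INR; ring).
  rewrite Cpower_plus, Cpower_2 by auto. ring.
Qed.

Lemma remainder_derive (m : nat) (p : Z) (a : C) (lambda : R) :
  right_sector a -> 0 < lambda ->
  is_Cderive (remainder m p a) lambda (- remainder m (p + 1) a lambda)%C.
Proof.
  intros Ha Hl. assert (Ha0 := right_sector_neq_0 a Ha). unfold remainder. eapply is_Cderive_eq.
  - apply is_Cderive_plus; [| apply tail_term_derive].
    apply is_Cderive_minus; [| apply zeta_term_derive].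
    apply is_Cderive_minus; [apply is_Cderive_scal, lattice_sum_derive; auto |].
    apply is_Cderive_scal, is_Cderive_RtoC, main_term_derive; auto.
  - replace (IZR (zdelta m p)) with (IZR (zdelta m (p + 1)) + 2) by (rewrite !IZR_zdelta, plus_IZR; ring).
    rewrite Cpower_plus, Cpower_2, RtoC_opp by auto. field. auto.
Qed.

Lemma Jfun_remainder (m : nat) (p : Z) (lambda : R) (B : nat -> nat -> R) (a : C) :
  is_Bcoef p B -> right_sector a ->
  (Jfun (INR m) p a lambda
   + RtoC (powerRZ (-1) (Z.of_nat m - p) * PI) * Cpower a (2 * IZR p + 1)
     * Cexp (RtoC lambda - RtoC (2 * PI) * a) * ABsum m B lambda a)%C
  = (Cpower a (- IZR (zdelta m p)) * remainder m p a lambda)%C.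
Proof.
  intros HB Ha. assert (Ha0 := right_sector_neq_0 a Ha).
  unfold Jfun. cbv zeta. rewrite Ssum_lattice_sum, calH1_main_term, Hfun_zeta_term, (ABsum_eq m p B) by auto.
  rewrite <- IZR_zdelta. unfold remainder, tail_term. fold (neg1_pow (Z.of_nat m - p)).
  replace (1 - IZR (zdelta m p)) with (- IZR (zdelta m p) + 1) by ring.
  (* The exponent is split off in this way so that a^(2m) cancels the denominator of the double
     sum. *)
  replace (2 * IZR p + 1) with (- IZR (zdelta m p) + 1 + INR (2 * m)) by (rewrite IZR_zdelta, mult_INR, INR_two; ring).
  rewrite !Cpower_plus, Cpower_1, Cpower_INR by auto.
  assert (N := Cpow_nz a (2 * m) Ha0).
  assert (E := Cpower_opp a (IZR (zdelta m p))).
  set (u := Cpower a (- IZR (zdelta m p))) in *. set (v := Cpower a (IZR (zdelta m p))) in *.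
  set (S0 := lattice_sum m p a lambda). set (t := tail_sum _ _ _ _).
  transitivity (u * v * S0 - u * a * RtoC (main_term m p lambda) - u * zeta_term m p a lambda
    + RtoC (neg1_pow (Z.of_nat m - p) * PI) * (u * a) * Cexp (RtoC lambda - RtoC (2 * PI) * a) * t)%C.
  - rewrite E. field. auto.
  - ring.
Qed.

Lemma Carg_right_sector (a : C) : right_sector a -> - PI / 2 < Carg a < PI / 2.
Proof.
  intros Ha. assert (Ha0 := right_sector_neq_0 a Ha). destruct Ha as [H1 _].
  assert (Hm : 0 < Cmod a) by (now apply Cmod_gt_0). assert (P := PI_RGT_0).
  assert (Q : 0 < Re a / Cmod a) by (now apply Rdiv_lt_0_compat).
  assert (HB := Re_over_Cmod a Ha0).
  assert (A : 0 <= acos (Re a / Cmod a) < PI / 2).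
  { assert (AB := acos_bound (Re a / Cmod a)). split; [lra |].
    destruct (Rlt_le_dec (acos (Re a / Cmod a)) (PI / 2)) as [|Hge]; auto. exfalso.
    assert (C1 := cos_acos (Re a / Cmod a) HB). assert (C2 : cos (acos (Re a / Cmod a)) <= 0) by (apply cos_le_0; lra). lra. }
  unfold Carg. destruct (Rle_dec 0 (Im a)); lra.
Qed.

(** The half-integral power of lambda / (pi a^2) is separated into a real power and a principal
    power of a by [Cpower_inv_sqr]; the rest is collecting exponents. *)
Lemma expansion_saddle_sum (m : nat) (p : Z) (lambda : R) (M : nat) (a : C) :
  right_sector a -> 0 < lambda ->
  expansion m p lambda M a =
  (Cpower a (- IZR (zdelta m p)) * (RtoC (neg1_pow (Z.of_nat m - p))
    * saddle_sum (fun r t => Ccoef m p t r) (zdelta m p) (M - 1) a lambda))%C.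
Proof.
  intros Ha Hl. assert (Ha0 := right_sector_neq_0 a Ha). assert (P := PI_RGT_0).
  assert (Hc := Carg_right_sector a Ha).
  unfold expansion. cbv zeta. rewrite <- IZR_zdelta. fold (neg1_pow (Z.of_nat m - p)). set (d := zdelta m p).
  replace (RtoC lambda / (RtoC PI * a ^ 2))%C with (RtoC (lambda / PI) / (a * a))%C.
  2:{ rewrite RtoC_div by lra. simpl. field. split; [auto | apply RtoC_neq; lra]. }
  assert (Hlp : 0 < lambda / PI) by (now apply Rdiv_lt_0_compat).
  rewrite Cpower_inv_sqr by auto.
  rewrite (Cmult_comm (RtoC (neg1_pow _))), <- !Cmult_assoc.
  unfold saddle_sum.
  set (v := (RtoC (Rpower (lambda / PI) (IZR d - / 2)) * Cpower a (- (2 * (IZR d - / 2))))%C).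
  transitivity (RtoC (neg1_pow (Z.of_nat m - p)) * (v * sum_n (fun r => RtoC ((-1) ^ r * Ccoef m p lambda r) *
      (RtoC lambda / (RtoC (PI ^ 2) * a ^ 2)) ^ r * Esum (IZR d) lambda r a)%C (M - 1)))%C; [unfold v; ring |].
  transitivity (RtoC (neg1_pow (Z.of_nat m - p)) * (Cpower a (- IZR d) * sum_n (fun r => RtoC ((-1) ^ r * Ccoef m p lambda r) * saddle_term d r a lambda)%C (M - 1)))%C; [| ring].
  f_equal. rewrite <- !sum_n_Cscal. apply sum_n_ext. intros r.
  rewrite Esum_gauss_zeta by auto. unfold saddle_term, v.
  replace ((RtoC lambda / (RtoC (PI ^ 2) * a ^ 2)) ^ r)%C with (RtoC (Rpower lambda (INR r) * Rpower PI (- (2 * INR r))) * Cpower a (- (2 * INR r)))%C.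
  2:{ assert (E1 := Cpower_opp a (INR (2 * r))). rewrite Cpower_INR in E1 by auto. rewrite mult_INR, INR_two in E1.
      replace (RtoC lambda / (RtoC (PI ^ 2) * a ^ 2))%C with (RtoC (lambda * / PI ^ 2) * / (a ^ 2))%C.
      2:{ rewrite RtoC_mult, RtoC_inv by nra. simpl. field. split; [auto |]. rewrite Rmult_1_r, RtoC_mult. apply Cmult_neq_0; apply RtoC_neq; lra. }
      rewrite Cpow_mult_l, Cpow_inv by (now apply Cpow_nz). rewrite <- Cpow_mult_r, <- RtoC_pow.
      assert (N := Cpow_nz a (2 * r) Ha0).
      replace (/ a ^ (2 * r))%C with (Cpower a (- (2 * INR r))).
      2:{ transitivity (Cpower a (- (2 * INR r)) * a ^ (2 * r) * / a ^ (2 * r))%C; [field; auto | rewrite E1; ring]. }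
      do 2 f_equal. rewrite Rpow_mult_distr, Rpower_pow, pow_inv, <- pow_mult by auto. f_equal.
      rewrite Rpower_Ropp. f_equal. rewrite <- (Rpower_pow (2 * r)) by auto. rewrite mult_INR, INR_two. reflexivity. }
  replace (Rpower lambda (IZR d + INR r - / 2) * Rpower PI (/ 2 - (IZR d + 2 * INR r)))
    with (Rpower (lambda / PI) (IZR d - / 2) * (Rpower lambda (INR r) * Rpower PI (- (2 * INR r)))).
  2:{ unfold Rdiv. rewrite <- Rpower_mult_distr by (auto; now apply Rinv_0_lt_compat).
      replace (Rpower (/ PI) (IZR d - / 2)) with (Rpower PI (- (IZR d - / 2))) by (unfold Rpower; rewrite ln_Rinv by auto; f_equal; ring).
      replace (IZR d + INR r - / 2) with (IZR d - / 2 + INR r) by ring.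
      replace (/ 2 - (IZR d + 2 * INR r)) with (- (IZR d - / 2) + - (2 * INR r)) by ring. rewrite !Rpower_plus. ring. }
  replace (Cpower a (1 - (IZR d + 2 * INR r))) with (Cpower a (IZR d) * (Cpower a (- (2 * (IZR d - / 2))) * Cpower a (- (2 * INR r))))%C.
  2:{ rewrite <- !Cpower_plus. f_equal. field. }
  assert (E := Cpower_opp a (IZR d)). rewrite (RtoC_mult (Rpower (lambda / PI) (IZR d - / 2))).
  set (u := Cpower a (- IZR d)) in *. set (w := Cpower a (IZR d)) in *.
  set (k1 := RtoC (Rpower (lambda / PI) _)). set (k2 := RtoC (Rpower lambda (INR r) * Rpower PI (- (2 * INR r)))). set (c1 := Cpower a (- (2 * (IZR d - / 2)))). set (c2 := Cpower a (- (2 * INR r))).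
  set (g := gauss_zeta _ _ _). set (cc := RtoC ((-1) ^ r * Ccoef m p lambda r)).
  transitivity ((u * w) * (cc * (k1 * k2 * (c1 * c2) * g)))%C; [rewrite E; cring | cring].
Qed.

(** The theta transformation with b = sqrt(lambda) / a. Its constant on the left is the zeta term
    -1/2, its constant on the right is the main term, and the dual sum is the only term of the
    series. *)
Lemma remainder_0_0 (a : C) (lambda : R) :
  right_sector a -> 0 < lambda -> remainder 0 0 a lambda = saddle_term 0 0 a lambda.
Proof.
  intros Ha Hl. assert (Ha0 := right_sector_neq_0 a Ha). assert (P := PI_RGT_0).
  assert (Hs : 0 < sqrt lambda) by (now apply sqrt_lt_R0).
  assert (Hss : sqrt lambda * sqrt lambda = lambda) by (apply sqrt_sqrt; lra).
  assert (Hsc := RtoC_neq _ (Rgt_not_eq _ _ Hs)).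
  set (b := (RtoC (sqrt lambda) * / a)%C).
  assert (Hb1 : 0 < Re b).
  { unfold b. rewrite Re_scal. apply Rmult_lt_0_compat; auto. destruct Ha as [H1 _].
    destruct a as [u v]; simpl in *. apply Rdiv_lt_0_compat; nra. }
  assert (Ebb : (b * b)%C = (RtoC lambda * / (a * a))%C).
  { unfold b. rewrite <- Hss at 3. rewrite RtoC_mult. field; auto. }
  assert (Hb2 : 0 < Re (b * b)%C).
  { rewrite Ebb, Re_scal. apply Rmult_lt_0_compat; auto. now apply inv_sqr_Re. }
  assert (T := theta_transform b Hb1 Hb2).
  assert (E1 : lattice_sum 0 0 a lambda = CSeries (fun j => gauss b (INR (S j)))).
  { apply CSeries_ext. intros j. unfold lattice_term, gauss.
    replace (2 * IZR 0) with 0 by ring. unfold Rpower. rewrite Rmult_0_l, exp_0. simpl (_ ^ 0)%C.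
    replace (b * RtoC (INR (S j)) * (b * RtoC (INR (S j))))%C with (b * b * RtoC (INR (S j) ^ 2))%C by (rewrite RtoC_pow; ring).
    rewrite Ebb, RtoC_mult. rewrite (Cmult_comm (RtoC lambda) (RtoC (INR (S j) ^ 2))).
    replace (RtoC lambda * / (a * a) * RtoC (INR (S j) ^ 2))%C with (RtoC (INR (S j) ^ 2) * RtoC lambda * / (a * a))%C by ring.
    set (e := Cexp _). field. }
  assert (E2 : gauss_zeta 0 a lambda = CSeries (fun j => gauss (RtoC PI / b) (INR (S j)))).
  { apply CSeries_ext. intros j. unfold gauss_zeta_term, gauss. rewrite Ropp_0. unfold Rpower. rewrite Rmult_0_l, exp_0, Cmult_1_r. f_equal. f_equal.
    assert (Hbn : b <> RtoC 0) by (now apply ne_0_of_Re).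
    replace (RtoC PI / b * RtoC (INR (S j)) * (RtoC PI / b * RtoC (INR (S j))))%C with (RtoC (PI ^ 2 * INR (S j) ^ 2) * / (b * b))%C.
    2:{ rewrite RtoC_mult, !RtoC_pow. simpl. field; auto. }
    rewrite Ebb, RtoC_inv by lra. field. split; [auto | apply RtoC_neq; lra]. }
  unfold remainder, saddle_term. rewrite E1, main_term_0_0.
  unfold zeta_term, tail_term. change (1 <=? 0)%Z with false. cbv iota. simpl (Z.to_nat (- 0)). rewrite zeta_sum_0. simpl (tail_sum _ 0 0 lambda).
  replace (IZR (zdelta 0 0)) with 0 by (simpl; reflexivity). rewrite Cpower_0.
  simpl (INR 0). replace (0 + 0 - / 2) with (- / 2) by ring. replace (0 + 2 * 0) with 0 by ring.
  replace (/ 2 - 0) with (/ 2) by ring. replace (1 - 0) with 1 by ring. rewrite Cpower_1, E2 by auto.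
  set (Th := CSeries (fun j => gauss b (INR (S j)))) in *. set (Td := CSeries (fun j => gauss (RtoC PI / b) (INR (S j)))) in *.
  assert (ET : Th = (RtoC (sqrt PI) / b * (/ RtoC 2 + Td) - / RtoC 2)%C) by (rewrite <- T; ring).
  rewrite ET. rewrite Rpower_Ropp, Rpower_sqrt by auto. rewrite Rpower_sqrt by auto.
  unfold b. rewrite !RtoC_mult, !RtoC_opp, !RtoC_inv by lra. field. repeat split; auto; apply RtoC_neq; lra.
Qed.

Lemma remainder_0_nat (n : nat) (a : C) : right_sector a -> forall lambda N, 0 < lambda -> (n <= N)%nat ->
  remainder 0 (Z.of_nat n) a lambda
  = (RtoC (neg1_pow (- Z.of_nat n)) * saddle_sum (fun r t => Ccoef 0 (Z.of_nat n) t r) (zdelta 0 (Z.of_nat n)) N a lambda)%C.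
Proof.
  intros Ha. induction n as [|n IH]; intros lambda N Hl HN.
  - simpl Z.of_nat. rewrite remainder_0_0 by auto. simpl (neg1_pow _). replace (neg1_pow 0) with 1 by reflexivity. rewrite Cmult_1_l.
    unfold saddle_sum. induction N as [|N IHN].
    + rewrite sum_O, Ccoef_0. simpl ((-1) ^ 0). rewrite Rmult_1_r. change (zdelta 0 0) with 0%Z. symmetry; apply Cmult_1_l.
    + rewrite sum_n_CS, <- IHN by lia. rewrite (Ccoef_m0_vanish 0) by lia. rewrite Rmult_0_r. cring.
  - replace (Z.of_nat (S n)) with (Z.of_nat n + 1)%Z by lia. set (p := Z.of_nat n) in *.
    assert (D1 := remainder_derive 0 p a lambda Ha Hl).
    assert (Ed : IZR (zdelta 0 p) = - 2 * IZR p) by (rewrite IZR_zdelta; simpl (INR 0); ring).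
    assert (D2 := saddle_sum_derive (fun r t => Ccoef 0 p t r) (fun _ _ => 0) (fun r t => Ccoef 0 (p + 1) t r) (zdelta 0 p) N a lambda Ha Hl
      (fun r => Ccoef_m0_derive p lambda r)).
    cbv beta in D2. rewrite !Ccoef_0, Ed in D2. specialize (D2 eq_refl (fun r => Ccoef_m0_rec p lambda r)).
    (* Here N exceeds n, so the leftover term has coefficient 0 and differentiation creates no
       error. *)
    unfold p in D2 at 6. rewrite (Ccoef_m0_vanish n lambda N) in D2 by lia.
    replace (zdelta 0 p - 2)%Z with (zdelta 0 (p + 1)) in D2 by (unfold zdelta; lia).
    assert (D3 : is_Cderive (remainder 0 p a) lambda (RtoC (neg1_pow (- p)) * saddle_sum (fun r t => Ccoef 0 (p + 1) t r) (zdelta 0 (p + 1)) N a lambda)%C).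
    { apply (is_Cderive_ext_loc (fun t => RtoC (neg1_pow (- p)) * saddle_sum (fun r t => Ccoef 0 p t r) (zdelta 0 p) N a t)%C).
      - exists (mkposreal lambda Hl). intros t Ht. change (Rabs (t - lambda) < lambda) in Ht. apply Rabs_def2 in Ht.
        symmetry. apply IH; [lra | lia].
      - eapply is_Cderive_eq; [apply is_Cderive_scal, D2 |]. rewrite !Rmult_0_r, Rplus_0_r, Rmult_0_r. ring. }
    assert (E := is_Cderive_unique _ _ _ _ D1 D3).
    replace (- p)%Z with (- (p + 1) + 1)%Z in E by lia. rewrite neg1_pow_succ, RtoC_opp in E.
    transitivity (- - remainder 0 (p + 1) a lambda)%C; [ring | rewrite E; ring].
Qed.

Lemma remainder_lim (m : nat) (p : Z) (a : C) :
  right_sector a -> is_Clim (at_right 0) (remainder m p a) (RtoC 0).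
Proof.
  intros Ha. assert (Ha0 := right_sector_neq_0 a Ha). revert p. induction m as [|m IH].
  - intros p. destruct (Z_le_gt_dec 0 p) as [Hp | Hp].
    + rewrite <- (Z2Nat.id p) by auto. set (n := Z.to_nat p).
      (* For m = 0 <= p the exact formula applies; its coefficients do not depend on lambda and may
         be frozen at 0. *)
      apply (is_Clim_ext (at_right 0) (fun t => RtoC (neg1_pow (- Z.of_nat n)) * saddle_sum (fun r t => Ccoef 0 (Z.of_nat n) 0 r) (zdelta 0 (Z.of_nat n)) n a t)%C).
      * apply at_right_pos. intros t Ht. rewrite (remainder_0_nat n a Ha t n Ht (le_n _)). f_equal.
        unfold saddle_sum. apply sum_n_ext. intros r. now rewrite !Ccoef_m0.
      * replace (RtoC 0) with (RtoC (neg1_pow (- Z.of_nat n)) * RtoC 0)%C by ring.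
        apply is_Clim_mult; [typeclasses eauto | apply is_Clim_const; typeclasses eauto |].
        unfold saddle_sum.
        assert (Z0 : forall k, sum_n (fun _ : nat => RtoC 0) k = RtoC 0).
        { induction k as [|k IHk]; [apply sum_O | rewrite sum_n_CS, IHk; cring]. }
        eapply is_Clim_eq; [apply (is_Clim_sum_n (at_right 0) (fun r t => RtoC ((-1) ^ r * Ccoef 0 (Z.of_nat n) 0 r) * saddle_term (zdelta 0 (Z.of_nat n)) r a t)%C (fun _ => RtoC 0)) | apply Z0].
        intros r _. replace (RtoC 0) with (RtoC ((-1) ^ r * Ccoef 0 (Z.of_nat n) 0 r) * RtoC 0)%C by ring.
        apply is_Clim_mult; [typeclasses eauto | apply is_Clim_const; typeclasses eauto | apply saddle_term_lim; auto].
    + set (q := Z.to_nat (- p - 1)). assert (Ep : p = (- Z.of_nat (S q))%Z) by (unfold q; lia).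
      assert (L1 := lattice_sum_lim_zeta q a Ha). rewrite <- Ep in L1.
      assert (L2 := zeta_sum_lim (S q) a).
      (* The first series vanishes with 1/Gamma(0), and the second carries the positive power -p -
         1/2 of lambda. *)
      assert (L3 : is_Clim (at_right 0) (fun t => RtoC (main_term 0 p t)) (RtoC 0)).
      { apply is_Clim_RtoC; [typeclasses eauto |].
        assert (H0 : / 2 * main_coef1 0 p 0 = 0) by (unfold main_coef1; simpl (INR 0); rewrite rGamma_0; ring).
        rewrite <- H0 at 2. apply main_term_lim. simpl (INR 0). assert (IZR p <= -1) by (apply IZR_le; lia). lra. }
      assert (EZ : forall t, zeta_term 0 p a t = zeta_sum 0 (S q) a t).
      { intros t. unfold zeta_term. replace (1 <=? p)%Z with false by (symmetry; apply Z.leb_gt; lia). f_equal. lia. }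
      unfold remainder.
      eapply is_Clim_eq.
      * apply is_Clim_plus; [typeclasses eauto | |].
        -- apply is_Clim_minus; [typeclasses eauto | |].
           ++ apply is_Clim_minus; [typeclasses eauto | |].
              ** apply is_Clim_mult; [typeclasses eauto | apply is_Clim_const; typeclasses eauto | exact L1].
              ** apply is_Clim_mult; [typeclasses eauto | apply is_Clim_const; typeclasses eauto | exact L3].
           ++ eapply (is_Clim_ext (at_right 0)); [apply filter_forall; intros t; symmetry; apply EZ | exact L2].
        -- unfold tail_term. simpl (tail_sum _ 0 p _). apply (is_Clim_ext (at_right 0) (fun _ => RtoC 0)); [| apply is_Clim_const; typeclasses eauto].
           apply filter_forall; intros t. simpl tail_sum. ring.
      * replace (IZR (zdelta 0 p)) with (INR (2 * S q)).
        2:{ rewrite IZR_zdelta, Ep, opp_IZR, <- INR_IZR_INZ, mult_INR, INR_two. simpl (INR 0). ring. }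
        rewrite Cpower_INR by auto. ring.
  (* At p = 0 the limit of the lattice sum has three parts. The one with [lattice_coef] is cancelled
     by the main term, the inverse even power by zeta(0), and the exponential part by the residue
     sum. *)
  - assert (L0 : is_Clim (at_right 0) (remainder (S m) 0 a) (RtoC 0)).
    { assert (L1 := lattice_sum_lim_0 m a Ha).
      assert (L3 : is_Clim (at_right 0) (fun t => RtoC (main_term (S m) 0 t)) (RtoC (lattice_coef m))).
      { apply is_Clim_RtoC; [typeclasses eauto |]. rewrite lattice_coef_main. apply main_term_lim.
        rewrite S_INR. assert (Hm := pos_INR m). lra. }
      assert (L4 := is_Clim_of_derive _ _ (tail_term_derive (S m) 0 a 0)).
      assert (L5 := is_Clim_of_derive _ _ (zeta_term_derive (S m) 0 a 0)).
      unfold remainder. eapply is_Clim_eq.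
      - apply is_Clim_plus; [typeclasses eauto | | exact L4].
        apply is_Clim_minus; [typeclasses eauto | | exact L5].
        apply is_Clim_minus; [typeclasses eauto | |].
        + apply is_Clim_mult; [typeclasses eauto | apply is_Clim_const; typeclasses eauto | exact L1].
        + apply is_Clim_mult; [typeclasses eauto | apply is_Clim_const; typeclasses eauto | exact L3].
      - assert (EZ : zeta_term (S m) 0 a 0 = RtoC (- / 2)) by apply zeta_sum_0.
        assert (ET : tail_term (S m) 0 a 0 = (- (RtoC (PI / INR (fact m)) * a * basis_sum (exp_moment a 1) 0 m))%C).
        { unfold tail_term.
          (* At lambda = 0 only the top weight survives, the others containing a positive power of
             lambda. *)
          assert (Es : tail_sum (scaled_sigma a) (S m) 0 0 = (RtoC ((-1) ^ m / INR (fact m)) * basis_sum (scaled_sigma a) 0 m)%C).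
          { unfold tail_sum. destruct m as [|m']; [rewrite sum_O, Acoef_top; reflexivity |].
            rewrite sum_n_CS, Acoef_top.
            assert (Z0 : forall k, (k <= m')%nat -> sum_n (fun l => RtoC (Acoef (S (S m')) 0 l) * basis_sum (scaled_sigma a) 0 l)%C k = RtoC 0).
            { assert (A0 : forall l, (l <= m')%nat -> Acoef (S (S m')) 0 l = 0).
              { intros l Hlm. unfold Acoef. replace (S (S m') - 1 - l)%nat with (S (m' - l)) by lia. rewrite pow_ne_zero by lia. unfold Rdiv; ring. }
              induction k as [|k IHk]; intros Hk; [rewrite sum_O, A0 by lia; cring | rewrite sum_n_CS, IHk, A0 by lia; cring]. }
            rewrite Z0 by lia. cring. }
          rewrite Es.
          (* The factor exp(2 pi a) inside sigma cancels against exp(-2 pi a), leaving the moments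
             produced by differentiating coth. *)
          assert (Ey : forall r, (Cexp (RtoC 0 - RtoC (2 * PI) * a) * scaled_sigma a r)%C = exp_moment a 1 r).
          { intros r. unfold scaled_sigma, Defs.sigma.
            replace (RtoC 0 - RtoC (2 * PI) * a)%C with (- (RtoC (2 * PI) * a))%C by ring.
            transitivity (Cexp (- (RtoC (2 * PI) * a)) * Cexp (RtoC (2 * PI) * a) * ((RtoC (2 * PI) * a) ^ r * CSeries (fun j => RtoC (INR (S j) ^ r) * Cexp (- (RtoC (2 * PI * INR (S j)) * a)))))%C; [ring |].
            rewrite Cexp_opp, Cmult_1_l. symmetry. apply is_Cseries_unique.
            assert (Ec := exp_moment_correct a 1 r Rlt_0_1 (proj1 Ha)).
            assert (En := Cpow_nz (RtoC (2 * PI) * a)%C r).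
            assert (N0 : (RtoC (2 * PI) * a)%C <> RtoC 0) by (apply Cmult_neq_0; auto; apply RtoC_neq; assert (P := PI_RGT_0); lra).
            specialize (En N0). set (w := ((RtoC (2 * PI) * a) ^ r)%C) in *.
            assert (Term : forall j, (let z := (RtoC (2 * PI * INR (S j)) * a * RtoC 1) in z ^ r * Cexp (- z))%C = (w * (RtoC (INR (S j) ^ r) * Cexp (- (RtoC (2 * PI * INR (S j)) * a))))%C).
            { intros j. cbv zeta. rewrite Cmult_1_r. rewrite (RtoC_mult (2 * PI)).
              replace (RtoC (2 * PI) * RtoC (INR (S j)) * a)%C with (RtoC (2 * PI) * a * RtoC (INR (S j)))%C by ring.
              rewrite Cpow_mult_l, RtoC_pow. fold w. ring. }
            assert (Eq2 : is_Cseries (fun j => RtoC (INR (S j) ^ r) * Cexp (- (RtoC (2 * PI * INR (S j)) * a)))%C (/ w * exp_moment a 1 r)%C).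
            { apply (is_Cseries_ext (fun j => / w * (let z := (RtoC (2 * PI * INR (S j)) * a * RtoC 1) in z ^ r * Cexp (- z)))%C); [| now apply is_Cseries_scal].
              intros j. rewrite Term. field; auto. }
            rewrite (is_Cseries_unique _ _ Eq2).
            replace (w * (/ w * exp_moment a 1 r))%C with (exp_moment a 1 r) by (field; auto). exact Ec. }
          assert (Eb : (Cexp (RtoC 0 - RtoC (2 * PI) * a) * basis_sum (scaled_sigma a) 0 m)%C = basis_sum (exp_moment a 1) 0 m).
          { unfold basis_sum. rewrite <- sum_n_Cscal. apply sum_n_ext. intros r. rewrite <- Ey. cring. }
          rewrite <- Eb.
          assert (Esg : neg1_pow (Z.of_nat (S m) - 0) * (-1) ^ m = -1).
          { unfold neg1_pow. rewrite Z.sub_0_r, <- pow_powerRZ. simpl pow. rewrite Rmult_assoc, <- Rpow_mult_distr. replace (-1 * -1) with 1 by ring. rewrite pow1; ring. }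
          set (s := neg1_pow _) in *. set (e := Cexp _).
          replace (RtoC (s * PI) * a * e * (RtoC ((-1) ^ m / INR (fact m)) * basis_sum (scaled_sigma a) 0 m))%C with
            (RtoC (s * (-1) ^ m) * (RtoC (PI / INR (fact m)) * a * (e * basis_sum (scaled_sigma a) 0 m)))%C.
          2:{ unfold Rdiv. rewrite !RtoC_mult. ring. }
          rewrite Esg. replace (RtoC (-1)) with (- RtoC 1)%C by (rewrite <- RtoC_opp; reflexivity). ring. }
        rewrite EZ, ET.
        replace (IZR (zdelta (S m) 0)) with (INR (2 * S m)) by (rewrite IZR_zdelta, mult_INR, INR_two; ring).
        rewrite Cpower_INR by auto. replace (2 * S m)%nat with (S (S (2 * m))) by lia. rewrite !Cpow_S.
        assert (N := Cpow_nz a (2 * m) Ha0). rewrite RtoC_opp, RtoC_inv by lra. field. repeat split; auto; apply RtoC_neq; lra. }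
    (* The recurrence relates (m+1, p+1) and (m+1, p) through (m, p), which is known; starting from
       p = 0 it is solved for the first when ascending and for the second when descending. *)
    assert (Up : forall n : nat, is_Clim (at_right 0) (remainder (S m) (Z.of_nat n) a) (RtoC 0)).
    { induction n as [|n IHn]; [exact L0 |].
      apply (is_Clim_ext (at_right 0) (fun t => remainder m (Z.of_nat n) a t - remainder (S m) (Z.of_nat n) a t)%C).
      - apply at_right_pos. intros t Ht. rewrite (remainder_rec m (Z.of_nat n)) by auto.
        replace (Z.of_nat (S n)) with (Z.of_nat n + 1)%Z by lia. ring.
      - replace (RtoC 0) with (RtoC 0 - RtoC 0)%C by ring. apply is_Clim_minus; [typeclasses eauto | apply IH | exact IHn]. }
    assert (Dn : forall n : nat, is_Clim (at_right 0) (remainder (S m) (- Z.of_nat n) a) (RtoC 0)).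
    { induction n as [|n IHn]; [exact L0 |].
      apply (is_Clim_ext (at_right 0) (fun t => remainder m (- Z.of_nat (S n)) a t - remainder (S m) (- Z.of_nat n) a t)%C).
      - apply at_right_pos. intros t Ht. rewrite (remainder_rec m (- Z.of_nat (S n))) by auto.
        replace (- Z.of_nat (S n) + 1)%Z with (- Z.of_nat n)%Z by lia. ring.
      - replace (RtoC 0) with (RtoC 0 - RtoC 0)%C by ring. apply is_Clim_minus; [typeclasses eauto | apply IH | exact IHn]. }
    intros p. destruct (Z_le_gt_dec 0 p).
    + rewrite <- (Z2Nat.id p) by auto. apply Up.
    + replace p with (- Z.of_nat (Z.to_nat (- p)))%Z by lia. apply Dn.
Qed.

(** * Propagation of the asymptotic bounds *)

(** A closed subsector, with k = sin(2 eps) in the application, outside the unit disc. On it |a|^2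
    and [saddle_exponent] are comparable. *)
Definition in_sector (k : R) (a : C) : Prop := 0 < Re a /\ k * Cmod a ^ 2 <= Re (a * a)%C /\ 1 <= Cmod a.

Lemma in_sector_right (k : R) (a : C) : 0 < k -> in_sector k a -> right_sector a.
Proof. intros Hk [H1 [H2 H3]]. split; auto. assert (0 < Cmod a ^ 2) by nra. nra. Qed.

(** The constant is uniform down to lambda = 0, as required for integrating the bound from there. *)
Definition negligible (k L : R) (d : Z) (r : nat) (G : C -> R -> C) : Prop :=
  exists K, 0 < K /\ forall a lambda, in_sector k a -> 0 < lambda <= L ->
    Cmod (G a lambda) <= K * saddle_size d r a lambda.

Lemma saddle_exponent_sector (k L lambda : R) (a : C) :
  0 < k -> in_sector k a -> 0 < lambda <= L -> PI ^ 2 * k / L <= saddle_exponent a / lambda.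
Proof.
  intros Hk [H1 [H2 H3]] Hl. assert (P := PI_RGT_0). unfold saddle_exponent.
  assert (A1 : k <= Re (a * a)%C).
  { assert (1 <= Cmod a ^ 2) by nra. nra. }
  assert (P2 : 0 < PI ^ 2) by (apply pow_lt; lra).
  unfold Rdiv. apply Rmult_le_compat.
  - apply Rmult_le_pos; lra.
  - apply Rlt_le, Rinv_0_lt_compat; lra.
  - apply Rmult_le_compat_l; lra.
  - apply Rinv_le_contravar; lra.
Qed.

Lemma negligible_saddle_term (k L : R) (d : Z) (r : nat) :
  0 < k -> 0 < L -> negligible k L d r (saddle_term d r).
Proof.
  intros Hk HL. assert (P := PI_RGT_0).
  destruct (saddle_term_bound d r (PI ^ 2 * k / L)) as [B [HB H]].
  - apply Rdiv_lt_0_compat; auto. apply Rmult_lt_0_compat; nra.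
  - exists B. split; auto. intros a lambda Ha Hl. apply H; [lra |]. now apply saddle_exponent_sector.
Qed.

Lemma negligible_plus (k L : R) (d : Z) (r : nat) (G H : C -> R -> C) :
  negligible k L d r G -> negligible k L d r H -> negligible k L d r (fun a t => G a t + H a t)%C.
Proof.
  intros [K1 [HK1 H1]] [K2 [HK2 H2]]. exists (K1 + K2). split; [lra |]. intros a lambda Ha Hl.
  eapply Rle_trans; [apply Cmod_triangle |]. rewrite Rmult_plus_distr_r.
  apply Rplus_le_compat; auto.
Qed.

Lemma negligible_scal (k L : R) (d : Z) (r : nat) (f : R -> R) (G : C -> R -> C) :
  (exists B, forall t, 0 < t <= L -> Rabs (f t) <= B) ->
  negligible k L d r G -> negligible k L d r (fun a t => RtoC (f t) * G a t)%C.
Proof.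
  intros [B HB] [K [HK H]]. exists ((Rabs B + 1) * K). split; [assert (Q := Rabs_pos B); nra |].
  intros a lambda Ha Hl. rewrite Cmod_mult, Cmod_R, Rmult_assoc.
  assert (Q := Rle_abs B). specialize (HB lambda Hl). apply Rmult_le_compat; auto; [apply Rabs_pos | apply Cmod_ge_0 | lra].
Qed.

Lemma negligible_ext (k L : R) (d : Z) (r : nat) (G H : C -> R -> C) :
  (forall a t, in_sector k a -> 0 < t <= L -> G a t = H a t) -> negligible k L d r G -> negligible k L d r H.
Proof. intros E [K [HK Q]]. exists K. split; auto. intros a t Ha Ht. rewrite <- E; auto. Qed.

(** One further order gains a factor lambda / |a|^2, which is at most L because |a| >= 1. *)
Lemma negligible_lower (k L : R) (d : Z) (r : nat) (G : C -> R -> C) :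
  0 < L -> negligible k L d (S r) G -> negligible k L d r G.
Proof.
  intros HL [K [HK H]]. exists (K * L). split; [nra |]. intros a lambda Ha Hl.
  eapply Rle_trans; [apply H; auto |]. rewrite Rmult_assoc. apply Rmult_le_compat_l; [lra |].
  destruct Ha as [_ [_ Ha]]. unfold saddle_size. rewrite S_INR.
  replace (IZR d + (INR r + 1) - / 2) with (IZR d + INR r - / 2 + 1) by ring.
  replace (1 - (IZR d + 2 * (INR r + 1))) with (1 - (IZR d + 2 * INR r) + - (2)) by ring.
  rewrite !Rpower_plus, Rpower_1, Rpower_Ropp, Rpower_2 by lra.
  assert (0 < / Cmod a ^ 2 <= 1).
  { split; [apply Rinv_0_lt_compat; nra |]. rewrite <- Rinv_1. apply Rinv_le_contravar; nra. }
  set (u := Rpower lambda _). set (v := Rpower (Cmod a) _). set (e := exp _).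
  assert (0 < u) by apply exp_pos. assert (0 < v) by apply exp_pos. assert (0 < e) by apply exp_pos.
  replace (u * lambda * (v * / Cmod a ^ 2) * e) with (lambda * / Cmod a ^ 2 * (u * v * e)) by ring.
  apply Rmult_le_compat_r; [mul_nonneg |]. nra.
Qed.

Lemma Rabs_le_of_derive_right (f g f' g' : R -> R) (x : R) :
  0 < x ->
  (forall t, 0 < t <= x -> is_derive f t (f' t)) ->
  (forall t, 0 < t <= x -> is_derive g t (g' t)) ->
  (forall t, 0 < t <= x -> Rabs (f' t) <= g' t) ->
  (forall t, 0 < t <= x -> 0 <= g t) ->
  filterlim f (at_right 0) (locally 0) ->
  Rabs (f x) <= g x.
Proof.
  intros Hx Hf Hg Hb Hp Hl. apply le_epsilon. intros eps Heps.
  destruct (proj1 (filterlim_locally (F := at_right 0) (U := R_UniformSpace) f 0) Hl (mkposreal eps Heps)) as [d Hd].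
  set (s := Rmin x (d / 2)). assert (Hd0 := cond_pos d).
  assert (Hs : 0 < s) by (apply Rmin_pos; lra). assert (Hsx : s <= x) by apply Rmin_l. assert (Hsd : s <= d / 2) by apply Rmin_r.
  assert (Hfs : Rabs (f s) < eps).
  { specialize (Hd s). assert (B : ball 0 d s) by (change (Rabs (s - 0) < d); rewrite Rminus_0_r, Rabs_pos_eq; lra).
    specialize (Hd B Hs). change (Rabs (f s - 0) < eps) in Hd. now rewrite Rminus_0_r in Hd. }
  assert (D : Rabs (f x - f s) <= g x - g s).
  { apply (Rabs_le_of_derive_le f g f' g'); auto; intros t Ht; [apply Hf | apply Hg | apply Hb]; lra. }
  specialize (Hp s ltac:(lra)).
  replace (f x) with ((f x - f s) + f s) by ring. eapply Rle_trans; [apply Rabs_triang |]. lra.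
Qed.

(* Integration from 0 gains a factor lambda^2/a^2, since (exp(-Y/t))' = Y t^(-2) exp(-Y/t). *)
Lemma negligible_primitive (k L : R) (d : Z) (r : nat) (G G' : C -> R -> C) :
  0 < k -> 0 <= IZR d + INR r - / 2 ->
  (forall a t, in_sector k a -> 0 < t -> is_Cderive (G a) t (G' a t)) ->
  (forall a, in_sector k a -> is_Clim (at_right 0) (G a) (RtoC 0)) ->
  negligible k L (d - 2) r G' -> negligible k L d r G.
Proof.
  intros Hk He HD HL [K [HK H]]. assert (P := PI_RGT_0).
  assert (Hpk : 0 < PI ^ 2 * k) by (apply Rmult_lt_0_compat; nra).
  set (D := K / (PI ^ 2 * k)). assert (HDp : 0 < D) by (now apply Rdiv_lt_0_compat).
  exists (2 * D). split; [lra |]. intros a lambda Ha Hl.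
  set (e := IZR d + INR r - / 2) in *.
  set (v := Rpower (Cmod a) (1 - (IZR d + 2 * INR r))). assert (Hv : 0 < v) by apply exp_pos.
  set (Y := saddle_exponent a).
  assert (HY : PI ^ 2 * k * Cmod a ^ 2 <= Y).
  { unfold Y, saddle_exponent. destruct Ha as [_ [Ha _]]. rewrite Rmult_assoc. apply Rmult_le_compat_l; nra. }
  assert (Ha1 : 1 <= Cmod a) by apply Ha.
  assert (HY0 : 0 < Y) by (assert (0 < PI ^ 2 * k * Cmod a ^ 2) by (apply Rmult_lt_0_compat; nra); lra).
  (* [g] is the comparison primitive. In its derivative the summand from the exponential dominates
     the given bound, by the choice of [D] and the lower bound for [Y]; the summand from the power
     is nonnegative because e >= 0. *)
  set (g := fun t => D * v * (Rpower t e * exp (- (Y / t)))).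
  set (g' := fun t => D * v * (e * Rpower t (e - 1) * exp (- (Y / t)) + Rpower t e * (Y * / t ^ 2 * exp (- (Y / t))))).
  assert (Hg : forall t, 0 < t -> is_derive g t (g' t)).
  { intros t Ht. apply (is_derive_scal (fun t => Rpower t e * exp (- (Y / t)))). apply (is_derive_Rmult (fun t => Rpower t e) (fun t => exp (- (Y / t))) t (e * Rpower t (e - 1)) (Y * / t ^ 2 * exp (- (Y / t)))); [now apply is_derive_Rpower |].
    auto_derive; [lra |]. unfold Rdiv. field. lra. }
  assert (Hg0 : forall t, 0 <= g t).
  { intros t. unfold g. assert (0 < Rpower t e) by apply exp_pos. assert (0 < exp (- (Y / t))) by apply exp_pos.
    mul_nonneg. }
  assert (Hb : forall t, 0 < t <= lambda -> Cmod (G' a t) <= g' t).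
  { intros t Ht. eapply Rle_trans; [apply H; [auto | lra] |]. unfold saddle_size, g'. rewrite minus_IZR. fold Y.
    replace (IZR d - 2 + INR r - / 2) with (e + - (2)) by (unfold e; ring).
    replace (1 - (IZR d - 2 + 2 * INR r)) with (1 - (IZR d + 2 * INR r) + 2) by ring.
    rewrite !Rpower_plus, Rpower_Ropp, !Rpower_2 by lra. fold v.
    set (E := exp (- (Y / t))). assert (0 < E) by apply exp_pos.
    set (u := Rpower t e). assert (0 < u) by apply exp_pos.
    assert (0 < Rpower t (e - 1)) by apply exp_pos.
    assert (0 < / t ^ 2) by (apply Rinv_0_lt_compat, pow_lt; lra).
    assert (T1 : K * (u * / t ^ 2 * (v * Cmod a ^ 2) * E) <= D * v * (u * (Y * / t ^ 2 * E))).
    { replace (D * v * (u * (Y * / t ^ 2 * E))) with ((D * Y) * (u * / t ^ 2 * v * E)) by ring.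
      replace (K * (u * / t ^ 2 * (v * Cmod a ^ 2) * E)) with ((D * (PI ^ 2 * k * Cmod a ^ 2)) * (u * / t ^ 2 * v * E)).
      2:{ unfold D. field. lra. }
      apply Rmult_le_compat_r; [mul_nonneg |]. apply Rmult_le_compat_l; lra. }
    assert (0 <= D * v * (e * Rpower t (e - 1) * E)) by (mul_nonneg). lra. }
  destruct (HL a Ha) as [L1 L2].
  assert (B1 : Rabs (Re (G a lambda)) <= g lambda).
  { apply (Rabs_le_of_derive_right (fun t => Re (G a t)) g (fun t => Re (G' a t)) g'); auto; [lra | | |].
    - intros t Ht. apply (HD a t Ha); lra.
    - intros t Ht. apply Hg; lra.
    - intros t Ht. eapply Rle_trans; [apply re_le_Cmod | auto]. }
  assert (B2 : Rabs (Im (G a lambda)) <= g lambda).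
  { apply (Rabs_le_of_derive_right (fun t => Im (G a t)) g (fun t => Im (G' a t)) g'); auto; [lra | | |].
    - intros t Ht. apply (HD a t Ha); lra.
    - intros t Ht. apply Hg; lra.
    - intros t Ht. eapply Rle_trans; [apply im_le_Cmod | auto]. }
  eapply Rle_trans; [apply Cmod_le_parts |]. unfold saddle_size. fold e v Y. unfold g in B1, B2. lra.
Qed.

Lemma bounded_on_compact (f : R -> R) (L : R) :
  0 < L -> (forall x, continuity_pt f x) -> exists B, forall t, 0 < t <= L -> Rabs (f t) <= B.
Proof.
  intros HL Hf.
  destruct (continuity_ab_maj f 0 L) as [M [HM _]]; [lra | auto |].
  destruct (continuity_ab_min f 0 L) as [m [Hm _]]; [lra | auto |].
  exists (Rabs (f M) + Rabs (f m)). intros t Ht. specialize (HM t ltac:(lra)). specialize (Hm t ltac:(lra)).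
  assert (Q1 := Rle_abs (f M)). assert (Q2 := Rle_abs (- f m)). rewrite Rabs_Ropp in Q2.
  assert (Q3 := Rabs_pos (f M)). assert (Q4 := Rabs_pos (f m)). apply Rabs_le. lra.
Qed.

Lemma continuity_of_derive (f f' : R -> R) : (forall x, is_derive f x (f' x)) -> forall x, continuity_pt f x.
Proof. intros H x. apply continuity_pt_filterlim, (ex_derive_continuous f). eexists; apply H. Qed.

Lemma Ccoef_continuous (m : nat) (p : Z) (r : nat) (x : R) : continuity_pt (fun t => Ccoef m p t r) x.
Proof. apply (continuity_of_derive _ (fun t => Ccoef_derive m p t r)). intros; apply is_derive_Ccoef. Qed.

Lemma Ccoef_derive_continuous (m : nat) (p : Z) (r : nat) (x : R) : continuity_pt (fun t => Ccoef_derive m p t r) x.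
Proof.
  unfold Ccoef_derive.
  apply (continuity_pt_sum_n (fun n t => - INR n * (- t) ^ pred n * (poch (INR m) n / INR (fact n) * half_poch (C_delta m p + 2 * INR n) (r - n)))).
  intros n _. set (K := poch (INR m) n / INR (fact n) * half_poch (C_delta m p + 2 * INR n) (r - n)).
  set (i := INR n). set (q := pred n).
  apply continuity_pt_filterlim, (ex_derive_continuous (fun t => - i * (- t) ^ q * K)). auto_derive; auto.
Qed.

Lemma saddle_sum_scal (f : R -> R) (c : nat -> R -> R) (d : Z) (N : nat) (a : C) (t : R) :
  saddle_sum (fun r t => f t * c r t) d N a t = (RtoC (f t) * saddle_sum c d N a t)%C.
Proof.
  unfold saddle_sum. rewrite <- sum_n_Cscal. apply sum_n_ext. intros r. rewrite !RtoC_mult. cring.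
Qed.

Lemma saddle_sum_lim (c : nat -> R -> R) (d : Z) (N : nat) (a : C) :
  right_sector a -> (forall r, continuity_pt (c r) 0) ->
  is_Clim (at_right 0) (saddle_sum c d N a) (RtoC 0).
Proof.
  intros Ha Hc. unfold saddle_sum.
  assert (Z0 : forall k, sum_n (fun _ : nat => RtoC 0) k = RtoC 0).
  { induction k as [|k IHk]; [apply sum_O | rewrite sum_n_CS, IHk; cring]. }
  eapply is_Clim_eq; [apply (is_Clim_sum_n (at_right 0) (fun r t => RtoC ((-1) ^ r * c r t) * saddle_term d r a t)%C (fun _ => RtoC 0)) | apply Z0].
  intros r _. replace (RtoC 0) with (RtoC ((-1) ^ r * c r 0) * RtoC 0)%C by ring.
  apply is_Clim_mult; [typeclasses eauto | | now apply saddle_term_lim].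
  apply is_Clim_RtoC; [typeclasses eauto |].
  apply (filterlim_Rmult (at_right 0) (fun _ => (-1) ^ r)); [apply filterlim_const |].
  assert (C := Hc r). apply continuity_pt_filterlim in C.
  intros P HP. destruct (C P HP) as [eps He]. exists eps. intros y Hy _. now apply He.
Qed.

(** * Induction over p and m *)

(** N is the last index kept, so the error has the order [S N] of the first omitted term. *)
Definition expands (k L : R) (m : nat) (p : Z) (N : nat) : Prop :=
  negligible k L (zdelta m p) (S N) (fun a t =>
    remainder m p a t - RtoC (neg1_pow (Z.of_nat m - p)) * saddle_sum (fun r t => Ccoef m p t r) (zdelta m p) N a t)%C.

Lemma expands_lower (k L : R) (m : nat) (p : Z) (N : nat) :
  0 < k -> 0 < L -> expands k L m p (S N) -> expands k L m p N.
Proof.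
  intros Hk HL H. unfold expands in *.
  eapply negligible_ext; [| apply negligible_plus; [apply negligible_lower; [exact HL | exact H] |
    apply (negligible_scal k L _ _ (fun t => neg1_pow (Z.of_nat m - p) * ((-1) ^ S N * Ccoef m p t (S N)))); [| apply (negligible_saddle_term k L (zdelta m p) (S N)); auto]]].
  - intros a t Ha Ht. cbv beta. unfold saddle_sum. rewrite sum_n_CS. rewrite !RtoC_mult. cring.
  - apply bounded_on_compact; auto. intros x.
    apply (continuity_pt_scal (fun t => (-1) ^ S N * Ccoef m p t (S N))), (continuity_pt_scal (fun t => Ccoef m p t (S N))), Ccoef_continuous.
Qed.

(** A bound at a high order implies all lower ones, since each discarded term has the size of the
    weaker error. It is enough to argue for large N. *)
Lemma expands_all (k L : R) (m : nat) (p : Z) (N0 : nat) :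
  0 < k -> 0 < L -> (forall N, (N0 <= N)%nat -> expands k L m p N) -> forall N, expands k L m p N.
Proof.
  intros Hk HL. induction N0 as [|N0 IH]; intros H N; [apply H; lia |].
  apply IH. intros N1 HN1. destruct (Nat.eq_dec N1 N0) as [-> | Hne].
  - apply expands_lower; auto.
  - apply H; lia.
Qed.

(** Supplies the nonnegative exponent demanded by [negligible_primitive], whatever the sign of
    delta. *)
Lemma large_exponent (d : Z) : exists N0 : nat, forall N, (N0 <= N)%nat -> 0 <= IZR d + INR (S N) - / 2.
Proof.
  exists (Z.abs_nat d). intros N HN. rewrite S_INR.
  assert (0 <= IZR (d + Z.of_nat N)) by (apply IZR_le; lia). rewrite plus_IZR, <- INR_IZR_INZ in H. lra.
Qed.

(** The derivative of the difference at p is, up to sign, the difference at p + 1 plus the leftover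
    of [saddle_sum_derive]. Both have order [S N] at delta - 2, and integration restores delta. *)
Lemma expands_0_pred (k L : R) (p : Z) :
  0 < k -> 0 < L -> (forall N, expands k L 0 (p + 1) N) -> forall N, expands k L 0 p N.
Proof.
  intros Hk HL H. destruct (large_exponent (zdelta 0 p)) as [N0 HN0].
  apply (expands_all k L 0 p N0 Hk HL). intros N HN. specialize (H N).
  assert (Ed : IZR (zdelta 0 p) = - 2 * IZR p) by (rewrite IZR_zdelta; simpl (INR 0); ring).
  assert (Ez : (zdelta 0 (p + 1) = zdelta 0 p - 2)%Z) by (unfold zdelta; lia).
  unfold expands in *. rewrite Ez in H.
  set (s := neg1_pow (Z.of_nat 0 - p)).
  assert (Es : neg1_pow (Z.of_nat 0 - (p + 1)) = - s).
  { unfold s. replace (Z.of_nat 0 - p)%Z with (Z.of_nat 0 - (p + 1) + 1)%Z by lia. rewrite neg1_pow_succ; ring. }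
  rewrite Es in H.
  apply (negligible_primitive k L _ _ _ (fun a t => - remainder 0 (p + 1) a t - RtoC s * (saddle_sum (fun r t => Ccoef 0 (p + 1) t r) (zdelta 0 p - 2) N a t
     + RtoC ((-1) ^ N * ((IZR (zdelta 0 p) + INR N - / 2) * Ccoef 0 p t N + t * 0)) * saddle_term (zdelta 0 p - 2) (S N) a t))%C Hk); auto.
  - intros a t Ha Ht. assert (Hr := in_sector_right k a Hk Ha).
    apply is_Cderive_minus; [now apply remainder_derive |]. apply is_Cderive_scal.
    apply (saddle_sum_derive (fun r t => Ccoef 0 p t r) (fun _ _ => 0) (fun r t => Ccoef 0 (p + 1) t r)); auto.
    + intros r. apply Ccoef_m0_derive.
    + intros r. rewrite Ed. apply Ccoef_m0_rec.
  - intros a Ha. assert (Hr := in_sector_right k a Hk Ha).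
    replace (RtoC 0) with (RtoC 0 - RtoC s * RtoC 0)%C by ring.
    apply is_Clim_minus; [typeclasses eauto | now apply remainder_lim |].
    apply is_Clim_mult; [typeclasses eauto | apply is_Clim_const; typeclasses eauto |].
    apply saddle_sum_lim; [auto | intros r; apply Ccoef_continuous].
  - eapply negligible_ext; [| apply negligible_plus; [apply (negligible_scal k L _ _ (fun _ => -1)); [exists 1; intros; rewrite Rabs_left; lra | exact H] |
      apply (negligible_scal k L _ _ (fun t => - s * ((-1) ^ N * ((IZR (zdelta 0 p) + INR N - / 2) * Ccoef 0 p t N + t * 0)))); [| apply (negligible_saddle_term k L (zdelta 0 p - 2) (S N)); auto]]].
    + intros a t Ha Ht. cbv beta. rewrite (RtoC_mult (- s)), !RtoC_opp.
      replace (RtoC (-1)) with (- RtoC 1)%C by (rewrite <- RtoC_opp; reflexivity). ring.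
    + apply bounded_on_compact; auto. intros x.
      apply (continuity_pt_ext (fun t => - s * ((-1) ^ N * ((IZR (zdelta 0 p) + INR N - / 2) * Ccoef 0 p t N)))); [intros; ring |].
      apply (continuity_pt_scal (fun t => (-1) ^ N * ((IZR (zdelta 0 p) + INR N - / 2) * Ccoef 0 p t N))).
      apply (continuity_pt_scal (fun t => (IZR (zdelta 0 p) + INR N - / 2) * Ccoef 0 p t N)).
      apply (continuity_pt_scal (fun t => Ccoef 0 p t N)), Ccoef_continuous.
Qed.

Lemma expands_0 (k L : R) (p : Z) : 0 < k -> 0 < L -> forall N, expands k L 0 p N.
Proof.
  intros Hk HL.
  assert (Hn : forall n N, expands k L 0 (Z.of_nat n) N).
  { intros n. apply (expands_all k L 0 (Z.of_nat n) n Hk HL). intros N HN. exists 1. split; [lra |].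
    intros a t Ha Ht. rewrite (remainder_0_nat n a (in_sector_right k a Hk Ha) t N) by (lra || lia).
    replace (Z.of_nat 0 - Z.of_nat n)%Z with (- Z.of_nat n)%Z by lia.
    match goal with |- Cmod (?x - ?x)%C <= _ => replace (x - x)%C with (RtoC 0) by ring end.
    rewrite Cmod_0, Rmult_1_l. apply Rlt_le, saddle_size_pos. }
  assert (Dn : forall n N, expands k L 0 (- Z.of_nat n) N).
  { induction n as [|n IH]; [apply (Hn 0%nat) |]. apply expands_0_pred; auto.
    replace (- Z.of_nat (S n) + 1)%Z with (- Z.of_nat n)%Z by lia. exact IH. }
  destruct (Z_le_gt_dec 0 p).
  - rewrite <- (Z2Nat.id p) by auto. apply Hn.
  - replace p with (- Z.of_nat (Z.to_nat (- p)))%Z by lia. apply Dn.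
Qed.

(** The factor exp(-t) is carried inside the coefficients, where it remains smooth and bounded on
    (0, L]. It is removed at the end at the price of a constant exp(L). *)
Lemma expands_succ (k L : R) (m : nat) (p : Z) :
  0 < k -> 0 < L -> (forall N, expands k L m p N) -> forall N, expands k L (S m) p N.
Proof.
  intros Hk HL H. destruct (large_exponent (zdelta (S m) p)) as [N0 HN0].
  apply (expands_all k L (S m) p N0 Hk HL). intros N HN. specialize (H N).
  set (d := zdelta (S m) p) in *.
  assert (Ed : IZR d = C_delta (S m) p) by (unfold d, C_delta; rewrite IZR_zdelta; ring).
  assert (Ez : (zdelta m p = d - 2)%Z) by (unfold d, zdelta; lia).
  unfold expands in *. rewrite Ez in H. fold d.
  set (s := neg1_pow (Z.of_nat (S m) - p)).
  assert (Es : neg1_pow (Z.of_nat m - p) = - s).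
  { unfold s. replace (Z.of_nat (S m) - p)%Z with (Z.of_nat m - p + 1)%Z by lia. rewrite neg1_pow_succ; ring. }
  rewrite Es in H.
  assert (Dexp : forall t, is_derive (fun t => exp (- t)) t (- exp (- t))) by (intros; auto_derive; auto; ring).
  (* The coefficient, up to sign, of the term left over at index [S N] when the truncated series is
     differentiated. *)
  set (lead := fun t => (IZR d + INR N - / 2) * (exp (- t) * Ccoef (S m) p t N) + t * (exp (- t) * (Ccoef_derive (S m) p t N - Ccoef (S m) p t N))).
  assert (Cexpm : forall x, continuity_pt (fun t => exp (- t)) x) by (intros x; apply (continuity_of_derive _ _ Dexp)).
  assert (Q : negligible k L d (S N) (fun a t => RtoC (exp (- t)) * remainder (S m) p a t
      - RtoC s * saddle_sum (fun r t => exp (- t) * Ccoef (S m) p t r)%R d N a t)%C).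
  { apply (negligible_primitive k L _ _ _ (fun a t => - (RtoC (exp (- t)) * remainder m p a t) - RtoC s * (saddle_sum (fun r t => exp (- t) * Ccoef m p t r)%R (d - 2) N a t
     + RtoC ((-1) ^ N * lead t) * saddle_term (d - 2) (S N) a t))%C Hk); auto.
    - intros a t Ha Ht. assert (Hr := in_sector_right k a Hk Ha).
      apply is_Cderive_minus.
      + eapply is_Cderive_eq; [apply is_Cderive_mult; [apply is_Cderive_RtoC, Dexp | now apply remainder_derive] |].
        cbv beta. rewrite (remainder_rec m p) by auto. rewrite RtoC_opp. ring.
      + apply is_Cderive_scal. unfold lead.
        apply (saddle_sum_derive (fun r t => exp (- t) * Ccoef (S m) p t r)%R (fun r t => exp (- t) * (Ccoef_derive (S m) p t r - Ccoef (S m) p t r))%R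
          (fun r t => exp (- t) * Ccoef m p t r)%R); auto.
        * intros r. eapply is_derive_eq; [apply is_derive_Rmult; [apply Dexp | apply is_derive_Ccoef] | cbv beta; rring].
        * intros r. rewrite Ccoef_rec, Ed. ring.
    - intros a Ha. assert (Hr := in_sector_right k a Hk Ha).
      assert (L1 : is_Clim (at_right 0) (fun t => RtoC (exp (- t))) (RtoC 1)).
      { eapply is_Clim_eq; [apply (is_Clim_of_derive (fun t => RtoC (exp (- t))) _ (is_Cderive_RtoC _ _ _ (Dexp 0))) |].
        now rewrite Ropp_0, exp_0. }
      apply (is_Clim_ext (at_right 0) (fun t => RtoC (exp (- t)) * (remainder (S m) p a t - RtoC s * saddle_sum (fun r t => Ccoef (S m) p t r) d N a t))%C).
      + apply filter_forall. intros t. rewrite saddle_sum_scal. ring.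
      + replace (RtoC 0) with (RtoC 1 * (RtoC 0 - RtoC s * RtoC 0))%C by ring.
        apply is_Clim_mult; [typeclasses eauto | exact L1 |].
        apply is_Clim_minus; [typeclasses eauto | now apply remainder_lim |].
        apply is_Clim_mult; [typeclasses eauto | apply is_Clim_const; typeclasses eauto |]. apply saddle_sum_lim; [auto | intros r; apply Ccoef_continuous].
    - eapply negligible_ext; [| apply negligible_plus; [apply (negligible_scal k L _ _ (fun t => - exp (- t))); [| exact H] |
        apply (negligible_scal k L _ _ (fun t => - s * ((-1) ^ N * lead t))); [| apply (negligible_saddle_term k L (d - 2) (S N)); auto]]].
      + intros a t Ha Ht. cbv beta. rewrite saddle_sum_scal, (RtoC_mult (- s)), !RtoC_opp. ring.
      + exists 1. intros t Ht. rewrite Rabs_Ropp, Rabs_pos_eq by apply Rlt_le, exp_pos. rewrite <- exp_0. apply exp_le; lra.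
      + apply bounded_on_compact; auto. intros x.
        apply (continuity_pt_scal (fun t => (-1) ^ N * lead t)), (continuity_pt_scal lead). unfold lead.
        apply continuity_pt_plus.
        * apply (continuity_pt_scal (fun t => exp (- t) * Ccoef (S m) p t N)), (continuity_pt_mult (fun t => exp (- t)) (fun t => Ccoef (S m) p t N)); auto. apply Ccoef_continuous.
        * apply (continuity_pt_mult (fun t => t)); [apply derivable_continuous_pt, derivable_pt_id |].
          apply (continuity_pt_mult (fun t => exp (- t))); auto.
          apply continuity_pt_minus; [apply Ccoef_derive_continuous | apply Ccoef_continuous]. }
  eapply negligible_ext; [| apply (negligible_scal k L _ _ (fun t => exp t)); [| exact Q]].
  - intros a t Ha Ht. cbv beta. rewrite saddle_sum_scal.
    transitivity (RtoC (exp t * exp (- t)) * (remainder (S m) p a t - RtoC s * saddle_sum (fun r t => Ccoef (S m) p t r) d N a t))%C; [rewrite RtoC_mult; ring |].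
    rewrite <- exp_plus. replace (t + - t) with 0 by ring. rewrite exp_0. ring.
  - exists (exp L). intros t Ht. rewrite Rabs_pos_eq by apply Rlt_le, exp_pos. apply exp_le; lra.
Qed.

Lemma expands_main (k L : R) (m : nat) (p : Z) : 0 < k -> 0 < L -> forall N, expands k L m p N.
Proof.
  intros Hk HL. induction m as [|m IH]; [now apply expands_0 | now apply expands_succ].
Qed.

(** * Conclusion at fixed lambda *)

Theorem theorem2 :
  forall (m : nat) (p : Z) (lambda : R) (B : nat -> nat -> R),
    0 < lambda ->
    is_Bcoef p B ->
    let delta := 2 * (INR m - IZR p) in
    forall (M : nat) (eps : R), (1 <= M)%nat -> 0 < eps ->
    exists K C0 : R, 0 < K /\
      forall a : C, a <> RtoC 0 -> Rabs (Carg a) <= PI / 4 - eps -> K <= Cmod a ->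
        Cmod (Jfun (INR m) p a lambda
              + RtoC (powerRZ (-1) (Z.of_nat m - p) * PI)
                * Cpower a (2 * IZR p + 1)
                * Cexp (RtoC lambda - RtoC (2 * PI) * a)
                * ABsum m B lambda a
              - expansion m p lambda M a)%C
        <= C0 * Rpower (Cmod a) (1 - 2 * delta - 2 * INR M)
           * Cmod (Cexp (- (RtoC (PI ^ 2) * a ^ 2 / RtoC lambda))%C).
Proof.
  intros m p lambda B Hl HB delta M eps HM Heps.
  destruct (Rlt_le_dec 0 (sin (2 * eps))) as [Hk | Hk].
  (* When sin(2 eps) <= 0 no a satisfies the condition on the argument, and any constants serve. *)
  2:{ exists 1, 0. split; [lra |]. intros a Ha Hc _. destruct (Carg_sector a eps Ha Heps Hc) as [_ [Q _]]. lra. }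
  (* The interval ends at lambda itself, and M terms mean that the last index is M - 1. *)
  destruct (expands_main (sin (2 * eps)) lambda m p Hk Hl (M - 1)) as [K [HK H]].
  set (d := zdelta m p) in *. set (e := IZR d + INR (S (M - 1)) - / 2).
  exists 1, (K * Rpower lambda e). split; [lra |]. intros a Ha Hc Ha1.
  destruct (Carg_sector a eps Ha Heps Hc) as [S1 [S2 S3]].
  assert (Hs : in_sector (sin (2 * eps)) a) by (repeat split; auto).
  assert (Hr := in_sector_right _ a Hk Hs).
  rewrite (Jfun_remainder m p lambda B a HB Hr), (expansion_saddle_sum m p lambda M a Hr Hl).
  fold d. specialize (H a lambda Hs ltac:(lra)). cbv beta in H.
  match goal with |- Cmod (?u * ?x - ?u * ?y)%C <= _ => replace (u * x - u * y)%C with (u * (x - y))%C by ring end.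
  rewrite Cmod_mult, Cmod_Cpower, Cmod_Cexp.
  replace (Re (- (RtoC (PI ^ 2) * a ^ 2 / RtoC lambda))%C) with (- (saddle_exponent a / lambda)).
  2:{ unfold saddle_exponent, Cdiv. rewrite <- RtoC_inv by lra.
      replace (a ^ 2)%C with (a * a)%C by (simpl; ring). rewrite Re_opp, (Cmult_comm _ (RtoC (/ lambda))), !Re_scal. unfold Rdiv; ring. }
  eapply Rle_trans; [apply Rmult_le_compat_l; [apply Rlt_le, exp_pos | exact H] |].
  right. unfold saddle_size. fold e.
  (* The prefactor a^(-delta), removed when passing to [remainder], contributes the second delta;
     the fixed power of lambda has gone into the constant. *)
  replace (1 - 2 * delta - 2 * INR M) with (- IZR d + (1 - (IZR d + 2 * INR (S (M - 1))))).
  2:{ replace (S (M - 1)) with M by lia. unfold d, delta. rewrite IZR_zdelta. ring. }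
  rewrite Rpower_plus. ring.
Qed.
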